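(* Let $t,a_1,a_2\in\mathbb C$ with $a_1\ne0$. Let $\mathcal X^{\mathrm{Tak}}_m$, $\mathcal X^{\mathrm{Ok}}$ and the blow-up $\rho:\tilde{\mathcal X}^{\mathrm{Ok}}\to\mathcal X^{\mathrm{Ok}}$ be the surfaces and the projection defined in the context. The map $\mathcal X^{\mathrm{Tak}}_m\to\mathcal X^{\mathrm{Ok}}$ given by $$f=\Big(\frac q2\Big)^2,\qquad g=\frac t2+\frac{2a_1}{q^2}+\frac p{2q}+\frac{q^2}{16}$$ decomposes as $$\rho\circ\tilde\varphi:\ \mathcal X^{\mathrm{Tak}}_m\longrightarrow\mathcal X^{\mathrm{Ok}},$$ where $\tilde\varphi:\mathcal X^{\mathrm{Tak}}_m\to\tilde{\mathcal X}^{\mathrm{Ok}}$ is a morphism (no indeterminacies) and has no critical locus (it contracts no curve). The map $\tilde\varphi$ sends the curves $C_i$ to $$\begin{aligned} &C_1\mapsto L_2, && C_2\mapsto L_1, && C_3\mapsto\tilde D_0, && C_4\mapsto\tilde D_6, && C_5\mapsto\tilde D_3,\\ &C_6\mapsto L_6, && C_7\mapsto\tilde D_4, && C_8\mapsto L_7, && C_9\mapsto\tilde D_5, && C_{10}\mapsto L_8,\\ &C_{11}\mapsto L_5, && C_{12}\mapsto\tilde D_2, && C_{13}\mapsto L_4, && C_{14}\mapsto\tilde D_1, && C_{15}\mapsto L_3, \end{aligned}$$ and the last exceptional divisors to $$F_3\mapsto E_4-L_2,\quad F_5\mapsto H_f-E_3-L_1,\quad F_{14}\mapsto E_8-L_8,\quad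 F_{20}\mapsto E_2-L_3 .$$
   Context: Blow-up convention: after blowing up a point given in an affine chart by $(x,y)=(x^*,y^* )$, the $i$-th exceptional curve is covered by charts $(u_i,v_i)$ and $(U_i,V_i)$ with $x-x^*=u_iv_i,\ y-y^*=v_i$ and $x-x^*=V_i,\ y-y^*=U_iV_i$. The notation $q_i\leftarrow q_j$ means that $q_j$ lies on the exceptional curve of $q_i$. The charts for different surfaces are unrelated. Exceptional divisors $F_i,E_i,L_i$ denote total transforms, so differences such as $F_1-F_2-F_4$ denote proper transforms; $H_q,H_p$ (resp. $H_f,H_g$) are total transforms of lines of constant $q,p$ (resp. $f,g$). Surface $\mathcal X^{\mathrm{Tak}}$: compactify $\mathbb C^2_{q,p}$ to $\mathbb P^1\times\mathbb P^1$ with $Q=1/q$, $P=1/p$, and blow up the 20 points $q_1:(q,P)=(0,0)$; over it $q_2:(u_1,v_1)=(4a_1,0)\leftarrow q_3:(u_2,v_2)=(0,0)$ and $q_4:(u_1,v_1)=(-4a_1,0)\leftarrow q_5:(u_4,v_4)=(0,0)$; $q_6:(Q,P)=(0,0)\leftarrow q_7:(U_6,V_6)=(0,0)\leftarrow q_8:(u_7,v_7)=(0,0)$; over $q_8$ the two chains $q_9:(u_8,v_8)=(8,0)\leftarrow q_{10}:(u_9,v_9)=(0,0)\leftarrow q_{11}:(u_{10},v_{10})=(-64t,0)\leftarrow q_{12}:(u_{11},v_{11})=(0,0)\leftarrow q_{13}:(u_{12},v_{12})=(256(2+2t^2-a_1-2a_2),0)\leftarrow q_{14}:(u_{13},v_{13})=(0,0)$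 and $q_{15}:(u_8,v_8)=(-8,0)\leftarrow q_{16}:(u_{15},v_{15})=(0,0)\leftarrow q_{17}:(u_{16},v_{16})=(64t,0)\leftarrow q_{18}:(u_{17},v_{17})=(0,0)\leftarrow q_{19}:(u_{18},v_{18})=(-256(2t^2-a_1-2a_2),0)\leftarrow q_{20}:(u_{19},v_{19})=(0,0)$, with exceptional divisors $F_1,\dots,F_{20}$. Minimised surface: $\sigma:\mathcal X^{\mathrm{Tak}}\to\mathcal X^{\mathrm{Tak}}_m$ contracts successively the proper transforms of $\{q=0\}$ and $\{q=\infty\}$ (classes $H_q-F_1$, $H_q-F_6$), then the image of $F_6-F_7$, then the image of $F_7-F_8$. On $\mathcal X^{\mathrm{Tak}}_m$ (writing a curve and its image under $\sigma$ by the same symbol) the curves $C_i$ are $C_1=F_2-F_3$, $C_2=F_4-F_5$, $C_3=\sigma(F_1-F_2-F_4)$, $C_4=H_p-F_1-F_6-F_7-F_8$, $C_5=\sigma(F_8-F_9-F_{15})$, $C_6=F_9-F_{10}$, $C_7=F_{10}-F_{11}$, $C_8=F_{11}-F_{12}$, $C_9=F_{12}-F_{13}$, $C_{10}=F_{13}-F_{14}$, $C_{11}=F_{15}-F_{16}$, $C_{12}=F_{16}-F_{17}$, $C_{13}=F_{17}-F_{18}$, $C_{14}=F_{18}-F_{19}$, $C_{15}=F_{19}-F_{20}$. Surface $\mathcal X^{\mathrm{Ok}}$: compactify $\mathbb C^2_{f,g}$ to $\mathbb P^1\times\mathbb P^1$ with $F=1/f$, $G=1/g$, and blow up $p_1:(F,g)=(0,0)\leftarrow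 p_2:(U_1,V_1)=(-a_2,0)$; $p_3:(f,G)=(0,0)\leftarrow p_4:(u_3,v_3)=(a_1,0)$; $p_5:(F,G)=(0,0)\leftarrow p_6:(U_5,V_5)=(2,0)\leftarrow p_7:(u_6,v_6)=(-4t,0)\leftarrow p_8:(u_7,v_7)=(4(1-a_1-a_2+2t^2),0)$, with exceptional divisors $E_1,\dots,E_8$. Put $D_0=E_3-E_4$, $D_1=E_1-E_2$, $D_2=H_f-E_1-E_5$, $D_3=E_5-E_6$, $D_4=E_6-E_7$, $D_5=E_7-E_8$, $D_6=H_g-E_3-E_5$. Extended surface: $\rho:\tilde{\mathcal X}^{\mathrm{Ok}}\to\mathcal X^{\mathrm{Ok}}$ is the blow-up of the eight points $z_1=D_0\cap(H_f-E_3)$ (where $H_f-E_3$ is the proper transform of $\{f=0\}$), $z_2=D_0\cap E_4$, $z_3=D_1\cap E_2$, $z_4=D_1\cap D_2$, $z_5=D_2\cap D_3$, $z_6=D_3\cap D_4$, $z_7=D_4\cap D_5$, $z_8=D_5\cap E_8$, with exceptional divisors $L_1,\dots,L_8$. $\tilde D_i$ is the proper transform of $D_i$ under $\rho$: $\tilde D_0=E_3-E_4-L_1-L_2$, $\tilde D_1=E_1-E_2-L_3-L_4$, $\tilde D_2=H_f-E_1-E_5-L_4-L_5$, $\tilde D_3=E_5-E_6-L_5-L_6$, $\tilde D_4=E_6-E_7-L_6-L_7$, $\tilde D_5=E_7-E_8-L_7-L_8$, $\tilde D_6=H_g-E_3-E_5$. *)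

(* Defs.v *)
From HB Require Import structures.
From mathcomp Require Import all_boot all_order all_algebra.
From mathcomp Require Import generic_quotient.
From mathcomp Require Import boolp classical_sets reals topology_structure.
From mathcomp Require Import complex.

Set Implicit Arguments.
Unset Strict Implicit.
Unset Printing Implicit Defensive.

Import GRing.Theory.

Local Open Scope classical_set_scope.
Local Open Scope ring_scope.
Local Open Scope quotient_scope.

Local Notation "x %:F" := (FracField.tofrac x).
Local Notation "\n_ x" := (frac x).1 (at level 8, format "\n_ x").
Local Notation "\d_ x" := (frac x).2 (at level 8, format "\d_ x").

(* Surfaces are Zariski models.  A smooth rational surface X over the         *)
(* algebraically closed field C, with function field K = C(X, Y), is          *)
(* identified with the set of the local rings of its closed points, each of   *)
(* which is a subring of K.  So a point is a subset of K, a surface or a      *)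
(* curve is a set of points, and the points of a surface and of its blow-up   *)
(* are the same subrings of K away from the centre.                           *)

Notation rfun C := {fraction {poly {poly C}}}.

HB.instance Definition _ (A : idomainType) := isPointed.Build {fraction A} 0.

Section Models.
Variable C : fieldType.
Implicit Types (x y r : rfun C) (a b : C).

Definition cst (a : C) : rfun C := (a%:P%:P)%:F.
Definition varX : rfun C := 'X%:F.
Definition varY : rfun C := ('Y)%:F.

Definition ev x y (P : {poly {poly C}}) : rfun C :=
  (map_poly (map_poly cst) P).[x, y].

(* The endomorphism r(X, Y) |-> r(x, y) of C(X, Y), for x and y algebraically *)
(* independent over C.                                                        *)
Definition subst x y r : rfun C :=
  ev x y (\n_(repr r)) / ev x y (\d_(repr r)).

Definition spoint := set (rfun C).
HB.instance Definition _ := Choice.copy spoint (set (rfun C)).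

(* The Zariski topology: the set of the points at which finitely many given   *)
(* rational functions are regular is a basic open set.                        *)
HB.instance Definition _ := @isSubBaseTopological.Build spoint
  (rfun C) setT (fun r => [set O : spoint | O r]).

Implicit Types (O : spoint) (X Z S : set spoint).

Definition maxideal O : spoint := [set r | O r /\ (r = 0 \/ ~ O r^-1)].

(* The point (a, b) of the affine chart with coordinates x and y. *)
Record centre := Centre { cx : rfun C; cy : rfun C; ca : C; cb : C }.

Definition pt (z : centre) : spoint :=
  [set r | exists P Q : {poly {poly C}},
     Q.[ca z, cb z] != 0 /\ r = ev (cx z) (cy z) P / ev (cx z) (cy z) Q].

(* On the blow-up of (x, y) = (a, b), the point (u, v) = (c, d) of the chart  *)
(* x - a = u v, y - b = v and the point (U, V) = (c, d) of the chart          *)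
(* x - a = V, y - b = U V.                                                    *)
Definition uv (z : centre) (c d : C) : centre :=
  let x := cx z - cst (ca z) in let y := cy z - cst (cb z) in
  Centre (x / y) y c d.
Definition UV (z : centre) (c d : C) : centre :=
  let x := cx z - cst (ca z) in let y := cy z - cst (cb z) in
  Centre (y / x) x c d.

Definition P1xP1 : set spoint :=
  [set O | exists (x y : rfun C) (a b : C),
     [/\ x \in [:: varX; varX^-1], y \in [:: varY; varY^-1]
       & O = pt (Centre x y a b)]].

(* The exceptional curve of the blow-up of the point O.  As z ranges over all *)
(* the presentations of O by local coordinates, the chart v = 0 of z is       *)
(* enough: exchanging the coordinates of z exchanges its two charts.          *)
Definition exc O : set spoint :=
  [set O' | exists (z : centre) (c : C), O = pt z /\ O' = pt (uv z c 0)].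
Definition excs Z : set spoint := \bigcup_(O in Z) exc O.

(* Z is a finite set of points of X *)
Definition blowup X Z : set spoint := (X `\` Z) `|` excs Z.

Definition blowdown Z O : spoint := xget O [set z | Z z /\ exc z O].

(* Given a curve (or a dense subset of a curve) S on some surface birational  *)
(* to X, the closure in X of the points of S that are still points of X.      *)
Definition proper X S : set spoint := closure (S `&` X) `&` X.

(* The contraction of the curve S to a point.  The local ring of a contracted *)
(* point is the ring of the rational functions regular along S, because the   *)
(* structure sheaf of the contracted surface is the direct image of that of X.*)
Definition contr S O : spoint :=
  if `[< S O >] then [set r | forall O', S O' -> O' r] else O.

(* The map phi is the morphism X -> Y with comorphism fs on function fields.  *)
Definition is_morphism (fs : rfun C -> rfun C) X Y (phi : spoint -> spoint) :=
  forall O, X O ->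
    [/\ Y (phi O), fs @` phi O `<=` O
      & fs @` maxideal (phi O) `<=` maxideal O].

(* Irreducible closed subsets of the surface X other than X and the points. *)
Definition is_curve X S :=
  [/\ S `<=` X, proper X S = S,
      forall A B, closed A -> closed B -> S `<=` A `|` B ->
        S `<=` A \/ S `<=` B,
      S !=set0 /\ S <> X & forall O, S <> [set O]].

(* The parts of the lines x = 0 and y = 0 lying in the affine chart (x, y) *)
Definition xline x y : set spoint := [set pt (Centre x y 0 b) | b in [set: C]].
Definition yline x y : set spoint := [set pt (Centre x y a 0) | a in [set: C]].

End Models.

Section Takasaki.
Variables (C : fieldType) (t a1 a2 : C).

Local Notation q := (varX C).
Local Notation p := (varY C).

Definition q1 := Centre q p^-1 0 0.
Definition q2 := uv q1 (4 * a1) 0.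
Definition q3 := uv q2 0 0.
Definition q4 := uv q1 (- (4 * a1)) 0.
Definition q5 := uv q4 0 0.
Definition q6 := Centre q^-1 p^-1 0 0.
Definition q7 := UV q6 0 0.
Definition q8 := uv q7 0 0.
Definition q9 := uv q8 8 0.
Definition q10 := uv q9 0 0.
Definition q11 := uv q10 (- (64 * t)) 0.
Definition q12 := uv q11 0 0.
Definition q13 := uv q12 (256 * (2 + 2 * t ^+ 2 - a1 - 2 * a2)) 0.
Definition q14 := uv q13 0 0.
Definition q15 := uv q8 (- 8) 0.
Definition q16 := uv q15 0 0.
Definition q17 := uv q16 (64 * t) 0.
Definition q18 := uv q17 0 0.
Definition q19 := uv q18 (- (256 * (2 * t ^+ 2 - a1 - 2 * a2))) 0.
Definition q20 := uv q19 0 0.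

Definition XTak : set (spoint C) :=
  foldl (fun X z => blowup X [set pt z]) (@P1xP1 C)
    [:: q1; q2; q3; q4; q5; q6; q7; q8; q9; q10; q11; q12; q13; q14; q15;
        q16; q17; q18; q19; q20].

(* The proper transform in XTak of the exceptional curve over z; for z = q1   *)
(* its class is F_1 - F_2 - F_4, for z = q2 it is F_2 - F_3, and so on.       *)
Definition TakF (z : centre C) : set (spoint C) := proper XTak (exc (pt z)).

(* {q = 0}, {q = oo} and {p = oo}, of classes H_q - F_1, H_q - F_6 and        *)
(* H_p - F_1 - F_6 - F_7 - F_8                                                *)
Definition Tak_q0 : set (spoint C) := proper XTak (xline q p).
Definition Tak_qoo : set (spoint C) := proper XTak (xline q^-1 p).
Definition Tak_poo : set (spoint C) := proper XTak (yline q p^-1).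

(* Successive contractions of {q = 0}, {q = oo}, F_6 - F_7 and F_7 - F_8 *)
Definition sigma1 : spoint C -> spoint C := contr Tak_q0.
Definition sigma2 := contr (sigma1 @` Tak_qoo) \o sigma1.
Definition sigma3 := contr (sigma2 @` TakF q6) \o sigma2.
Definition sigma := contr (sigma3 @` TakF q7) \o sigma3.

Definition XTakm : set (spoint C) := sigma @` XTak.

Definition C1 := sigma @` TakF q2.
Definition C2 := sigma @` TakF q4.
Definition C3 := sigma @` TakF q1.
Definition C4 := sigma @` Tak_poo.
Definition C5 := sigma @` TakF q8.
Definition C6 := sigma @` TakF q9.
Definition C7 := sigma @` TakF q10.
Definition C8 := sigma @` TakF q11.
Definition C9 := sigma @` TakF q12.
Definition C10 := sigma @` TakF q13.
Definition C11 := sigma @` TakF q15.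
Definition C12 := sigma @` TakF q16.
Definition C13 := sigma @` TakF q17.
Definition C14 := sigma @` TakF q18.
Definition C15 := sigma @` TakF q19.

Definition F3 := sigma @` TakF q3.
Definition F5 := sigma @` TakF q5.
Definition F14 := sigma @` TakF q14.
Definition F20 := sigma @` TakF q20.

End Takasaki.

Section Okamoto.
Variables (C : fieldType) (t a1 a2 : C).

Local Notation f := (varX C).
Local Notation g := (varY C).

Definition p1 := Centre f^-1 g 0 0.
Definition p2 := UV p1 (- a2) 0.
Definition p3 := Centre f g^-1 0 0.
Definition p4 := uv p3 a1 0.
Definition p5 := Centre f^-1 g^-1 0 0.
Definition p6 := UV p5 2 0.
Definition p7 := uv p6 (- (4 * t)) 0.
Definition p8 := uv p7 (4 * (1 - a1 - a2 + 2 * t ^+ 2)) 0.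

Definition XOk : set (spoint C) :=
  foldl (fun X z => blowup X [set pt z]) (@P1xP1 C)
    [:: p1; p2; p3; p4; p5; p6; p7; p8].

Definition OkE (z : centre C) : set (spoint C) := proper XOk (exc (pt z)).
Definition D0 := OkE p3.
Definition D1 := OkE p1.
Definition D2 : set (spoint C) := proper XOk (xline f^-1 g).
Definition D3 := OkE p5.
Definition D4 := OkE p6.
Definition D5 := OkE p7.
Definition D6 : set (spoint C) := proper XOk (yline f g^-1).
Definition Ok_f0 : set (spoint C) := proper XOk (xline f g).

(* Each of these intersections is a single point. *)
Definition z1 := D0 `&` Ok_f0.
Definition z2 := D0 `&` OkE p4.
Definition z3 := D1 `&` OkE p2.
Definition z4 := D1 `&` D2.
Definition z5 := D2 `&` D3.
Definition z6 := D3 `&` D4.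
Definition z7 := D4 `&` D5.
Definition z8 := D5 `&` OkE p8.
Definition zs := z1 `|` z2 `|` z3 `|` z4 `|` z5 `|` z6 `|` z7 `|` z8.

Definition XOkt : set (spoint C) := blowup XOk zs.
Definition rho : spoint C -> spoint C := blowdown zs.

Definition L1 := excs z1.
Definition L2 := excs z2.
Definition L3 := excs z3.
Definition L4 := excs z4.
Definition L5 := excs z5.
Definition L6 := excs z6.
Definition L7 := excs z7.
Definition L8 := excs z8.

Definition Dt0 := proper XOkt D0.
Definition Dt1 := proper XOkt D1.
Definition Dt2 := proper XOkt D2.
Definition Dt3 := proper XOkt D3.
Definition Dt4 := proper XOkt D4.
Definition Dt5 := proper XOkt D5.
Definition Dt6 := proper XOkt D6.

(* H_f - E_3 - L_1, E_2 - L_3, E_4 - L_2 and E_8 - L_8 *)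
Definition Okt_f0 := proper XOkt Ok_f0.
Definition Et2 := proper XOkt (OkE p2).
Definition Et4 := proper XOkt (OkE p4).
Definition Et8 := proper XOkt (OkE p8).

End Okamoto.

Section Map.
Variables (C : fieldType) (t a1 : C).

Definition phi_f (q : C) : C := (q / 2) ^+ 2.
Definition phi_g (q p : C) : C :=
  t / 2 + 2 * a1 / q ^+ 2 + p / (2 * q) + q ^+ 2 / 16.

(* The comorphism C(f, g) -> C(q, p) of the rational map (q, p) |-> (f, g) *)
Definition phi_star : rfun C -> rfun C :=
  let q := varX C in let p := varY C in
  subst ((q / 2) ^+ 2)
    (cst t / 2 + 2 * cst a1 / q ^+ 2 + p / (2 * q) + q ^+ 2 / 16).

Definition affine_pt (x y : C) : spoint C := pt (Centre (varX C) (varY C) x y).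

End Map.

(* Submission.v *)
(* Through its comorphism fs, the map makes C(q, p) a quadratic extension of C(f, g):
   with xi = q / 2 we have f = xi^2, while g is unchanged by the involution
   tau : (q, p) |-> (-q, -p).  The image of a point O, a local ring, is the preimage of O
   under fs.  If fs x = xi^2 and fs y = eta, the point (xi, eta) = (a, b) is mapped
   to (x, y) = (a^2, b), as one sees by splitting a fraction into its even and odd parts in
   xi.  So everything reduces to suitable coordinates.  In the coordinates (xi, g),
   both surfaces acquire their fibres f = 0 and f = oo by eight steps, each made of two
   blowups: p_j and then some z_i downstairs, two consecutive q_j upstairs.  The map is the
   quotient by tau on each step.  A contracted curve yields the expected point because a function
   regular along the exceptional curve of a point is regular at the point (Gauss'
   lemma).  A curve is determined by its discrete valuation ring R: it consists of the
   points O contained in R.  Finally no curve is contracted, because a fibre of the map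
   consists of at most the two points O and tau O. *)

Require Import Defs.
From HB Require Import structures.
From mathcomp Require Import all_boot all_order all_algebra.
From mathcomp Require Import generic_quotient polyXY ring.
From mathcomp Require Import boolp classical_sets reals topology_structure.
From mathcomp Require Import complex.

Set Implicit Arguments.
Unset Strict Implicit.
Unset Printing Implicit Defensive.

Import GRing.Theory Num.Theory.

Local Open Scope classical_set_scope.
Local Open Scope ring_scope.

(** * Local rings of points *)

(** The obstacle is bookkeeping: a point is only a subring with many presentations, and the surfaces
    come from long sequences of blow-ups. Two devices tame this. An exceptional curve is defined
    through all presentations of its centre, but invariance under changes of coordinates reduces it
    to one chart and one further point. And since points are rings, a function regular at one point
    and not at another separates them, so exclusions reduce to tables of poles. The constants match
    as follows. Near q = 0, f g = q p / 8 + a_1 / 2 + ..., so q p = 4 a_1, -4 a_1, 0 become f g =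
    a_1, 0, a_1 / 2. Near q = oo, with s = q^3 / p, f / g = s / (2 + s / 4 + ...), so s = 8, -8, oo
    become f / g = 2, oo, 4. The first two values of each list start the steps; the third is the
    point that receives the contracted curves. The lines {f = 0} and {f = oo} are themselves treated
    as exceptional curves: each is the curve E of a step whose base fibre is the exceptional curve
    of p_3, respectively p_5. *)

Definition hE := (hornerD, hornerN, hornerM, hornerC, hornerX, hornerZ).

Section Points.
Variables (C K : fieldType) (k : C -> K).
Implicit Types (x y r : K) (a b : C) (P Q : {poly {poly C}}).

(* The field C(X, Y) of the definitions is replaced by any field K, the constants
   being embedded by k; gev, gpt, gmax, gexc, guv, gcontr are then ev, pt, maxideal,
   exc, uv, contr. *)
Definition gev x y P : K := (map_poly (map_poly k) P).[x, y].

Record gcentre := GCentre { gx : K; gy : K; ga : C; gb : C }.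

Definition gpt (z : gcentre) : set K :=
  [set r | exists P Q : {poly {poly C}},
     Q.[ga z, gb z] != 0 /\ r = gev (gx z) (gy z) P / gev (gx z) (gy z) Q].

Definition gmax (O : set K) : set K := [set r | O r /\ (r = 0 \/ ~ O r^-1)].

(** A weak form of independence: relations between the coordinates vanish at the point. It makes
    values well defined, and it passes to any functions taking prescribed values at a good point
    ([good_sub]), before these are known to be independent. *)
Definition good (z : gcentre) := forall P, gev (gx z) (gy z) P = 0 -> P.[ga z, gb z] = 0.

(* r is regular at the point z, where it takes the value c *)
Definition val (z : gcentre) r c := exists P Q,
  [/\ Q.[ga z, gb z] != 0, r = gev (gx z) (gy z) P / gev (gx z) (gy z) Q
    & c = P.[ga z, gb z] / Q.[ga z, gb z]].

End Points.

Section LocalRings.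
Variables (C K : fieldType) (k : {rmorphism C -> K}).
Implicit Types (x y r s : K) (a b c d : C) (P Q : {poly {poly C}}).
Local Notation gcentre := (gcentre C K).
Implicit Types z : gcentre.
Local Notation gev := (gev k).
Local Notation val := (val k).
Local Notation gpt := (gpt k).
Local Notation good := (good k).

HB.instance Definition _ x y :=
  GRing.RMorphism.copy (gev x y)
    (horner_eval y \o horner_eval x%:P \o map_poly (map_poly k)).

Lemma gevE x y P : gev x y P = (map_poly (map_poly k) P).[x, y].
Proof. by []. Qed.

Lemma evX x y : gev x y 'X = x.
Proof. by rewrite gevE map_polyX hornerX hornerC. Qed.

Lemma evY x y : gev x y 'Y = y.
Proof. by rewrite gevE map_polyC /= map_polyX hornerC hornerX. Qed.

Lemma evC x y a : gev x y a%:P%:P = k a.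
Proof. by rewrite gevE map_polyC /= map_polyC !hornerC. Qed.

Lemma evYE x y (p : {poly C}) : gev x y p%:P = (map_poly k p).[y].
Proof. by rewrite gevE map_polyC /= hornerC. Qed.

Lemma gevD x y : {morph gev x y : P Q / P + Q}.
Proof. exact: rmorphD. Qed.

Lemma gevN x y : {morph gev x y : P / - P}.
Proof. exact: rmorphN. Qed.

Lemma gevB x y : {morph gev x y : P Q / P - Q}.
Proof. exact: rmorphB. Qed.

Lemma gevM x y : {morph gev x y : P Q / P * Q}.
Proof. exact: rmorphM. Qed.

Lemma gev1 x y : gev x y 1 = 1.
Proof. exact: rmorph1. Qed.

Lemma gev0 x y : gev x y 0 = 0.
Proof. exact: rmorph0. Qed.

Lemma gevXn x y n : {morph gev x y : P / P ^+ n}.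
Proof. exact: rmorphXn. Qed.

Lemma poly2_ind (T : {poly {poly C}} -> Prop) :
  (forall a, T a%:P%:P) -> T 'X -> T 'Y ->
  (forall P Q, T P -> T Q -> T (P + Q)) ->
  (forall P Q, T P -> T Q -> T (P * Q)) -> forall P, T P.
Proof.
move=> TC TX TY TD TM; have T1 (p : {poly C}) : T p%:P.
  elim/poly_ind: p => [|p c IH]; first by have := TC 0.
  by rewrite polyCD polyCM; apply: TD => //; apply: TM.
by elim/poly_ind => [|P p IH]; [have := TC 0 | apply: TD => //; apply: TM].
Qed.

Lemma good_neq0 z Q : good z -> Q.[ga z, gb z] != 0 -> gev (gx z) (gy z) Q != 0.
Proof. by move=> gz; apply: contra_neq => /gz. Qed.

Lemma val_poly z P : val z (gev (gx z) (gy z) P) P.[ga z, gb z].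
Proof. by exists P, 1; rewrite !hornerC rmorph1 !divr1 oner_neq0. Qed.

Lemma val_cst z a : val z (k a) a.
Proof. by have := val_poly z a%:P%:P; rewrite evC !hornerC. Qed.

Lemma val_x z : val z (gx z) (ga z).
Proof. by have := val_poly z 'X; rewrite evX hornerX hornerC. Qed.

Lemma val_y z : val z (gy z) (gb z).
Proof. by have := val_poly z 'Y; rewrite evY hornerC hornerX. Qed.

Lemma val0 z : val z 0 0.
Proof. by rewrite -{1}(rmorph0 k); apply: val_cst. Qed.

Lemma val1 z : val z 1 1.
Proof. by rewrite -{1}(rmorph1 k); apply: val_cst. Qed.

Lemma val_eq z r r' c c' : val z r' c' -> r = r' -> c = c' -> val z r c.
Proof. by move=> + -> ->. Qed.

Lemma val_pt z r c : val z r c -> gpt z r.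
Proof. by move=> [P [Q [Q0 -> _]]]; exists P, Q. Qed.

Lemma pt_val z r : gpt z r -> exists c, val z r c.
Proof.
by move=> [P [Q [Q0 ->]]]; exists (P.[ga z, gb z] / Q.[ga z, gb z]), P, Q.
Qed.

Section Good.
Variable z : gcentre.
Hypothesis gz : good z.

Lemma valD r s c d : val z r c -> val z s d -> val z (r + s) (c + d).
Proof.
move=> [P [Q [Q0 -> ->]]] [P' [Q' [Q'0 -> ->]]].
exists (P * Q' + P' * Q), (Q * Q').
have e0 := good_neq0 gz Q0; have e0' := good_neq0 gz Q'0.
rewrite !rmorphD !rmorphM /= !hE; split; rewrite ?mulf_neq0 ?addf_div //.

Qed.

Lemma valM r s c d : val z r c -> val z s d -> val z (r * s) (c * d).
Proof.
move=> [P [Q [Q0 -> ->]]] [P' [Q' [Q'0 -> ->]]].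
exists (P * P'), (Q * Q').
rewrite !rmorphM /= !hE; split; rewrite ?mulf_neq0 ?mulf_div //.
Qed.

Lemma valN r c : val z r c -> val z (- r) (- c).
Proof.
move=> v; rewrite -(mulN1r r) -(mulN1r c); apply: valM => //.
by rewrite -(rmorphN1 k); apply: val_cst.
Qed.

Lemma valB r s c d : val z r c -> val z s d -> val z (r - s) (c - d).
Proof. by move=> vr vs; apply: valD => //; apply: valN. Qed.

Lemma valV r c : c != 0 -> val z r c -> val z r^-1 c^-1.
Proof.
move=> c0 [P [Q [Q0 -> Ec]]]; exists Q, P; rewrite Ec !invf_div; split=> //.
by apply: contra_neq c0; rewrite Ec => ->; rewrite mul0r.
Qed.

Lemma val_div r s c d : d != 0 -> val z r c -> val z s d -> val z (r / s) (c / d).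
Proof. by move=> d0 vr vs; apply: valM => //; apply: valV. Qed.

Lemma valXn n r c : val z r c -> val z (r ^+ n) (c ^+ n).
Proof.
move=> v; elim: n => [|n IH]; first exact: val1.
by rewrite !exprS; apply: valM.
Qed.

Lemma val_nat n : val z n%:R n%:R.
Proof. by rewrite -{1}(rmorph_nat k); apply: val_cst. Qed.

Lemma val_inj r c d : val z r c -> val z r d -> c = d.
Proof.
move=> [P [Q [Q0 -> ->]]] [P' [Q' [Q'0 /eqP + ->]]].
have e0 := good_neq0 gz Q0; have e0' := good_neq0 gz Q'0.
rewrite eqr_div // -subr_eq0 -!rmorphM -rmorphB => /eqP /gz.
rewrite !hE => /eqP; rewrite subr_eq0 => E.
by apply/eqP; rewrite eqr_div.
Qed.

Lemma val_ne0 r c : c != 0 -> val z r c -> r != 0.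
Proof.
by move=> c0 v; apply: contra_neq c0 => r0; rewrite r0 in v; apply: val_inj v (val0 z).
Qed.

Lemma val_notV r : val z r 0 -> r != 0 -> ~ gpt z r^-1.
Proof.
move=> v r0 /pt_val [c w]; have := valM v w; rewrite mul0r divff // => v1.
by have /eqP := val_inj v1 (val1 z); rewrite eq_sym oner_eq0.
Qed.

Lemma val_max r : val z r 0 <-> gmax (gpt z) r.
Proof.
split=> [v|[/pt_val [c v] H]].
  by split; [apply: val_pt v | have [->|r0] := eqVneq r 0; [left|right; apply: val_notV]].
have [<-//|c0] := eqVneq c 0; case: H => [r0|]; last by case; apply/val_pt/valV/v.
by have /eqP := val_ne0 c0 v.
Qed.

End Good.

Lemma val_ev z2 z1 P : good z2 -> val z2 (gx z1) (ga z1) -> val z2 (gy z1) (gb z1) ->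
  val z2 (gev (gx z1) (gy z1) P) P.[ga z1, gb z1].
Proof.
move=> gz vx vy; elim/poly2_ind: P => [a|||P Q vP vQ|P Q vP vQ].
- by rewrite evC !hornerC; apply: val_cst.
- by rewrite evX hornerX hornerC.
- by rewrite evY hornerC hornerX.
- by rewrite rmorphD !hE; apply: valD.
- by rewrite rmorphM !hE; apply: valM.
Qed.

Lemma good_sub z2 z1 : good z2 -> val z2 (gx z1) (ga z1) -> val z2 (gy z1) (gb z1) ->
  good z1.
Proof.
move=> gz vx vy P E; have := val_ev P gz vx vy; rewrite E => v.
exact: (val_inj gz v (val0 z2)).
Qed.

Lemma val_sub z2 z1 r c : good z2 -> val z2 (gx z1) (ga z1) ->
  val z2 (gy z1) (gb z1) -> val z1 r c -> val z2 r c.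
Proof.
move=> gz vx vy [P [Q [Q0 -> ->]]].
by apply: val_div => //; apply: val_ev.
Qed.

Lemma pt_sub z2 z1 : good z2 -> val z2 (gx z1) (ga z1) -> val z2 (gy z1) (gb z1) ->
  gpt z1 `<=` gpt z2.
Proof. by move=> gz vx vy r /pt_val [c v]; apply/val_pt/val_sub/v. Qed.

(** The working criterion for equality of points: each pair of coordinates is regular, with the
    right values, at the other presentation. *)
Lemma pt_eq z2 z1 : good z2 -> val z2 (gx z1) (ga z1) -> val z2 (gy z1) (gb z1) ->
  val z1 (gx z2) (ga z2) -> val z1 (gy z2) (gb z2) -> gpt z1 = gpt z2.
Proof.
move=> gz vx vy wx wy; apply/seteqP; split; apply: pt_sub => //.
exact: good_sub gz vx vy.
Qed.

Lemma val_pteq z z' r c : good z -> good z' -> gpt z = gpt z' -> val z r c -> val z' r c.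
Proof.
move=> gz gz' E v.
have : val z (r - k c) 0 by rewrite -(subrr c); apply: valB => //; apply: val_cst.
move/(val_max gz); rewrite E => /(val_max gz') v'.
by rewrite -(add0r c) -(subrK (k c) r); apply: valD => //; apply: val_cst.
Qed.

(* The constant rings gpt z of degenerate coordinates are not genuine points. *)
Lemma good_pteq z z' x : good z -> gpt z = gpt z' -> val z x 0 -> x != 0 -> good z'.
Proof.
move=> gz E vx x0 R R0; apply/eqP/contraT => Rn0; case: (val_notV gz vx x0).
have := val_pt vx; rewrite E => -[P [Q [Q0 Ex]]].
have P0 : gev (gx z') (gy z') P != 0.
  by apply: contra_neq x0 => P0; rewrite Ex P0 mul0r.
have [Pn|Pn] := eqVneq P.[ga z', gb z'] 0; last by exists Q, P; rewrite Ex invf_div.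
(* Adding the relation [R] to the denominator changes its value at the point but not its image in
   [K]. *)
by exists Q, (P + R); rewrite Ex invf_div rmorphD /= R0 addr0 !hE Pn add0r.
Qed.

(** The two coordinates generate the maximal ideal: divide the numerator by ['X - a]; the remainder
    is a polynomial in the second variable vanishing at [b], hence a multiple of ['Y - b]. *)
Lemma val_gen z r : good z -> val z r 0 -> exists s1 s2 c1 c2,
  [/\ val z s1 c1, val z s2 c2
    & r = s1 * (gx z - k (ga z)) + s2 * (gy z - k (gb z))].
Proof.
move=> gz [P [Q [Q0 -> /esym/eqP]]].
rewrite mulf_eq0 invr_eq0 (negPf Q0) orbF => /eqP P0.
have /factor_theorem [R ER] : root (P - P.[(ga z)%:P]%:P) (ga z)%:P.
  by rewrite rootE !hE subrr.
have /factor_theorem [S ES] : root P.[(ga z)%:P] (gb z) by rewrite rootE P0.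
have EP : P = R * ('X - (ga z)%:P%:P) + S%:P * ('Y - (gb z)%:P%:P).
  by rewrite -ER -!rmorphB -rmorphM -ES subrK.
exists (gev (gx z) (gy z) R / gev (gx z) (gy z) Q).
exists (gev (gx z) (gy z) S%:P / gev (gx z) (gy z) Q).
exists (R.[ga z, gb z] / Q.[ga z, gb z]), ((S%:P).[ga z, gb z] / Q.[ga z, gb z]).
split; [by exists R, Q | by exists S%:P, Q |].
rewrite EP rmorphD !rmorphM !rmorphB /= evX evY !evC; field.
exact: good_neq0.
Qed.

End LocalRings.

(** * Coordinate systems of the function field *)

Section Charts.
Variables (C K : fieldType) (k : {rmorphism C -> K}).
Implicit Types (x y r s : K) (a b c d : C) (P Q : {poly {poly C}}).
Local Notation gcentre := (gcentre C K).
Implicit Types z : gcentre.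
Local Notation gev := (gev k).
Local Notation good := (good k).

Definition indep x y := forall P, gev x y P = 0 -> P = 0.

Definition fracs x y : set K :=
  [set r | exists A B, gev x y B != 0 /\ r = gev x y A / gev x y B].

Definition chart x y := indep x y /\ forall r, fracs x y r.

Lemma indep_good x y a b : indep x y -> good (GCentre x y a b).
Proof. by move=> i P /i ->; rewrite !hE. Qed.

Lemma indep_subx x y a : indep x y -> x - k a != 0.
Proof.
move=> i; apply/eqP => E.
have /i/eqP : gev x y ('X - a%:P%:P) = 0 by rewrite gevB evX evC.
by rewrite polyXsubC_eq0.
Qed.

Lemma indep_x x y : indep x y -> x != 0.
Proof. by move/(indep_subx 0); rewrite rmorph0 subr0. Qed.

Lemma gev_swap x y P : gev y x (swapXY P) = gev x y P.
Proof.
elim/poly2_ind: P => [a|||P Q IP IQ|P Q IP IQ].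
- by rewrite swapXY_polyC map_polyC !evC.
- by rewrite swapXY_X evX evY.
- by rewrite swapXY_Y evX evY.
- by rewrite (rmorphD (@swapXY C)) !gevD IP IQ.
- by rewrite (rmorphM (@swapXY C)) !gevM IP IQ.
Qed.

Lemma indep_swap x y : indep x y -> indep y x.
Proof.
move=> i P; rewrite -gev_swap => /i /eqP.
by rewrite swapXY_eq0 => /eqP.
Qed.

Lemma indep_y x y : indep x y -> y != 0.
Proof. by move/indep_swap/indep_x. Qed.

Lemma indep_suby x y b : indep x y -> y - k b != 0.
Proof. by move/indep_swap/indep_subx. Qed.

Lemma gev_comp x y P Q : gev (gev x y Q) y P = gev x y (P \Po Q).
Proof.
elim/poly2_ind: P => [a|||P R IP IR|P R IP IR].
- by rewrite comp_polyC !evC.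
- by rewrite comp_polyX evX.
- by rewrite comp_polyC !evY.
- by rewrite comp_polyD !gevD IP IR.
- by rewrite comp_polyM !gevM IP IR.
Qed.

Lemma indep_poly x y Q : (1 < size Q)%N -> indep x y -> indep (gev x y Q) y.
Proof.
move=> sQ i P; rewrite gev_comp => /i/eqP.
by rewrite comp_poly_eq0 // => /eqP.
Qed.

Lemma gev_sum x y P n : (size P <= n)%N ->
  gev x y P = \sum_(i < n) gev x y (P`_i)%:P * x ^+ i.
Proof.
move=> le; have {1}-> : P = \sum_(i < n) (P`_i)%:P * 'X ^+ i.
  rewrite -[LHS]coefK poly_def (big_ord_widen n (fun i => P`_i *: 'X^i)) //.
  rewrite big_mkcond; apply: eq_bigr => i _; rewrite -mul_polyC.
  by case: ltnP => // /leq_sizeP/(_ i (leqnn _)) ->; rewrite mul0r.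
rewrite (big_morph (gev x y) (gevD k x y) (gev0 k x y)); apply: eq_bigr => i _.
by rewrite gevM gevXn evX.
Qed.

Lemma indep_inv x y : indep x y -> indep x^-1 y.
Proof.
move=> i P EP; have x0 := indep_x i.
have [/eqP|/prednK/esym] := posnP (size P).
  by rewrite size_poly_eq0 => /eqP.
set n := (size P).-1 => En.
(* The reciprocal polynomial: [R] at [x] is [x ^+ n] times [P] at [x^-1], so independence of [x]
   kills its coefficients, which are those of [P] in reverse order. *)
pose R := \poly_(j < n.+1) P`_(n - j).
have ER : gev x y R = x ^+ n * gev x^-1 y P.
  rewrite (gev_sum _ _ (size_poly _ _)) (@gev_sum _ _ P n.+1) ?En // mulr_sumr.
  rewrite (reindex_inj rev_ord_inj) /=; apply: eq_bigr => j _.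
  have lej : (j <= n)%N by rewrite -ltnS.
  rewrite coef_poly subSS ltnS leq_subr subKn // [RHS]mulrCA; congr (_ * _); first by rewrite !evYE.
  by rewrite exprVn expfB_cond ?(negPf x0).
have /i R0 : gev x y R = 0 by rewrite ER EP mulr0.
apply/polyP => j; rewrite coef0; have [ltj|] := ltnP j n.+1; last first.
  by rewrite -En => /leq_sizeP ->.
have := congr1 (fun T : {poly {poly C}} => T`_(n - j)) R0.
by rewrite /= coef0 coef_poly ltnS leq_subr subKn.
Qed.

Section Fracs.
Variables x y : K.

Lemma fracs_poly P : fracs x y (gev x y P).
Proof. by exists P, 1; rewrite gev1 divr1 oner_neq0. Qed.

Lemma fracs_k a : fracs x y (k a).
Proof. by rewrite -(evC k x y); apply: fracs_poly. Qed.

Lemma fracs_x : fracs x y x.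
Proof. by rewrite -{2}(evX k x y); apply: fracs_poly. Qed.

Lemma fracs_y : fracs x y y.
Proof. by rewrite -{2}(evY k x y); apply: fracs_poly. Qed.

Lemma fracsD r s : fracs x y r -> fracs x y s -> fracs x y (r + s).
Proof.
move=> [A [B [B0 ->]]] [A' [B' [B'0 ->]]].
exists (A * B' + A' * B), (B * B').
by rewrite !(gevD, gevM) mulf_neq0 // addf_div.
Qed.

Lemma fracsM r s : fracs x y r -> fracs x y s -> fracs x y (r * s).
Proof.
move=> [A [B [B0 ->]]] [A' [B' [B'0 ->]]].
exists (A * A'), (B * B').
by rewrite !gevM mulf_neq0 // mulf_div.
Qed.

Lemma fracsV r : fracs x y r -> fracs x y r^-1.
Proof.
move=> [A [B [B0 ->]]]; have [->|A0] := eqVneq (gev x y A) 0.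
  by rewrite mul0r invr0 -(rmorph0 k); apply: fracs_k.
by exists B, A; rewrite invf_div.
Qed.

Lemma fracs_ev u v P : fracs x y u -> fracs x y v -> fracs x y (gev u v P).
Proof.
move=> fu fv; elim/poly2_ind: P => [a|||P Q IP IQ|P Q IP IQ].
- by rewrite evC; apply: fracs_k.
- by rewrite evX.
- by rewrite evY.
- by rewrite gevD; apply: fracsD.
- by rewrite gevM; apply: fracsM.
Qed.

Lemma fracs_trans u v r : fracs x y u -> fracs x y v -> fracs u v r -> fracs x y r.
Proof.
move=> fu fv [A [B [B0 ->]]].
by apply: fracsM; [|apply: fracsV]; apply: fracs_ev.
Qed.

End Fracs.

Lemma chart_gen x y x' y' : chart x y -> indep x' y' -> fracs x' y' x -> fracs x' y' y ->
  chart x' y'.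
Proof. by move=> [_ g] i fx fy; split=> // r; apply: fracs_trans fx fy (g r). Qed.

Lemma chart_swap x y : chart x y -> chart y x.
Proof.
move=> c; apply: (chart_gen c); last exact: fracs_x.
  by apply: indep_swap; case: c.
exact: fracs_y.
Qed.

Lemma chart_inv x y : chart x y -> chart x^-1 y.
Proof.
move=> c; apply: (chart_gen c); last exact: fracs_y.
  by apply: indep_inv; case: c.
by rewrite -[X in fracs _ _ X]invrK; apply/fracsV/fracs_x.
Qed.

Lemma chart_mul x y : chart x y -> chart (x * y) y.
Proof.
move=> c; have [i _] := c; have y0 := indep_y i.
have -> : x * y = gev x y ('X * 'Y) by rewrite gevM evX evY.
apply: (chart_gen c); last exact: fracs_y.
  apply: indep_poly i.
  rewrite mulrC mul_polyC size_scale ?size_polyX //.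
  by rewrite polyX_eq0.
rewrite gevM evX evY -[X in fracs _ _ X](mulfK y0).
by apply: fracsM; [exact: fracs_x | apply/fracsV/fracs_y].
Qed.

Lemma chart_add x y (p : {poly C}) : chart x y -> chart (x + (map_poly k p).[y]) y.
Proof.
move=> c; have [i _] := c.
have -> : x + (map_poly k p).[y] = gev x y ('X + p%:P) by rewrite gevD evX evYE.
apply: (chart_gen c); last exact: fracs_y.
  by apply: indep_poly i; rewrite size_XaddC.
have {2}-> : x = gev x y ('X + p%:P) - gev x y p%:P by rewrite gevD evX addrK.
apply: fracsD; first exact: fracs_x.
set u := gev x y _; rewrite evYE -(evYE k u) -gevN.
exact: fracs_poly.
Qed.

Lemma chart_scale x y a : a != 0 -> chart x y -> chart (k a * x) y.
Proof.
move=> a0 c; have [i _] := c.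
have -> : k a * x = gev x y (a%:P%:P * 'X) by rewrite gevM evX evC.
apply: (chart_gen c); last exact: fracs_y.
  by apply: indep_poly i; rewrite mul_polyC size_scale ?size_polyX // polyC_eq0.
rewrite gevM evX evC -[X in fracs _ _ X](mulKf (_ : k a != 0)) ?fmorph_eq0 //.
by rewrite -fmorphV; apply: fracsM; [exact: fracs_k | exact: fracs_x].
Qed.

Lemma chart_subx x y a : chart x y -> chart (x - k a) y.
Proof.
by move/(chart_add (- a)%:P); rewrite map_polyC hornerC /= rmorphN.
Qed.

Lemma chart_suby x y a : chart x y -> chart x (y - k a).
Proof. by move/chart_swap/(chart_subx a)/chart_swap. Qed.

Lemma chart_invy x y : chart x y -> chart x y^-1.
Proof. by move/chart_swap/chart_inv/chart_swap. Qed.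

Lemma chart_div x y : chart x y -> chart (x / y) y.
Proof.
by move/chart_invy/chart_mul/chart_invy; rewrite invrK.
Qed.

Lemma chart_muly x y : chart x y -> chart x (y * x).
Proof. by move/chart_swap/chart_mul/chart_swap. Qed.

Lemma chart_divy x y : chart x y -> chart x (y / x).
Proof. by move/chart_swap/chart_div/chart_swap. Qed.

Lemma chart_good x y a b : chart x y -> good (GCentre x y a b).
Proof. by case=> i _; apply: indep_good. Qed.

Lemma chart_x0 x y : chart x y -> x != 0.
Proof. by case=> /indep_x. Qed.

Lemma chart_y0 x y : chart x y -> y != 0.
Proof. by case=> /indep_y. Qed.

End Charts.

Arguments chart_good {C K k x y} a b _.

(** * Blow-up charts under a change of coordinates *)

Section BlowupPoints.
Variables (C K : fieldType) (k : {rmorphism C -> K}).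
Implicit Types (x y r s : K) (a b c d : C) (P Q : {poly {poly C}}).
Local Notation gcentre := (gcentre C K).
Implicit Types z : gcentre.
Local Notation val := (val k).
Local Notation gpt := (gpt k).
Local Notation good := (good k).

Definition guv z c d : gcentre :=
  GCentre ((gx z - k (ga z)) / (gy z - k (gb z))) (gy z - k (gb z)) c d.

Definition gswap z : gcentre := GCentre (gy z) (gx z) (gb z) (ga z).

Definition gexc (O : set K) : set (set K) :=
  [set O' | exists z c, O = gpt z /\ O' = gpt (guv z c 0)].

Lemma gpt_swap z : good z -> gpt (gswap z) = gpt z.
Proof.
move=> gz.
have vx := val_x k z; have vy := val_y k z.
apply: pt_eq => //=; [exact: val_y (gswap z)|exact: val_x (gswap z)].
Qed.

Lemma good_swap z : good z -> good (gswap z).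
Proof. by move=> gz; apply: good_sub gz _ _; [exact: val_y|exact: val_x]. Qed.

Lemma val_swap z r c : good z -> val (gswap z) r c <-> val z r c.
Proof.
move=> gz; have gz' := good_swap gz; split; apply: val_pteq => //.
  by rewrite gpt_swap.
by rewrite gpt_swap.
Qed.

Lemma val_sub0 z r c : good z -> val z r c -> val z (r - k c) 0.
Proof.
by move=> gz v; rewrite -(subrr c); apply: valB => //; apply: val_cst.
Qed.

Lemma val_uv z c r e : good (guv z c 0) -> gy z - k (gb z) != 0 ->
  val z r e -> val (guv z c 0) r e.
Proof.
move=> g0 n0; apply: val_sub => //; last first.
  have := valD g0 (val_y k (guv z c 0)) (val_cst k (guv z c 0) (gb z)).
  by rewrite /= subrK add0r.
have := valM (val_x k (guv z c 0)) (val_y k (guv z c 0)) => /=.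
rewrite mulr0 divfK // => v.
by have := valD g0 v (val_cst k (guv z c 0) (ga z)); rewrite subrK add0r.
Qed.

Section ChangeOfCoordinates.
Variables (z z' : gcentre) (s1 s2 s3 s4 : K) (c1 c2 c3 c4 c c' : C).
Hypotheses (gz : good z) (gz' : good z') (Ez : gpt z = gpt z').
Hypothesis gc : good (guv z c 0).
Hypothesis y0 : gy z - k (gb z) != 0.
Hypotheses (v1 : val z s1 c1) (v2 : val z s2 c2) (v3 : val z s3 c3) (v4 : val z s4 c4).
Hypothesis Ex' : gx z' - k (ga z') = s1 * (gx z - k (ga z)) + s2 * (gy z - k (gb z)).
Hypothesis Ey' : gy z' - k (gb z') = s3 * (gx z - k (ga z)) + s4 * (gy z - k (gb z)).
Hypothesis det : c1 * c4 - c2 * c3 != 0.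
Hypothesis N0 : c3 * c + c4 != 0.
Hypothesis Ec' : c' * (c3 * c + c4) = c1 * c + c2.

Let u := (gx z - k (ga z)) / (gy z - k (gb z)).
Let v := gy z - k (gb z).

(** A change of coordinates acts on the directions at a point by the Moebius transformation of its
    linear part [c1, c2, c3, c4]. Dividing the two expressions of the new coordinates gives
    [u' = (s1 * u + s2) / (s3 * u + s4)]; a nonzero determinant allows [u] to be recovered from
    [u'], so the coordinates are regular at each other's points. *)
Lemma uv_change : gpt (guv z' c' 0) = gpt (guv z c 0).
Proof.
have w1 := val_uv gc y0 v1; have w2 := val_uv gc y0 v2.
have w3 := val_uv gc y0 v3; have w4 := val_uv gc y0 v4.
have vu : val (guv z c 0) u c := val_x k (guv z c 0).
have vv : val (guv z c 0) v 0 := val_y k (guv z c 0).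
have Exz : gx z - k (ga z) = u * v by rewrite /u /v divfK.
have wN : val (guv z c 0) (s3 * u + s4) (c3 * c + c4) by apply: valD => //; apply: valM.
have n0 := val_ne0 gc N0 wN.
have Ev' : gy z' - k (gb z') = (s3 * u + s4) * v by rewrite Ey' Exz /v; ring.
have v'0 : gy z' - k (gb z') != 0 by rewrite Ev' mulf_neq0.
have Eu' : (gx z' - k (ga z')) / (gy z' - k (gb z')) = (s1 * u + s2) / (s3 * u + s4).
  by rewrite Ev' Ex' Exz -/v; field; rewrite n0.
have Ec : c' = (c1 * c + c2) / (c3 * c + c4) by rewrite -Ec' mulfK.
have vu' : val (guv z c 0) ((gx z' - k (ga z')) / (gy z' - k (gb z'))) c'.
  by rewrite Eu' Ec; apply: val_div => //; apply: valD => //; apply: valM.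
have vv' : val (guv z c 0) (gy z' - k (gb z')) 0.
  by apply: val_eq (valM wN vv) Ev' _; rewrite mulr0.
have gc' : good (guv z' c' 0) by exact: (@good_sub _ _ _ _ (guv z' c' 0) gc vu' vv').
have x1 := val_uv gc' v'0 (val_pteq gz gz' Ez v1).
have x2 := val_uv gc' v'0 (val_pteq gz gz' Ez v2).
have x3 := val_uv gc' v'0 (val_pteq gz gz' Ez v3).
have x4 := val_uv gc' v'0 (val_pteq gz gz' Ez v4).
have xu := val_x k (guv z' c' 0); have xv := val_y k (guv z' c' 0).
set u' := gx (guv z' c' 0) in xu; set v' := gy (guv z' c' 0) in xv.
have Eu'' : u' * (s3 * u + s4) = s1 * u + s2 by rewrite [u']Eu' divfK.
have d0 : c1 - c3 * c' != 0.
  apply: contra_neq det => E; transitivity ((c1 - c3 * c') * (c3 * c + c4)).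
    by rewrite mulrBl -mulrA Ec'; ring.
  by rewrite E mul0r.
have xd : val (guv z' c' 0) (s1 - s3 * u') (c1 - c3 * c').
  by apply: valB => //; apply: valM.
have nd := val_ne0 gc' d0 xd.
have Eu : u = (s4 * u' - s2) / (s1 - s3 * u').
  apply: (mulIf nd); rewrite divfK //; apply/eqP; rewrite -subr_eq0; apply/eqP.
  by transitivity (s1 * u + s2 - u' * (s3 * u + s4)); [ring | rewrite Eu'' subrr].
have xu0 : val (guv z' c' 0) u c.
  rewrite Eu; apply: val_eq (val_div d0 (valB gc' (valM x4 xu) x2) xd) _ _ => //.
  apply: (mulIf d0); rewrite divfK //.
  transitivity (c1 * c + c2 - c' * (c3 * c + c4) + (c4 * c' - c2)); first by ring.
  by rewrite Ec' subrr add0r.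
apply: pt_eq => //.
have Ev : v = v' / (s3 * u + s4) by rewrite [v']Ev' mulrC mulKf.
have xN := valD gc' (valM x3 xu0) x4.
by apply: val_eq (val_div N0 xv xN) Ev _; rewrite mul0r.
Qed.

End ChangeOfCoordinates.
End BlowupPoints.

(** * The exceptional curve in fixed coordinates *)

Section ExceptionalCurve.
Variables (C K : fieldType) (k : {rmorphism C -> K}).
Implicit Types (x y r s : K) (a b c d : C) (P Q : {poly {poly C}}).
Local Notation gcentre := (gcentre C K).
Implicit Types z : gcentre.
Local Notation val := (val k).
Local Notation gpt := (gpt k).
Local Notation good := (good k).
Local Notation chart := (chart k).
Local Notation guv := (guv k).
Local Notation gexc := (gexc k).

(** Linear independence of the coordinates modulo the square of the maximal ideal: clear
    denominators, set the first variable equal to [ga z], cancel the factor ['Y - gb z] and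
    evaluate. *)
Lemma lin_indep2 z s1 s2 c1 c2 : chart (gx z) (gy z) -> val z s1 c1 -> val z s2 c2 ->
  s1 * (gx z - k (ga z)) + s2 * (gy z - k (gb z)) = 0 -> c2 = 0.
Proof.
move=> cz; have gz := chart_good (ga z) (gb z) cz; have [i _] := cz.
move=> [P1 [Q1 [n1 -> _]]] [P2 [Q2 [n2 -> ->]]] E.
have m1 := good_neq0 gz n1; have m2 := good_neq0 gz n2.
have : gev k (gx z) (gy z)
    (P1 * Q2 * ('X - (ga z)%:P%:P) + P2 * Q1 * ('Y - (gb z)%:P%:P)) = 0.
  rewrite gevD !gevM !gevB evX evY !evC.
  rewrite -[RHS](mul0r (gev k (gx z) (gy z) Q1 * gev k (gx z) (gy z) Q2)) -E.
  by field; rewrite m1 m2.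
move/i/(congr1 (horner^~ (ga z)%:P)); rewrite /= !hE subrr mulr0 add0r => /eqP.
rewrite mulf_eq0 polyXsubC_eq0 orbF => /eqP /(congr1 (horner^~ (gb z))) /eqP.
rewrite /= !hE mulf_eq0 (negPf n1) orbF => /eqP ->.
by rewrite mul0r.
Qed.

Lemma lin_indep1 z s1 s2 c1 c2 : chart (gx z) (gy z) -> val z s1 c1 -> val z s2 c2 ->
  s1 * (gx z - k (ga z)) + s2 * (gy z - k (gb z)) = 0 -> c1 = 0.
Proof.
move=> cz v1 v2 E; have gz := chart_good (ga z) (gb z) cz.
apply: (@lin_indep2 (gswap z) s2 s1 c2 c1); first exact: chart_swap.
- by apply/val_swap.
- by apply/val_swap.
- by rewrite /= addrC.
Qed.

Lemma chart_uv z c d : chart (gx z) (gy z) -> chart (gx (guv z c d)) (gy (guv z c d)).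
Proof. by move=> cz; apply/chart_div/chart_subx/chart_suby. Qed.

Lemma good_uv z c d : chart (gx z) (gy z) -> good (guv z c d).
Proof. by move=> cz; apply: chart_good; apply: chart_uv. Qed.

(** Any presentation of the point has coordinates generating the same maximal ideal, so its linear
    part relative to [z] is invertible and [uv_change] identifies its directions with those of [z].
    Only the direction at infinity of the chart of [z] needs the swapped chart. *)
Lemma gexcP z : chart (gx z) (gy z) -> gexc (gpt z) =
  [set O | (exists c, O = gpt (guv z c 0)) \/ O = gpt (guv (gswap z) 0 0)].
Proof.
move=> cz; have gz := chart_good (ga z) (gb z) cz.
have czs : chart (gx (gswap z)) (gy (gswap z)) by apply: chart_swap.
have gzs := good_swap gz.
have [i _] := cz.
have nx := indep_subx (ga z) i; have ny := indep_suby (gb z) i.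
apply/seteqP; split=> [O [z' [c' [Ez ->]]]|O [[c ->]|->]]; last first.
- by exists (gswap z), 0; rewrite gpt_swap.
- by exists z, c.
have vx0 : val z (gx z - k (ga z)) 0 by apply: val_sub0 gz (val_x k z).
have vy0 : val z (gy z - k (gb z)) 0 by apply: val_sub0 gz (val_y k z).
have gz' := good_pteq gz Ez vx0 nx.
have wx := val_pteq gz' gz (esym Ez) (val_sub0 gz' (val_x k z')).
have wy := val_pteq gz' gz (esym Ez) (val_sub0 gz' (val_y k z')).
have [s1 [s2 [c1 [c2 [v1 v2 Ex']]]]] := val_gen gz wx.
have [s3 [s4 [c3 [c4 [v3 v4 Ey']]]]] := val_gen gz wy.
have [t1 [t2 [d1 [d2 [w1 w2 Ex]]]]] := val_gen gz' (val_pteq gz gz' Ez vx0).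
have [t3 [t4 [d3 [d4 [w3 w4 Ey]]]]] := val_gen gz' (val_pteq gz gz' Ez vy0).
have {w1 w2 w3 w4} [w1 w2 w3 w4] : [/\ val z t1 d1, val z t2 d2, val z t3 d3 & val z t4 d4].
  by split; apply: val_pteq gz' gz (esym Ez) _.
set X := gx z - k (ga z) in nx vx0 Ex Ex' Ey'; set Y := gy z - k (gb z) in ny vy0 Ey Ex' Ey'.
set X' := gx z' - k (ga z') in wx Ex Ex' Ey; set Y' := gy z' - k (gb z') in wy Ey Ey' Ex.
have E1 : d1 * c1 + d2 * c3 - 1 = 0.
  apply: (@lin_indep1 z (t1 * s1 + t2 * s3 - 1) (t1 * s2 + t2 * s4) _ (d1 * c2 + d2 * c4) cz).
  - by do ![apply: val1 | apply: valB | apply: valD | apply: valM].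
  - by do ![apply: valD | apply: valM].
  - by rewrite -/X -/Y -[RHS](subrr X) [Z in _ = Z - _]Ex Ex' Ey'; ring.
have E2 : d1 * c2 + d2 * c4 = 0.
  apply: (@lin_indep2 z (t1 * s1 + t2 * s3 - 1) (t1 * s2 + t2 * s4) (d1 * c1 + d2 * c3 - 1) _ cz).
  - by do ![apply: val1 | apply: valB | apply: valD | apply: valM].
  - by do ![apply: valD | apply: valM].
  - by rewrite -/X -/Y -[RHS](subrr X) [Z in _ = Z - _]Ex Ex' Ey'; ring.
have E3 : d3 * c1 + d4 * c3 = 0.
  apply: (@lin_indep1 z (t3 * s1 + t4 * s3) (t3 * s2 + t4 * s4 - 1) _ (d3 * c2 + d4 * c4 - 1) cz).
  - by do ![apply: valD | apply: valM].
  - by do ![apply: val1 | apply: valB | apply: valD | apply: valM].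
  - by rewrite -/X -/Y -[RHS](subrr Y) [Z in _ = Z - _]Ey Ex' Ey'; ring.
have E4 : d3 * c2 + d4 * c4 - 1 = 0.
  apply: (@lin_indep2 z (t3 * s1 + t4 * s3) (t3 * s2 + t4 * s4 - 1) (d3 * c1 + d4 * c3) _ cz).
  - by do ![apply: valD | apply: valM].
  - by do ![apply: val1 | apply: valB | apply: valD | apply: valM].
  - by rewrite -/X -/Y -[RHS](subrr Y) [Z in _ = Z - _]Ey Ex' Ey'; ring.
have det : c1 * c4 - c2 * c3 != 0.
  suff E : (d1 * d4 - d2 * d3) * (c1 * c4 - c2 * c3) = 1.
    by apply: contra_eq_neq E => ->; rewrite mulr0 eq_sym oner_neq0.
  transitivity ((d1 * c1 + d2 * c3 - 1 + 1) * (d3 * c2 + d4 * c4 - 1 + 1)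
    - (d1 * c2 + d2 * c4) * (d3 * c1 + d4 * c3)); first by ring.
  by rewrite E1 E2 E3 E4; ring.
(* The inverse Moebius transformation has denominator [c1 - c3 * c']; where it vanishes the
   direction is the one at infinity, covered by the swapped chart. *)
have [E0|n0] := eqVneq (c1 - c3 * c') 0.
  right; apply: (@uv_change _ _ k (gswap z) z' s2 s1 s4 s3 c2 c1 c4 c3) => //.
  - by rewrite gpt_swap.
  - exact: good_uv.
  - by apply/val_swap.
  - by apply/val_swap.
  - by apply/val_swap.
  - by apply/val_swap.
  - by rewrite /= [RHS]addrC; apply: Ex'.
  - by rewrite /= [RHS]addrC; apply: Ey'.
  - by apply: contra_neq det => E; rewrite -[LHS]opprK -[RHS]oppr0 -E; congr (- _); ring.
  - apply: contra_neq det => E; move: E0; rewrite mulr0 add0r in E.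
    by rewrite E mul0r subr0 => ->; ring.
  - by rewrite !mulr0 !add0r mulrC; apply/eqP; rewrite eq_sym -subr_eq0 E0.
left; exists ((c4 * c' - c2) / (c1 - c3 * c')).
apply: (@uv_change _ _ k z z' s1 s2 s3 s4 c1 c2 c3 c4) => //.
- exact: good_uv.
- have -> : c3 * ((c4 * c' - c2) / (c1 - c3 * c')) + c4
    = (c1 * c4 - c2 * c3) / (c1 - c3 * c') by field.
  by rewrite mulf_neq0 ?invr_eq0.
- by field.
Qed.

Definition pt0 x y b := gpt (GCentre x y 0 b).

Lemma pt_sym x y a b : chart x y -> gpt (GCentre x y a b) = gpt (GCentre y x b a).
Proof. by move=> c; rewrite -gpt_swap //; apply: chart_good. Qed.

(** In the first family the exceptional curve is again the line x = 0, now with the slope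
    [(y - k b) / x] as its coordinate. The extra point is where it meets the proper transform of x =
    0. *)
Lemma exc_pt0 x y b : chart x y -> gexc (pt0 x y b) =
  [set O | (exists c, O = pt0 x ((y - k b) / x) c) \/ O = pt0 (x / (y - k b)) (y - k b) 0].
Proof.
move=> cxy; have cs := chart_swap cxy.
rewrite /pt0 pt_sym // gexcP //= /gexc /gswap /guv /= !rmorph0 !subr0.
have c1 : chart ((y - k b) / x) x by apply/chart_div/chart_subx.
have c1s := chart_swap c1.
by apply/seteqP; split=> O [[c ->]|->]; [left; exists c|right|left; exists c|right];
  first [by [] | by rewrite pt_sym].
Qed.

(** The same curve seen in the other chart, where its equation is [y - k b = 0]; the extra point is
    the direction of the line y = b. *)
Lemma exc_pt0' x y b : chart x y -> gexc (pt0 x y b) =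
  [set O | (exists c, O = pt0 (y - k b) (x / (y - k b)) c) \/ O = pt0 x ((y - k b) / x) 0].
Proof.
move=> cxy; have cs := chart_swap cxy.
rewrite /pt0 gexcP //= /gexc /gswap /guv /= !rmorph0 !subr0.
have c1 : chart ((y - k b) / x) x by apply/chart_div/chart_subx.
have c1s := chart_swap c1.
have c2 : chart (x / (y - k b)) (y - k b) by apply/chart_div/chart_suby.
have c2s := chart_swap c2.
by apply/seteqP; split=> O [[c ->]|->]; [left; exists c|right|left; exists c|right];
  first [by [] | by rewrite pt_sym].
Qed.

End ExceptionalCurve.

(** * Lowest terms for fractions in two variables *)

Section Coprime.
Variable C : closedFieldType.
Implicit Types (a c : C) (p q : {poly C}) (A B D E N P Q R : {poly {poly C}}).

(** Specialisation of the inner variable: a polynomial in X and Y is restricted to the line Y = a,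
    leaving a polynomial in X. *)
Definition speval a P : {poly C} := map_poly (horner_eval a) P.

Lemma spevalM a P Q : speval a (P * Q) = speval a P * speval a Q.
Proof. exact: rmorphM. Qed.

Lemma spevalC a p : speval a p%:P = (p.[a])%:P.
Proof. by rewrite /speval map_polyC. Qed.

Lemma speval_coef a P i : (speval a P)`_i = (P`_i).[a].
Proof. by rewrite coef_map. Qed.

Lemma speval_horner a c P : (speval a P).[c] = P.[c, a].
Proof.
rewrite /speval -[c in LHS](hornerC c a) -[(c%:P).[a]]/(horner_eval a c%:P).
by rewrite horner_map.
Qed.

Lemma speval_eq0 a P : speval a P = 0 -> exists P1, P = ('X - a%:P)%:P * P1.
Proof.
move=> P0; exists (\poly_(i < size P) (P`_i %/ ('X - a%:P))).
apply/polyP => i; rewrite coefCM coef_poly; case: ltnP => [_|/leq_sizeP -> //]; last first.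
  by rewrite mulr0.
rewrite mulrC divpK // dvdp_XsubCl rootE.
by have := speval_coef a P i; rewrite P0 coef0 => <-.
Qed.

(** Induction on the degree of [p]. Modulo Y - a, for a root [a] of [p], both [B * Q] and [A * Q]
    vanish. Either [Q] is divisible by Y - a and the factor cancels, or both [A] and [B] are
    divisible by it. Once [p] is constant, [B] divides [D]. *)
Lemma strip_const A B D Q N p : p != 0 -> p%:P * D = B * Q -> A * Q = p%:P * N ->
  (exists E, D = B * E) \/
  (exists a A1 B1, A = ('X - a%:P)%:P * A1 /\ B = ('X - a%:P)%:P * B1).
Proof.
have [n] := ubnP (size p); elim: n => // n IH in p Q N * => lep p0 E1 E2.
have [/eqP/size_poly1P [e e0 Ep]|sp] := eqVneq (size p) 1.
  left; exists (e^-1%:P%:P * Q).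
  rewrite mulrCA -E1 Ep mulrA -!polyCM mulVf //.
  by rewrite mul1r.
have /closed_rootP [a] : size p != 1 by [].
move/factor_theorem => [p1 Ep].
have p10 : p1 != 0 by apply: contra_neq p0 => p10; rewrite Ep p10 mul0r.
have X0 : ('X - a%:P)%:P != 0 :> {poly {poly C}} by rewrite polyC_eq0 polyXsubC_eq0.
have E1a : speval a B * speval a Q = 0.
  by rewrite -spevalM -E1 spevalM spevalC Ep !hE subrr mulr0 mul0r.
have E2a : speval a A * speval a Q = 0.
  by rewrite -spevalM E2 spevalM spevalC Ep !hE subrr mulr0 mul0r.
have [/speval_eq0 [Q1 EQ]|Q0] := eqVneq (speval a Q) 0.
  apply: (IH p1 Q1 N) => //.
  - by rewrite -ltnS (leq_trans _ lep) // ltnS Ep size_mul ?polyXsubC_eq0 // size_XsubC addn2.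
  - by apply: (mulfI X0); rewrite mulrA -polyCM mulrC -mulrC [_ * p1]mulrC -Ep E1 EQ mulrCA.
  - by apply: (mulfI X0); rewrite mulrCA -EQ E2 Ep mulrA -polyCM [_ * p1]mulrC.
right; exists a.
have /speval_eq0 [A1 ->] : speval a A = 0.
  by move/eqP: E2a; rewrite mulf_eq0 (negPf Q0) orbF => /eqP.
have /speval_eq0 [B1 ->] : speval a B = 0.
  by move/eqP: E1a; rewrite mulf_eq0 (negPf Q0) orbF => /eqP.
by exists A1, B1.
Qed.

(** Coprimality in the form in which it is used, Euclid's lemma, so that no gcd of polynomials in
    two variables has to be built. *)
Definition coprime2 A B := forall D N, A * D = B * N -> exists E, D = B * E.

(** Lexicographic induction on the X-degree of [B] and the Y-degree of its leading coefficient. If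
    Euclid's lemma fails for some [D], pseudo-divide [D] by [B]: a nonzero remainder [R] gives the
    same fraction with the smaller denominator [R], and a zero remainder gives, by [strip_const], a
    common factor Y - a to cancel. *)
Lemma coprime_frac A B : B != 0 ->
  exists A' B', [/\ B' != 0, A * B' = A' * B & coprime2 A' B'].
Proof.
have [n] := ubnP (size B); elim: n => // n IH in A B *.
have [m] := ubnP (size (lead_coef B)); elim: m => // m IHm in A B * => lem len B0.
have [cop|] := pselect (coprime2 A B); first by exists A, B.
move/existsNP => [D] /existsNP [N] /not_implyP [EDN nE].
have := Pdiv.Idomain.divp_eq D B.
set l := lead_coef B ^+ _ => ED; have l0 : l != 0 by rewrite expf_neq0 // lead_coef_eq0.
set Q := (D %/ B)%R in ED; set R := (D %% B)%R in ED.
have [R0|R0] := eqVneq R 0.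
  have H1 : l%:P * D = B * Q by rewrite mul_polyC ED R0 addr0 mulrC.
  have H2 : A * Q = l%:P * N.
    by apply: (mulfI B0); rewrite mulrCA -H1 mulrCA EDN mulrCA.
  have [//|] := strip_const l0 H1 H2.
  move=> [a [A1 [B1 [EA EB]]]].
  have X0 : ('X - a%:P)%:P != 0 :> {poly {poly C}} by rewrite polyC_eq0 polyXsubC_eq0.
  have B10 : B1 != 0 by apply: contra_neq B0 => B10; rewrite EB B10 mulr0.
  have lm1 : (size (lead_coef B1) < m)%N.
    rewrite -ltnS; apply: leq_trans lem; rewrite ltnS EB lead_coefM lead_coefC.
    by rewrite size_mul ?polyXsubC_eq0 ?lead_coef_eq0 // size_XsubC.
  have ln1 : (size B1 < n.+1)%N.
    by apply: leq_trans len; rewrite EB mul_polyC size_scale ?polyXsubC_eq0.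
  have [A' [B' [B'0 E' cop]]] := IHm A1 B1 lm1 ln1 B10; exists A', B'; split=> //.
  by rewrite EA EB -mulrA E' mulrCA.
have [] := IH (l%:P * N - A * Q) R => //.
  by rewrite -ltnS (leq_trans _ len) // ltnS ltn_modp.
move=> A' [B' [B'0 E' cop]]; exists A', B'; split=> //.
apply: (mulfI R0).
have ER : A * R = (l%:P * N - A * Q) * B.
  have -> : R = l%:P * D - Q * B by rewrite mul_polyC ED addrAC subrr add0r.
  by rewrite mulrBr mulrCA EDN mulrBl; congr (_ - _); ring.
rewrite mulrA [R * A]mulrC ER mulrAC E' -mulrA [R * B]mulrC mulrA; ring.
Qed.

End Coprime.

(** * Regularity along an exceptional curve *)

Section Contraction.
Variables (C : closedFieldType) (K : fieldType) (k : {rmorphism C -> K}).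
Implicit Types (x y w r s : K) (a b c d : C) (p q : {poly C}).
Implicit Types (A B D E N P Q R : {poly {poly C}}).
Local Notation gpt := (gpt k).
Local Notation gev := (gev k).
Local Notation chart := (chart k).

(** The pull-back to the chart x = u v, y = v, with ['X] for u and ['Y] for v. *)
Definition blow P : {poly {poly C}} := P \Po ('X * 'Y).

Lemma blow_coef P i : (blow P)`_i = P`_i * 'X^i.
Proof.
elim/poly_ind: P i => [|P p IH] i; first by rewrite /blow comp_poly0 !coef0 mul0r.
rewrite /blow comp_polyD comp_polyM comp_polyX comp_polyC mulrA.
rewrite !coefD coefMC !coefMX !coefC; case: i => [|i] /=.
  by rewrite expr0 mulr1 mul0r.
by rewrite !addr0 IH exprSr mulrA.
Qed.

Lemma blowM P Q : blow (P * Q) = blow P * blow Q.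
Proof. exact: comp_polyM. Qed.

Lemma gev_blow w y P : gev w y (blow P) = gev (w * y) y P.
Proof. by rewrite /blow -gev_comp gevM evX evY. Qed.

(** Applied to [blow P], the exponent [m] is the multiplicity of [P] at the origin, [P'] is the
    strict transform, and [speval 0 P'] is the dehomogenised initial form of [P]. *)
Lemma strip_power P : P != 0 ->
  exists m P', P = ('X^m)%:P * P' /\ speval 0 P' != 0.
Proof.
have [n] := ubnP (size (lead_coef P)); elim: n => // n IH in P *.
move=> len P0; have [|] := eqVneq (speval 0 P) 0; last first.
  by exists 0%N, P; rewrite expr0 mul1r.
case/speval_eq0 => P1; rewrite subr0 => EP.
have X0 : ('X : {poly C}) != 0 by rewrite polyX_eq0.
have P10 : P1 != 0 by apply: contra_neq P0 => P10; rewrite EP P10 mulr0.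
have [|//|m [P' [EP1 P'0]]] := IH P1.
  rewrite -ltnS (leq_trans _ len) // ltnS EP lead_coefM lead_coefC.
  by rewrite size_mul ?lead_coef_eq0 // size_polyX.
by exists m.+1, P'; rewrite EP EP1 mulrA -polyCM exprS.
Qed.

Lemma power_unique m n P Q : speval 0 P != 0 -> speval 0 Q != 0 ->
  ('X^m)%:P * P = ('X^n)%:P * Q -> m = n.
Proof.
wlog le : m n P Q / (m <= n)%N => [H|] P0 Q0 E.
  by case: (leqP m n) => [le|/ltnW le]; [apply: H E | apply/esym; apply: H (esym E)].
apply/eqP; rewrite eqn_leq le /= leqNgt; apply/negP => lt.
have X0 : ('X^m)%:P != 0 :> {poly {poly C}} by rewrite polyC_eq0 expf_neq0 // polyX_eq0.
move: E; rewrite -(subnKC le) exprD polyCM -mulrA => /(mulfI X0) E.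
case/eqP: P0; rewrite E spevalM spevalC horner_exp hornerX expr0n.
by rewrite subn_eq0 leqNgt lt mul0r.
Qed.

(** The polynomial in x and y equal to [y ^+ k * P (x / y, y)]: it clears the denominators
    introduced by u = x / y once [k] is at least the degree of [P] in u. *)
Definition homog k P : {poly {poly C}} := \poly_(i < size P) (P`_i * 'X^(k - i)).

Lemma blow_homog n P : (size P <= n.+1)%N -> blow (homog n P) = ('X^n)%:P * P.
Proof.
move=> le; apply/polyP => i; rewrite blow_coef coefCM coef_poly.
case: ltnP => [lt|/leq_sizeP -> //]; last by rewrite mul0r mulr0.
by rewrite -mulrA -exprD subnK -1?ltnS ?(leq_trans lt) // mulrC.
Qed.

Lemma exc_denominator x y A B m B' c :
  chart x y -> coprime2 A B -> B != 0 -> blow B = ('X^m)%:P * B' ->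
  speval 0 B' != 0 -> gpt (GCentre (x / y) y c 0) (gev x y A / gev x y B) ->
  (speval 0 B').[c] != 0.
Proof.
move=> cxy cop B0 EB B'0 [N [D]] /= [D0 E].
have cwy := chart_div cxy; have [i _] := cxy; have [iw _] := cwy.
have y0 := indep_y i.
have Exy : x = x / y * y by rewrite divfK.
have Bn : gev x y B != 0 by apply: contra_neq B0 => /i.
have Dn : gev (x / y) y D != 0 by apply: contra_neq D0 => /iw ->; rewrite !hE.
pose n := maxn (size D) (size N).
have ED : gev x y (homog n D) = gev x y ('X^n)%:P * gev (x / y) y D.
  rewrite {1}Exy -gev_blow blow_homog ?gevM; last by rewrite leqW // leq_maxl.
  by rewrite !evYE.
have EN : gev x y (homog n N) = gev x y ('X^n)%:P * gev (x / y) y N.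
  rewrite {1}Exy -gev_blow blow_homog ?gevM; last by rewrite leqW // leq_maxr.
  by rewrite !evYE.
have [E1 EE] : exists E1, homog n D = B * E1.
  apply: (cop _ (homog n N)); apply/eqP; rewrite -subr_eq0; apply/eqP/i.
  rewrite gevB !gevM ED EN; apply/eqP; rewrite subr_eq0; apply/eqP.
  by rewrite mulrCA [RHS]mulrCA; congr (_ * _); rewrite [RHS]mulrC; apply/eqP; rewrite -eqr_div // E.
have bD : ('X^n)%:P * D = blow B * blow E1.
  by rewrite -blowM -EE blow_homog // leqW // leq_maxl.
have sD0 : speval 0 D != 0.
  by apply: contra_neq D0 => sD; rewrite -speval_horner sD hornerC.
have E10 : blow E1 != 0.
  apply: contra_neq sD0 => E10; move: bD; rewrite E10 mulr0 => /eqP.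
  rewrite mulf_eq0 polyC_eq0 expf_eq0 polyX_eq0 andbF /= => /eqP ->.
  by rewrite /speval rmorph0.
have [j [E' [EE1 E'0]]] := strip_power E10.
have bD' : ('X^n)%:P * D = ('X^(m + j))%:P * (B' * E').
  by rewrite bD EB EE1 exprD polyCM mulrACA.
have nmj : n = (m + j)%N.
  by apply: power_unique sD0 _ bD'; rewrite spevalM mulf_neq0.
have X0 : ('X^n)%:P != 0 :> {poly {poly C}} by rewrite polyC_eq0 expf_neq0 // polyX_eq0.
move: bD'; rewrite -nmj => /(mulfI X0) EDD.
by move: D0; rewrite -speval_horner EDD spevalM hornerM mulf_eq0 negb_or => /andP [].
Qed.

Lemma coprime2_swap A B : coprime2 A B -> coprime2 (swapXY A) (swapXY B).
Proof.
move=> cop D N E; have [|E1 EE] := cop (swapXY D) (swapXY N).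
  by apply: (can_inj (@swapXYK C)); rewrite !(rmorphM (@swapXY C)) /= !swapXYK.
by exists (swapXY E1); rewrite -[LHS]swapXYK EE (rmorphM (@swapXY C)).
Qed.

(** In lowest terms, the initial form of the denominator [B] vanishes in no direction:
    [exc_denominator] handles the chart, and the swapped chart handles the last direction. Over an
    algebraically closed field a binary form without zeros is a constant, so [B] does not vanish at
    the origin. *)
Lemma regular_on_exc x y r : chart x y ->
  (forall c, gpt (GCentre (x / y) y c 0) r) -> gpt (GCentre x (y / x) 0 0) r ->
  gpt (GCentre x y 0 0) r.
Proof.
move=> cxy Hc H0; have [i g] := cxy.
have [A0 [B0 [B0n Er]]] := g r.
have B0n' : B0 != 0 by apply: contra_neq B0n => ->; rewrite gev0.
have [A [B [Bn EAB cop]]] := coprime_frac A0 B0n'.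
have Bv : gev x y B != 0 by apply: contra_neq Bn => /i.
have {}Er : r = gev x y A / gev x y B.
  by rewrite Er; apply/eqP; rewrite eqr_div // -!gevM EAB.
have nz P : P != 0 -> blow P != 0.
  by move=> P0; rewrite /blow comp_poly_eq0 // mulrC mul_polyC size_scale ?size_polyX ?polyX_eq0.
have [m [B' [EB B'0]]] := strip_power (nz _ Bn).
have sBn : swapXY B != 0 by rewrite swapXY_eq0.
have [m' [B'' [EB' B''0]]] := strip_power (nz _ sBn).
have noroot c : (speval 0 B').[c] != 0.
  by apply: exc_denominator cxy cop Bn EB B'0 _; rewrite -Er.
have r0 : (speval 0 B'').[0] != 0.
  apply: exc_denominator (chart_swap cxy) (coprime2_swap cop) sBn EB' B''0 _.
  rewrite !gev_swap -Er -pt_sym //.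
  by apply/chart_divy.
(* A polynomial without roots is constant here, so the initial form is a multiple of ['Y ^+ m]. *)
have sz : size (speval 0 B') = 1%N.
  by apply/eqP/negPn/negP => /closed_rootP [c /rootP]; apply/eqP.
have cE n l : (B`_n * 'X^n)`_l = ('X^m * B'`_n)`_l.
  by rewrite -blow_coef EB coefCM.
have cE' n l : ((swapXY B)`_n * 'X^n)`_l = ('X^m' * B''`_n)`_l.
  by rewrite -blow_coef EB' coefCM.
have b1 : (B`_0)`_m != 0.
  have := cE 0%N m; rewrite expr0 mulr1 coefXnM ltnn subnn => ->.
  rewrite -horner_coef0 -speval_coef.
  have := noroot 0; by rewrite horner_coef0.
have b2 : (B`_m')`_0 != 0.
  have := cE' 0%N m'; rewrite expr0 mulr1 coefXnM ltnn subnn coef_swapXY => ->.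
  by rewrite -horner_coef0 -speval_coef; rewrite horner_coef0 in r0.
have le1 : (m <= m')%N.
  rewrite leqNgt; apply/negP => lt.
  have := cE m' m'; rewrite coefXnM lt coefMXn ltnn subnn.
  by apply/eqP.
have le2 : (m' <= m)%N.
  rewrite leqNgt; apply/negP => lt.
  have := cE' m m; rewrite coefXnM lt coefMXn ltnn subnn coef_swapXY.
  by apply/eqP.
have Em : m' = m by apply/eqP; rewrite eqn_leq le1 le2.
(* By the swapped chart ([b2]) the initial form also contains ['X ^+ m]; both monomials can occur
   only for exponent 0. *)
have m0 : m = 0%N.
  apply/eqP/negPn/negP => mn0.
  have : (speval 0 B')`_m = 0.
    by apply: (leq_sizeP _ _ (leqnn _)); rewrite sz lt0n.
  rewrite speval_coef horner_coef0 => Bm.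
  have := cE m m; rewrite coefXnM ltnn subnn coefMXn ltnn subnn Bm -{1}Em.
  by apply/eqP.
exists A, B; split=> //=.
by rewrite polyC0 !horner_coef0; move: b1; rewrite m0.
Qed.

(** Local rings of points are integrally closed, here for square roots only. With [r = A / B] in
    lowest terms and [r ^+ 2 = N / D], Euclid's lemma used twice shows that [B] divides [D], which
    does not vanish at the point. *)
Lemma regular_sqr (z : gcentre C K) r : chart (gx z) (gy z) -> gpt z (r ^+ 2) -> gpt z r.
Proof.
move=> cz [N [D [D0 E]]]; have [i g] := cz.
have [A0 [B0 [B0n Er]]] := g r.
have B0n' : B0 != 0 by apply: contra_neq B0n => ->; rewrite gev0.
have [A [B [Bn EAB cop]]] := coprime_frac A0 B0n'.
have Bv : gev (gx z) (gy z) B != 0 by apply: contra_neq Bn => /i.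
have Dv : gev (gx z) (gy z) D != 0 by apply: contra_neq D0 => /i ->; rewrite !hE.
have {}Er : r = gev (gx z) (gy z) A / gev (gx z) (gy z) B.
  by rewrite Er; apply/eqP; rewrite eqr_div // -!gevM EAB.
have E1 : A * (A * D) = B * (B * N).
  apply/eqP; rewrite -subr_eq0; apply/eqP/i; rewrite gevB !gevM.
  apply/eqP; rewrite subr_eq0 !mulrA -!expr2 -[X in _ == X]mulrC.
  by rewrite -eqr_div ?expf_neq0 // -expr_div_n -Er E.
have [E2 /cop [E3 ED]] := cop _ _ E1.
exists A, B; split=> //.
by move: D0; rewrite ED !hornerM mulf_eq0 negb_or => /andP [].
Qed.

End Contraction.

(** * The double cover *)

Section Valuations.
Variables (C : closedFieldType) (K : fieldType) (k : {rmorphism C -> K}).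
Implicit Types (x y r s : K) (a b c d : C).
Local Notation gev := (gev k).
Local Notation chart := (chart k).
Local Notation pt0 := (pt0 k).

(** A root of [1 + 'X * \prod (...)] cannot lie in [l]; the factor ['X] keeps the polynomial
    nonconstant even for the empty list. *)
Lemma fresh (l : seq C) : exists b, b \notin l.
Proof.
have : size ((\prod_(b <- l) ('X - b%:P)) * 'X + 1) != 1%N.
  have p0 : \prod_(b <- l) ('X - b%:P) != 0.
    by rewrite prodf_seq_neq0; apply/allP => b _; rewrite polyXsubC_eq0.
  have sM : size ((\prod_(b <- l) ('X - b%:P)) * 'X) = (size (\prod_(b <- l) ('X - b%:P))).+1.
    exact: size_mulX.
  by rewrite size_polyDl sM ?size_poly1 ?ltnS ?size_poly_gt0 // eqSS size_poly_eq0.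
move=> /closed_rootP [c]; rewrite rootE hornerD hornerM hornerX -(polyC1) hornerC => /eqP rc; exists c.
apply/negP => cl; have /rootP E : root (\prod_(b <- l) ('X - b%:P)) c.
  by rewrite root_prod_XsubC.
by move: rc; rewrite E mul0r add0r => /eqP; rewrite oner_eq0.
Qed.

(* The discrete valuation ring of the curve x = 0. *)
Definition gdvr x y : set K := [set r | exists b, pt0 x y b r].

(** The denominator restricted to x = 0 is a nonzero polynomial in y with finitely many roots. Hence
    finitely many elements of [gdvr x y] are regular at a common point, which makes it a ring and
    later gives density in the Zariski topology. *)
Lemma dvr_cofin x y r : gdvr x y r -> exists l : seq C, forall b, b \notin l -> pt0 x y b r.
Proof.
move=> [b0 [P [Q [/= Q0 ->]]]]; have [l El] := closed_field_poly_normal Q.[0%:P].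
exists l => b bl; exists P, Q; split=> //=; rewrite El hornerZ mulf_neq0 ?lead_coef_eq0 //.
  by apply: contra_neq Q0 => ->; rewrite hornerC.
by apply: contra bl; rewrite -[_ == 0]/(root _ b) root_prod_XsubC.
Qed.

Lemma pt0_dvr x y b : pt0 x y b `<=` gdvr x y.
Proof. by move=> r H; exists b. Qed.

(** Two presentations of a curve are compared on all but finitely many of its points, so the points
    where one chart fails may be ignored. *)
Lemma dvr_via x y x' y' (l : seq C) :
  (forall c, c \notin l -> exists b, pt0 x' y' c `<=` pt0 x y b) ->
  gdvr x' y' `<=` gdvr x y.
Proof.
move=> H r /dvr_cofin [l' H']; have [c] := fresh (l ++ l').
by rewrite mem_cat negb_or => /andP [/H [b sb] /H' /sb]; exists b.
Qed.

Definition subring (R : set K) := [/\ forall a, R (k a),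
  forall r s, R r -> R s -> R (r - s) & forall r s, R r -> R s -> R (r * s)].

Lemma subring_dvr x y : chart x y -> subring (gdvr x y).
Proof.
move=> cxy; split=> [a|r s|r s].
- by exists 0; apply/val_pt/val_cst.
- move=> /dvr_cofin [l Hl] /dvr_cofin [l' Hl']; have [b] := fresh (l ++ l').
  rewrite mem_cat negb_or => /andP [/Hl /pt_val [c v] /Hl' /pt_val [d w]].
  by exists b; apply/val_pt/(valB (chart_good _ _ cxy) v w).
- move=> /dvr_cofin [l Hl] /dvr_cofin [l' Hl']; have [b] := fresh (l ++ l').
  rewrite mem_cat negb_or => /andP [/Hl /pt_val [c v] /Hl' /pt_val [d w]].
  by exists b; apply/val_pt/(valM v w).
Qed.

Lemma subringD R r s : subring R -> R r -> R s -> R (r + s).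
Proof.
move=> [Rk RB RM] Rr Rs; rewrite -[s]opprK; apply: (RB) => //.
by rewrite -sub0r -(rmorph0 k); apply: RB.
Qed.

Lemma dvr_x x y : chart x y -> gdvr x y x.
Proof. by move=> cxy; exists 0; apply: val_pt (val_x k (GCentre x y 0 0)). Qed.

Lemma dvr_y x y : chart x y -> gdvr x y y.
Proof. by move=> cxy; exists 0; apply: val_pt (val_y k (GCentre x y 0 0)). Qed.

Lemma dvr_xV x y : chart x y -> ~ gdvr x y x^-1.
Proof.
move=> cxy [b].
exact: (val_notV (chart_good 0 b cxy) (val_x k (GCentre x y 0 b)) (chart_x0 cxy)).
Qed.

Lemma dvr_yV x y c : chart x y -> gdvr x y (y - k c)^-1.
Proof.
move=> cxy; exists (c + 1); pose z := GCentre x y 0 (c + 1).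
apply: (val_pt (valV _ (valB (chart_good _ _ cxy) (val_y k z) (val_cst k z c)))).
by rewrite /= addrC addKr oner_neq0.
Qed.

Lemma fs_gev (fs : {rmorphism K -> K}) x y P : (forall a, fs (k a) = k a) ->
  fs (gev x y P) = gev (fs x) (fs y) P.
Proof.
move=> fk; elim/poly2_ind: P => [a|||P Q IP IQ|P Q IP IQ].
- by rewrite !evC.
- by rewrite !evX.
- by rewrite !evY.
- by rewrite !gevD rmorphD IP IQ.
- by rewrite !gevM rmorphM IP IQ.
Qed.

End Valuations.

(** * The quotient by the involution *)

Section DoubleCover.
Variables (C : closedFieldType) (K : fieldType) (k : {rmorphism C -> K}).
Variables (fs tau : {rmorphism K -> K}).
Hypothesis two0 : 2 != 0 :> K.
Hypothesis fk : forall a, fs (k a) = k a.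
Hypothesis tk : forall a, tau (k a) = k a.
Hypothesis tf : forall r, tau (fs r) = fs r.
Hypothesis tt : involutive tau.
Implicit Types (x y r s xi eta : K) (a b c d : C) (O : set K).
Local Notation gpt := (gpt k).
Local Notation gev := (gev k).
Local Notation val := (val k).
Local Notation chart := (chart k).

(* (x, y) are local coordinates downstairs, (xi, eta) upstairs, and x = 0 is the
   branch curve. *)
Definition cover x y xi eta := [/\ chart x y, chart xi eta, fs x = xi ^+ 2,
  fs y = eta & tau xi = - xi].

Definition pre (f : K -> K) O : set K := [set r | O (f r)].

Lemma gev_even_odd xi eta P :
  gev xi eta P = gev (xi ^+ 2) eta (even_poly P) + xi * gev (xi ^+ 2) eta (odd_poly P).
Proof.
by rewrite -{1}[P]poly_even_odd gevD gevM evX -!gev_comp !gevXn !evX mulrC.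
Qed.

Lemma horner2_even_odd a b (P : {poly {poly C}}) :
  P.[a, b] = (even_poly P).[a ^+ 2, b] + a * (odd_poly P).[a ^+ 2, b].
Proof.
rewrite -{1}[P]poly_even_odd hornerD hornerM !horner_comp hornerXn hornerX -rmorphXn /=.
by rewrite !hE [_ * a]mulrC.
Qed.

(** Comparing [B * fs r = A] with its image under [tau] separates the parts in [xi]: the quotients
    of the even parts and of the odd parts both equal [fs r]. This gives a numerator and a
    denominator in [xi ^+ 2] and [eta], that is, downstairs. *)
Lemma pre_cover x y xi eta a b : cover x y xi eta ->
  pre fs (gpt (GCentre xi eta a b)) = gpt (GCentre x y (a ^+ 2) b).
Proof.
move=> [cxy cxe fx fy tx]; apply/seteqP; split=> [r /= [A [B [/= Bn E]]]|r].
  have [ixe _] := cxe; have [ixy _] := cxy.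
  have nB : gev xi eta B != 0 by apply: contra_neq Bn => /ixe ->; rewrite !hE.
  have te P : tau (gev (xi ^+ 2) eta P) = gev (xi ^+ 2) eta P.
    by rewrite fs_gev // rmorphXn /= tx sqrrN -fy tf.
  have E1 : gev xi eta B * fs r = gev xi eta A by rewrite E mulrC divfK.
  rewrite (gev_even_odd xi eta B) (gev_even_odd xi eta A) in E1.
  have := congr1 tau E1; rewrite rmorphM !rmorphD !rmorphM /= !te tx tf => E2.
  set B0 := gev _ _ (even_poly B) in E1 E2; set B1 := gev _ _ (odd_poly B) in E1 E2.
  set A0 := gev _ _ (even_poly A) in E1 E2; set A1 := gev _ _ (odd_poly A) in E1 E2.
  have EE : B0 * fs r = A0.
    apply: (mulfI two0); transitivity ((B0 + xi * B1) * fs r + (B0 + - xi * B1) * fs r); first by ring.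
    by rewrite E1 E2; ring.
  have EO : B1 * fs r = A1.
    apply: (mulfI (chart_x0 cxe)); apply: (addrI (B0 * fs r)).
    by rewrite {2}EE -E1; ring.
  (* The even or the odd part of [B] alone may vanish at the point. The combination with the
     constant [a] takes at (a^2, b) exactly the value of [B] at (a, b). *)
  exists (even_poly A + a%:P%:P * odd_poly A), (even_poly B + a%:P%:P * odd_poly B) => /=.
  have Bn' : (even_poly B + a%:P%:P * odd_poly B).[a ^+ 2, b] != 0.
    by rewrite !hE -horner2_even_odd.
  split=> //.
  have nB' : gev x y (even_poly B + a%:P%:P * odd_poly B) != 0.
    by apply: contra_neq Bn' => /ixy ->; rewrite !hE.
  apply: (mulIf nB'); rewrite divfK //; apply: (fmorph_inj fs).
  rewrite rmorphM !gevD !gevM !evC !rmorphD !rmorphM /= fk !fs_gev // fx fy.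
  by rewrite -/A0 -/A1 -EE -EO; ring.
move=> [P [Q [/= Qn ->]]]; rewrite /pre /= fmorph_div !fs_gev // fx fy.
exists (P \Po 'X^2), (Q \Po 'X^2) => /=.
by rewrite -!gev_comp !gevXn !evX !horner_comp !hornerXn -!rmorphXn.
Qed.

Lemma pre_cover' x y xi eta a b : cover x y xi eta ->
  pre fs (gpt (GCentre eta xi b a)) = gpt (GCentre y x b (a ^+ 2)).
Proof.
move=> cv; have [cxy cxe _ _ _] := cv.
by rewrite -(pt_sym a b cxe) (pre_cover a b cv) pt_sym.
Qed.

Definition covered O := exists x y xi eta a b,
  cover x y xi eta /\ O = gpt (GCentre xi eta a b).

(** Non-units downstairs remain non-units upstairs because [fs] commutes with inverses; so values
    are preserved. *)
Lemma val_pre z z' r c : good k z -> good k z' -> pre fs (gpt z) = gpt z' ->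
  val z' r c -> val z (fs r) c.
Proof.
move=> gz gz' E v; have [Ho Hn] : gmax (gpt z') (r - k c).
  by apply/val_max => //; apply: val_sub0.
have v0 : val z (fs (r - k c)) 0.
  apply/val_max => //; split; first by move: Ho; rewrite -E.
  case: Hn => [->|]; first by left; rewrite rmorph0.
  by rewrite -E /pre /= fmorphV; right.
have := valD gz v0 (val_cst k z c).
by rewrite rmorphB fk subrK add0r.
Qed.

(** The coordinate [xi] of the first point has a regular square [fs x] at the second, hence is
    regular there by [regular_sqr]. Its value has square [a ^+ 2]: the value [a] gives the first
    inclusion, and the value [- a] gives the one twisted by [tau]. *)
Lemma covered_pre O1 O2 : covered O1 -> covered O2 -> pre fs O1 = pre fs O2 ->
  O1 `<=` O2 \/ pre tau O1 `<=` O2.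
Proof.
move=> [x [y [xi [eta [a [b [cv ->]]]]]]] [x2 [y2 [xi2 [eta2 [a2 [b2 [cv2 ->]]]]]]].
rewrite (pre_cover _ _ cv) => /esym E.
have [cxy cxe fx fy tx] := cv; have [_ cxe2 _ _ _] := cv2.
set z2 := GCentre xi2 eta2 a2 b2 in E *.
have g2 : good k z2 by apply: chart_good.
have g' : good k (GCentre x y (a ^+ 2) b) by apply: chart_good.
have vx := val_pre g2 g' E (val_x k _); have vy := val_pre g2 g' E (val_y k _).
rewrite /= fx in vx; rewrite /= fy in vy.
have [e ve] : exists e, val z2 xi e.
  by apply/pt_val/regular_sqr; [exact: cxe2 | exact: val_pt vx].
have /eqP : e ^+ 2 = a ^+ 2 by exact: (val_inj g2 (valXn 2 ve) vx).
rewrite eqf_sqr => /orP [/eqP Ee|/eqP Ee]; [left|right].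
  by apply: pt_sub => //=; rewrite -Ee.
move=> r [P [Q [/= Qn Er]]].
have vN : val z2 (- xi) a by rewrite -[a]opprK -Ee; apply: valN.
have -> : r = gev (- xi) eta P / gev (- xi) eta Q.
  by rewrite -[r]tt Er fmorph_div !fs_gev // tx -fy tf.
by apply: (@pt_sub _ _ _ z2 (GCentre (- xi) eta a b)) => //; exists P, Q.
Qed.

(** In the twisted case, [pre tau O1] lies in [O2], which lies in [O1]; as [tau] is an involution,
    [O1] then lies in [pre tau O1], hence in [O2]. *)
Lemma covered_incomparable O1 O2 : covered O1 -> covered O2 -> pre fs O1 = pre fs O2 ->
  O2 `<=` O1 -> O1 = O2.
Proof.
move=> c1 c2 E s21; have sub A B : pre tau A `<=` B -> A `<=` pre tau B.
  by move=> s r Ar; apply: s; rewrite /pre /= tt.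
have mon A B : A `<=` B -> pre tau A `<=` pre tau B by move=> s r; apply: s.
case: (covered_pre c1 c2 E) => [s12|t12]; first by apply/seteqP.
apply/seteqP; split=> //; apply: (subset_trans _ t12); apply: sub.
exact: (subset_trans t12 s21).
Qed.

Lemma covered_fibre O1 O2 : covered O1 -> covered O2 -> pre fs O1 = pre fs O2 ->
  O2 = O1 \/ O2 = pre tau O1.
Proof.
move=> c1 c2 E; have tpre A : pre tau (pre tau A) = A.
  by apply/seteqP; split=> r; rewrite /pre /= tt.
have mon A B : A `<=` B -> pre tau A `<=` pre tau B by move=> s r; apply: s.
case: (covered_pre c2 c1 (esym E)) => [s21|t21].
  by left; rewrite (covered_incomparable c1 c2 E).
case: (covered_pre c1 c2 E) => [s12|t12].
  by left; rewrite -(covered_incomparable c2 c1 (esym E)).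
by right; apply/seteqP; split=> //; rewrite -[O2]tpre; apply: mon.
Qed.

End DoubleCover.

(** * The surface of Okamoto *)

Section Steps.
Variables (C : closedFieldType) (K : fieldType) (k : {rmorphism C -> K}).
Implicit Types (x y r s : K) (a b c d : C) (O R : set K).
Local Notation gpt := (gpt k).
Local Notation val := (val k).
Local Notation chart := (chart k).
Local Notation pt0 := (pt0 k).
Local Notation gexc := (gexc k).
Local Notation subring := (subring k).

(* Blow up the point y = b of the curve x = 0, and then the point where the
   exceptional curve E meets the proper transform of x = 0, with exceptional
   curve L.  The points e1 form E, the points e2 form L, e3 is the intersection of
   E and L, and eZ is the second centre. *)
Definition e1 x y b c := pt0 x ((y - k b) / x) c.
Definition eZ x y b := pt0 (y - k b) (x / (y - k b)) 0.
Definition e2 x y b d := pt0 (y - k b) (x / (y - k b) ^+ 2) d.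
Definition e3 x y b := pt0 (x / (y - k b)) ((y - k b) ^+ 2 / x) 0.

(** [nxt] selects the points of E that are not the centre of a further step. [step] is the state
    after both blow-ups, [stepZ] the state after the first one only, when the node [eZ] is still a
    point. *)
Definition step x y b (nxt : C -> Prop) O :=
  [\/ exists2 c, nxt c & O = e1 x y b c, exists d, O = e2 x y b d | O = e3 x y b].

Definition stepZ x y b (nxt : C -> Prop) O :=
  (exists2 c, nxt c & O = e1 x y b c) \/ O = eZ x y b.

Section Step.
Variables (x y : K) (b : C).
Hypothesis cxy : chart x y.
Local Notation u := (y - k b).

Lemma chart_e1 : chart x (u / x).
Proof. exact/chart_divy/chart_suby. Qed.

Lemma chart_eZ : chart u (x / u).
Proof. exact/chart_swap/chart_div/chart_suby. Qed.

Lemma chart_e2 : chart u (x / u ^+ 2).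
Proof.
have -> : x / u ^+ 2 = (x / u) / u by rewrite expr2 invfM mulrA.
exact/chart_divy/chart_eZ.
Qed.

Lemma chart_e3 : chart (x / u) (u ^+ 2 / x).
Proof.
have -> : u ^+ 2 / x = u / (x / u) by rewrite invf_div mulrA -expr2.
exact/chart_divy/chart_swap/chart_eZ.
Qed.

Lemma step_u0 : u != 0. Proof. by case: cxy => i _; apply: indep_suby i. Qed.
Lemma step_x0 : x != 0. Proof. exact: chart_x0 cxy. Qed.

Lemma exc_e1 : gexc (pt0 x y b) = [set O | (exists c, O = e1 x y b c) \/ O = eZ x y b].
Proof.
rewrite exc_pt0 // /eZ /pt0; have cz := chart_eZ.
by rewrite (pt_sym 0 0 cz).
Qed.

Lemma exc_e2 : gexc (eZ x y b) = [set O | (exists d, O = e2 x y b d) \/ O = e3 x y b].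
Proof.
rewrite /eZ exc_pt0 ?rmorph0 ?subr0; last exact: chart_eZ.
have ux := step_u0; have x0 := step_x0.
have -> : x / u / u = x / u ^+ 2 by field.
have -> : u / (x / u) = u ^+ 2 / x by field; rewrite ?ux ?x0.
by rewrite /e3 /pt0 (pt_sym 0 0 chart_e3).
Qed.

Lemma val_e1 c r d : val (GCentre x y 0 b) r d -> val (GCentre x (u / x) 0 c) r d.
Proof.
pose z := @GCentre C K x (u / x) 0 c; have gz : good k z := chart_good 0 c chart_e1.
have vx : val z x 0 := val_x k z; have vy : val z (u / x) c := val_y k z.
apply: (val_sub gz) => //=.
have := valD gz (valM vy vx) (val_cst k z b).
by rewrite divfK ?subrK ?mulr0 ?add0r // step_x0.
Qed.

Lemma val_eZ r d : val (GCentre x y 0 b) r d -> val (GCentre u (x / u) 0 0) r d.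
Proof.
pose z := @GCentre C K u (x / u) 0 0; have gz : good k z := chart_good 0 0 chart_eZ.
have vx : val z u 0 := val_x k z; have vy : val z (x / u) 0 := val_y k z.
apply: (val_sub gz) => //=.
  by have := valM vy vx; rewrite divfK ?mulr0 // step_u0.
by have := valD gz vx (val_cst k z b); rewrite subrK add0r.
Qed.

Lemma val_e2 c r d : val (GCentre u (x / u) 0 0) r d ->
  val (GCentre u (x / u ^+ 2) 0 c) r d.
Proof.
have ux := step_u0.
pose z := @GCentre C K u (x / u ^+ 2) 0 c; have gz : good k z := chart_good 0 c chart_e2.
have vx : val z u 0 := val_x k z; have vy : val z (x / u ^+ 2) c := val_y k z.
apply: (val_sub gz) => //=.
apply: val_eq (valM vy vx) _ _; last by rewrite mulr0.
by field.
Qed.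

Lemma val_e3 r d : val (GCentre u (x / u) 0 0) r d ->
  val (GCentre (x / u) (u ^+ 2 / x) 0 0) r d.
Proof.
have ux := step_u0; have x0 := step_x0.
pose z := @GCentre C K (x / u) (u ^+ 2 / x) 0 0; have gz : good k z := chart_good 0 0 chart_e3.
have vx : val z (x / u) 0 := val_x k z; have vy : val z (u ^+ 2 / x) 0 := val_y k z.
apply: (val_sub gz) => //=.
apply: val_eq (valM vy vx) _ _; last by rewrite mulr0.
by field; rewrite ?ux ?x0.
Qed.

Lemma e1_above c : pt0 x y b `<=` e1 x y b c.
Proof. by move=> r /pt_val [d /val_e1 v]; exact: (val_pt (v c)). Qed.

Lemma eZ_above : pt0 x y b `<=` eZ x y b.
Proof. by move=> r /pt_val [d /val_eZ v]; exact: (val_pt v). Qed.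

Lemma e2_above d : eZ x y b `<=` e2 x y b d.
Proof. by move=> r /pt_val [c /val_e2 v]; exact: (val_pt (v d)). Qed.

Lemma e3_above : eZ x y b `<=` e3 x y b.
Proof. by move=> r /pt_val [c /val_e3 v]; exact: (val_pt v). Qed.

Lemma step_above nxt O : step x y b nxt O -> pt0 x y b `<=` O.
Proof.
case=> [[c _ ->]|[d ->]|->]; first exact: e1_above.
  exact: subset_trans eZ_above (@e2_above d).
exact: subset_trans eZ_above e3_above.
Qed.

Lemma stepZ_above nxt O : stepZ x y b nxt O -> pt0 x y b `<=` O.
Proof. by case=> [[c _ ->]|->]; [exact: e1_above|exact: eZ_above]. Qed.

(** * Points of a step lying on a given curve *)

Section Incidence.
Variables (R : set K) (nxt : C -> Prop) (O : set K).
Hypothesis Rr : subring R.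
Hypothesis OR : O `<=` R.

Let RM r s : R r -> R s -> R (r * s). Proof. by case: Rr => _ _; apply. Qed.

Lemma step_out r : pt0 x y b r -> ~ R r -> ~ step x y b nxt O.
Proof. by move=> Or nr /step_above sO; apply/nr/OR/sO. Qed.

Lemma stepZ_out r : pt0 x y b r -> ~ R r -> ~ stepZ x y b nxt O.
Proof. by move=> Or nr /stepZ_above sO; apply/nr/OR/sO. Qed.

Lemma e1_y c : e1 x y b c (u / x).
Proof. exact: (val_pt (val_y k (GCentre x (u / x) 0 c))). Qed.

Lemma e1_par c : R u^-1 -> ~ R x^-1 -> O <> e1 x y b c.
Proof.
move=> Ru nx EO; apply: (nx); have := RM (OR (_ : O (u / x))) Ru.
rewrite mulrAC divff ?mul1r ?step_u0 //; apply.
by rewrite EO; apply: e1_y.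
Qed.

(** Here [R] behaves like the valuation ring of the line x = 0, where y - b is a unit and x is not.
    After the two blow-ups the proper transform of this line meets the step only on L, where
    [x / u ^+ 2] vanishes. *)
Lemma step_par : R u^-1 -> ~ R x^-1 -> step x y b nxt O -> O = e2 x y b 0.
Proof.
move=> Ru nx; have ux := step_u0; have x0 := step_x0.
have nux : ~ O (u ^+ 2 / x).
  move=> /OR H; apply: nx; have := RM H (RM Ru Ru).
  suff -> : u ^+ 2 / x * (u^-1 * u^-1) = x^-1 by [].
  by field; rewrite ?ux ?x0.
case=> [[c _ /(e1_par Ru nx)//]|[d EO]|EO].
  have [<-//|d0] := eqVneq d 0; case: nux; rewrite EO -invf_div.
  exact: (val_pt (valV d0 (val_y k (GCentre u (x / u ^+ 2) 0 d)))).
by case: nux; rewrite EO; exact: (val_pt (val_y k (GCentre (x / u) (u ^+ 2 / x) 0 0))).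
Qed.

Lemma stepZ_par : R u^-1 -> ~ R x^-1 -> stepZ x y b nxt O -> O = eZ x y b.
Proof. by move=> Ru nx [[c _ /(e1_par Ru nx)]|]. Qed.

(** Here [R] behaves like the valuation ring of L. At a point of E off L the slope [u / x] is
    regular, and [u^-1 = (u / x) * (x / u ^+ 2)] would make [u] invertible. *)
Lemma step_L : R (x / u ^+ 2) -> ~ R u^-1 -> step x y b nxt O ->
  (exists d, O = e2 x y b d) \/ O = e3 x y b.
Proof.
move=> Rw nu; have ux := step_u0; have x0 := step_x0.
case=> [[c _ EO]|?|?]; [|by left|by right]; case: nu.
have -> : u^-1 = (u / x) * (x / u ^+ 2) by field; rewrite ?ux ?x0.
by apply: RM => //; apply: OR; rewrite EO; apply: e1_y.
Qed.

Lemma e2_child d : R (u / x) -> ~ R x^-1 -> O <> e2 x y b d.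
Proof.
move=> Ry nx EO; have ux := step_u0; have x0 := step_x0; apply: nx.
have -> : x^-1 = (x / u ^+ 2) * ((u / x) * (u / x)) by field; rewrite ?ux ?x0.
apply: RM; last by apply: RM.
by apply: OR; rewrite EO; exact: (val_pt (val_y k (GCentre u (x / u ^+ 2) 0 d))).
Qed.

(** Here [R] behaves like the valuation ring of E. At a point of L off E the function [x / u ^+ 2]
    is regular, and multiplied by the square of the slope [u / x] it gives [x^-1]. *)
Lemma step_child : R (u / x) -> ~ R x^-1 -> step x y b nxt O ->
  (exists2 c, nxt c & O = e1 x y b c) \/ O = e3 x y b.
Proof. by move=> Ry nx [|[d /(e2_child Ry nx)]|]; [left| |right]. Qed.

Section Beyond.
Variable b' : C.
Hypothesis nb : ~ R (u / x - k b')^-1.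

Let xu_beyond z : good k z -> val z (x / u) 0 -> O = gpt z -> False.
Proof.
move=> gz v EO; have ux := step_u0; have x0 := step_x0.
have Rxu : R (x / u) by apply: OR; rewrite EO; exact: (val_pt v).
apply: nb; have [b0|b0] := eqVneq b' 0.
  by rewrite b0 rmorph0 subr0 invf_div.
have [n0|n0] := eqVneq (u / x - k b') 0.
  by rewrite n0 invr0 -(rmorph0 k); case: Rr.
have v1 : val z (1 - k b' * (x / u)) 1.
  apply: val_eq (valB gz (val1 k z) (valM (val_cst k z b') v)) _ _ => //.
  by rewrite mulr0 subr0.
have -> : (u / x - k b')^-1 = (1 - k b' * (x / u))^-1 * (x / u).
  rewrite -[RHS]invrK invfM invrK invf_div; congr (_^-1).
  by field; rewrite ?ux ?x0.
apply: RM => //; apply: OR; rewrite EO.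
exact: (val_pt (valV (oner_neq0 _) v1)).
Qed.

Lemma e1_beyond c : c != b' -> O <> e1 x y b c.
Proof.
move=> cb EO; apply: nb; apply: OR; rewrite EO.
pose z := @GCentre C K x (u / x) 0 c.
apply: (val_pt (valV _ (valB (chart_good 0 c chart_e1) (val_y k z) (val_cst k z b')))).
by rewrite /= subr_eq0.
Qed.

(** Here the curve of [R] lies over the point [u / x = b'] of E, centre of the next step. Every
    point that this step retains either has [u / x - b'] invertible, or lies on L and is excluded as
    in [step_child] or by its slope being infinite. *)
Lemma step_beyond : R (u / x) -> ~ R x^-1 -> (forall c, nxt c -> c != b') ->
  ~ step x y b nxt O.
Proof.
move=> Ry nx nc [[c /nc cb /(e1_beyond cb)]//|[d /(e2_child Ry nx)]//|].
exact: xu_beyond (chart_good 0 0 chart_e3) (val_x k _).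
Qed.

Lemma stepZ_beyond : (forall c, nxt c -> c != b') -> ~ stepZ x y b nxt O.
Proof.
move=> nc [[c /nc cb /(e1_beyond cb)]//|].
exact: xu_beyond (chart_good 0 0 chart_eZ) (val_y k (GCentre u (x / u) 0 0)).
Qed.

End Beyond.
End Incidence.
End Step.
End Steps.

(** * Three steps at infinitely near points *)

Section ChainOfSteps.
Variables (C : closedFieldType) (K : fieldType) (k : {rmorphism C -> K}).
Implicit Types (x y r s : K) (a b c d : C) (O R : set K).
Local Notation chart := (chart k).
Local Notation pt0 := (pt0 k).
Local Notation subring := (subring k).
Local Notation e2 := (e2 k).
Local Notation step := (step k).

Definition any : C -> Prop := fun=> True.
Definition ne b : C -> Prop := fun c => c != b.

Lemma child_facts R x y b : subring R -> chart x y -> R x -> ~ R x^-1 ->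
  R ((y - k b) / x) -> R y /\ ~ R (y - k b)^-1.
Proof.
move=> Rr cxy Rx nx Ry; have [Rk RB RM] := Rr; have x0 := chart_x0 cxy.
have u0 := step_u0 b cxy; split.
  have -> : y = (y - k b) / x * x + k b by rewrite divfK // subrK.
  by apply: subringD => //; apply: RM.
move=> Ru; apply: nx; have := RM _ _ Ry Ru.
by rewrite mulrAC divff // mul1r.
Qed.

Lemma L_facts R x y b : subring R -> chart x y -> R (y - k b) -> ~ R (y - k b)^-1 ->
  R (x / (y - k b) ^+ 2) -> [/\ R x, ~ R x^-1 & R y].
Proof.
move=> Rr cxy Ru nu Rw; have [Rk RB RM] := Rr; have x0 := chart_x0 cxy.
have u0 := step_u0 b cxy; split.
- have -> : x = x / (y - k b) ^+ 2 * ((y - k b) * (y - k b)) by field.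
  by apply: (RM) => //; apply: RM.
- move=> Rx; apply: nu.
  have -> : (y - k b)^-1 = x^-1 * (x / (y - k b) ^+ 2) * (y - k b) by field; rewrite u0.
  by apply: (RM) => //; apply: RM.
- by have := subringD Rr Ru (Rk b); rewrite subrK.
Qed.

Lemma nonreg_par R x y b : subring R -> chart x y -> R (y - k b)^-1 -> ~ R x^-1 ->
  ~ R ((y - k b) / x).
Proof.
move=> [Rk RB RM] cxy Ru nx Ry; apply: nx; have := RM _ _ Ry Ru.
by rewrite mulrAC divff ?mul1r // (step_u0 b cxy).
Qed.

Lemma nonreg_L R x y b : subring R -> chart x y -> R (x / (y - k b) ^+ 2) ->
  ~ R (y - k b)^-1 -> ~ R ((y - k b) / x).
Proof.
move=> [Rk RB RM] cxy Rw nu Ry; apply: nu; have := RM _ _ Ry Rw.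
have x0 := chart_x0 cxy; have u0 := step_u0 b cxy.
suff -> : (y - k b) / x * (x / (y - k b) ^+ 2) = (y - k b)^-1 by [].
by field; rewrite u0.
Qed.

Variables (x y0 y1 y2 : K) (b0 b1 b2 : C).
Hypothesis c0 : chart x y0.
Hypothesis E1 : y1 = (y0 - k b0) / x.
Hypothesis E2 : y2 = (y1 - k b1) / x.

(** The curve E of a step is again x = 0 with the slope as its coordinate, and the next step starts
    at one of its points; this point is removed by [ne]. The last curve E is kept whole, hence
    [any]. *)
Definition chain (st : K -> K -> C -> (C -> Prop) -> set K -> Prop) O :=
  [\/ st x y0 b0 (ne b1) O, st x y1 b1 (ne b2) O | st x y2 b2 any O].

Lemma chart_y1 : chart x y1. Proof. rewrite E1; exact/chart_divy/chart_suby. Qed.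
Lemma chart_y2 : chart x y2. Proof. rewrite E2; exact/chart_divy/chart_suby/chart_y1. Qed.
Local Notation c1 := chart_y1.
Local Notation c2 := chart_y2.

Lemma y1_reg2 : pt0 x y2 b2 y1.
Proof.
pose z := @GCentre C K x y2 0 b2; have gz : good k z := chart_good 0 b2 c2.
apply: (@val_pt _ _ k z y1 b1).
apply: val_eq (valD gz (valM (val_x k z) (val_y k z)) (val_cst k z b1)) _ _ => /=.
  by rewrite E2 mulrC divfK ?subrK // (chart_x0 c0).
by rewrite mul0r add0r.
Qed.

Lemma y_reg y b : pt0 x y b y.
Proof. exact: (val_pt (val_y k (GCentre x y 0 b))). Qed.

Variables (R R' : set K) (O : set K).
Hypothesis Rr : subring R.
Hypothesis OR : O `<=` R.

Lemma chain_y1 : ~ R y1 -> chain step O -> step x y0 b0 (ne b1) O.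
Proof.
move=> n1 [//|H|H]; [case: (step_out c1 OR _ n1 H)|case: (step_out c2 OR _ n1 H)].
  exact: y_reg.
exact: y1_reg2.
Qed.

Lemma chain_y2 : R y1 -> ~ R x^-1 -> ~ R (y1 - k b1)^-1 -> ~ R y2 ->
  chain step O -> step x y1 b1 (ne b2) O.
Proof.
move=> Ry nx n1 n2 [H|//|H]; last by case: (step_out c2 OR (y_reg _ _) n2 H).
by case: (step_beyond c0 Rr OR (b' := b1) _ _ _ _ H) => //; rewrite -E1.
Qed.

Lemma chain_last : R y1 -> R y2 -> ~ R x^-1 -> ~ R (y1 - k b1)^-1 ->
  ~ R (y2 - k b2)^-1 -> chain step O -> step x y2 b2 any O.
Proof.
move=> Ry1 Ry2 nx n1 n2 [H|H|//].
  by case: (step_beyond c0 Rr OR (b' := b1) _ _ _ _ H) => //; rewrite -E1.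
by case: (step_beyond c1 Rr OR (b' := b2) _ _ _ _ H) => //; rewrite -E2.
Qed.

Lemma chain_par : R (y0 - k b0)^-1 -> ~ R x^-1 -> chain step O -> O = e2 x y0 b0 0.
Proof.
move=> Ru nx H; have n1 : ~ R y1 by rewrite E1; apply: nonreg_par.
exact: (step_par c0 Rr OR Ru nx (chain_y1 n1 H)).
Qed.

End ChainOfSteps.

Section ChainCurves.
Variables (C : closedFieldType) (K : fieldType) (k : {rmorphism C -> K}).
Implicit Types (r s : K) (a b c d : C) (O : set K).
Local Notation chart := (chart k).
Local Notation gdvr := (gdvr k).
Local Notation e1 := (e1 k).
Local Notation e2 := (e2 k).
Local Notation e3 := (e3 k).
Local Notation eZ := (eZ k).
Local Notation step := (step k).
Local Notation stepZ := (stepZ k).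
Implicit Types x y : K.

(** The valuation rings of the two curves L and E of a step, in the charts of [e2] and [e1]. *)
Definition dvrL x y b := gdvr (y - k b) (x / (y - k b) ^+ 2).
Definition dvrE x y b := gdvr x ((y - k b) / x).

Lemma dvrE_facts x y b : chart x y ->
  [/\ subring k (dvrE x y b), dvrE x y b x, ~ dvrE x y b x^-1,
      dvrE x y b ((y - k b) / x) & dvrE x y b y /\ ~ dvrE x y b (y - k b)^-1].
Proof.
move=> cxy; have ce := chart_e1 b cxy; have Rr := subring_dvr ce.
have Rx := dvr_x ce; have nx := dvr_xV ce; have Ry := dvr_y ce.
by split=> //; apply: child_facts Rr cxy Rx nx Ry.
Qed.

Lemma dvrL_facts x y b : chart x y ->
  [/\ subring k (dvrL x y b), ~ dvrL x y b (y - k b)^-1,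
      dvrL x y b (x / (y - k b) ^+ 2), ~ dvrL x y b ((y - k b) / x)
    & [/\ dvrL x y b x, ~ dvrL x y b x^-1 & dvrL x y b y]].
Proof.
move=> cxy; have ce := chart_e2 b cxy; have Rr := subring_dvr ce.
have Ru := dvr_x ce; have nu := dvr_xV ce; have Rw := dvr_y ce.
split=> //; first exact: (nonreg_L Rr cxy Rw nu).
exact: (L_facts Rr cxy Ru nu Rw).
Qed.

Variables (x y0 y1 y2 : K) (b0 b1 b2 : C).
Hypothesis c0 : chart x y0.
Hypothesis E1 : y1 = (y0 - k b0) / x.
Hypothesis E2 : y2 = (y1 - k b1) / x.
Local Notation chain := (chain x y0 y1 y2 b0 b1 b2).
Let c1 : chart x y1 := chart_y1 c0 E1.
Let c2 : chart x y2 := chart_y2 c0 E1 E2.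

Lemma chain_D O : O `<=` gdvr x y0 -> chain step O -> O = e2 x y0 b0 0.
Proof.
by move=> OR; apply: (chain_par c0 E1 E2 (subring_dvr c0) OR (dvr_yV b0 c0) (dvr_xV c0)).
Qed.

Lemma chain_L0 O : O `<=` dvrL x y0 b0 -> chain step O ->
  (exists d, O = e2 x y0 b0 d) \/ O = e3 x y0 b0.
Proof.
move=> OR H; have [Rr nu Rw n1 _] := dvrL_facts b0 c0; rewrite -E1 in n1.
exact: (step_L c0 Rr OR Rw nu (chain_y1 c0 E1 E2 OR n1 H)).
Qed.

(** For the following step the curve E is the base line x = 0. So besides its own points and the
    node with its own L, it contains one point of the next L, at coordinate 0. *)
Lemma chain_E0 O : O `<=` dvrE x y0 b0 -> chain step O ->
  [\/ exists2 c, ne b1 c & O = e1 x y0 b0 c, O = e3 x y0 b0 | O = e2 x y1 b1 0].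
Proof.
move=> OR; have [Rr Rx nx Ry _] := dvrE_facts b0 c0.
have Rv : dvrE x y0 b0 (y1 - k b1)^-1.
  by rewrite /dvrE -E1; apply: dvr_yV.
case=> [H|H|H].
- by case: (step_child c0 Rr OR Ry nx H) => ?; [constructor 1|constructor 2].
- by constructor 3; exact: (step_par c1 Rr OR Rv nx H).
- have n2 : ~ dvrE x y0 b0 y2 by rewrite E2; apply: nonreg_par.
  by case: (step_out c2 OR (y_reg _ _ _ _) n2 H).
Qed.

Lemma chain_L1 O : O `<=` dvrL x y1 b1 -> chain step O ->
  (exists d, O = e2 x y1 b1 d) \/ O = e3 x y1 b1.
Proof.
move=> OR H; have [Rr nu Rw n2 [Rx nx Ry]] := dvrL_facts b1 c1; rewrite -E2 in n2.
exact: (step_L c1 Rr OR Rw nu (chain_y2 c0 E1 E2 Rr OR Ry nx nu n2 H)).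
Qed.

Lemma chain_E1 O : O `<=` dvrE x y1 b1 -> chain step O ->
  [\/ exists2 c, ne b2 c & O = e1 x y1 b1 c, O = e3 x y1 b1 | O = e2 x y2 b2 0].
Proof.
move=> OR; have [Rr Rx nx Ry [Ry1 nu]] := dvrE_facts b1 c1.
have Rv : dvrE x y1 b1 (y2 - k b2)^-1.
  by rewrite /dvrE -E2; apply: dvr_yV.
case=> [H|H|H].
- by case: (step_beyond c0 Rr OR (b' := b1) _ _ _ _ H) => //; rewrite -E1.
- by case: (step_child c1 Rr OR Ry nx H) => ?; [constructor 1|constructor 2].
- by constructor 3; exact: (step_par c2 Rr OR Rv nx H).
Qed.

Lemma chain_L2 O : O `<=` dvrL x y2 b2 -> chain step O ->
  (exists d, O = e2 x y2 b2 d) \/ O = e3 x y2 b2.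
Proof.
move=> OR H; have [Rr nu Rw n2 [Rx nx Ry]] := dvrL_facts b2 c2.
have Ry' : dvrL x y2 b2 ((y1 - k b1) / x) by rewrite -E2.
have [Ry1 n1] := child_facts Rr c1 Rx nx Ry'.
exact: (step_L c2 Rr OR Rw nu (chain_last c0 E1 E2 Rr OR Ry1 Ry nx n1 nu H)).
Qed.

Lemma chain_E2 O : O `<=` dvrE x y2 b2 -> chain step O ->
  (exists2 c, any c & O = e1 x y2 b2 c) \/ O = e3 x y2 b2.
Proof.
move=> OR H; have [Rr Rx nx Ry3 [Ry nu]] := dvrE_facts b2 c2.
have Ry' : dvrE x y2 b2 ((y1 - k b1) / x) by rewrite -E2.
have [Ry1 n1] := child_facts Rr c1 Rx nx Ry'.
exact: (step_child c2 Rr OR Ry3 nx (chain_last c0 E1 E2 Rr OR Ry1 Ry nx n1 nu H)).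
Qed.

(** As long as the nodes are not blown up, consecutive curves of the chain meet, and only in the
    node [eZ]. This and the next two lemmas make the points z_i single points. *)
Lemma chain_Z0 O : O `<=` gdvr x y0 -> O `<=` dvrE x y0 b0 -> chain stepZ O ->
  O = eZ x y0 b0.
Proof.
move=> OR OR'; have n1 : ~ gdvr x y0 y1.
  by rewrite E1; apply: (nonreg_par (subring_dvr c0) c0 (dvr_yV b0 c0) (dvr_xV c0)).
case=> H.
- exact: (stepZ_par c0 (subring_dvr c0) OR (dvr_yV b0 c0) (dvr_xV c0) H).
- by case: (stepZ_out c1 OR (y_reg _ _ _ _) n1 H).
- by case: (stepZ_out c2 OR (y1_reg2 b2 c0 E1 E2) n1 H).
Qed.

Lemma chain_Z1 O : O `<=` dvrE x y0 b0 -> O `<=` dvrE x y1 b1 -> chain stepZ O ->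
  O = eZ x y1 b1.
Proof.
move=> OR OR'; have [Rr Rx nx Ry _] := dvrE_facts b0 c0.
have [Rr' Rx' nx' Ry' [Ry1' nu']] := dvrE_facts b1 c1.
have Rv : dvrE x y0 b0 (y1 - k b1)^-1.
  by rewrite /dvrE -E1; apply: dvr_yV.
case=> H.
- by case: (stepZ_beyond c0 Rr' OR' (b' := b1) _ _ H) => //; rewrite -E1.
- exact: (stepZ_par c1 Rr OR Rv nx H).
- have n2 : ~ dvrE x y0 b0 y2 by rewrite E2; apply: nonreg_par.
  by case: (stepZ_out c2 OR (y_reg _ _ _ _) n2 H).
Qed.

Lemma chain_Z2 O : O `<=` dvrE x y1 b1 -> O `<=` dvrE x y2 b2 -> chain stepZ O ->
  O = eZ x y2 b2.
Proof.
move=> OR OR'; have [Rr Rx nx Ry _] := dvrE_facts b1 c1.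
have [Rr' Rx' nx' Ry' [Ry2' nu']] := dvrE_facts b2 c2.
have Ry1e : dvrE x y2 b2 ((y1 - k b1) / x) by rewrite -E2.
have [Ry1' nu1'] := child_facts Rr' c1 Rx' nx' Ry1e.
have Rv : dvrE x y1 b1 (y2 - k b2)^-1.
  by rewrite /dvrE -E2; apply: dvr_yV.
case=> H.
- by case: (stepZ_beyond c0 Rr' OR' (b' := b1) _ _ H) => //; rewrite -E1.
- by case: (stepZ_beyond c1 Rr' OR' (b' := b2) _ _ H) => //; rewrite -E2.
- exact: (stepZ_par c2 Rr OR Rv nx H).
Qed.

(** The centre of the chain is a specialisation of [R] in the weak sense that neither of its
    coordinates is invertible. The curves E and L of the chain satisfy it, which confines their
    points to this chain. *)
Definition nearby R x' y b := [/\ subring k R, ~ R x'^-1 & ~ R (y - k b)^-1].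

Lemma nearby_down R : subring k R -> R x -> ~ R x^-1 -> R y1 -> nearby R x y0 b0.
Proof.
move=> Rr Rx nx; rewrite E1 => Ry.
by have [_ n0] := child_facts Rr c0 Rx nx Ry.
Qed.

Lemma nearby_down2 R : subring k R -> R x -> ~ R x^-1 -> R y2 -> nearby R x y0 b0.
Proof.
move=> Rr Rx nx; rewrite E2 => Ry.
have [Ry1 _] := child_facts Rr c1 Rx nx Ry; exact: nearby_down.
Qed.

Lemma nearby_L0 : nearby (dvrL x y0 b0) x y0 b0.
Proof. by have [? ? ? ? [? ? ?]] := dvrL_facts b0 c0. Qed.

Lemma nearby_E0 : nearby (dvrE x y0 b0) x y0 b0.
Proof. by have [? ? ? ? [? ?]] := dvrE_facts b0 c0. Qed.

Lemma nearby_L1 : nearby (dvrL x y1 b1) x y0 b0.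
Proof. have [? ? ? ? [? ? ?]] := dvrL_facts b1 c1; exact: nearby_down. Qed.

Lemma nearby_E1 : nearby (dvrE x y1 b1) x y0 b0.
Proof. have [? ? ? ? [? ?]] := dvrE_facts b1 c1; exact: nearby_down. Qed.

Lemma nearby_L2 : nearby (dvrL x y2 b2) x y0 b0.
Proof. have [? ? ? ? [? ? ?]] := dvrL_facts b2 c2; exact: nearby_down2. Qed.

Lemma nearby_E2 : nearby (dvrE x y2 b2) x y0 b0.
Proof. have [? ? ? ? [? ?]] := dvrE_facts b2 c2; exact: nearby_down2. Qed.

End ChainCurves.

(** * Okamoto's surface fibred by f *)

Section Downstairs.
Variables (C : closedFieldType) (K : fieldType) (k : {rmorphism C -> K}).
Implicit Types (r s : K) (a b c d : C) (O R : set K).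
Local Notation gpt := (gpt k).
Local Notation val := (val k).
Local Notation chart := (chart k).
Local Notation pt0 := (pt0 k).
Local Notation gdvr := (gdvr k).
Local Notation subring := (subring k).
Local Notation e1 := (e1 k).
Local Notation e2 := (e2 k).
Local Notation e3 := (e3 k).
Local Notation eZ := (eZ k).
Local Notation step := (step k).
Local Notation stepZ := (stepZ k).
Local Notation dvrL := (dvrL k).
Local Notation dvrE := (dvrE k).

Variables (f g : K) (a1 b1 b2 b3 : C).
Hypothesis cfg : chart f g.
Hypothesis a10 : a1 != 0.
Hypothesis two0 : (2 : C) != 0.

(** [fA1] and [fA2] are the coordinates on the exceptional curves of p_6 and p_7, on which p_7 and
    p_8 are the points [b1] and [b2]. *)
Definition fA1 := (f / g - k 2) / f^-1.
Definition fA2 := (fA1 - k b1) / f^-1.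

(* The surface described by its fibration f: a Hirzebruch surface blown up along
   eight steps, two on the fibre f = 0 and six on the fibre f = oo. *)
Inductive down (st : K -> K -> C -> (C -> Prop) -> set K -> Prop) : set K -> Prop :=
| DownGen a b of a != 0 : down st (gpt (GCentre f g a b))
| DownGoo a of a != 0 : down st (pt0 g^-1 f a)
| DownZero c of c != 0 & c != a1 : down st (pt0 f (f * g) c)
| DownZeroOo : down st (pt0 f (f * g)^-1 0)
| DownOo c of c != 2 : down st (pt0 f^-1 (f / g) c)
| DownS1 O of st f (f * g) a1 (@any C) O : down st O
| DownS2 O of st f (f * g) 0 (@any C) O : down st O
| DownA O of chain f^-1 (f / g) fA1 fA2 2 b1 b2 st O : down st O
| DownB O of chain f^-1 (g / f) g (f * g) 0 0 b3 st O : down st O.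

Let f0 : f != 0 := chart_x0 cfg.
Let g0 : g != 0 := chart_y0 cfg.

Lemma chart_fg : chart f (f * g).
Proof. by rewrite mulrC; apply: chart_muly. Qed.

Lemma chart_B0 : chart f^-1 (g / f).
Proof. exact/chart_muly/chart_inv. Qed.

Lemma chart_A0 : chart f^-1 (f / g).
Proof. by rewrite -[X in chart _ X]invf_div; apply/chart_invy/chart_B0. Qed.

Lemma B1E : g = (g / f - k 0) / f^-1.
Proof. by rewrite rmorph0 subr0 invrK divfK. Qed.

Lemma B2E : f * g = (g - k 0) / f^-1.
Proof. by rewrite rmorph0 subr0 invrK mulrC. Qed.

Definition above (st : K -> K -> C -> (C -> Prop) -> set K -> Prop) :=
  forall x y b nxt O, chart x y -> st x y b nxt O -> pt0 x y b `<=` O.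

Lemma above_step : above step.
Proof. by move=> x y b nxt O cxy; apply: step_above. Qed.

Lemma above_stepZ : above stepZ.
Proof. by move=> x y b nxt O cxy; apply: stepZ_above. Qed.

Lemma chain_above st x y0 y1 y2 b0 c1 c2 O : above st -> chart x y0 ->
  y1 = (y0 - k b0) / x -> y2 = (y1 - k c1) / x ->
  chain x y0 y1 y2 b0 c1 c2 st O -> pt0 x y0 b0 `<=` O.
Proof.
move=> ab c0 E1 E2; have cc1 := chart_y1 c0 E1; have cc2 := chart_y2 c0 E1 E2.
have s01 : pt0 x y0 b0 `<=` pt0 x y1 c1 by rewrite E1; apply: (e1_above c0).
have s12 : pt0 x y1 c1 `<=` pt0 x y2 c2 by rewrite E2; apply: (e1_above cc1).
case=> /ab H; first exact: H.
  exact: (subset_trans s01 (H cc1)).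
exact: (subset_trans s01 (subset_trans s12 (H cc2))).
Qed.

Let A_above st O : above st -> chain f^-1 (f / g) fA1 fA2 2 b1 b2 st O ->
  pt0 f^-1 (f / g) 2 `<=` O.
Proof. by move=> ab; apply: chain_above ab chart_A0 _ _. Qed.

Let B_above st O : above st -> chain f^-1 (g / f) g (f * g) 0 0 b3 st O ->
  pt0 f^-1 (g / f) 0 `<=` O.
Proof. by move=> ab; apply: chain_above ab chart_B0 B1E B2E. Qed.

Lemma pt0_x x y c : pt0 x y c x.
Proof. exact: (val_pt (val_x k (GCentre x y 0 c))). Qed.

Lemma pt0_y x y c : pt0 x y c y.
Proof. exact: (val_pt (val_y k (GCentre x y 0 c))). Qed.

Lemma pt0_yV x y b c : chart x y -> c != b -> pt0 x y c (y - k b)^-1.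
Proof.
move=> cxy cb; pose z := @GCentre C K x y 0 c.
apply: (val_pt (valV _ (valB (chart_good 0 c cxy) (val_y k z) (val_cst k z b)))).
by rewrite /= subr_eq0.
Qed.

Lemma pt0_yV0 x y c : chart x y -> c != 0 -> pt0 x y c y^-1.
Proof. by move=> cxy /(pt0_yV cxy); rewrite rmorph0 subr0. Qed.

Lemma zero_fibre st R O : above st -> ~ R f^-1 -> O `<=` R -> down st O ->
  [\/ exists c, [/\ c != 0, c != a1 & O = pt0 f (f * g) c], O = pt0 f (f * g)^-1 0,
      st f (f * g) a1 (@any C) O | st f (f * g) 0 (@any C) O].
Proof.
move=> ab nf OR H; have nO : ~ O f^-1 by move/OR.
case: H nO {OR} => {O} [a b a0|a a0|c c0 ca||c c2|O H|O H|O H|O H] nO.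
- case: nO; exact: (val_pt (valV a0 (val_x k (GCentre f g a b)))).
- by case: nO; apply: pt0_yV0 a0; apply/chart_swap/chart_invy.
- by constructor 1; exists c.
- by constructor 2.
- by case: nO; apply: pt0_x.
- by constructor 3.
- by constructor 4.
- by case: nO; apply: (A_above ab H); apply: pt0_x.
- by case: nO; apply: (B_above ab H); apply: pt0_x.
Qed.

Lemma oo_fibre st R O : above st -> ~ R f -> O `<=` R -> down st O ->
  [\/ exists2 c, c != 2 & O = pt0 f^-1 (f / g) c,
      chain f^-1 (f / g) fA1 fA2 2 b1 b2 st O
    | chain f^-1 (g / f) g (f * g) 0 0 b3 st O].
Proof.
move=> ab nf OR H; have nO : ~ O f by move/OR.
case: H nO {OR} => {O} [a b a0|a a0|c c0 ca||c c2|O H|O H|O H|O H] nO.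
- case: nO; exact: (val_pt (val_x k (GCentre f g a b))).
- by case: nO; apply: pt0_y.
- by case: nO; apply: pt0_x.
- by case: nO; apply: pt0_x.
- by constructor 1; exists c.
- by case: nO; apply: (ab _ _ _ _ _ chart_fg H); apply: pt0_x.
- by case: nO; apply: (ab _ _ _ _ _ chart_fg H); apply: pt0_x.
- by constructor 2.
- by constructor 3.
Qed.

(** The two chains start on the same fibre, at f / g = 2 and g / f = 0. On the second chain [(f / g
    - 2)^-1 = (1 - 2 * (g / f))^-1 * (g / f)] is regular, against the assumption on [R]. *)
Lemma chainA_only st R O : above st -> subring R -> ~ R f -> ~ R (f / g - k 2)^-1 ->
  O `<=` R -> down st O -> chain f^-1 (f / g) fA1 fA2 2 b1 b2 st O.
Proof.
move=> ab Rr nf n2 OR H; case: (oo_fibre ab nf OR H) => [[c c2 EO]|//|HB].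
  by case: n2; apply: OR; rewrite EO; apply: pt0_yV c2; apply: chart_A0.
case: n2; pose z := @GCentre C K f^-1 (g / f) 0 0.
have gz : good k z := chart_good 0 0 chart_B0.
have [Rk RB RM] := Rr; have sB := B_above ab HB.
have u0 : f / g - k 2 != 0 by case: chart_A0 => i _; apply: indep_suby i.
have v1 : val z (1 - k 2 * (g / f)) 1.
  apply: val_eq (valB gz (val1 k z) (valM (val_cst k z 2) (val_y k z))) _ _ => //=.
  by rewrite mulr0 subr0.
have n0 := val_ne0 gz (oner_neq0 _) v1.
have -> : (f / g - k 2)^-1 = (1 - k 2 * (g / f))^-1 * (g / f).
  rewrite -[RHS]invrK invfM invrK invf_div; congr (_^-1).
  by field; rewrite ?f0 ?g0.
apply: RM; apply/OR/sB; last exact: pt0_y.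
exact: (val_pt (valV (oner_neq0 _) v1)).
Qed.

Lemma chainB_only st R O : above st -> ~ R f -> ~ R (f / g) ->
  O `<=` R -> down st O -> chain f^-1 (g / f) g (f * g) 0 0 b3 st O.
Proof.
move=> ab nf n2 OR H; case: (oo_fibre ab nf OR H) => [[c c2 EO]|HA|//].
  by case: n2; apply: OR; rewrite EO; apply: pt0_y.
by case: n2; apply/OR/(A_above ab HA)/pt0_y.
Qed.

(** At any point of the fibre f = 0 outside the step over f g = b, the function [f * g - k b] has a
    regular inverse; at f g = oo this inverse is [(1 - k b / (f * g))^-1 / (f * g)]. *)
Lemma zero_only st R O b b' : above st -> subring R -> ~ R f^-1 -> b \in [:: 0; a1] ->
  b' \in [:: 0; a1] -> b != b' -> ~ R (f * g - k b)^-1 ->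
  O `<=` R -> down st O -> st f (f * g) b (@any C) O.
Proof.
move=> ab Rr nf bin b'in bb nb OR H; have [Rk RB RM] := Rr.
have cfg' := chart_fg; have fg0 := chart_y0 cfg'.
have Pout c O' : c \in [:: 0; a1] -> c != b -> st f (f * g) c (@any C) O' -> ~ O' `<=` R.
  move=> _ cb /(ab _ _ _ _ _ cfg') sO OR'; apply/nb/OR'/sO; exact: pt0_yV.
case: (zero_fibre ab nf OR H) => [[c [c0 ca EO]]|EO|HS|HS].
- case: nb; apply: OR; rewrite EO; apply: pt0_yV => //.
  by move: bin; rewrite !inE => /orP [] /eqP ->.
- case: nb; pose z := @GCentre C K f (f * g)^-1 0 0.
  have gz : good k z := chart_good 0 0 (chart_invy cfg').
  have v1 : val z (1 - k b * (f * g)^-1) 1.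
    apply: val_eq (valB gz (val1 k z) (valM (val_cst k z b) (val_y k z))) _ _ => //=.
    by rewrite mulr0 subr0.
  have n0 := val_ne0 gz (oner_neq0 _) v1.
  have -> : (f * g - k b)^-1 = (1 - k b * (f * g)^-1)^-1 * (f * g)^-1.
    rewrite -[RHS]invrK invfM !invrK; congr (_^-1).
    by rewrite mulrBl mul1r mulfVK.
  apply: RM; apply: OR; rewrite EO; last exact: pt0_y.
  exact: (val_pt (valV (oner_neq0 _) v1)).
- have [Eb|nb1] := eqVneq b a1; first by rewrite Eb.
  by case: (Pout a1 O _ _ HS OR); rewrite ?inE ?eqxx ?orbT // eq_sym.
- have [Eb|nb1] := eqVneq b 0; first by rewrite Eb.
  by case: (Pout 0 O _ _ HS OR); rewrite ?inE ?eqxx ?orbT // eq_sym.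
Qed.

Lemma nearA_only st R O : above st -> nearby k R f^-1 (f / g) 2 ->
  O `<=` R -> down st O -> chain f^-1 (f / g) fA1 fA2 2 b1 b2 st O.
Proof. by rewrite /nearby invrK => ab [Rr nx n2]; apply: chainA_only ab Rr nx n2. Qed.

Lemma nearB_only st R O : above st -> nearby k R f^-1 (g / f) 0 ->
  O `<=` R -> down st O -> chain f^-1 (g / f) g (f * g) 0 0 b3 st O.
Proof.
rewrite /nearby invrK rmorph0 subr0 invf_div => ab [Rr nx n2].
exact: chainB_only ab nx n2.
Qed.

Lemma zero_near st R O b b' : above st -> b \in [:: 0; a1] -> b' \in [:: 0; a1] ->
  b != b' -> nearby k R f (f * g) b -> O `<=` R -> down st O ->
  st f (f * g) b (@any C) O.
Proof. by move=> ab bi bi' bb [Rr nx n2]; apply: (zero_only ab Rr nx bi bi' bb n2). Qed.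

Let cA := chart_A0.
Let cB := chart_B0.
Let cF := chart_fg.

Section Curves.
Variable O : set K.
Hypothesis dO : down step O.

Lemma on_zeroL b b' : b \in [:: 0; a1] -> b' \in [:: 0; a1] -> b != b' ->
  O `<=` dvrL f (f * g) b -> (exists d, O = e2 f (f * g) b d) \/ O = e3 f (f * g) b.
Proof.
move=> bi bi' bb OR; have [Rr nu Rw n1 [Rx nx Ry]] := dvrL_facts b cF.
have H := zero_near above_step bi bi' bb (And3 Rr nx nu) OR dO.
exact: (step_L cF Rr OR Rw nu H).
Qed.

Lemma on_zeroE b b' : b \in [:: 0; a1] -> b' \in [:: 0; a1] -> b != b' ->
  O `<=` dvrE f (f * g) b ->
  (exists2 c, any c & O = e1 f (f * g) b c) \/ O = e3 f (f * g) b.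
Proof.
move=> bi bi' bb OR; have [Rr Rx nx Ry [_ nu]] := dvrE_facts b cF.
have H := zero_near above_step bi bi' bb (And3 Rr nx nu) OR dO.
exact: (step_child cF Rr OR Ry nx H).
Qed.

Lemma on_D0 : O `<=` gdvr f (f * g) ->
  [\/ exists c, [/\ c != 0, c != a1 & O = pt0 f (f * g) c], O = pt0 f (f * g)^-1 0,
      O = e2 f (f * g) a1 0 | O = e2 f (f * g) 0 0].
Proof.
move=> OR; have Rr := subring_dvr cF; have nx := dvr_xV cF.
case: (zero_fibre above_step nx OR dO) => H; first by constructor 1.
- by constructor 2.
- by constructor 3; exact: (step_par cF Rr OR (dvr_yV _ cF) nx H).
- by constructor 4; exact: (step_par cF Rr OR (dvr_yV _ cF) nx H).
Qed.

Lemma dvr_A0B0 : gdvr f^-1 (f / g) `<=` gdvr f^-1 (g / f).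
Proof.
apply: (dvr_via (l := [:: 0])) => c; rewrite inE => c0; exists c^-1 => r.
pose z := @GCentre C K f^-1 (g / f) 0 c^-1.
apply: (@pt_sub _ _ k z (GCentre f^-1 (f / g) 0 c) (chart_good _ _ cB)).
  exact: (val_x k z).
rewrite /= -invf_div -[c]invrK; apply: (valV _ (val_y k z)).
by rewrite invr_eq0.
Qed.

Lemma on_D3 : O `<=` gdvr f^-1 (f / g) ->
  [\/ exists2 c, c != 2 & O = pt0 f^-1 (f / g) c, O = e2 f^-1 (f / g) 2 0
    | O = e2 f^-1 (g / f) 0 0].
Proof.
move=> OR; have nx := dvr_xV cA; rewrite invrK in nx.
case: (oo_fibre above_step nx OR dO) => H; first by constructor 1.
- by constructor 2; apply: (chain_D cA erefl erefl OR H).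
- by constructor 3; apply: (chain_D cB B1E B2E (subset_trans OR dvr_A0B0) H).
Qed.

(** Along g = oo the function f is a unit and g has a pole, so none of g, f g and g / f is regular
    at a point of this curve. Each of the remaining cases makes one of them regular; 2 being
    nonzero, g / f is regular over f / g = 2 too. *)
Lemma on_D6 : O `<=` gdvr g^-1 f ->
  [\/ exists2 a, a != 0 & O = pt0 g^-1 f a, O = pt0 f (f * g)^-1 0
    | O = pt0 f^-1 (f / g) 0].
Proof.
have cgf : chart g^-1 f by apply/chart_inv/chart_swap.
move=> OR; have Rr := subring_dvr cgf; have [Rk RB RM] := Rr.
have ng : ~ gdvr g^-1 f g by have := dvr_xV cgf; rewrite invrK.
have Rf := dvr_y cgf; have Rfv := dvr_yV 0 cgf; rewrite rmorph0 subr0 in Rfv.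
have nfg : ~ gdvr g^-1 f (f * g).
  by move=> H; apply: ng; have := RM _ _ Rfv H; rewrite mulKf.
have ngf : ~ gdvr g^-1 f (g / f).
  by move=> H; apply: ng; have := RM _ _ H Rf; rewrite divfK.
have nfgO : ~ O (f * g) by move/OR.
have ngfO : ~ O (g / f) by move/OR.
have ngO : ~ O g by move/OR.
case: dO nfgO ngfO ngO => {OR} [a b a0|a a0|c c0 ca||c c2|O' H|O' H|O' H|O' H] n1 n2 n3.
- case: n3; exact: (val_pt (val_y k (GCentre f g a b))).
- by constructor 1; exists a.
- by case: n1; apply: pt0_y.
- by constructor 2.
- have [->|c0] := eqVneq c 0; first by constructor 3.
  by case: n2; have := pt0_yV0 cA c0; rewrite invf_div.
- by case: n1; apply: (above_step cF H); apply: pt0_y.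
- by case: n1; apply: (above_step cF H); apply: pt0_y.
- case: n2; apply: (A_above above_step H).
  by have := pt0_yV0 cA two0; rewrite invf_div.
- by case: n2; apply: (B_above above_step H); apply: pt0_y.
Qed.

Lemma on_L6 : O `<=` dvrL f^-1 (f / g) 2 ->
  (exists d, O = e2 f^-1 (f / g) 2 d) \/ O = e3 f^-1 (f / g) 2.
Proof.
move=> OR; apply: (chain_L0 cA erefl erefl OR).
exact: (nearA_only above_step (nearby_L0 _ cA) OR dO).
Qed.

Lemma on_D4 : O `<=` dvrE f^-1 (f / g) 2 ->
  [\/ exists2 c, ne b1 c & O = e1 f^-1 (f / g) 2 c, O = e3 f^-1 (f / g) 2
    | O = e2 f^-1 fA1 b1 0].
Proof.
move=> OR; apply: (chain_E0 cA erefl erefl OR).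
exact: (nearA_only above_step (nearby_E0 _ cA) OR dO).
Qed.

Lemma on_L7 : O `<=` dvrL f^-1 fA1 b1 ->
  (exists d, O = e2 f^-1 fA1 b1 d) \/ O = e3 f^-1 fA1 b1.
Proof.
move=> OR; apply: (chain_L1 cA erefl erefl OR).
exact: (nearA_only above_step (nearby_L1 _ cA erefl) OR dO).
Qed.

Lemma on_D5 : O `<=` dvrE f^-1 fA1 b1 ->
  [\/ exists2 c, ne b2 c & O = e1 f^-1 fA1 b1 c, O = e3 f^-1 fA1 b1
    | O = e2 f^-1 fA2 b2 0].
Proof.
move=> OR; apply: (chain_E1 cA erefl erefl OR).
exact: (nearA_only above_step (nearby_E1 _ cA erefl) OR dO).
Qed.

Lemma on_L8 : O `<=` dvrL f^-1 fA2 b2 ->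
  (exists d, O = e2 f^-1 fA2 b2 d) \/ O = e3 f^-1 fA2 b2.
Proof.
move=> OR; apply: (chain_L2 cA erefl erefl OR).
exact: (nearA_only above_step (nearby_L2 _ cA erefl erefl) OR dO).
Qed.

Lemma on_E8 : O `<=` dvrE f^-1 fA2 b2 ->
  (exists2 c, any c & O = e1 f^-1 fA2 b2 c) \/ O = e3 f^-1 fA2 b2.
Proof.
move=> OR; apply: (chain_E2 cA erefl erefl OR).
exact: (nearA_only above_step (nearby_E2 _ cA erefl erefl) OR dO).
Qed.

Lemma on_L5 : O `<=` dvrL f^-1 (g / f) 0 ->
  (exists d, O = e2 f^-1 (g / f) 0 d) \/ O = e3 f^-1 (g / f) 0.
Proof.
move=> OR; apply: (chain_L0 cB B1E B2E OR).
exact: (nearB_only above_step (nearby_L0 _ cB) OR dO).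
Qed.

Lemma on_D2 : O `<=` dvrE f^-1 (g / f) 0 ->
  [\/ exists2 c, ne 0 c & O = e1 f^-1 (g / f) 0 c, O = e3 f^-1 (g / f) 0
    | O = e2 f^-1 g 0 0].
Proof.
move=> OR; apply: (chain_E0 cB B1E B2E OR).
exact: (nearB_only above_step (nearby_E0 _ cB) OR dO).
Qed.

Lemma on_L4 : O `<=` dvrL f^-1 g 0 ->
  (exists d, O = e2 f^-1 g 0 d) \/ O = e3 f^-1 g 0.
Proof.
move=> OR; apply: (chain_L1 cB B1E B2E OR).
exact: (nearB_only above_step (nearby_L1 _ cB B1E) OR dO).
Qed.

Lemma on_D1 : O `<=` dvrE f^-1 g 0 ->
  [\/ exists2 c, ne b3 c & O = e1 f^-1 g 0 c, O = e3 f^-1 g 0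
    | O = e2 f^-1 (f * g) b3 0].
Proof.
move=> OR; apply: (chain_E1 cB B1E B2E OR).
exact: (nearB_only above_step (nearby_E1 _ cB B1E) OR dO).
Qed.

Lemma on_L3 : O `<=` dvrL f^-1 (f * g) b3 ->
  (exists d, O = e2 f^-1 (f * g) b3 d) \/ O = e3 f^-1 (f * g) b3.
Proof.
move=> OR; apply: (chain_L2 cB B1E B2E OR).
exact: (nearB_only above_step (nearby_L2 _ cB B1E B2E) OR dO).
Qed.

Lemma on_E2 : O `<=` dvrE f^-1 (f * g) b3 ->
  (exists2 c, any c & O = e1 f^-1 (f * g) b3 c) \/ O = e3 f^-1 (f * g) b3.
Proof.
move=> OR; apply: (chain_E2 cB B1E B2E OR).
exact: (nearB_only above_step (nearby_E2 _ cB B1E B2E) OR dO).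
Qed.

End Curves.

Section Nodes.
Variable O : set K.
Hypothesis dO : down stepZ O.

Lemma on_zeroZ b b' : b \in [:: 0; a1] -> b' \in [:: 0; a1] -> b != b' ->
  O `<=` gdvr f (f * g) -> O `<=` dvrE f (f * g) b -> O = eZ f (f * g) b.
Proof.
move=> bi bi' bb OR OR'; have [Rr Rx nx Ry [_ nu]] := dvrE_facts b cF.
have H := zero_near above_stepZ bi bi' bb (And3 Rr nx nu) OR' dO.
exact: (stepZ_par cF (subring_dvr cF) OR (dvr_yV b cF) (dvr_xV cF) H).
Qed.

Lemma on_z6 : O `<=` gdvr f^-1 (f / g) -> O `<=` dvrE f^-1 (f / g) 2 ->
  O = eZ f^-1 (f / g) 2.
Proof.
move=> OR OR'; apply: (chain_Z0 cA erefl erefl OR OR').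
exact: (nearA_only above_stepZ (nearby_E0 _ cA) OR' dO).
Qed.

Lemma on_z7 : O `<=` dvrE f^-1 (f / g) 2 -> O `<=` dvrE f^-1 fA1 b1 ->
  O = eZ f^-1 fA1 b1.
Proof.
move=> OR OR'; apply: (chain_Z1 cA erefl erefl OR OR').
exact: (nearA_only above_stepZ (nearby_E1 _ cA erefl) OR' dO).
Qed.

Lemma on_z8 : O `<=` dvrE f^-1 fA1 b1 -> O `<=` dvrE f^-1 fA2 b2 ->
  O = eZ f^-1 fA2 b2.
Proof.
move=> OR OR'; apply: (chain_Z2 cA erefl erefl OR OR').
exact: (nearA_only above_stepZ (nearby_E2 _ cA erefl erefl) OR' dO).
Qed.

Lemma on_z5 : O `<=` gdvr f^-1 (f / g) -> O `<=` dvrE f^-1 (g / f) 0 ->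
  O = eZ f^-1 (g / f) 0.
Proof.
move=> OR OR'; apply: (chain_Z0 cB B1E B2E (subset_trans OR dvr_A0B0) OR').
exact: (nearB_only above_stepZ (nearby_E0 _ cB) OR' dO).
Qed.

Lemma on_z4 : O `<=` dvrE f^-1 (g / f) 0 -> O `<=` dvrE f^-1 g 0 ->
  O = eZ f^-1 g 0.
Proof.
move=> OR OR'; apply: (chain_Z1 cB B1E B2E OR OR').
exact: (nearB_only above_stepZ (nearby_E1 _ cB B1E) OR' dO).
Qed.

Lemma on_z3 : O `<=` dvrE f^-1 g 0 -> O `<=` dvrE f^-1 (f * g) b3 ->
  O = eZ f^-1 (f * g) b3.
Proof.
move=> OR OR'; apply: (chain_Z2 cB B1E B2E OR OR').
exact: (nearB_only above_stepZ (nearby_E2 _ cB B1E B2E) OR' dO).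
Qed.

End Nodes.
End Downstairs.

(** * Membership in an iterated blow-up *)

Section BlowupSequence.
Variables (C K : fieldType) (k : {rmorphism C -> K}).
Implicit Types (O P : set K) (X : set (set K)) (l : seq (set K)).
Local Notation gexc := (gexc k).

Definition blow1 X P : set (set K) := (X `\` [set P]) `|` gexc P.

Definition avoid l O : Prop := foldr (fun P T => O <> P /\ T) True l.

(** A point created by the blow-up of some centre of the list and removed by none of the later
    ones. *)
Fixpoint late l O : Prop :=
  if l is P :: l' then gexc P O /\ avoid l' O \/ late l' O else False.

Lemma foldl_blow1 X l O : foldl blow1 X l O <-> X O /\ avoid l O \/ late l O.
Proof.
elim: l X => [|P l IH] X /=; first by split=> [|[[]|]//]; left.
rewrite IH /blow1 /=; split.
  by case=> [[[[XO OP]|eO] al]|ll]; [left|right; left|right; right].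
case=> [[XO [OP al]]|[[eO al]|ll]]; last by right.
  by left; split=> //; left.
by left; split=> //; right.
Qed.

Definition lacks (r : K) l : Prop := foldr (fun P T => ~ P r /\ T) True l.
Definition has_all (r : K) l : Prop := foldr (fun P T => P r /\ T) True l.

(** Points being rings, one function regular at [O] and at none of the centres proves all the
    required disequalities at once; [avoid_has] is the reverse situation. *)
Lemma avoid_lacks r l O : O r -> lacks r l -> avoid l O.
Proof.
move=> Or; elim: l => //= P l IH [nP /IH al]; split=> // EP.
by apply: nP; rewrite -EP.
Qed.

Lemma avoid_has r l O : ~ O r -> has_all r l -> avoid l O.
Proof.
move=> nO; elim: l => //= P l IH [Pr /IH al]; split=> // EP.
by apply: nO; rewrite EP.
Qed.

Lemma avoid_cat l l' O : avoid (l ++ l') O <-> avoid l O /\ avoid l' O.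
Proof.
elim: l => /= [|P l ->]; first by split=> [|[]].
by split=> [[? [? ?]]|[[? ?] ?]].
Qed.

Definition gP1xP1 (f g : K) : set (set K) :=
  [set O | exists (x y : K) (a b : C), [/\ x \in [:: f; f^-1], y \in [:: g; g^-1]
     & O = gpt k (GCentre x y a b)]].

Lemma avoid_in l O P : avoid l O -> List.In P l -> O <> P.
Proof. by elim: l => //= P' l IH [n al] [<-|/(IH al)]. Qed.

End BlowupSequence.

(** * Okamoto's eight centres as steps *)

Section OkamotoSurface.
Variables (C : closedFieldType) (K : fieldType) (k : {rmorphism C -> K}).
Implicit Types (r s : K) (a b c d : C) (O R : set K).
Local Notation gpt := (gpt k).
Local Notation val := (val k).
Local Notation chart := (chart k).
Local Notation pt0 := (pt0 k).
Local Notation gexc := (gexc k).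
Local Notation e1 := (e1 k).
Local Notation eZ := (eZ k).
Local Notation stepZ := (stepZ k).

Variables (f g : K) (a1 b1 b2 b3 : C).
Hypothesis cfg : chart f g.
Hypothesis a10 : a1 != 0.
Hypothesis two0 : (2 : C) != 0.
Local Notation fA1 := (fA1 k f g).
Local Notation fA2 := (fA2 k f g b1).
Local Notation down := (down k f g a1 b1 b2 b3).

Let f0 : f != 0 := chart_x0 cfg.
Let g0 : g != 0 := chart_y0 cfg.
Let cF := chart_fg cfg.
Let cA := chart_A0 cfg.
Let cB := chart_B0 cfg.
Let cA1 : chart f^-1 fA1 := chart_y1 cA erefl.
Let cA2 : chart f^-1 fA2 := chart_y2 cA erefl erefl.
Let cB1 : chart f^-1 g := chart_inv cfg.
Let cB2 : chart f^-1 (f * g) := chart_inv cF.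

Definition okP1 := pt0 f^-1 g 0.
Definition okP2 := pt0 f^-1 (f * g) b3.
Definition okP3 := gpt (GCentre f g^-1 0 0).
Definition okP4 := pt0 f (f * g) a1.
Definition okP5 := pt0 f^-1 g^-1 0.
Definition okP6 := pt0 f^-1 (f / g) 2.
Definition okP7 := pt0 f^-1 fA1 b1.
Definition okP8 := pt0 f^-1 fA2 b2.

Definition okPs := [:: okP1; okP2; okP3; okP4; okP5; okP6; okP7; okP8].

Definition gXOk := foldl (blow1 k) (gP1xP1 k f g) okPs.

Lemma p1_step : e1 f^-1 (g / f) 0 = pt0 f^-1 g.
Proof. by rewrite funeqE => c; rewrite /e1 /Submission.e1 -(B1E cfg). Qed.

(** An elementary transformation of the fibre f = 0: the exceptional curve of p_3 has coordinate f
    g, and it is taken as the base fibre. The old line f = 0 then becomes the exceptional curve of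
    the point f g = 0, which is why its intersection with the base fibre appears as
    [eZ f (f * g) 0]. *)
Lemma exc_P3 O : gexc okP3 O <->
  [\/ exists2 c, c != 0 & O = pt0 f (f * g) c, O = eZ f (f * g) 0 | O = pt0 f (f * g)^-1 0].
Proof.
have cfgi : chart f g^-1 by apply: chart_invy.
have Eoo : gpt (GCentre (g^-1 / f) f 0 0) = pt0 f (f * g)^-1 0.
  by rewrite /pt0 (pt_sym 0 0 (chart_invy cF)) invfM [f^-1 * _]mulrC.
have E0 : gpt (GCentre (f * g) g^-1 0 0) = eZ f (f * g) 0.
  rewrite /eZ /Submission.eZ /pt0 rmorph0 subr0; congr (gpt (GCentre _ _ _ _)).
  by rewrite invfM mulrA divff // mul1r.
have E1 c : c != 0 -> gpt (GCentre (f * g) g^-1 c 0) = pt0 f (f * g) c.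
  move=> c0; pose z := @GCentre C K f (f * g) 0 c.
  have gz : good k z := chart_good 0 c cF.
  have vx : val z f 0 := val_x k z; have vy : val z (f * g) c := val_y k z.
  pose z' := @GCentre C K (f * g) g^-1 c 0.
  have cz' : chart (f * g) g^-1.
    by have := chart_div cfgi; rewrite invrK.
  have gz' : good k z' := chart_good c 0 cz'.
  have wx : val z' (f * g) c := val_x k z'; have wy : val z' g^-1 0 := val_y k z'.
  apply: (@pt_eq _ _ k z z') => //=.
    apply: val_eq (val_div c0 vx vy) _ _; last by rewrite mul0r.
    by rewrite invfM mulrA divff // mul1r.
  apply: val_eq (valM wx wy) _ _; last by rewrite mulr0.
  by rewrite mulfK.
rewrite /okP3 gexcP //= /guv /gswap /= !rmorph0 !subr0 invrK Eoo; split.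
  case=> [[c ->]|->]; last by constructor 3.
  have [->|c0] := eqVneq c 0; [by constructor 2|constructor 1].
  by exists c => //; apply: E1.
case=> [[c c0 ->]|->|->]; [left; exists c|left; exists 0|right] => //.
by rewrite E1.
Qed.

(** The same exchange at f = oo: the exceptional curve of p_5, with coordinate f / g, becomes the
    base fibre, and the line f = oo is the curve E of the step at g / f = 0. *)
Lemma exc_P5 O : gexc okP5 O <->
  (exists c, O = pt0 f^-1 (f / g) c) \/ O = eZ f^-1 (g / f) 0.
Proof.
have cgi : chart f^-1 g^-1 by apply/chart_invy/chart_inv.
rewrite /okP5 exc_pt0 // rmorph0 subr0 !invrK [g^-1 * f]mulrC [f^-1 * g]mulrC.
have -> // : eZ f^-1 (g / f) 0 = pt0 (g / f) g^-1 0.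
rewrite /eZ /Submission.eZ rmorph0 subr0; congr pt0.
by rewrite invf_div mulrA mulVf // mul1r.
Qed.

Let inv_gen a b x y : a != 0 -> chart x y ->
  gpt (GCentre x^-1 y a b) = gpt (GCentre x y a^-1 b).
Proof.
move=> a0 cxy; pose z := @GCentre C K x y a^-1 b.
have gz : good k z := chart_good _ _ cxy.
apply: (@pt_eq _ _ k z (GCentre x^-1 y a b)) => //=.
- rewrite -[a]invrK; apply: valV (val_x k z); by rewrite invr_eq0.
- exact: (val_y k z).
- rewrite -[x in val _ x]invrK; apply: (valV a0 (val_x k (GCentre x^-1 y a b))).
- exact: (val_y k (GCentre x^-1 y a b)).
Qed.

Lemma P1xP1_points O : gP1xP1 k f g O ->
  [\/ exists a b, a != 0 /\ O = gpt (GCentre f g a b), exists2 a, a != 0 & O = pt0 g^-1 f a,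
      exists b, O = pt0 f g b | exists b, O = pt0 f^-1 g b] \/ O = okP3 \/ O = okP5.
Proof.
have cgi := chart_invy cfg; have cif := chart_inv cfg; have cii := chart_invy cif.
move=> [x [y [a [b [xi yi ->]]]]]; move: xi yi; rewrite !inE.
have affine a' b' : [\/ exists a b, a != 0 /\ gpt (GCentre f g a' b') = gpt (GCentre f g a b),
    exists2 a, a != 0 & gpt (GCentre f g a' b') = pt0 g^-1 f a,
    exists b, gpt (GCentre f g a' b') = pt0 f g b
  | exists b, gpt (GCentre f g a' b') = pt0 f^-1 g b].
  have [->|a'0] := eqVneq a' 0; first by constructor 3; exists b'.
  by constructor 1; exists a', b'.
have goo a' b' : [\/ exists a b, a != 0 /\ gpt (GCentre f g^-1 a' b') = gpt (GCentre f g a b),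
    exists2 a, a != 0 & gpt (GCentre f g^-1 a' b') = pt0 g^-1 f a,
    exists b, gpt (GCentre f g^-1 a' b') = pt0 f g b
  | exists b, gpt (GCentre f g^-1 a' b') = pt0 f^-1 g b] \/ gpt (GCentre f g^-1 a' b') = okP3.
  have [->|b'0] := eqVneq b' 0.
    have [->|a'0] := eqVneq a' 0; first by right.
    by left; constructor 2; exists a' => //; rewrite pt_sym.
  by left; rewrite (pt_sym _ _ cgi) (inv_gen _ b'0 (chart_swap cfg)) -(pt_sym _ _ cfg).
case/orP=> /eqP -> /orP [] /eqP ->; first by left.
- by case: (goo a b) => [|->]; [left|right; left].
- have [->|a0] := eqVneq a 0; first by left; constructor 4; exists b.
  by left; rewrite inv_gen.
- have [->|a0] := eqVneq a 0; last first.
    by rewrite inv_gen //; case: (goo a^-1 b) => [|->]; [left|right; left].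
  have [->|b0] := eqVneq b 0; first by right; right.
  left; constructor 4; exists b^-1.
  by rewrite (pt_sym _ _ cii) (inv_gen _ b0 (chart_swap cif)) -(pt_sym _ _ cif).
Qed.

(** The blow-ups at p_4, p_6, p_7, p_8, p_1, p_2 are first blow-ups of steps. Those at p_3 and p_5
    account for the two remaining steps, whose curves E are the lines f = 0 and f = oo already
    present in the product of lines. *)
Lemma gXOk_down O : gXOk O -> down stepZ O.
Proof.
rewrite /gXOk => /foldl_blow1 [[P1 [n1 [_ [n3 [_ [n5 _]]]]]]|].
  case: (P1xP1_points P1) => [[[a [b [a0 ->]]]|[a a0 ->]|[b ->]|[b Eb]]|[//|//]].
  - exact: DownGen.
  - exact: DownGoo.
  - apply: DownS2; left; exists b => //; rewrite /Submission.e1 rmorph0 subr0.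
    by rewrite [f * g]mulrC mulfK.
  - apply: DownB; constructor 1; left; exists b; last by rewrite p1_step.
    by apply/eqP => b0; apply: n1; rewrite Eb b0.
rewrite /= (exc_e1 0 cB1) (exc_e1 b3 cB2) (exc_e1 a1 cF) (exc_e1 2 cA) (exc_e1 b1 cA1) (exc_e1 b2 cA2); case=> [[[[c ->]|->] [n2 _]]|].
- apply: DownB; constructor 2; left; exists c => //.
  by apply/eqP => Ec; apply: n2; rewrite Ec /okP2 /Submission.e1 -(B2E k f g).
- by apply: DownB; constructor 2; right.
case=> [[[[c ->]|->] _]|].
- by apply: DownB; constructor 3; left; exists c.
- by apply: DownB; constructor 3; right.
case=> [[/exc_P3 [[c c0 Ec]|->|->] [n4 _]]|].
- rewrite Ec; apply: DownZero => //.
  by apply/eqP => Ea; apply: n4; rewrite Ec Ea.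
- by apply: DownS2; right.
- exact: DownZeroOo.
case=> [[[[c ->]|->] _]|].
- by apply: DownS1; left; exists c.
- by apply: DownS1; right.
case=> [[/exc_P5 [[c Ec]|->] [n6 _]]|].
- by rewrite Ec; apply: DownOo; apply/eqP => E2; apply: n6; rewrite Ec E2.
- by apply: DownB; constructor 1; right.
case=> [[[[c Ec]|->] [n7 _]]|].
- apply: DownA; constructor 1; left; exists c => //.
  by apply/eqP => Eb; apply: n7; rewrite Ec Eb.
- by apply: DownA; constructor 1; right.
case=> [[[[c Ec]|->] [n8 _]]|].
- apply: DownA; constructor 2; left; exists c => //.
  by apply/eqP => Eb; apply: n8; rewrite Ec Eb.
- by apply: DownA; constructor 2; right.
case=> // -[[[c ->]|->] _].
- by apply: DownA; constructor 3; left; exists c.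
- by apply: DownA; constructor 3; right.
Qed.

Definition okZ1 := eZ f (f * g) 0.
Definition okZ2 := eZ f (f * g) a1.
Definition okZ3 := eZ f^-1 (f * g) b3.
Definition okZ4 := eZ f^-1 g 0.
Definition okZ5 := eZ f^-1 (g / f) 0.
Definition okZ6 := eZ f^-1 (f / g) 2.
Definition okZ7 := eZ f^-1 fA1 b1.
Definition okZ8 := eZ f^-1 fA2 b2.

Definition okZs := [:: okZ1; okZ2; okZ3; okZ4; okZ5; okZ6; okZ7; okZ8].

Let zP x y b := @GCentre C K x y 0 b.

Let val_u x y b : chart x y -> val (zP x y b) (y - k b) 0.
Proof. by move=> c; apply: val_sub0 (chart_good _ _ c) (val_y k (zP x y b)). Qed.

Let zZ x y b := @GCentre C K (y - k b) (x / (y - k b)) 0 0.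

Let no_xV x y b : chart x y -> ~ pt0 x y b x^-1.
Proof.
move=> c; exact: (val_notV (chart_good 0 b c) (val_x k (zP x y b)) (chart_x0 c)).
Qed.

Let no_x x y b : chart x^-1 y -> ~ pt0 x^-1 y b x.
Proof. by move=> c; have := @no_xV _ _ b c; rewrite invrK. Qed.

Let no x y b r : chart x y -> val (zP x y b) r 0 -> r != 0 -> ~ pt0 x y b r^-1.
Proof. by move=> c v r0; exact: (val_notV (chart_good 0 b c) v r0). Qed.

Let noZ x y b r : chart x y -> val (zP x y b) r 0 -> r != 0 -> ~ eZ x y b r^-1.
Proof.
by move=> c v r0; exact: (val_notV (chart_good 0 0 (chart_eZ b c)) (val_eZ c v) r0).
Qed.

Lemma noZ_child x y b : chart x y -> ~ eZ x y b ((y - k b) / x).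
Proof.
move=> c; rewrite -invf_div.
exact: (val_notV (chart_good 0 0 (chart_eZ b c)) (val_y k (zZ x y b)) (chart_y0 (chart_eZ b c))).
Qed.

Let val_next x y b c r d : chart x y -> val (zP x y b) r d ->
  val (zP x ((y - k b) / x) c) r d.
Proof. by move=> cxy; apply: val_e1. Qed.

Let ne0 x y b : chart x y -> y - k b != 0.
Proof. by case=> i _; apply: indep_suby i. Qed.

Let vf c : val (zP f^-1 g c) f^-1 0 := val_x k _.
Let vg1 : val (zP f^-1 g 0) g 0 := val_y k _.
Let E12 : f * g = (g - k 0) / f^-1 := B2E k f g.
Let v2 r d : val (zP f^-1 g 0) r d -> val (zP f^-1 (f * g) b3) r d.
Proof. by rewrite E12; apply: val_next. Qed.
Let vg2 := v2 vg1.
Let EA0 : (g / f)^-1 = f / g. Proof. by rewrite invf_div. Qed.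
Let gf0 : g / f != 0. Proof. by rewrite mulf_neq0 ?invr_eq0. Qed.
Let vgf1 : val (zP f^-1 g 0) (g / f) 0.
Proof. by apply: val_eq (valM vg1 (vf 0)) _ _ => //; rewrite mul0r. Qed.
Let v7 r d : val (zP f^-1 (f / g) 2) r d -> val (zP f^-1 fA1 b1) r d := @val_next _ _ 2 b1 r d cA.
Let v8 r d : val (zP f^-1 fA1 b1) r d -> val (zP f^-1 fA2 b2) r d := @val_next _ _ b1 b2 r d cA1.
Let vgi4 : val (zP f (f * g) a1) g^-1 0.
Proof.
apply: val_eq (val_div a10 (val_x k (zP f (f * g) a1)) (val_y k (zP f (f * g) a1))) _ _.
  by rewrite /= invfM mulrA divff // mul1r.
by rewrite mul0r.
Qed.
Let vgi6 : val (zP f^-1 (f / g) 2) g^-1 0.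
Proof.
apply: val_eq (valM (val_x k (zP f^-1 (f / g) 2)) (val_y k (zP f^-1 (f / g) 2))) _ _.
  by rewrite /= mulKf.
by rewrite mul0r.
Qed.
Let gi0 : g^-1 != 0. Proof. by rewrite invr_eq0. Qed.
Let vA1_7 := @val_u _ _ b1 cA1.
Let vA2_8 := @val_u _ _ b2 cA2.
Let vA0_6 := @val_u _ _ 2 cA.
Let nA0 := @ne0 _ _ 2 cA.
Let nA1 := @ne0 _ _ b1 cA1.
Let nA2 := @ne0 _ _ b2 cA2.

(** From here on, a table of poles: each function listed is regular on some region of the surface
    and has a pole at all the listed centres, which proves that the points of the region are none of
    these centres. *)
Lemma lack_f_P12 : lacks f [:: okP1; okP2].
Proof. by do !split; apply: no_x. Qed.
Lemma lack_f_P58 : lacks f [:: okP5; okP6; okP7; okP8].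
Proof. by do !split; apply: no_x => //; apply: chart_invy. Qed.
Lemma lack_f_Z38 : lacks f [:: okZ3; okZ4; okZ5; okZ6; okZ7; okZ8].
Proof.
have H x y b (c : chart f^-1 y) : ~ eZ f^-1 y b f.
  by have := noZ c (val_x k (zP f^-1 y b)) (chart_x0 c); rewrite invrK.
by do !split; apply: H.
Qed.
Lemma lack_fV_P34 : lacks f^-1 [:: okP3; okP4].
Proof.
split; last by split=> //; apply: no_xV.
by apply: (@no_xV f g^-1 0); apply: chart_invy.
Qed.
Lemma lack_fV_Z12 : lacks f^-1 [:: okZ1; okZ2].
Proof. by do !split; apply: noZ (val_x k _) f0. Qed.
Lemma lack_g_P38 : lacks g [:: okP3; okP4; okP5; okP6; okP7; okP8].
Proof.
have cgi : chart f g^-1 by apply: chart_invy.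
have cgi' : chart f^-1 g^-1 by apply: chart_invy.
have H x y b : chart x y -> val (zP x y b) g^-1 0 -> ~ pt0 x y b g.
  by move=> c v; have := no c v gi0; rewrite invrK.
do !split; apply: H => //; [exact: val_y|exact: val_y|exact: v7|exact/v8/v7].
Qed.
Let noZg x y b : chart x y -> val (zP x y b) g^-1 0 -> ~ eZ x y b g.
Proof. by move=> c v; have := noZ c v gi0; rewrite invrK. Qed.
Lemma lack_g_Z12 : lacks g [:: okZ1; okZ2].
Proof.
split; last by split=> //; apply: noZg.
by have := @noZ_child _ _ 0 cF; rewrite rmorph0 subr0 mulrAC divff // mul1r.
Qed.
Lemma lack_g_Z58 : lacks g [:: okZ5; okZ6; okZ7; okZ8].
Proof.
split; first by have := @noZ_child _ _ 0 cB; rewrite -(B1E cfg).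
by do !split; apply: noZg => //; [exact: v7|exact/v8/v7].
Qed.
Lemma lack_gV_P12 : lacks g^-1 [:: okP1; okP2].
Proof. by do !split; apply: no. Qed.
Lemma lack_gV_Z34 : lacks g^-1 [:: okZ3; okZ4].
Proof. by do !split; apply: noZ. Qed.
Lemma lack_gV_Z3 : lacks (f / g) [:: okZ3; okZ4; okZ5].
Proof.
do !split; rewrite -EA0; apply: noZ => //; first exact: v2.
exact: val_y.
Qed.
Lemma lack_fg_P2 : lacks (f * g - k b3)^-1 [:: okP2].
Proof. by split=> //; apply: no => //; [exact: val_u|exact: ne0 cB2]. Qed.
Lemma lack_fg_Z3 : lacks (f * g - k b3)^-1 [:: okZ3].
Proof. by split=> //; apply: noZ => //; [exact: val_u|exact: ne0 cB2]. Qed.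
Lemma lack_a1_P4 : lacks (f * g - k a1)^-1 [:: okP4].
Proof. by split=> //; apply: no => //; [exact: val_u|exact: ne0 cF]. Qed.
Lemma lack_a1_Z2 : lacks (f * g - k a1)^-1 [:: okZ2].
Proof. by split=> //; apply: noZ => //; [exact: val_u|exact: ne0 cF]. Qed.
Lemma lack_fgV_Z1 : lacks (f * g)^-1 [:: okZ1].
Proof. by split=> //; apply: noZ => //; [exact: val_y|exact: chart_y0 cF]. Qed.
Lemma lack_A0_P68 : lacks (f / g - k 2)^-1 [:: okP6; okP7; okP8].
Proof. by do !split; apply: no => //; [exact: v7|exact/v8/v7]. Qed.
Lemma lack_A0_Z68 : lacks (f / g - k 2)^-1 [:: okZ6; okZ7; okZ8].
Proof. by do !split; apply: noZ => //; [exact: v7|exact/v8/v7]. Qed.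
Lemma lack_A1_P78 : lacks (fA1 - k b1)^-1 [:: okP7; okP8].
Proof. by do !split; apply: no => //; exact/v8. Qed.
Lemma lack_A1_Z78 : lacks (fA1 - k b1)^-1 [:: okZ7; okZ8].
Proof. by do !split; apply: noZ => //; exact/v8. Qed.
Lemma lack_A2_P8 : lacks (fA2 - k b2)^-1 [:: okP8].
Proof. by split=> //; apply: no. Qed.
Lemma lack_A2_Z8 : lacks (fA2 - k b2)^-1 [:: okZ8].
Proof. by split=> //; apply: noZ. Qed.

End OkamotoSurface.

(** * The extended surface as eight complete steps *)

Section OkamotoAtlas.
Variables (C : closedFieldType) (K : fieldType) (k : {rmorphism C -> K}).
Implicit Types (r s : K) (a b c d : C) (O R : set K).
Local Notation gpt := (gpt k).
Local Notation chart := (chart k).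
Local Notation pt0 := (pt0 k).
Local Notation gexc := (gexc k).
Local Notation e1 := (e1 k).
Local Notation eZ := (eZ k).
Local Notation step := (step k).
Local Notation stepZ := (stepZ k).

Lemma avoid_app (l l' : seq (set K)) O : avoid l O -> avoid l' O -> avoid (l ++ l') O.
Proof. by move=> al al'; apply/avoid_cat. Qed.

Lemma avoid1 r P O : O r -> ~ P r -> avoid [:: P] O.
Proof. by move=> Or nP; apply: avoid_lacks Or _. Qed.

Variables (f g : K) (a1 b1 b2 b3 : C).
Hypothesis cfg : chart f g.
Hypothesis a10 : a1 != 0.
Hypothesis two0 : (2 : C) != 0.
Local Notation fA1 := (fA1 k f g).
Local Notation fA2 := (fA2 k f g b1).
Local Notation down := (down k f g a1 b1 b2 b3).
Local Notation P1 := (okP1 k f g).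
Local Notation P2 := (okP2 k f g b3).
Local Notation P3 := (okP3 k f g).
Local Notation P4 := (okP4 k f g a1).
Local Notation P5 := (okP5 k f g).
Local Notation P6 := (okP6 k f g).
Local Notation P7 := (okP7 k f g b1).
Local Notation P8 := (okP8 k f g b1 b2).
Local Notation Z1 := (okZ1 k f g).
Local Notation Z2 := (okZ2 k f g a1).
Local Notation Z3 := (okZ3 k f g b3).
Local Notation Z4 := (okZ4 k f g).
Local Notation Z5 := (okZ5 k f g).
Local Notation Z6 := (okZ6 k f g).
Local Notation Z7 := (okZ7 k f g b1).
Local Notation Z8 := (okZ8 k f g b1 b2).
Local Notation okPs := (okPs k f g a1 b1 b2 b3).
Local Notation okZs := (okZs k f g a1 b1 b2 b3).
Local Notation gXOk := (gXOk k f g a1 b1 b2 b3).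

Let f0 : f != 0 := chart_x0 cfg.
Let g0 : g != 0 := chart_y0 cfg.
Let cF := chart_fg cfg.
Let cA := chart_A0 cfg.
Let cB := chart_B0 cfg.
Let cA1 : chart f^-1 fA1 := chart_y1 cA erefl.
Let cA2 : chart f^-1 fA2 := chart_y2 cA erefl erefl.
Let cB1 : chart f^-1 g := chart_inv cfg.
Let cB2 : chart f^-1 (f * g) := chart_inv cF.

Definition gXOkt O := (gXOk O /\ avoid okZs O) \/ exists2 Z, List.In Z okZs & gexc Z O.

Let lf12 := lack_f_P12 b3 cfg.
Let lf58 := lack_f_P58 b1 b2 cfg.
Let lf38 := lack_f_Z38 b1 b2 b3 cfg.
Let lfi34 := lack_fV_P34 a1 cfg.
Let lfi12 := lack_fV_Z12 a1 cfg.
Let lg38 := lack_g_P38 b1 b2 cfg a10.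
Let lg12 := lack_g_Z12 cfg a10.
Let lg58 := lack_g_Z58 b1 b2 cfg.
Let lgi12 := lack_gV_P12 b3 cfg.
Let lgi34 := lack_gV_Z34 b3 cfg.
Let lA35 := lack_gV_Z3 b3 cfg.
Let lb3 := lack_fg_P2 b3 cfg.
Let lb3Z := lack_fg_Z3 b3 cfg.
Let la1 := lack_a1_P4 a1 cfg.
Let la1Z := lack_a1_Z2 a1 cfg.
Let l1Z := lack_fgV_Z1 cfg.
Let lA0 := lack_A0_P68 b1 b2 cfg.
Let lA0Z := lack_A0_Z68 b1 b2 cfg.
Let lA1 := lack_A1_P78 b1 b2 cfg.
Let lA1Z := lack_A1_Z78 b1 b2 cfg.
Let lA2 := lack_A2_P8 b1 b2 cfg.
Let lA2Z := lack_A2_Z8 b1 b2 cfg.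

Let P1xP1_in x y a b : x \in [:: f; f^-1] -> y \in [:: g; g^-1] ->
  gP1xP1 k f g (gpt (GCentre x y a b)).
Proof. by move=> xi yi; exists x, y, a, b. Qed.

Let low_plane O : gP1xP1 k f g O -> avoid okPs O -> gXOk O.
Proof. by move=> PO aO; apply/foldl_blow1; left. Qed.

Let avoid_units O : O f -> O f^-1 -> avoid okPs O /\ avoid okZs O.
Proof.
move=> Of Ofi; split.
  apply: (avoid_app (l := [:: P1; P2])); first exact: avoid_lacks Of lf12.
  apply: (avoid_app (l := [:: P3; P4])); first exact: avoid_lacks Ofi lfi34.
  exact: avoid_lacks Of lf58.
apply: (avoid_app (l := [:: Z1; Z2])); first exact: avoid_lacks Ofi lfi12.
exact: avoid_lacks Of lf38.
Qed.

Lemma gen_ok a b : a != 0 -> gXOk (gpt (GCentre f g a b)) /\ avoid okZs (gpt (GCentre f g a b)).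
Proof.
move=> a0; pose z := @GCentre C K f g a b.
have Of : gpt z f := val_pt (val_x k z).
have Ofi : gpt z f^-1 := val_pt (valV a0 (val_x k z)).
have [aP aZ] := avoid_units Of Ofi.
by split=> //; apply: low_plane aP; apply: P1xP1_in; rewrite !inE eqxx ?orbT.
Qed.

Lemma goo_ok a : a != 0 -> gXOk (pt0 g^-1 f a) /\ avoid okZs (pt0 g^-1 f a).
Proof.
move=> a0; have cgi : chart f g^-1 by apply: chart_invy.
have [aP aZ] := avoid_units (pt0_y k g^-1 f a) (pt0_yV0 (chart_swap cgi) a0).
split=> //; apply: low_plane aP; rewrite /pt0 -(pt_sym _ _ cgi).
by apply: P1xP1_in; rewrite !inE eqxx ?orbT.
Qed.

Lemma zero_ok c : c != 0 -> c != a1 ->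
  gXOk (pt0 f (f * g) c) /\ avoid okZs (pt0 f (f * g) c).
Proof.
move=> c0 ca; have Of := pt0_x k f (f * g) c.
have Oa := pt0_yV cF ca; have O0 := pt0_yV0 cF c0; split.
  apply/foldl_blow1; right; do 2!right; left; split; first by apply/exc_P3 => //; constructor 1; exists c.
  apply: (avoid_app (l := [:: P4])); first exact: avoid_lacks Oa la1.
  exact: avoid_lacks Of lf58.
apply: (avoid_app (l := [:: Z1])); first exact: avoid_lacks O0 l1Z.
apply: (avoid_app (l := [:: Z2])); first exact: avoid_lacks Oa la1Z.
exact: avoid_lacks Of lf38.
Qed.

Lemma zoo_ok : gXOk (pt0 f (f * g)^-1 0) /\ avoid okZs (pt0 f (f * g)^-1 0).
Proof.
have Of := pt0_x k f (f * g)^-1 0.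
have ci := chart_invy cF.
have n1 : ~ pt0 f (f * g)^-1 0 (f * g).
  have := val_notV (chart_good 0 0 ci) (val_y k (GCentre f (f * g)^-1 0 0)) (chart_y0 ci).
  by rewrite invrK.
split.
  apply/foldl_blow1; right; do 2!right; left; split; first by apply/exc_P3 => //; constructor 3.
  apply: (avoid_app (l := [:: P4])); last exact: avoid_lacks Of lf58.
  by apply: avoid_has n1 _; split=> //; apply: pt0_y.
apply: (avoid_app (l := [:: Z1; Z2])); last exact: avoid_lacks Of lf38.
by apply: avoid_has n1 _; do !split; apply: (eZ_above cF); apply: pt0_y.
Qed.

Lemma oo_ok c : c != 2 -> gXOk (pt0 f^-1 (f / g) c) /\ avoid okZs (pt0 f^-1 (f / g) c).
Proof.
move=> c2; have Ofi := pt0_x k f^-1 (f / g) c; have OA := pt0_y k f^-1 (f / g) c.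
have O2 := pt0_yV cA c2; split.
  apply/foldl_blow1; right; do 4!right; left; split; first by apply/exc_P5 => //; left; exists c.
  exact: avoid_lacks O2 lA0.
apply: (avoid_app (l := [:: Z1; Z2])); first exact: avoid_lacks Ofi lfi12.
apply: (avoid_app (l := [:: Z3; Z4; Z5])); first exact: avoid_lacks OA lA35.
exact: avoid_lacks O2 lA0Z.
Qed.

Let in_e1 x y b c : chart x y -> e1 x y b c ((y - k b) / x).
Proof. by move=> cxy; apply: e1_y. Qed.

Lemma S1_e1 c : gXOk (e1 f (f * g) a1 c) /\ avoid okZs (e1 f (f * g) a1 c).
Proof.
have up : pt0 f (f * g) a1 `<=` e1 f (f * g) a1 c by apply: e1_above.
have Of := up _ (pt0_x k f (f * g) a1); have O0 := up _ (pt0_yV0 cF a10); split.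
  apply/foldl_blow1; right; do 3!right; left; split; last exact: avoid_lacks Of lf58.
  by rewrite exc_e1 //; left; exists c.
apply: (avoid_app (l := [:: Z1])); first exact: avoid_lacks O0 l1Z.
apply: (avoid_app (l := [:: Z2])); last exact: avoid_lacks Of lf38.
by apply: avoid1 (in_e1 a1 c cF) _; apply: noZ_child.
Qed.

Let S1_Z : gXOk Z2.
Proof.
have up : pt0 f (f * g) a1 `<=` Z2 by apply: eZ_above.
have Of := up _ (pt0_x k f (f * g) a1).
apply/foldl_blow1; right; do 3!right; left; split; last exact: avoid_lacks Of lf58.
by rewrite exc_e1 //; right.
Qed.

Lemma S2_e1 c : gXOk (e1 f (f * g) 0 c) /\ avoid okZs (e1 f (f * g) 0 c).
Proof.
have -> : e1 f (f * g) 0 c = pt0 f g c.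
  by rewrite /Submission.e1 rmorph0 subr0 mulrAC divff // mul1r.
have Of := pt0_x k f g c; have Og := pt0_y k f g c; split.
  apply: low_plane; first by apply: P1xP1_in; rewrite !inE eqxx ?orbT.
  apply: (avoid_app (l := [:: P1; P2])); first exact: avoid_lacks Of lf12.
  exact: avoid_lacks Og lg38.
apply: (avoid_app (l := [:: Z1; Z2])); first exact: avoid_lacks Og lg12.
exact: avoid_lacks Of lf38.
Qed.

Let S2_Z : gXOk Z1.
Proof.
have up : pt0 f (f * g) 0 `<=` Z1 by apply: eZ_above.
have Of := up _ (pt0_x k f (f * g) 0); have [n1 _] := l1Z.
apply/foldl_blow1; right; do 2!right; left; split; first by apply/exc_P3 => //; constructor 2.
apply: (avoid_app (l := [:: P4])); last exact: avoid_lacks Of lf58.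
by apply: avoid_has n1 _; split=> //; apply: pt0_yV0 cF a10.
Qed.

Let A_avoid O : pt0 f^-1 (f / g) 2 `<=` O -> avoid [:: Z1; Z2; Z3; Z4; Z5] O.
Proof.
move=> up; have Ofi : O f^-1 by apply: up; apply: pt0_x.
have OA : O (f / g) by apply: up; apply: pt0_y.
apply: (avoid_app (l := [:: Z1; Z2])); first exact: avoid_lacks Ofi lfi12.
exact: avoid_lacks OA lA35.
Qed.

Let s6 : pt0 f^-1 (f / g) 2 `<=` pt0 f^-1 fA1 b1 := @e1_above _ _ k _ _ 2 cA b1.
Let s7 : pt0 f^-1 fA1 b1 `<=` pt0 f^-1 fA2 b2 := @e1_above _ _ k _ _ b1 cA1 b2.

Lemma A0_e1 c : ne b1 c -> gXOk (e1 f^-1 (f / g) 2 c) /\ avoid okZs (e1 f^-1 (f / g) 2 c).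
Proof.
move=> cb; have up : pt0 f^-1 (f / g) 2 `<=` e1 f^-1 (f / g) 2 c by apply: e1_above.
have O1 : e1 f^-1 (f / g) 2 c (fA1 - k b1)^-1 by apply: (pt0_yV cA1 cb).
split.
  apply/foldl_blow1; right; do 5!right; left; split; last exact: avoid_lacks O1 lA1.
  by rewrite exc_e1 //; left; exists c.
apply: (avoid_app (A_avoid up)).
apply: (avoid_app (l := [:: Z6])); last exact: avoid_lacks O1 lA1Z.
by apply: avoid1 (in_e1 2 c cA) _; apply: noZ_child.
Qed.

Let A0_Z : gXOk Z6.
Proof.
apply/foldl_blow1; right; do 5!right; left; split; first by rewrite exc_e1 //; right.
have n1 : ~ Z6 fA1 by apply: noZ_child.
apply: avoid_has n1 _; do !split; [exact: pt0_y|exact/s7/pt0_y].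
Qed.

Lemma A1_e1 c : ne b2 c -> gXOk (e1 f^-1 fA1 b1 c) /\ avoid okZs (e1 f^-1 fA1 b1 c).
Proof.
move=> cb; have up : pt0 f^-1 fA1 b1 `<=` e1 f^-1 fA1 b1 c by apply: e1_above.
have O2 : e1 f^-1 fA1 b1 c (fA2 - k b2)^-1 by apply: (pt0_yV cA2 cb).
have O1 : e1 f^-1 fA1 b1 c fA1 by apply: up; apply: pt0_y.
split.
  apply/foldl_blow1; right; do 6!right; left; split; last exact: avoid_lacks O2 lA2.
  by rewrite exc_e1 //; left; exists c.
apply: (avoid_app (A_avoid (subset_trans s6 up))).
apply: (avoid_app (l := [:: Z6])); first by apply: avoid1 O1 _; apply: noZ_child.
apply: (avoid_app (l := [:: Z7])); last exact: avoid_lacks O2 lA2Z.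
by apply: avoid1 (in_e1 b1 c cA1) _; apply: noZ_child.
Qed.

Let A1_Z : gXOk Z7.
Proof.
apply/foldl_blow1; right; do 6!right; left; split; first by rewrite exc_e1 //; right.
have n1 : ~ Z7 fA2 by apply: noZ_child.
by apply: avoid_has n1 _; do !split; apply: pt0_y.
Qed.

Lemma A2_e1 c : gXOk (e1 f^-1 fA2 b2 c) /\ avoid okZs (e1 f^-1 fA2 b2 c).
Proof.
have up : pt0 f^-1 fA2 b2 `<=` e1 f^-1 fA2 b2 c by apply: e1_above.
have O2 : e1 f^-1 fA2 b2 c fA2 by apply: up; apply: pt0_y.
have O1 : e1 f^-1 fA2 b2 c fA1 by apply/up/s7/pt0_y.
split.
  apply/foldl_blow1; right; do 7!right; left; split=> //.
  by rewrite exc_e1 //; left; exists c.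
apply: (avoid_app (A_avoid (subset_trans s6 (subset_trans s7 up)))).
apply: (avoid_app (l := [:: Z6])); first by apply: avoid1 O1 _; apply: noZ_child.
apply: (avoid_app (l := [:: Z7])); first by apply: avoid1 O2 _; apply: noZ_child.
by apply: avoid1 (in_e1 b2 c cA2) _; apply: noZ_child.
Qed.

Let A2_Z : gXOk Z8.
Proof.
by apply/foldl_blow1; right; do 7!right; left; split=> //; rewrite exc_e1 //; right.
Qed.

Lemma B0_e1 c : ne 0 c -> gXOk (e1 f^-1 (g / f) 0 c) /\ avoid okZs (e1 f^-1 (g / f) 0 c).
Proof.
rewrite /ne p1_step // => c0.
have Ofi := pt0_x k f^-1 g c; have Og := pt0_y k f^-1 g c; have Ogi := pt0_yV0 cB1 c0.
split.
  apply: low_plane; first by apply: P1xP1_in; rewrite !inE eqxx ?orbT.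
  apply: (avoid_app (l := [:: P1; P2])); first exact: avoid_lacks Ogi lgi12.
  exact: avoid_lacks Og lg38.
apply: (avoid_app (l := [:: Z1; Z2])); first exact: avoid_lacks Ofi lfi12.
apply: (avoid_app (l := [:: Z3; Z4])); first exact: avoid_lacks Ogi lgi34.
exact: avoid_lacks Og lg58.
Qed.

Let B0_Z : gXOk Z5.
Proof.
apply/foldl_blow1; right; do 4!right; left; split; first by apply/exc_P5 => //; right.
have [_ [_ [n1 _]]] := lA35.
apply: avoid_has n1 _; do !split; [exact: pt0_y|exact/s6/pt0_y|exact/s7/s6/pt0_y].
Qed.

Let B_avoid O : O f^-1 -> O g -> avoid [:: P3; P4; P5; P6; P7; P8] O /\
  (avoid [:: Z1; Z2] O /\ avoid [:: Z5; Z6; Z7; Z8] O).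
Proof.
move=> Ofi Og; split; first exact: avoid_lacks Og lg38.
by split; [exact: avoid_lacks Og lg12|exact: avoid_lacks Og lg58].
Qed.

Let E12 : f * g = (g - k 0) / f^-1 := B2E k f g.

Let s1 : pt0 f^-1 g 0 `<=` pt0 f^-1 (f * g) b3.
Proof. by rewrite E12; apply: e1_above. Qed.

Lemma B1_e1 c : ne b3 c -> gXOk (e1 f^-1 g 0 c) /\ avoid okZs (e1 f^-1 g 0 c).
Proof.
move=> cb; have up : pt0 f^-1 g 0 `<=` e1 f^-1 g 0 c by apply: e1_above.
have O3 : e1 f^-1 g 0 c (f * g - k b3)^-1 by rewrite /Submission.e1 -E12; apply: (pt0_yV cB2 cb).
have O1 : e1 f^-1 g 0 c (f * g) by rewrite /Submission.e1 -E12; apply: pt0_y.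
have [aP [aZ aZ']] := B_avoid (up _ (pt0_x k _ _ _)) (up _ (pt0_y k _ _ _)).
split.
  apply/foldl_blow1; right; left; split; first by rewrite exc_e1 //; left; exists c.
  by apply: (avoid_app (l := [:: P2])); first exact: avoid_lacks O3 lb3.
apply: (avoid_app aZ).
apply: (avoid_app (l := [:: Z3])); first exact: avoid_lacks O3 lb3Z.
apply: (avoid_app (l := [:: Z4])) => //; apply: avoid1 O1 _; rewrite E12.
exact: noZ_child.
Qed.

Let B1_Z : gXOk Z4.
Proof.
have up : pt0 f^-1 g 0 `<=` Z4 by apply: eZ_above.
have [aP _] := B_avoid (up _ (pt0_x k _ _ _)) (up _ (pt0_y k _ _ _)).
apply/foldl_blow1; right; left; split; first by rewrite exc_e1 //; right.
apply: (avoid_app (l := [:: P2])) => //.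
have n1 : ~ Z4 (f * g) by rewrite E12; apply: noZ_child.
by apply: avoid_has n1 _; split=> //; apply: pt0_y.
Qed.

Lemma B2_e1 c : gXOk (e1 f^-1 (f * g) b3 c) /\ avoid okZs (e1 f^-1 (f * g) b3 c).
Proof.
have up : pt0 f^-1 (f * g) b3 `<=` e1 f^-1 (f * g) b3 c by apply: e1_above.
have O1 : e1 f^-1 (f * g) b3 c (f * g) by apply: up; apply: pt0_y.
have [aP [aZ aZ']] := B_avoid (up _ (pt0_x k _ _ _)) (up _ (s1 (pt0_y k _ _ _))).
split.
  apply/foldl_blow1; right; right; left; split=> //.
  by rewrite exc_e1 //; left; exists c.
apply: (avoid_app aZ); apply: (avoid_app (l := [:: Z3])).
  by apply: avoid1 (in_e1 b3 c cB2) _; apply: noZ_child.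
apply: (avoid_app (l := [:: Z4])) => //; apply: avoid1 O1 _; rewrite E12.
exact: noZ_child.
Qed.

Let B2_Z : gXOk Z3.
Proof.
have up : pt0 f^-1 (f * g) b3 `<=` Z3 by apply: eZ_above.
have [aP _] := B_avoid (up _ (pt0_x k _ _ _)) (up _ (s1 (pt0_y k _ _ _))).
by apply/foldl_blow1; right; right; left; split=> //; rewrite exc_e1 //; right.
Qed.

Lemma okZs_in : forall Z, List.In Z okZs -> gXOk Z.
Proof. by move=> Z /= [<-|[<-|[<-|[<-|[<-|[<-|[<-|[<-|[]]]]]]]]]. Qed.

Let in_excZ x y b (cxy : chart x y) nxt O : step x y b nxt O -> List.In (eZ x y b) okZs ->
  (forall c, nxt c -> gXOk (e1 x y b c) /\ avoid okZs (e1 x y b c)) -> gXOkt O.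
Proof.
move=> [[c nc ->]|[d ->]|->] Zin H1; first by left; apply: H1.
- by right; exists (eZ x y b) => //; rewrite exc_e2 //; left; exists d.
- by right; exists (eZ x y b) => //; rewrite exc_e2 //; right.
Qed.

Lemma down_XOkt O : down step O -> gXOkt O.
Proof.
case=> {O} [a b a0|a a0|c c0 ca||c c2|O H|O H|O [H|H|H]|O [H|H|H]].
- by left; apply: gen_ok.
- by left; apply: goo_ok.
- by left; apply: zero_ok.
- by left; apply: zoo_ok.
- by left; apply: oo_ok.
- by apply: in_excZ cF _ _ H _ _ => [|c _]; [do 1!right; left|exact: S1_e1].
- by apply: in_excZ cF _ _ H _ _ => [|c _]; [left|exact: S2_e1].
- by apply: in_excZ cA _ _ H _ _ => [|c cn]; [do 5!right; left|exact: A0_e1].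
- by apply: in_excZ cA1 _ _ H _ _ => [|c cn]; [do 6!right; left|exact: A1_e1].
- by apply: in_excZ cA2 _ _ H _ _ => [|c _]; [do 7!right; left|exact: A2_e1].
- by apply: in_excZ cB _ _ H _ _ => [|c cn]; [do 4!right; left|exact: B0_e1].
- by apply: in_excZ cB1 _ _ H _ _ => [|c cn]; [do 3!right; left|exact: B1_e1].
- by apply: in_excZ cB2 _ _ H _ _ => [|c _]; [do 2!right; left|exact: B2_e1].
Qed.

Let stepZ_step x y b nxt O : stepZ x y b nxt O -> O <> eZ x y b -> step x y b nxt O.
Proof. by case=> [H _|//]; constructor 1. Qed.

Lemma XOkt_down O : gXOkt O -> down step O.
Proof.
case=> [[/(gXOk_down cfg) H aZ]|[Z Zin eO]].
  have aZ' Z := avoid_in aZ (P := Z).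
  case: H aZ' => {O aZ} [a b a0|a a0|c c0 ca||c c2|O H|O H|O [H|H|H]|O [H|H|H]] aZ.
  - exact: DownGen.
  - exact: DownGoo.
  - exact: DownZero.
  - exact: DownZeroOo.
  - exact: DownOo.
  - by apply/DownS1/(stepZ_step H)/aZ; do 1!right; left.
  - by apply/DownS2/(stepZ_step H)/aZ; left.
  - by apply/DownA; constructor 1; apply/(stepZ_step H)/aZ; do 5!right; left.
  - by apply/DownA; constructor 2; apply/(stepZ_step H)/aZ; do 6!right; left.
  - by apply/DownA; constructor 3; apply/(stepZ_step H)/aZ; do 7!right; left.
  - by apply/DownB; constructor 1; apply/(stepZ_step H)/aZ; do 4!right; left.
  - by apply/DownB; constructor 2; apply/(stepZ_step H)/aZ; do 3!right; left.
  - by apply/DownB; constructor 3; apply/(stepZ_step H)/aZ; do 2!right; left.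
have st x y b nxt : chart x y -> gexc (eZ x y b) O -> step x y b nxt O.
  by move=> cxy; rewrite exc_e2 // => -[[d ->]|->]; [constructor 2; exists d|constructor 3].
case: Zin eO => [<-|[<-|[<-|[<-|[<-|[<-|[<-|[<-|//]]]]]]]] eO.
- exact/DownS2/st.
- exact/DownS1/st.
- by apply: DownB; constructor 3; apply: st.
- by apply: DownB; constructor 2; apply: st.
- by apply: DownB; constructor 1; apply: st.
- by apply: DownA; constructor 1; apply: st.
- by apply: DownA; constructor 2; apply: st.
- by apply: DownA; constructor 3; apply: st.
Qed.

End OkamotoAtlas.

(** * The surface of Takasaki *)

Section Upstairs.
Variables (C : closedFieldType) (K : fieldType) (k : {rmorphism C -> K}).
Variables (fs tau : {rmorphism K -> K}).
Hypothesis two0 : 2 != 0 :> K.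
Hypothesis fk : forall a, fs (k a) = k a.
Hypothesis tk : forall a, tau (k a) = k a.
Hypothesis tf : forall r, tau (fs r) = fs r.
Hypothesis tt : involutive tau.
Implicit Types (x y r s xi eta : K) (a b c d : C) (O : set K).
Local Notation gpt := (gpt k).
Local Notation chart := (chart k).
Local Notation pt0 := (pt0 k).
Local Notation gexc := (gexc k).
Local Notation gdvr := (gdvr k).
Local Notation e1 := (e1 k).
Local Notation e2 := (e2 k).
Local Notation e3 := (e3 k).
Local Notation eZ := (eZ k).
Local Notation step := (step k).
Local Notation cover := (cover k fs tau).
Local Notation covered := (covered k fs tau).

(* Upstairs a step is the blowup of eta = b on xi = 0, with exceptional curve
   {f2}, and then of the point uO of that curve which lies away from xi = 0 in the
   direction of the coordinate eta, with exceptional curve {f1}. *)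
Definition uO xi eta b := e1 xi eta b 0.
Definition f1 xi eta b c := e1 xi ((eta - k b) / xi) 0 c.
Definition f2 xi eta b d := pt0 (eta - k b) (xi / (eta - k b)) d.
Definition f3 xi eta b := eZ xi ((eta - k b) / xi) 0.

(** The order of creation is opposite to the one downstairs, since [{f2}] arises before [{f1}]. The
    numbering follows the images: [f1], [f2], [f3] are sent to [e1], [e2], [e3]. *)
Definition ustep xi eta b (nxt : C -> Prop) O :=
  [\/ exists2 c, nxt c & O = f1 xi eta b c, exists d, O = f2 xi eta b d | O = f3 xi eta b].

Lemma f1E xi eta b c : f1 xi eta b c = pt0 xi ((eta - k b) / xi ^+ 2) c.
Proof. by rewrite /f1 /Submission.e1 rmorph0 subr0 -mulrA -invfM expr2. Qed.

Lemma f3E xi eta b : chart xi eta ->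
  f3 xi eta b = gpt (GCentre ((eta - k b) / xi) (xi ^+ 2 / (eta - k b)) 0 0).
Proof.
move=> c; rewrite /f3 /Submission.eZ rmorph0 subr0 /Submission.pt0; congr (gpt (GCentre _ _ _ _)).
by rewrite invf_div mulrA -expr2.
Qed.

Lemma exc_f2 xi eta b : chart xi eta ->
  gexc (pt0 xi eta b) = [set O | (exists d, O = f2 xi eta b d) \/ O = uO xi eta b].
Proof. exact: exc_pt0'. Qed.

Lemma exc_f1 xi eta b : chart xi eta ->
  gexc (uO xi eta b) = [set O | (exists c, O = f1 xi eta b c) \/ O = f3 xi eta b].
Proof. by move=> c; rewrite /uO exc_e1 //; apply: chart_e1. Qed.

Section Cover.
Variables (x y xi eta : K).
Hypothesis cv : cover x y xi eta.
Let cxy : chart x y. Proof. by case: cv. Qed.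
Let cxe : chart xi eta. Proof. by case: cv. Qed.
Let fx : fs x = xi ^+ 2. Proof. by case: cv. Qed.
Let fy : fs y = eta. Proof. by case: cv. Qed.
Let tx : tau xi = - xi. Proof. by case: cv. Qed.
Let te : tau eta = eta. Proof. by rewrite -fy tf. Qed.

Let fu b : fs (y - k b) = eta - k b. Proof. by rewrite rmorphB fk fy. Qed.
Let tu b : tau (eta - k b) = eta - k b. Proof. by rewrite rmorphB tk te. Qed.

Lemma cover_f1 b : cover x ((y - k b) / x) xi ((eta - k b) / xi ^+ 2).
Proof.
split=> //; first exact: chart_e1.
  rewrite expr2 invfM mulrA; exact/chart_divy/chart_divy/chart_suby.
by rewrite fmorph_div fu fx.
Qed.

Lemma cover_f2 b : cover (x / (y - k b) ^+ 2) (y - k b) (xi / (eta - k b)) (eta - k b).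
Proof.
split.
- exact/chart_swap/chart_e2.
- exact/chart_div/chart_suby.
- by rewrite fmorph_div rmorphXn /= fu fx expr_div_n.
- exact: fu.
- by rewrite fmorph_div tu tx mulNr.
Qed.

Lemma cover_f3 b : cover ((y - k b) ^+ 2 / x) (x / (y - k b))
  ((eta - k b) / xi) (xi ^+ 2 / (eta - k b)).
Proof.
split.
- exact/chart_swap/chart_e3.
- have -> : xi ^+ 2 / (eta - k b) = xi / ((eta - k b) / xi).
    by rewrite invf_div mulrA -expr2.
  exact/chart_divy/chart_swap/chart_divy/chart_suby.
- by rewrite fmorph_div rmorphXn /= fu fx expr_div_n.
- by rewrite fmorph_div fu fx.
- by rewrite fmorph_div tu tx invrN mulrN.
Qed.

Lemma pre_pt0 b : pre fs (pt0 xi eta b) = pt0 x y b.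
Proof. by rewrite /Submission.pt0 (pre_cover two0 fk tk tf 0 b cv) expr0n. Qed.

Lemma covered_pt0 b : covered (pt0 xi eta b).
Proof. by exists x, y, xi, eta, 0, b. Qed.

Lemma pre_dvr O : O `<=` gdvr xi eta -> pre fs O `<=` gdvr x y.
Proof. by move=> OR r /OR [b Hb]; exists b; rewrite -pre_pt0. Qed.

Lemma pre_dvr' O : O `<=` gdvr eta xi -> pre fs O `<=` gdvr y x.
Proof.
move=> OR r /OR [a Ha]; exists (a ^+ 2).
by rewrite /Submission.pt0 -(pre_cover' two0 fk tk tf a 0 cv).
Qed.

End Cover.

Section CoverStep.
Variables (x y xi eta : K) (b : C).
Hypothesis cv : cover x y xi eta.
Let cxy : chart x y. Proof. by case: cv. Qed.
Let cxe : chart xi eta. Proof. by case: cv. Qed.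

Lemma pre_f1 c : pre fs (f1 xi eta b c) = e1 x y b c.
Proof. by rewrite f1E (pre_pt0 (cover_f1 cv b)). Qed.

(** The curve L is not in the branch locus, so [{f2}] covers it by squaring the coordinate. The two
    fixed points, d = 0 and d = oo, are the intersections with the two branch curves, the base line
    and E. *)
Lemma pre_f2 d : pre fs (f2 xi eta b d) = e2 x y b (d ^+ 2).
Proof. by rewrite /f2 /Submission.pt0 (pre_cover' two0 fk tk tf d 0 (cover_f2 cv b)). Qed.

Lemma pre_f3 : pre fs (f3 xi eta b) = e3 x y b.
Proof.
rewrite f3E // (pre_cover two0 fk tk tf 0 0 (cover_f3 cv b)) expr0n /=.
by rewrite /e3 /Submission.pt0 (pt_sym 0 0 (chart_e3 b cxy)).
Qed.

Lemma covered_f1 c : covered (f1 xi eta b c).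
Proof. by rewrite f1E; apply: (covered_pt0 (cover_f1 cv b)). Qed.

Lemma covered_f2 d : covered (f2 xi eta b d).
Proof.
have cv' := cover_f2 cv b; have [_ c _ _ _] := cv'.
exists (x / (y - k b) ^+ 2), (y - k b), (xi / (eta - k b)), (eta - k b), d, 0; split=> //.
by rewrite (pt_sym _ _ c).
Qed.

Lemma covered_f3 : covered (f3 xi eta b).
Proof. by rewrite f3E //; do 6!eexists; split; first exact: (cover_f3 cv b). Qed.

Lemma ustep_step nxt O : ustep xi eta b nxt O -> step x y b nxt (pre fs O).
Proof.
case=> [[c nc ->]|[d ->]|->]; first by constructor 1; exists c; rewrite // pre_f1.
  by constructor 2; exists (d ^+ 2); apply: pre_f2.
by constructor 3; apply: pre_f3.
Qed.

Lemma ustep_covered nxt O : ustep xi eta b nxt O -> covered O.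
Proof.
by case=> [[c nc ->]|[d ->]|->]; [exact: covered_f1|exact: covered_f2|exact: covered_f3].
Qed.

End CoverStep.

Variables (f g xi gg : K) (a1 b1 b2 b3 : C).
Hypothesis cv : cover f g xi gg.
Local Notation F := (xi ^+ 2).

Inductive up : set K -> Prop :=
| UpGen a b of a != 0 : up (gpt (GCentre xi gg a b))
| UpGoo a of a != 0 : up (pt0 gg^-1 xi a)
| UpZero c of c != 0 & c != a1 : up (pt0 xi (F * gg) c)
| UpZeroOo : up (pt0 xi (F * gg)^-1 0)
| UpOo c of c != 2 : up (pt0 xi^-1 (F / gg) c)
| UpS1 O of ustep xi (F * gg) a1 (@any C) O : up O
| UpS2 O of ustep xi (F * gg) 0 (@any C) O : up O
| UpA O of chain xi^-1 (F / gg) (fA1 k F gg) (fA2 k F gg b1) 2 b1 b2 ustep O : up O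
| UpB O of chain xi^-1 (gg / F) gg (F * gg) 0 0 b3 ustep O : up O.

Let cfg : chart f g. Proof. by case: cv. Qed.
Let cxg : chart xi gg. Proof. by case: cv. Qed.
Let ff : fs f = F. Proof. by case: cv. Qed.
Let fg : fs g = gg. Proof. by case: cv. Qed.
Let tx : tau xi = - xi. Proof. by case: cv. Qed.

Lemma chart_xiF : chart xi (F * gg).
Proof.
have -> : F * gg = gg * xi * xi by ring.
exact/chart_muly/chart_muly.
Qed.

Lemma cover_goo : cover f g^-1 xi gg^-1.
Proof. by split=> //; [exact: chart_invy|exact: chart_invy|rewrite fmorphV fg]. Qed.

Lemma cover_zero : cover f (f * g) xi (F * gg).
Proof. by split=> //; [exact: chart_fg|exact: chart_xiF|rewrite rmorphM ff fg]. Qed.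

Lemma cover_zoo : cover f (f * g)^-1 xi (F * gg)^-1.
Proof.
have [c c' ? E ?] := cover_zero.
by split=> //; [exact: chart_invy|exact: chart_invy|rewrite fmorphV E].
Qed.

Let fxi : fs f^-1 = xi^-1 ^+ 2. Proof. by rewrite fmorphV ff exprVn. Qed.
Let txi : tau xi^-1 = - xi^-1. Proof. by rewrite fmorphV tx invrN. Qed.

Lemma chart_B0up : chart xi^-1 (gg / F).
Proof.
have -> : gg / F = gg * xi^-1 * xi^-1 by rewrite -exprVn expr2 mulrA.
exact/chart_muly/chart_muly/chart_inv.
Qed.

Lemma chart_A0up : chart xi^-1 (F / gg).
Proof. by rewrite -[F / gg]invf_div; exact/chart_invy/chart_B0up. Qed.

Lemma cover_A0 : cover f^-1 (f / g) xi^-1 (F / gg).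
Proof.
by split=> //; [exact: chart_A0|exact: chart_A0up|rewrite fmorph_div ff fg].
Qed.

Lemma cover_B0 : cover f^-1 (g / f) xi^-1 (gg / F).
Proof.
by split=> //; [exact: chart_B0|exact: chart_B0up|rewrite fmorph_div ff fg].
Qed.

Lemma cover_next x y xi' eta b : cover x y xi' eta ->
  cover x ((y - k b) / x) xi' ((eta - k b) / xi' ^+ 2).
Proof. by move=> c; apply: cover_f1. Qed.

Lemma cover_A1 : cover f^-1 (fA1 k f g) xi^-1 (fA1 k F gg).
Proof. by have := cover_next 2 cover_A0; rewrite exprVn. Qed.

Lemma cover_A2 : cover f^-1 (fA2 k f g b1) xi^-1 (fA2 k F gg b1).
Proof. by have := cover_next b1 cover_A1; rewrite exprVn. Qed.

Lemma cover_B1 : cover f^-1 g xi^-1 gg.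
Proof. by split=> //; exact: chart_inv. Qed.

Lemma cover_B2 : cover f^-1 (f * g) xi^-1 (F * gg).
Proof.
have [c c' ? E ?] := cover_zero.
by split=> //; exact: chart_inv.
Qed.

Lemma up_down O : up O -> down k f g a1 b1 b2 b3 step (pre fs O) /\ covered O.
Proof.
case=> {O} [a b a0|a a0|c c0 ca||c c2|O H|O H|O [H|H|H]|O [H|H|H]].
- rewrite (pre_cover two0 fk tk tf a b cv); split; last by exists f, g, xi, gg, a, b.
  by apply: DownGen; rewrite expf_neq0.
- have [_ c _ _ _] := cover_goo.
  rewrite /Submission.pt0 (pre_cover' two0 fk tk tf a 0 cover_goo); split.
    by apply: DownGoo; rewrite expf_neq0.
  by exists f, g^-1, xi, gg^-1, a, 0; split; [exact: cover_goo|rewrite (pt_sym _ _ c)].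
- by rewrite (pre_pt0 cover_zero); split; [exact: DownZero|apply: covered_pt0 cover_zero _].
- by rewrite (pre_pt0 cover_zoo); split; [exact: DownZeroOo|apply: covered_pt0 cover_zoo _].
- by rewrite (pre_pt0 cover_A0); split; [exact: DownOo|apply: covered_pt0 cover_A0 _].
- by split; [apply: DownS1; exact: (ustep_step cover_zero H)|exact: (ustep_covered cover_zero H)].
- by split; [apply: DownS2; exact: (ustep_step cover_zero H)|exact: (ustep_covered cover_zero H)].
- split; [apply/DownA|exact: (ustep_covered cover_A0 H)].
  by constructor 1; exact: (ustep_step cover_A0 H).
- split; [apply/DownA|exact: (ustep_covered cover_A1 H)].
  by constructor 2; exact: (ustep_step cover_A1 H).
- split; [apply/DownA|exact: (ustep_covered cover_A2 H)].
  by constructor 3; exact: (ustep_step cover_A2 H).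
- split; [apply/DownB|exact: (ustep_covered cover_B0 H)].
  by constructor 1; exact: (ustep_step cover_B0 H).
- split; [apply/DownB|exact: (ustep_covered cover_B1 H)].
  by constructor 2; exact: (ustep_step cover_B1 H).
- split; [apply/DownB|exact: (ustep_covered cover_B2 H)].
  by constructor 3; exact: (ustep_step cover_B2 H).
Qed.

End Upstairs.

(** * Infinitely near points in two coordinate systems *)

Section Transport.
Variables (C : closedFieldType) (K : fieldType) (k : {rmorphism C -> K}).
Implicit Types (x y r s h xi : K) (a b c d : C) (O : set K).
Local Notation val := (val k).
Local Notation chart := (chart k).
Local Notation pt0 := (pt0 k).
Local Notation e1 := (e1 k).
Local Notation uO := (uO k).

Section TS.
Variables (h s xi y A B : K) (c b kappa A0 B0 : C).
Hypotheses (chs : chart h s) (cxy : chart xi y) (k0 : kappa != 0).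
Hypothesis Exi : xi = k kappa * h.
Hypothesis Ept : pt0 h s c = pt0 xi y b.
Hypothesis Ey : y - k b = A * (s - k c) + h ^+ 2 * B.
Hypotheses (vA : val (GCentre h s 0 c) A A0) (vB : val (GCentre h s 0 c) B B0).
Hypothesis A00 : A0 != 0.

Let h0 : h != 0 := chart_x0 chs.
Let kk0 : k kappa != 0. Proof. by rewrite fmorph_eq0. Qed.

(** Modulo the square of h, [y - k b] is a unit multiple of [s - k c]. Hence the direction s = c is
    the direction y = b. *)
Lemma uO_transport : e1 h s c 0 = uO xi y b.
Proof.
have csh := chart_swap chs; have cyx := chart_swap cxy.
have cE := chart_e1 c chs; have cE' := chart_e1 b cxy.
rewrite /uO /Submission.e1 /Submission.pt0 (pt_sym 0 0 cE) (pt_sym 0 0 cE').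
have swp r d : val (GCentre h s 0 c) r d -> val (GCentre s h c 0) r d.
  by move=> v; apply/(@val_swap _ _ k (GCentre h s 0 c)) => //; apply: chart_good.
(* The remainder is read as [(h * B) * h], with a coefficient vanishing at the point. So the linear
   part is diagonal with entries [A0] and [kappa], and it fixes the direction 0. *)
have := @uv_change _ _ k (GCentre s h c 0) (GCentre y xi b 0)
  A (h * B) 0 (k kappa) A0 0 0 kappa 0 0.
rewrite /guv /= !rmorph0 !subr0 => -> //.
- exact: chart_good.
- exact: chart_good.
- by rewrite -(pt_sym _ _ chs) -(pt_sym _ _ cxy).
- by apply: chart_good; apply: chart_swap.
- exact: swp.
- apply: swp; apply: val_eq (valM (val_x k (GCentre h s 0 c)) vB) _ _ => //.
  by rewrite mul0r.
- exact: val0.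
- exact: val_cst.
- by rewrite Ey; ring.
- by rewrite mul0r add0r.
- by rewrite mul0r subr0 mulf_neq0.
- by rewrite mul0r add0r.
- by rewrite mul0r mulr0 addr0.
Qed.

(** Dividing the relation [Ey] by [xi ^+ 2 = k kappa ^+ 2 * h ^+ 2] turns it into an affine map
    between the coordinates of the two second exceptional curves; its coefficients are values at the
    point below. *)
Lemma pt0_transport c' : pt0 h ((s - k c) / h ^+ 2) c' =
  pt0 xi ((y - k b) / xi ^+ 2) ((A0 * c' + B0) / kappa ^+ 2).
Proof.
have c1 : chart h ((s - k c) / h ^+ 2).
  rewrite expr2 invfM mulrA; exact/chart_divy/chart_divy/chart_suby.
have c2 : chart xi ((y - k b) / xi ^+ 2).
  rewrite expr2 invfM mulrA; exact/chart_divy/chart_divy/chart_suby.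
set b' := (A0 * c' + B0) / _; set s' := (s - k c) / _ in c1 *; set y' := (y - k b) / _ in c2 *.
pose z := @GCentre C K h s 0 c; pose w := @GCentre C K xi y 0 b.
pose z' := @GCentre C K h s' 0 c'; pose w' := @GCentre C K xi y' 0 b'.
have gz : good k z := chart_good _ _ chs. have gw : good k w := chart_good _ _ cxy.
have gz' : good k z' := chart_good _ _ c1. have gw' : good k w' := chart_good _ _ c2.
have Es' : s = k c + h ^+ 2 * s' by rewrite /s' mulrC divfK ?expf_neq0 // addrC subrK.
have xi0 : xi != 0 := chart_x0 cxy.
have Ey1 : y = k b + xi ^+ 2 * y' by rewrite /y' mulrC divfK ?expf_neq0 // addrC subrK.
have Ey' : y' = (A * s' + B) / k kappa ^+ 2.
  by rewrite /y' Ey Es' Exi; field; rewrite h0 kk0.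
have up r d : val z r d -> val z' r d.
  apply: (val_sub gz') => /=; first exact: (val_x k z').
  rewrite Es'; apply: val_eq (valD gz' (val_cst k z' c) (valM (valXn 2 (val_x k z')) (val_y k z'))) _ _ => //=.
  by rewrite expr2 !mul0r addr0.
have upw r d : val w r d -> val w' r d.
  apply: (val_sub gw') => /=; first exact: (val_x k w').
  rewrite Ey1; apply: val_eq (valD gw' (val_cst k w' b) (valM (valXn 2 (val_x k w')) (val_y k w'))) _ _ => //=.
  by rewrite expr2 !mul0r addr0.
have vk1 : val z' (k kappa ^+ 2) (kappa ^+ 2) := valXn 2 (val_cst k z' kappa).
have vk2 : val w' (k kappa ^+ 2) (kappa ^+ 2) := valXn 2 (val_cst k w' kappa).
have wA := upw _ _ (val_pteq gz gw Ept vA); have wB := upw _ _ (val_pteq gz gw Ept vB).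
have kk2 : kappa ^+ 2 != 0 by rewrite expf_neq0.
have An := val_ne0 gw' A00 wA.
symmetry; apply: (@pt_eq _ _ k z' w') => //=.
- apply: val_eq (valM (val_cst k z' kappa) (val_x k z')) Exi _; by rewrite mulr0.
- apply: val_eq (val_div kk2 (valD gz' (valM (up _ _ vA) (val_y k z')) (up _ _ vB)) vk1) Ey' _ => //.
- apply: val_eq (val_div k0 (val_x k w') (val_cst k w' kappa)) _ _; last by rewrite mul0r.
  by rewrite /= Exi mulrC mulKf.
- apply: val_eq (val_div A00 (valB gw' (valM vk2 (val_y k w')) wB) wA) _ _ => /=.
    by rewrite Ey'; field; rewrite An kk0.
  by rewrite /b'; field; rewrite A00 k0.
Qed.

End TS.
End Transport.

(** * Expansions at q = oo *)

Section Expansions.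
Variables (K : fieldType) (t a1 a2 s h N : K).
Hypothesis two0 : (2 : K) != 0.
Hypothesis NE : N = 2 + s / 4 + 2 * t * s * h ^+ 2 + 8 * a1 * s * h ^+ 4.
Hypotheses (N0 : N != 0) (s0 : s != 0) (h0 : h != 0).

Let pow2 n : (2 ^+ n : K) != 0. Proof. exact: expf_neq0. Qed.
Let n4 : (4 : K) != 0. Proof. by have := pow2 2; rewrite -natrX. Qed.
Let n8 : (8 : K) != 0. Proof. by have := pow2 3; rewrite -natrX. Qed.
Let n16 : (16 : K) != 0. Proof. by have := pow2 4; rewrite -natrX. Qed.
Let n32 : (32 : K) != 0. Proof. by have := pow2 5; rewrite -natrX. Qed.
Let n64 : (64 : K) != 0. Proof. by have := pow2 6; rewrite -natrX. Qed.
Local Ltac conds := rewrite ?N0 ?s0 ?h0 ?two0 ?n4 ?n8 ?n16 ?n32 ?n64.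

(** Here h = 1 / q, s = q^3 / p and N = s g / f, so [s / N] is f / g. The right-hand side has the
    form needed by [uO_transport]: a unit times [s - 8], plus [h ^+ 2] times a regular function. *)
Lemma expandA0 : s / N - 2 = (2 * N)^-1 * (s - 8)
  + h ^+ 2 * (- (4 * t * s + 16 * a1 * s * h ^+ 2) / N).
Proof.
transitivity ((s - 2 * N) / N); first by field; conds.
by rewrite {1}NE; field; conds.
Qed.

Variables (s1 s2 : K).
Hypothesis Es : s = 8 + h ^+ 2 * s1.

Lemma expandA1 : ((s / N - 2) / (4 * h ^+ 2)) + 4 * t = (8 * N)^-1 * (s1 + 64 * t)
  + h ^+ 2 * ((32 * t ^+ 2 * s - 16 * a1 * s + 128 * a1 * t * s * h ^+ 2) / (4 * N)).
Proof.
transitivity (((s - 2 * N) / (4 * h ^+ 2) + 4 * t * N) / N); first by field; conds.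
rewrite {1 2}NE; have -> : s1 = (s - 8) / h ^+ 2 by rewrite Es; field; conds.
by field; conds.
Qed.

Hypothesis Es1 : s1 = - (64 * t) + h ^+ 2 * s2.

(** As f^-1 = 4 h^2, each further division by [4 * h ^+ 2] passes to the next exceptional curve
    downstairs, while [s1] and [s2] do so upstairs. The constant of q_13 is the value of [s2] that
    matches p_8. *)
Lemma expandA2 (b2 := 4 * (1 - a1 - a2 + 2 * t ^+ 2)) :
  (((s / N - 2) / (4 * h ^+ 2)) + 4 * t) / (4 * h ^+ 2) - b2 =
  (32 * N)^-1 * (s2 - 256 * (2 + 2 * t ^+ 2 - a1 - 2 * a2))
  + h ^+ 2 * ((32 * t ^+ 2 * s1 - 16 * a1 * s1 + 128 * a1 * t * s
      - b2 * (4 * s1 + 32 * t * s + 128 * a1 * s * h ^+ 2)) / (16 * N)).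
Proof.
rewrite expandA1 Es1.
transitivity (((s2 / 2 + (32 * t ^+ 2 * s - 16 * a1 * s + 128 * a1 * t * s * h ^+ 2)) - 16 * b2 * N)
  / (16 * N)); first by field; conds.
by rewrite {1}NE Es Es1 /b2; field; conds.
Qed.

End Expansions.

Section ExpansionsB.
Variables (K : fieldType) (t a1 a2 s h N : K).
Hypothesis two0 : (2 : K) != 0.
Hypothesis NE : N = 2 + s / 4 + 2 * t * s * h ^+ 2 + 8 * a1 * s * h ^+ 4.
Hypotheses (s0 : s != 0) (h0 : h != 0).

Let pow2 n : (2 ^+ n : K) != 0. Proof. exact: expf_neq0. Qed.
Let n4 : (4 : K) != 0. Proof. by have := pow2 2; rewrite -natrX. Qed.
Let n8 : (8 : K) != 0. Proof. by have := pow2 3; rewrite -natrX. Qed.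
Let n16 : (16 : K) != 0. Proof. by have := pow2 4; rewrite -natrX. Qed.
Let n64 : (64 : K) != 0. Proof. by have := pow2 6; rewrite -natrX. Qed.
Local Ltac conds := rewrite ?s0 ?h0 ?two0 ?n4 ?n8 ?n16 ?n64.

Lemma expandB0 : N / s = (4 * s)^-1 * (s + 8) + h ^+ 2 * (2 * t + 8 * a1 * h ^+ 2).
Proof. by rewrite NE; field; conds. Qed.

Variables (s1 s2 : K).
Hypothesis Es : s = - 8 + h ^+ 2 * s1.

Lemma expandB1 : N / s / (4 * h ^+ 2) = (16 * s)^-1 * (s1 - 64 * t)
  + h ^+ 2 * ((8 * t * s1 + 32 * a1 * s) / (16 * s)).
Proof.
rewrite NE; have -> : s1 = (s + 8) / h ^+ 2 by rewrite Es; field; conds.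
by field; conds.
Qed.

Hypothesis Es1 : s1 = 64 * t + h ^+ 2 * s2.

(** The left-hand side is f g + a_2: the three quantities [N / s], its quotient by [4 * h ^+ 2] and
    the next quotient are g / f, g and f g. The constant of q_19 is the value of [s2] at which f g
    equals - a_2. *)
Lemma expandB2 : N / s / (4 * h ^+ 2) / (4 * h ^+ 2) + a2 =
  (64 * s)^-1 * (s2 + 256 * (2 * t ^+ 2 - a1 - 2 * a2))
  + h ^+ 2 * ((8 * t * s2 + (32 * a1 + 64 * a2) * s1) / (64 * s)).
Proof.
have sn : - 8 + h ^+ 2 * (64 * t + h ^+ 2 * s2) != 0 by rewrite -Es1 -Es.
rewrite expandB1 Es Es1; field; rewrite ?sn; conds; rewrite //.
Qed.

End ExpansionsB.

(** * The twenty centres in the coordinates xi and g *)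

Section TakasakiCentres.
Variables (C : closedFieldType) (K : fieldType) (k : {rmorphism C -> K}).
Implicit Types (x y r : K) (c d : C) (O : set K).
Local Notation gpt := (gpt k).
Local Notation val := (val k).
Local Notation chart := (chart k).
Local Notation pt0 := (pt0 k).
Local Notation guv := (guv k).
Local Notation e1 := (e1 k).
Local Notation uO := (uO k).
Local Notation gcentre := (gcentre C K).

Variables (q p : K) (t a1 a2 : C).
Hypothesis cqp : chart q p.
Hypothesis a10 : a1 != 0.
Hypothesis two0 : (2 : C) != 0.

Definition gUV (z : gcentre) c d := guv (gswap z) c d.

Definition tq1 : gcentre := GCentre q p^-1 0 0.
Definition tq2 := guv tq1 (4 * a1) 0.
Definition tq3 := guv tq2 0 0.
Definition tq4 := guv tq1 (- (4 * a1)) 0.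
Definition tq5 := guv tq4 0 0.
Definition tq6 : gcentre := GCentre q^-1 p^-1 0 0.
Definition tq7 := gUV tq6 0 0.
Definition tq8 := guv tq7 0 0.
Definition tq9 := guv tq8 8 0.
Definition tq10 := guv tq9 0 0.
Definition tq11 := guv tq10 (- (64 * t)) 0.
Definition tq12 := guv tq11 0 0.
Definition tq13 := guv tq12 (256 * (2 + 2 * t ^+ 2 - a1 - 2 * a2)) 0.
Definition tq14 := guv tq13 0 0.
Definition tq15 := guv tq8 (- 8) 0.
Definition tq16 := guv tq15 0 0.
Definition tq17 := guv tq16 (64 * t) 0.
Definition tq18 := guv tq17 0 0.
Definition tq19 := guv tq18 (- (256 * (2 * t ^+ 2 - a1 - 2 * a2))) 0.
Definition tq20 := guv tq19 0 0.

Definition xi : K := q / 2.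
Definition gg : K := k t / 2 + 2 * k a1 / q ^+ 2 + p / (2 * q) + q ^+ 2 / 16.
Definition b1 : C := - (4 * t).
Definition b2 : C := 4 * (1 - a1 - a2 + 2 * t ^+ 2).
Definition b3 : C := - a2.

Local Notation F := (xi ^+ 2).
Local Notation h := (q^-1).
Local Notation s0 := (q ^+ 3 / p).
Local Notation fA1 := (fA1 k F gg).
Local Notation fA2 := (fA2 k F gg b1).

Let q0 : q != 0 := chart_x0 cqp.
Let p0 : p != 0 := chart_y0 cqp.
Let twoK : (2 : K) != 0. Proof. by rewrite -(rmorph_nat k) fmorph_eq0. Qed.
Let powK n : (2 ^+ n : K) != 0. Proof. exact: expf_neq0. Qed.
Let fourK : (4 : K) != 0. Proof. by have := powK 2; rewrite -natrX. Qed.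
Let eightK : (8 : K) != 0. Proof. by have := powK 3; rewrite -natrX. Qed.
Let sixteenK : (16 : K) != 0. Proof. by have := powK 4; rewrite -natrX. Qed.
Let powC n : (2 ^+ n : C) != 0. Proof. exact: expf_neq0. Qed.
Let fourC : (4 : C) != 0. Proof. by have := powC 2; rewrite -natrX. Qed.
Let eightC : (8 : C) != 0. Proof. by have := powC 3; rewrite -natrX. Qed.
Let sixteenC : (16 : C) != 0. Proof. by have := powC 4; rewrite -natrX. Qed.
Let halfC : (2^-1 : C) != 0. Proof. by rewrite invr_eq0. Qed.

Lemma xiE : xi = k 2^-1 * q.
Proof. by rewrite /xi fmorphV rmorph_nat mulrC. Qed.

Lemma xiVE : xi^-1 = k 2 * h.
Proof. by rewrite /xi invf_div rmorph_nat. Qed.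

Lemma xi0 : xi != 0. Proof. by rewrite /xi mulf_neq0 ?invr_eq0. Qed.

(** Multiplying g by f clears its poles at q = 0. The result differs from q p / 8 by a polynomial in
    q, so (q, f g) arises from (q, q p) by a triangular change of coordinates. *)
Lemma FggE : F * gg = q * p / 8 + (k a1 / 2 + k t * q ^+ 2 / 8 + q ^+ 4 / 64).
Proof.
have n64 : (64 : K) != 0 by have := powK 6; rewrite -natrX.
by rewrite /xi /gg; field; rewrite ?q0 ?twoK ?fourK ?eightK ?sixteenK ?n64.
Qed.

Lemma chart_qFgg : chart q (F * gg).
Proof.
have c1 : chart q (k 8^-1 * (p * q)).
  apply/chart_swap/chart_scale; last exact/chart_swap/chart_muly.
  by rewrite invr_eq0.
pose P : {poly C} := (a1 / 2)%:P + (t / 8) *: 'X^2 + 64^-1 *: 'X^4.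
have := chart_swap (chart_add P (chart_swap c1)).
suff -> : k 8^-1 * (p * q) + (map_poly k P).[q] = F * gg by [].
rewrite FggE /P !rmorphD /= !map_polyZ /= map_polyC /= !map_polyXn !(hornerD, hornerZ, hornerC, hornerXn).
rewrite !fmorph_div !fmorphV !rmorph_nat; congr (_ + (_ + _ + _)).
- by rewrite mulrC [p * q]mulrC.
- by rewrite mulrAC.
- by rewrite mulrC.
Qed.

Lemma chart_qgg : chart q gg.
Proof.
have := chart_divy (chart_divy chart_qFgg).
have -> : F * gg / q / q = k 4^-1 * gg.
  by rewrite fmorphV rmorph_nat /xi; field; rewrite twoK fourK q0.
have k4 : (4 : C) != 0 by [].
move/chart_swap/(chart_scale k4)/chart_swap.
by rewrite mulrA -rmorphM divff // rmorph1 mul1r.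
Qed.

Lemma chart_xigg : chart xi gg.
Proof. by rewrite xiE; apply: chart_scale; last exact: chart_qgg. Qed.

Let chs : chart q (q * p). Proof. by rewrite mulrC; apply: chart_muly. Qed.
Let cxF : chart xi (F * gg). Proof. by have := chart_scale halfC chart_qFgg; rewrite -xiE. Qed.

(** The expansion [FggE] at q = 0. The values 4 a_1, -4 a_1 and 0 of [c] give q_2, q_4 and the point
    to which {q = 0} is contracted, with f g equal to a_1, 0 and a_1 / 2. *)
Lemma zero_pt c : pt0 q (q * p) c = pt0 xi (F * gg) ((c + 4 * a1) / 8).
Proof.
pose z := @GCentre C K q (q * p) 0 c; pose w := @GCentre C K xi (F * gg) 0 ((c + 4 * a1) / 8).
have gz : good k z := chart_good _ _ chs. have gw : good k w := chart_good _ _ cxF.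
have n64 : (64 : C) != 0 by have := powC 6; rewrite -natrX.
have n64K : (64 : K) != 0 by have := powK 6; rewrite -natrX.
have vP (z' : gcentre) : good k z' -> val z' q 0 ->
    val z' (k a1 / 2 + k t * q ^+ 2 / 8 + q ^+ 4 / 64) (a1 / 2).
  move=> gz' vq; apply: val_eq (valD gz' (valD gz' (val_div two0 (val_cst k z' a1) (val_nat k z' 2))
    (val_div eightC (valM (val_cst k z' t) (valXn 2 vq)) (val_nat k z' 8)))
    (val_div n64 (valXn 4 vq) (val_nat k z' 64))) _ _ => //.
  by rewrite !exprS !mul0r mulr0 mul0r !addr0.
apply: (@pt_eq _ _ k w z) => //=.
- apply: val_eq (valM (val_cst k w 2) (val_x k w)) _ _; last by rewrite mulr0.
  by rewrite /= xiE mulrA -rmorphM divff // rmorph1 mul1r.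
- have vq : val w q 0.
    apply: val_eq (valM (val_cst k w 2) (val_x k w)) _ _; last by rewrite mulr0.
    by rewrite /= xiE mulrA -rmorphM divff // rmorph1 mul1r.
  apply: val_eq (valM (val_nat k w 8) (valB gw (val_y k w) (vP w gw vq))) _ _ => /=.
    by rewrite FggE addrK [8 * _]mulrC divfK.
  by field; rewrite ?two0 ?eightC.
- rewrite xiE; apply: val_eq (valM (val_cst k z 2^-1) (val_x k z)) _ _ => //.
  by rewrite mulr0.
- rewrite FggE; apply: val_eq (valD gz (val_div eightC (val_y k z) (val_nat k z 8)) (vP z gz (val_x k z))) _ _ => //=.
  by field; rewrite ?two0 ?eightC.
Qed.

Let v1_of (c : C) : c != 0 -> gpt (GCentre (q * p) p^-1 c 0) = pt0 q (q * p) c.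
Proof.
move=> c0; have csp : chart (q * p) p^-1.
  by have := chart_div (chart_invy cqp); rewrite invrK.
pose z := @GCentre C K q (q * p) 0 c; pose w := @GCentre C K (q * p) p^-1 c 0.
have gz : good k z := chart_good _ _ chs. have gw : good k w := chart_good _ _ csp.
apply: (@pt_eq _ _ k z w) => //=.
- exact: (val_y k z).
- apply: val_eq (val_div c0 (val_x k z) (val_y k z)) _ _; last by rewrite mul0r.
  by rewrite /= invfM mulrA divff // mul1r.
- apply: val_eq (valM (val_x k w) (val_y k w)) _ _; last by rewrite mulr0.
  by rewrite /= mulfK.
- exact: (val_x k w).
Qed.

Lemma tq1_uv c : c != 0 -> gpt (guv tq1 c 0) = pt0 xi (F * gg) ((c + 4 * a1) / 8).
Proof.
by move=> c0; rewrite /guv /tq1 /= !rmorph0 !subr0 invrK v1_of // zero_pt.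
Qed.

Lemma tq2E : gpt tq2 = pt0 xi (F * gg) a1.
Proof. by rewrite tq1_uv ?mulf_neq0 //; congr pt0; field. Qed.

Lemma tq4E : gpt tq4 = pt0 xi (F * gg) 0.
Proof.
by rewrite tq1_uv ?oppr_eq0 ?mulf_neq0 //; congr pt0; rewrite addNr mul0r.
Qed.

(** The tangent direction of the second centre: f g - b equals (q p - c) / 8 plus a multiple of q^2,
    so [uO_transport] applies with A = 1/8 and kappa = 1/2. *)
Let zero_uO (c b : C) : c != 0 -> b = (c + 4 * a1) / 8 ->
  gpt (guv (guv tq1 c 0) 0 0) = uO xi (F * gg) b.
Proof.
move=> c0 Eb; have vqs : val (GCentre q (q * p) 0 c) q 0 := val_x k _.
pose z := @GCentre C K q (q * p) 0 c; have gz : good k z := chart_good _ _ chs.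
have n64 : (64 : C) != 0 by have := powC 6; rewrite -natrX.
have n64K : (64 : K) != 0 by have := powK 6; rewrite -natrX.
have vB : val z (k t / 8 + q ^+ 2 / 64) (t / 8 + 0 ^+ 2 / 64).
  apply: (valD gz); apply: val_div => //; try exact: val_nat; first exact: val_cst.
  exact: (valXn 2 (val_x k z)).
have vA : val z 8^-1 8^-1 by apply: valV => //; apply: val_nat.
rewrite -(uO_transport (kappa := 2^-1) chs cxF halfC xiE _ _ vA vB).
- have csp : chart (q * p) p^-1 by have := chart_div (chart_invy cqp); rewrite invrK.
  have cE := chart_e1 c chs.
  have Ec : guv tq1 c 0 = GCentre (q * p) p^-1 c 0.
    by rewrite /guv /tq1 /= !rmorph0 !subr0 invrK.
  have -> : gpt (guv (guv tq1 c 0) 0 0) = gpt (guv (GCentre (q * p) q c 0) 0 0).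
    (* The centre is given with p^-1 as its second coordinate; it is replaced by q, using
       [p^-1 = (q * p)^-1 * q], whose factor is a unit as c is nonzero. *)
    rewrite Ec; apply: (@uv_change _ _ k (GCentre (q * p) q c 0) (GCentre (q * p) p^-1 c 0)
      1 0 0 (q * p)^-1 1 0 0 c^-1 0 0).
    - by apply: chart_good; apply: chart_swap.
    - exact: chart_good.
    - by rewrite v1_of // -(pt_sym _ _ chs).
    - by apply: chart_good; apply/chart_div/chart_subx/chart_suby/chart_swap.
    - by rewrite /= rmorph0 subr0.
    - exact: val1.
    - exact: val0.
    - exact: val0.
    - by apply: valV => //; apply: val_x.
    - by rewrite /= mul1r mul0r addr0.
    - by rewrite /= !rmorph0 !subr0 mul0r add0r invfM mulrAC mulVf // mul1r.
    - by rewrite mul1r mul0r subr0 invr_eq0.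
    - by rewrite mul0r add0r invr_eq0.
    - by rewrite !(mul0r, mulr0, addr0, add0r).
  by rewrite /guv /= rmorph0 !subr0 /Submission.e1 /Submission.pt0 (pt_sym 0 0 cE).
- by rewrite zero_pt Eb.
- rewrite FggE Eb fmorph_div rmorphD rmorphM !rmorph_nat.
  by field; rewrite ?twoK ?eightK ?n64K.
- by rewrite invr_eq0.
Qed.

Lemma tq3E : gpt tq3 = uO xi (F * gg) a1.
Proof. by apply: zero_uO; [rewrite mulf_neq0|field]. Qed.

Lemma tq5E : gpt tq5 = uO xi (F * gg) 0.
Proof. by apply: zero_uO; [rewrite oppr_eq0 mulf_neq0|rewrite addNr mul0r]. Qed.

Lemma tq7c : tq7 = GCentre (q / p) h 0 0.
Proof. by rewrite /tq7 /gUV /guv /gswap /= !rmorph0 !subr0 invrK mulrC. Qed.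

Lemma tq8c : tq8 = GCentre (q ^+ 2 / p) h 0 0.
Proof.
rewrite /tq8 tq7c /guv /= !rmorph0 !subr0 invrK; congr GCentre.
by rewrite mulrAC -expr2.
Qed.

Lemma tq8_uv c : guv tq8 c 0 = GCentre s0 h c 0.
Proof.
rewrite tq8c /guv /= !rmorph0 !subr0 invrK; congr GCentre.
by rewrite mulrAC -exprSr.
Qed.

Lemma guv_e1 x s c : chart x s -> gpt (guv (GCentre s x c 0) 0 0) = e1 x s c 0.
Proof.
move=> cxs; have cE := chart_e1 c cxs.
by rewrite /guv /= rmorph0 !subr0 /Submission.e1 /Submission.pt0 (pt_sym 0 0 cE).
Qed.

Lemma guv_next x s c c' :
  guv (guv (GCentre s x c 0) 0 0) c' 0 = GCentre ((s - k c) / x ^+ 2) x c' 0.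
Proof. by rewrite /guv /= !rmorph0 !subr0 expr2 invfM mulrA. Qed.

Local Notation c13 := (256 * (2 + 2 * t ^+ 2 - a1 - 2 * a2)).
Local Notation c19 := (- (256 * (2 * t ^+ 2 - a1 - 2 * a2))).

Let chs0 : chart h s0.
Proof.
have -> : s0 = p^-1 / h / h / h by rewrite !invrK; field; rewrite p0.
exact/chart_divy/chart_divy/chart_divy/chart_invy/chart_inv.
Qed.

Let s00 : s0 != 0 := chart_y0 chs0.
Let h0 : h != 0 := chart_x0 chs0.
Let cA0 : chart xi^-1 (F / gg).
Proof.
rewrite -[F / gg]invf_div; apply/chart_invy.
have -> : gg / F = gg * xi^-1 * xi^-1 by rewrite -exprVn expr2 mulrA.
exact/chart_muly/chart_muly/chart_inv/chart_xigg.
Qed.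
Let cB0 : chart xi^-1 (gg / F).
Proof. by rewrite -[gg / F]invf_div; apply/chart_invy. Qed.

(** This is [s0 * gg / F] (see [NE]); written as a polynomial in [s0] and h, it is regular wherever
    these are. *)
Let N : K := 2 + s0 / 4 + 2 * k t * s0 * h ^+ 2 + 8 * k a1 * s0 * h ^+ 4.

Let NE : N = s0 * (gg / F).
Proof.
rewrite /N /xi /gg; field.
by rewrite ?q0 ?p0 ?twoK ?fourK ?eightK ?sixteenK.
Qed.

Let N0 : N != 0.
Proof. by rewrite NE mulf_neq0 // (chart_y0 cB0). Qed.

Let y0E : F / gg = s0 / N.
Proof. by rewrite NE invfM mulVKf // invf_div. Qed.

Let val_N (z : gcentre) c : good k z -> val z h 0 -> val z s0 c -> val z N (2 + c / 4).
Proof.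
move=> gz vh vs; apply: val_eq (valD gz (valD gz (valD gz (val_nat k z 2)
  (val_div fourC vs (val_nat k z 4)))
  (valM (valM (valM (val_nat k z 2) (val_cst k z t)) vs) (valXn 2 vh)))
  (valM (valM (valM (val_nat k z 8) (val_cst k z a1)) vs) (valXn 4 vh))) _ _ => //.
by rewrite !exprS !mul0r !mulr0 !addr0.
Qed.

Let val_m (z : gcentre) : good k z -> val z h 0 ->
  val z (4^-1 + 2 * k t * h ^+ 2 + 8 * k a1 * h ^+ 4) 4^-1.
Proof.
move=> gz vh; apply: val_eq (valD gz (valD gz (valV fourC (val_nat k z 4))
  (valM (valM (val_nat k z 2) (val_cst k z t)) (valXn 2 vh)))
  (valM (valM (val_nat k z 8) (val_cst k z a1)) (valXn 4 vh))) _ _ => //.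
by rewrite !exprS !mul0r !mulr0 !addr0.
Qed.

Let Nm : N = 2 + s0 * (4^-1 + 2 * k t * h ^+ 2 + 8 * k a1 * h ^+ 4).
Proof. by rewrite /N; ring. Qed.

Let xiV_h (z : gcentre) : val z xi^-1 0 -> val z h 0.
Proof.
move=> v; apply: val_eq (valM (val_cst k z 2^-1) v) _ _; last by rewrite mulr0.
by rewrite xiVE mulrA -rmorphM mulVf // rmorph1 mul1r.
Qed.

Let h_xiV (z : gcentre) : val z h 0 -> val z xi^-1 0.
Proof.
by move=> v; apply: val_eq (valM (val_cst k z 2) v) xiVE _; rewrite mulr0.
Qed.

(** At h = 0 the function [N] reduces to 2 + s / 4, so f / g is a Moebius function of s = q^3 / p.
    It sends 8 to 2; its pole at -8 is the start of the other chain, and its value 4 at infinity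
    receives the contracted curves. *)
Lemma oo_pt c : 2 + c / 4 != 0 -> pt0 h s0 c = pt0 xi^-1 (F / gg) (c / (2 + c / 4)).
Proof.
move=> n0; pose z := @GCentre C K h s0 0 c.
pose w := @GCentre C K xi^-1 (F / gg) 0 (c / (2 + c / 4)).
have gz : good k z := chart_good _ _ chs0. have gw : good k w := chart_good _ _ cA0.
have vh : val w h 0 := xiV_h (val_x k w).
have n0' : 8 + c != 0.
  apply: contra_neq n0 => E; have -> : 2 + c / 4 = (8 + c) / 4 by field; rewrite ?fourC.
  by rewrite E mul0r.
have d0 : 1 - c / (2 + c / 4) * 4^-1 != 0.
  have -> : 1 - c / (2 + c / 4) * 4^-1 = 2 / (2 + c / 4) by field; rewrite ?n0' ?fourC.
  by rewrite mulf_neq0 // invr_eq0.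
have vd := valB gw (val1 k w) (valM (val_y k w) (val_m gw vh)).
have dn := val_ne0 gw d0 vd; rewrite /= in dn.
symmetry; apply: (@pt_eq _ _ k z w) => //=.
- exact: h_xiV (val_x k z).
- rewrite y0E; apply: (val_div n0 (val_y k z)).
  exact: val_N gz (val_x k z) (val_y k z).
- apply: val_eq (val_div d0 (valM (val_nat k w 2) (val_y k w)) vd) _ _ => /=.
    apply: (mulIf dn); rewrite divfK // y0E; set m := 4^-1 + _ + _.
    have E2 : N - s0 * m = 2 by rewrite Nm addrK.
    transitivity (s0 * (N - s0 * m) / N); first by field; rewrite ?N0 ?dn ?p0.
    by rewrite E2; field; rewrite ?N0 ?dn ?p0.
  apply: (mulIf d0); rewrite divfK //.
  by field; rewrite ?n0' ?fourC.
Qed.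

Section ChainA.
Let sA1 : K := (s0 - k 8) / h ^+ 2.
Let sA2 : K := (sA1 - k (- (64 * t))) / h ^+ 2.
Let k8 : k 8 = 8 := rmorph_nat k 8.
Let k2 : k 2 = 2 := rmorph_nat k 2.
Let hh0 : h ^+ 2 != 0. Proof. exact: expf_neq0. Qed.
Let EsA : s0 = 8 + h ^+ 2 * sA1.
Proof. by rewrite /sA1 k8 [h ^+ 2 * _]mulrC divfK // addrC subrK. Qed.
Let kc1 : k (- (64 * t)) = - (64 * k t).
Proof. by rewrite rmorphN rmorphM rmorph_nat. Qed.
Let kb1 : k b1 = - (4 * k t).
Proof. by rewrite /b1 rmorphN rmorphM rmorph_nat. Qed.
Let EsA1 : sA1 = - (64 * k t) + h ^+ 2 * sA2.
Proof. by rewrite /sA2 kc1 [h ^+ 2 * _]mulrC divfK // addrC subrK. Qed.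
Let FV : F^-1 = 4 * h ^+ 2.
Proof. by rewrite -exprVn xiVE k2; ring. Qed.
Let csA1 : chart h sA1.
Proof. rewrite /sA1 expr2 invfM mulrA; exact/chart_divy/chart_divy/chart_suby. Qed.
Let csA2 : chart h sA2.
Proof. rewrite /sA2 expr2 invfM mulrA; exact/chart_divy/chart_divy/chart_suby. Qed.
Let cfA1 : chart xi^-1 fA1.
Proof. rewrite /Submission.fA1 -exprVn [xi^-1 ^+ 2]expr2 invfM mulrA; exact/chart_divy/chart_divy/chart_suby. Qed.
Let cfA2 : chart xi^-1 fA2.
Proof. rewrite /Submission.fA2 -exprVn [xi^-1 ^+ 2]expr2 invfM mulrA; exact/chart_divy/chart_divy/chart_suby. Qed.

Let valN8 (z : gcentre) : good k z -> val z h 0 -> val z s0 8 -> val z N 4.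
Proof.
by move=> gz vh vs; apply: val_eq (val_N gz vh vs) _ _ => //; field; rewrite ?fourC.
Qed.

Let thirtytwoC : (32 : C) != 0. Proof. by have := powC 5; rewrite -natrX. Qed.

Let vinv (z : gcentre) n : (n%:R : C) != 0 -> val z N 4 -> val z (n%:R * N)^-1 (n%:R * 4)^-1.
Proof. by move=> n0 v; apply: valV; [rewrite mulf_neq0|apply: valM (val_nat k z n) v]. Qed.

Let z0 := @GCentre C K h s0 0 8.
Let z1 := @GCentre C K h sA1 0 (- (64 * t)).
Let z2 := @GCentre C K h sA2 0 c13.
Let g0 : good k z0 := chart_good _ _ chs0.
Let g1 : good k z1 := chart_good _ _ csA1.
Let g2 : good k z2 := chart_good _ _ csA2.
Let vs1 : val z1 s0 8.
Proof.
apply: val_eq (valD g1 (val_nat k z1 8) (valM (valXn 2 (val_x k z1)) (val_y k z1))) EsA _.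
by rewrite expr2 !mul0r addr0.
Qed.
Let vs2 : val z2 sA1 (- (64 * t)).
Proof.
apply: val_eq (valD g2 (valN (valM (val_nat k z2 64) (val_cst k z2 t)))
  (valM (valXn 2 (val_x k z2)) (val_y k z2))) EsA1 _.
by rewrite expr2 !mul0r addr0.
Qed.

Let vA0 : val z0 (2 * N)^-1 (2 * 4)^-1 := vinv two0 (valN8 g0 (val_x k z0) (val_y k z0)).
Let vB0 : val z0 (- (4 * k t * s0 + 16 * k a1 * s0 * h ^+ 2) / N) (- (4 * t * 8) / 4).
Proof.
have vh := val_x k z0; have vs := val_y k z0.
apply: val_eq (val_div fourC (valN (valD g0 (valM (valM (val_nat k z0 4) (val_cst k z0 t)) vs)
  (valM (valM (valM (val_nat k z0 16) (val_cst k z0 a1)) vs) (valXn 2 vh)))) (valN8 g0 vh vs)) _ _ => //=.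
by rewrite expr2 !mul0r mulr0 addr0.
Qed.
Let EA0 : F / gg - k 2 = (2 * N)^-1 * (s0 - k 8)
  + h ^+ 2 * (- (4 * k t * s0 + 16 * k a1 * s0 * h ^+ 2) / N).
Proof. by rewrite y0E k2 k8; apply: expandA0. Qed.
Let n24 : ((2 * 4)^-1 : C) != 0. Proof. by rewrite invr_eq0 mulf_neq0. Qed.
Let P0 : pt0 h s0 8 = pt0 xi^-1 (F / gg) 2.
Proof.
by rewrite oo_pt; [congr pt0; field|rewrite (_ : 2 + 8 / 4 = 4 :> C) //; field]; rewrite ?fourC //.
Qed.

Lemma tq9E : gpt tq9 = pt0 xi^-1 (F / gg) 2.
Proof. by rewrite /tq9 tq8_uv -P0 /Submission.pt0 (pt_sym _ _ chs0). Qed.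

Lemma tq10E : gpt tq10 = uO xi^-1 (F / gg) 2.
Proof.
rewrite /tq10 /tq9 tq8_uv (guv_e1 8 chs0).
exact: (uO_transport chs0 cA0 two0 xiVE P0 EA0 vA0 vB0 n24).
Qed.

Let fA1E : fA1 = (s0 / N - 2) / (4 * h ^+ 2). Proof. by rewrite /Submission.fA1 FV y0E k2. Qed.

Let P1 : pt0 h sA1 (- (64 * t)) = pt0 xi^-1 fA1 b1.
Proof.
rewrite /sA1 (pt0_transport chs0 cA0 two0 xiVE P0 EA0 vA0 vB0 n24).
rewrite exprVn /Submission.fA1; congr pt0; rewrite /b1; field.
by rewrite ?two0 ?fourC ?eightC.
Qed.

Lemma tq11E : gpt tq11 = pt0 xi^-1 fA1 b1.
Proof.
rewrite /tq11 /tq10 /tq9 tq8_uv guv_next -P1 /Submission.pt0 (pt_sym _ _ csA1).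
by [].
Qed.

Let vA1 : val z1 (8 * N)^-1 (8 * 4)^-1 := vinv eightC (valN8 g1 (val_x k z1) vs1).
Let vB1 : val z1 ((32 * k t ^+ 2 * s0 - 16 * k a1 * s0 + 128 * k a1 * k t * s0 * h ^+ 2) / (4 * N))
  ((32 * t ^+ 2 * 8 - 16 * a1 * 8) / (4 * 4)).
Proof.
have vh := val_x k z1; have vt := val_cst k z1 t; have va := val_cst k z1 a1.
have vN := valM (val_nat k z1 4) (valN8 g1 vh vs1).
have n44 : (4 * 4 : C) != 0 by rewrite mulf_neq0.
apply: val_eq (val_div n44 (valD g1 (valB g1 (valM (valM (val_nat k z1 32) (valXn 2 vt)) vs1)
  (valM (valM (val_nat k z1 16) va) vs1))
  (valM (valM (valM (valM (val_nat k z1 128) va) vt) vs1) (valXn 2 vh))) vN) _ _ => //=.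
by rewrite expr0n /= mulr0 addr0.
Qed.
Let EA1 : fA1 - k b1 = (8 * N)^-1 * (sA1 - k (- (64 * t)))
  + h ^+ 2 * ((32 * k t ^+ 2 * s0 - 16 * k a1 * s0 + 128 * k a1 * k t * s0 * h ^+ 2) / (4 * N)).
Proof. by rewrite fA1E kb1 kc1 !opprK; apply: expandA1. Qed.
Let n84 : ((8 * 4)^-1 : C) != 0. Proof. by rewrite invr_eq0 mulf_neq0. Qed.

Lemma tq12E : gpt tq12 = uO xi^-1 fA1 b1.
Proof.
rewrite /tq12 /tq11 /tq10 /tq9 tq8_uv guv_next (guv_e1 _ csA1).
exact: (uO_transport csA1 cfA1 two0 xiVE P1 EA1 vA1 vB1 n84).
Qed.

Let P2 : pt0 h sA2 c13 = pt0 xi^-1 fA2 b2.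
Proof.
rewrite /sA2 (pt0_transport csA1 cfA1 two0 xiVE P1 EA1 vA1 vB1 n84).
rewrite exprVn /Submission.fA2; congr pt0; rewrite /b2; field.
by rewrite ?two0 ?fourC ?eightC ?sixteenC ?thirtytwoC.
Qed.

Lemma tq13E : gpt tq13 = pt0 xi^-1 fA2 b2.
Proof.
rewrite /tq13 /tq12 /tq11 /tq10 /tq9 tq8_uv !guv_next -P2 /Submission.pt0 (pt_sym _ _ csA2).
by [].
Qed.

Let vA2 : val z2 (32 * N)^-1 (32 * 4)^-1.
Proof.
have v8 : val z2 s0 8.
  apply: val_eq (valD g2 (val_nat k z2 8) (valM (valXn 2 (val_x k z2)) vs2)) EsA _.
  by rewrite expr2 !mul0r addr0.
exact: (vinv thirtytwoC (valN8 g2 (val_x k z2) v8)).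
Qed.
Let kb2 : k b2 = 4 * (1 - k a1 - k a2 + 2 * k t ^+ 2).
Proof. by rewrite /b2 rmorphM !rmorphD !rmorphN rmorphM rmorphXn !rmorph_nat rmorph1. Qed.
Let B2v : K := (32 * k t ^+ 2 * sA1 - 16 * k a1 * sA1 + 128 * k a1 * k t * s0
      - k b2 * (4 * sA1 + 32 * k t * s0 + 128 * k a1 * s0 * h ^+ 2)) / (16 * N).
(** The value is left unspecified: on the last exceptional curve the remainder enters only through
    [uO_transport], whose conclusion does not involve it. *)
Let vB2 : exists c, val z2 B2v c.
Proof.
have v8 : val z2 s0 8.
  apply: val_eq (valD g2 (val_nat k z2 8) (valM (valXn 2 (val_x k z2)) vs2)) EsA _.
  by rewrite expr2 !mul0r addr0.
have vt := val_cst k z2 t; have va := val_cst k z2 a1; have vb := val_cst k z2 b2.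
have nt n := val_nat k z2 n; have vh := val_x k z2.
have n164 : (16 * 4 : C) != 0 by rewrite mulf_neq0.
eexists; apply: (val_div n164); last exact: valM (nt 16) (valN8 g2 vh v8).
apply: (valB g2); last first.
  apply: (valM vb); apply: (valD g2); last exact: (valM (valM (valM (nt 128) va) v8) (valXn 2 vh)).
  exact: (valD g2 (valM (nt 4) vs2) (valM (valM (nt 32) vt) v8)).
apply: (valD g2); last exact: (valM (valM (valM (nt 128) va) vt) v8).
exact: (valB g2 (valM (valM (nt 32) (valXn 2 vt)) vs2) (valM (valM (nt 16) va) vs2)).
Qed.
Let kc13 : k c13 = 256 * (2 + 2 * k t ^+ 2 - k a1 - 2 * k a2).
Proof.
rewrite [k (256 * _)]rmorphM [k (_ - 2 * a2)]rmorphB [k (_ - a1)]rmorphB.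
rewrite [k (2 + _)]rmorphD [k (2 * t ^+ 2)]rmorphM [k (t ^+ 2)]rmorphXn.
by rewrite [k (2 * a2)]rmorphM !rmorph_nat.
Qed.
Let EA2 : fA2 - k b2 = (32 * N)^-1 * (sA2 - k c13) + h ^+ 2 * B2v.
Proof.
rewrite /Submission.fA2 fA1E kb1 FV opprK kc13 /B2v kb2.
exact: expandA2.
Qed.

Lemma tq14E : gpt tq14 = uO xi^-1 fA2 b2.
Proof.
have [c vB] := vB2.
rewrite /tq14 /tq13 /tq12 /tq11 /tq10 /tq9 tq8_uv !guv_next (guv_e1 _ csA2).
apply: (uO_transport csA2 cfA2 two0 xiVE P2 EA2 vA2 vB).
by rewrite invr_eq0 mulf_neq0.
Qed.

End ChainA.

Section ChainB.
Let sB1 : K := (s0 - k (- 8)) / h ^+ 2.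
Let sB2 : K := (sB1 - k (64 * t)) / h ^+ 2.
Let k8 : k (- 8) = - 8. Proof. by rewrite rmorphN rmorph_nat. Qed.
Let k2 : k 2 = 2 := rmorph_nat k 2.
Let hh0 : h ^+ 2 != 0. Proof. exact: expf_neq0. Qed.
Let EsB : s0 = - 8 + h ^+ 2 * sB1.
Proof. by rewrite /sB1 k8 [h ^+ 2 * _]mulrC divfK // addrC subrK. Qed.
Let kc1 : k (64 * t) = 64 * k t.
Proof. by rewrite rmorphM rmorph_nat. Qed.
Let EsB1 : sB1 = 64 * k t + h ^+ 2 * sB2.
Proof. by rewrite /sB2 kc1 [h ^+ 2 * _]mulrC divfK // addrC subrK. Qed.
Let FV : F^-1 = 4 * h ^+ 2.
Proof. by rewrite -exprVn xiVE k2; ring. Qed.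
Let F0 : F != 0. Proof. by rewrite expf_neq0 // xi0. Qed.
Let csB1 : chart h sB1.
Proof. rewrite /sB1 expr2 invfM mulrA; exact/chart_divy/chart_divy/chart_suby. Qed.
Let csB2 : chart h sB2.
Proof. rewrite /sB2 expr2 invfM mulrA; exact/chart_divy/chart_divy/chart_suby. Qed.
Let cgg : chart xi^-1 gg. Proof. exact/chart_inv/chart_xigg. Qed.
Let cFgg : chart xi^-1 (F * gg). Proof. exact/chart_inv. Qed.

Let m8 : (- 8 : C) != 0. Proof. by rewrite oppr_eq0. Qed.
Let n32 : (32 : C) != 0. Proof. by have := powC 5; rewrite -natrX. Qed.
Let n64 : (64 : C) != 0. Proof. by have := powC 6; rewrite -natrX. Qed.
Let n128 : (128 : C) != 0. Proof. by have := powC 7; rewrite -natrX. Qed.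

Let z0 := @GCentre C K h s0 0 (- 8).
Let z1 := @GCentre C K h sB1 0 (64 * t).
Let z2 := @GCentre C K h sB2 0 c19.
Let g0 : good k z0 := chart_good _ _ chs0.
Let g1 : good k z1 := chart_good _ _ csB1.
Let g2 : good k z2 := chart_good _ _ csB2.
Let vs1 : val z1 s0 (- 8).
Proof.
apply: val_eq (valD g1 (valN (val_nat k z1 8)) (valM (valXn 2 (val_x k z1)) (val_y k z1))) EsB _.
by rewrite expr2 !mul0r addr0.
Qed.
Let vs2 : val z2 sB1 (64 * t).
Proof.
apply: val_eq (valD g2 (valM (val_nat k z2 64) (val_cst k z2 t))
  (valM (valXn 2 (val_x k z2)) (val_y k z2))) EsB1 _.
by rewrite expr2 !mul0r addr0.
Qed.
Let vs0_2 : val z2 s0 (- 8).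
Proof.
apply: val_eq (valD g2 (valN (val_nat k z2 8)) (valM (valXn 2 (val_x k z2)) vs2)) EsB _.
by rewrite expr2 !mul0r addr0.
Qed.

Let vinv (z : gcentre) n : (n%:R : C) != 0 -> val z s0 (- 8) ->
  val z (n%:R * s0)^-1 (n%:R * - 8)^-1.
Proof. by move=> n0 v; apply: valV; [rewrite mulf_neq0|apply: valM (val_nat k z n) v]. Qed.

Let ninv n : (n%:R : C) != 0 -> (n%:R * - 8 : C)^-1 != 0.
Proof. by move=> n0; rewrite invr_eq0 mulf_neq0. Qed.

Let ysN : gg / F = N / s0. Proof. by rewrite NE [RHS]mulrAC divff // mul1r. Qed.

(** At s = -8 the function f / g has a pole, so g / f = N / s is used. By [Nm] it is 2 / s plus a
    function with value 1/4, which vanishes at -8 and can be solved for s. *)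
Let P0 : pt0 h s0 (- 8) = pt0 xi^-1 (gg / F) 0.
Proof.
pose w := @GCentre C K xi^-1 (gg / F) 0 0.
have gw : good k w := chart_good _ _ cB0.
have vh : val w h 0 := xiV_h (val_x k w).
have d0 : 0 - 4^-1 != 0 :> C by rewrite sub0r oppr_eq0 invr_eq0.
have vd := valB gw (val_y k w) (val_m gw vh).
have dn := val_ne0 gw d0 vd; rewrite /= in dn.
symmetry; apply: (@pt_eq _ _ k z0 w) => //=.
- exact: h_xiV (val_x k z0).
- rewrite ysN; apply: val_eq (val_div m8 (val_N g0 (val_x k z0) (val_y k z0)) (val_y k z0)) _ _ => //=.
  by field; rewrite ?fourC ?m8 ?eightC ?oner_neq0 ?oppr_eq0 ?eightC.
- apply: val_eq (val_div d0 (val_nat k w 2) vd) _ _ => /=.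
    apply: (mulIf dn); rewrite divfK // mulrBr ysN mulrC divfK // mulrC Nm.
    by rewrite [_ * s0]mulrC addrK.
  by field; rewrite ?fourC ?oppr_eq0 ?oner_neq0.
Qed.

Let EB0 : gg / F - k 0 = (4 * s0)^-1 * (s0 - k (- 8))
  + h ^+ 2 * (2 * k t + 8 * k a1 * h ^+ 2).
Proof. by rewrite ysN k8 opprK rmorph0 subr0; apply: expandB0. Qed.
Let vA0 : val z0 (4 * s0)^-1 (4 * - 8)^-1 := vinv fourC (val_y k z0).
Let vB0 : val z0 (2 * k t + 8 * k a1 * h ^+ 2) (2 * t).
Proof.
apply: val_eq (valD g0 (valM (val_nat k z0 2) (val_cst k z0 t))
  (valM (valM (val_nat k z0 8) (val_cst k z0 a1)) (valXn 2 (val_x k z0)))) _ _ => //=.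
by rewrite expr2 mul0r mulr0 addr0.
Qed.

Lemma tq15E : gpt tq15 = pt0 xi^-1 (gg / F) 0.
Proof. by rewrite /tq15 tq8_uv -P0 /Submission.pt0 (pt_sym _ _ chs0). Qed.

Lemma tq16E : gpt tq16 = uO xi^-1 (gg / F) 0.
Proof.
rewrite /tq16 /tq15 tq8_uv (guv_e1 (- 8) chs0).
exact: (uO_transport chs0 cB0 two0 xiVE P0 EB0 vA0 vB0 (ninv fourC)).
Qed.

Let ggE : (gg / F - k 0) / F^-1 = gg. Proof. by rewrite rmorph0 subr0 invrK divfK. Qed.
Let FggE' : (gg - k 0) / F^-1 = F * gg. Proof. by rewrite rmorph0 subr0 invrK mulrC. Qed.
Let gg_s : gg = N / s0 / (4 * h ^+ 2). Proof. by rewrite -FV invrK -ysN divfK. Qed.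

Let P1 : pt0 h sB1 (64 * t) = pt0 xi^-1 gg 0.
Proof.
rewrite /sB1 (pt0_transport chs0 cB0 two0 xiVE P0 EB0 vA0 vB0 (ninv fourC)).
by rewrite exprVn ggE; congr pt0; field; rewrite ?two0 ?fourC ?n32 ?m8 ?oppr_eq0.
Qed.

Lemma tq17E : gpt tq17 = pt0 xi^-1 gg 0.
Proof.
rewrite /tq17 /tq16 /tq15 tq8_uv guv_next -P1 /Submission.pt0 (pt_sym _ _ csB1).
by [].
Qed.

Let vA1 : val z1 (16 * s0)^-1 (16 * - 8)^-1 := vinv sixteenC vs1.
Let vB1 : val z1 ((8 * k t * sB1 + 32 * k a1 * s0) / (16 * s0))
  ((8 * t * (64 * t) + 32 * a1 * - 8) / (16 * - 8)).
Proof.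
have nt n := val_nat k z1 n; have vt := val_cst k z1 t; have va := val_cst k z1 a1.
have n16m : (16 * - 8 : C) != 0 by rewrite mulf_neq0.
exact: (val_div n16m (valD g1 (valM (valM (nt 8) vt) (val_y k z1)) (valM (valM (nt 32) va) vs1))
  (valM (nt 16) vs1)).
Qed.
Let EB1 : gg - k 0 = (16 * s0)^-1 * (sB1 - k (64 * t))
  + h ^+ 2 * ((8 * k t * sB1 + 32 * k a1 * s0) / (16 * s0)).
Proof. by rewrite rmorph0 subr0 kc1 {1}gg_s; apply: expandB1. Qed.

Lemma tq18E : gpt tq18 = uO xi^-1 gg 0.
Proof.
rewrite /tq18 /tq17 /tq16 /tq15 tq8_uv guv_next (guv_e1 _ csB1).
exact: (uO_transport csB1 cgg two0 xiVE P1 EB1 vA1 vB1 (ninv sixteenC)).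
Qed.

Let P2 : pt0 h sB2 c19 = pt0 xi^-1 (F * gg) b3.
Proof.
rewrite /sB2 (pt0_transport csB1 cgg two0 xiVE P1 EB1 vA1 vB1 (ninv sixteenC)).
rewrite exprVn FggE'; congr pt0; rewrite /b3; field.
by rewrite ?two0 ?fourC ?eightC ?sixteenC ?n32 ?n128 ?oppr_eq0.
Qed.

Lemma tq19E : gpt tq19 = pt0 xi^-1 (F * gg) b3.
Proof.
rewrite /tq19 /tq18 /tq17 /tq16 /tq15 tq8_uv !guv_next -P2 /Submission.pt0 (pt_sym _ _ csB2).
by [].
Qed.

Let kc19 : k c19 = - (256 * (2 * k t ^+ 2 - k a1 - 2 * k a2)).
Proof.
rewrite [k (- _)]rmorphN [k (256 * _)]rmorphM [k (_ - 2 * a2)]rmorphB [k (_ - a1)]rmorphB.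
rewrite [k (2 * t ^+ 2)]rmorphM [k (t ^+ 2)]rmorphXn.
by rewrite [k (2 * a2)]rmorphM !rmorph_nat.
Qed.
Let B2v : K := (8 * k t * sB2 + (32 * k a1 + 64 * k a2) * sB1) / (64 * s0).
Let vB2 : exists c, val z2 B2v c.
Proof.
have vt := val_cst k z2 t; have va := val_cst k z2 a1; have vb := val_cst k z2 a2.
have nt n := val_nat k z2 n.
have n64m : (64 * - 8 : C) != 0 by rewrite mulf_neq0.
eexists; apply: (val_div n64m); last exact: valM (nt 64) vs0_2.
apply: (valD g2); first exact: (valM (valM (nt 8) vt) (val_y k z2)).
apply: valM; last exact: vs2.
exact: (valD g2 (valM (nt 32) va) (valM (nt 64) vb)).
Qed.
Let EB2 : F * gg - k b3 = (64 * s0)^-1 * (sB2 - k c19) + h ^+ 2 * B2v.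
Proof.
have -> : k b3 = - k a2 by rewrite rmorphN.
rewrite -FggE' rmorph0 subr0 FV {1}gg_s kc19 !opprK.
exact: expandB2.
Qed.

Lemma tq20E : gpt tq20 = uO xi^-1 (F * gg) b3.
Proof.
have [c vB] := vB2.
rewrite /tq20 /tq19 /tq18 /tq17 /tq16 /tq15 tq8_uv !guv_next (guv_e1 _ csB2).
exact: (uO_transport csB2 cFgg two0 xiVE P2 EB2 (vinv n64 vs0_2) vB (ninv n64)).
Qed.

End ChainB.

End TakasakiCentres.

(** * Pairs of consecutive centres *)

Section Segments.
Variables (C : closedFieldType) (K : fieldType) (k : {rmorphism C -> K}).
Implicit Types (x y r : K) (b c d : C) (O P : set K) (l : seq (set K)).
Local Notation gpt := (gpt k).
Local Notation val := (val k).
Local Notation chart := (chart k).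
Local Notation pt0 := (pt0 k).
Local Notation gexc := (gexc k).
Local Notation guv := (guv k).
Local Notation uO := (uO k).
Local Notation f1 := (f1 k).
Local Notation f2 := (f2 k).
Local Notation ustep := (ustep k).
Local Notation late := (late k).
Local Notation gcentre := (gcentre C K).
Implicit Types z : gcentre.

Let zP x y b := @GCentre C K x y 0 b.

(* P lies over z, possibly after blowups, so that values at z persist at P *)
Definition dom z P : Prop :=
  exists w, [/\ good k w, P = gpt w & forall r c, val z r c -> val w r c].

Lemma exc_dom z O : chart (gx z) (gy z) -> gexc (gpt z) O -> dom z O.
Proof.
move=> cz; have gz := chart_good (ga z) (gb z) cz; have [i _] := cz.
have czs : chart (gx (gswap z)) (gy (gswap z)) by apply: chart_swap.
rewrite gexcP // => -[[c ->]|->].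
  have gw := @good_uv _ _ k z c 0 cz; exists (guv z c 0); split=> // r d v.
  exact: (@val_uv _ _ k z c r d gw (indep_suby (gb z) i) v).
have gw := @good_uv _ _ k (gswap z) 0 0 czs; exists (guv (gswap z) 0 0); split=> // r d v.
have w : val (gswap z) r d by apply/val_swap.
exact: (@val_uv _ _ k (gswap z) 0 r d gw (indep_subx (ga z) i) w).
Qed.

Lemma exc_above z O : chart (gx z) (gy z) -> gexc (gpt z) O -> gpt z `<=` O.
Proof.
by move=> cz /(exc_dom cz) [w [gw -> H]] r /pt_val [d /H v]; exact: (val_pt v).
Qed.

Definition doms z l : Prop := foldr (fun P T => dom z P /\ T) True l.

Lemma dom_refl x y b : chart x y -> dom (zP x y b) (pt0 x y b).
Proof. by move=> cxy; exists (zP x y b); split=> //; apply: chart_good. Qed.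

Lemma dom_trans z w P : (forall r c, val z r c -> val w r c) -> dom w P -> dom z P.
Proof. by move=> H [v [gv -> Hv]]; exists v; split=> // r c /H /Hv. Qed.

Lemma doms_trans z w l : (forall r c, val z r c -> val w r c) -> doms w l -> doms z l.
Proof. by move=> H; elim: l => //= P l IH [/(dom_trans H) dP /IH]. Qed.

Lemma doms_cat z l l' : doms z l -> doms z l' -> doms z (l ++ l').
Proof. by move=> + dl'; elim: l => //= P l IH [dP /IH dl]. Qed.

Lemma doms_lacks z l r : doms z l -> val z r 0 -> r != 0 -> lacks r^-1 l.
Proof.
move=> + v r0; elim: l => //= P l IH [[w [gw -> H]] /IH dl]; split=> //.
exact: (val_notV gw (H _ _ v) r0).
Qed.

Lemma doms_has z l r c : doms z l -> val z r c -> has_all r l.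
Proof.
move=> + v; elim: l => //= P l IH [[w [gw -> H]] /IH dl]; split=> //.
exact: (val_pt (H _ _ v)).
Qed.

Lemma late_cat l l' O : late (l ++ l') O <-> late l O /\ avoid l' O \/ late l' O.
Proof.
elim: l => [|P l IH] /=; first by split=> [|[[]|]//]; right.
split.
  by case=> [[eO /avoid_cat [? ?]]|/IH [[? ?]|?]]; [left; split=> //; left|left; split=> //; right|right].
case=> [[[[eO ?]|?] ?]|?]; last by right; apply/IH; right.
  by left; split=> //; apply/avoid_cat.
by right; apply/IH; left.
Qed.

Definition seg x y b := [:: pt0 x y b; uO x y b].

Section Segment.
Variables (x y : K) (b : C).
Hypothesis cxy : chart x y.
Local Notation u := (y - k b).
Let cu : chart x (u / x) := chart_e1 b cxy.
Let x0 : x != 0 := chart_x0 cxy.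
Let u0 : u != 0 := step_u0 b cxy.

Lemma doms_next l c : doms (zP x (u / x ^+ 2) c) l -> doms (zP x (u / x) 0) l.
Proof.
apply: doms_trans => r d v; have := @val_e1 _ _ k x (u / x) 0 cu c r d v.
by rewrite rmorph0 subr0 -mulrA -invfM expr2.
Qed.

Lemma doms_seg l : doms (zP x (u / x) 0) l -> doms (zP x y b) (seg x y b ++ l).
Proof.
have H r d : val (zP x y b) r d -> val (zP x (u / x) 0) r d by apply: val_e1.
move=> dl; split; first exact: dom_refl.
split; first exact: dom_trans H (dom_refl _ cu).
exact: doms_trans H dl.
Qed.

Lemma ustep_above nxt O : ustep x y b nxt O -> pt0 x y b `<=` O.
Proof.
have H : pt0 x y b `<=` uO x y b by apply: e1_above.
have H' O' : gexc (uO x y b) O' -> pt0 x y b `<=` O'.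
  by move=> e; apply: subset_trans H (exc_above (z := zP x (u / x) 0) cu e).
case=> [[c _ ->]|[d ->]|->].
- by apply: H'; rewrite exc_f1 //; left; exists c.
- by apply: (exc_above (z := zP x y b)) => //; rewrite [gexc _](exc_f2 b cxy); left; exists d.
- by apply: H'; rewrite exc_f1 //; right.
Qed.

(** The later centres in [l] lie over [uO], where the slope u / x vanishes, so they differ from the
    points [f2], at which x / u is regular. They differ from [f3] because u / x^2 is regular at them
    and not at [f3]. For [f1] it is assumed. *)
Lemma ustep_late nxt l O : (forall c, nxt c -> avoid l (f1 x y b c)) ->
  doms (zP x (u / x) 0) l -> has_all (u / x ^+ 2) l ->
  ustep x y b nxt O -> late (seg x y b ++ l) O.
Proof.
move=> al dl hl [[c /al ac ->]|[d ->]|->] /=.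
- by right; left; split=> //; rewrite exc_f1 //; left; exists c.
- left; split; first by rewrite exc_f2 //; left; exists d.
  have dl' : doms (zP x (u / x) 0) (uO x y b :: l) by split=> //; apply: dom_refl.
  suff av : avoid (uO x y b :: l) (f2 x y b d) by [].
  apply: (avoid_lacks (r := x / u)); first exact: pt0_y.
  rewrite -invf_div; apply: doms_lacks dl' (val_y _ _) _.
  by rewrite mulf_neq0 ?invr_eq0.
- right; left; split; first by rewrite exc_f1 //; right.
  apply: avoid_has hl; have := @noZ_child _ _ k x (u / x) 0 cu.
  by rewrite rmorph0 subr0 -mulrA -invfM expr2.
Qed.

Lemma late_ustep nxt l O : (forall c, avoid l (f1 x y b c) -> nxt c) ->
  late (seg x y b ++ l) O -> ustep x y b nxt O \/ late l O.
Proof.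
move=> al /=; rewrite exc_f1 // exc_f2 //.
case=> [[[[d ->]|->] [n _]]|[[[[c ->]|->] av]|]]; last by right.
- by left; constructor 2; exists d.
- by case: n.
- by left; constructor 1; exists c => //; apply: al.
- by left; constructor 3.
Qed.

Lemma late_seg O : late (seg x y b) O <-> ustep x y b (@any C) O.
Proof.
rewrite -[seg x y b]cats0; split; first by case/(late_ustep (nxt := @any C)).
exact: ustep_late.
Qed.

End Segment.

Variables (x y0 y1 y2 : K) (b0 b1 b2 : C).
Hypothesis c0 : chart x y0.
Hypothesis E1 : y1 = (y0 - k b0) / x ^+ 2.
Hypothesis E2 : y2 = (y1 - k b1) / x ^+ 2.

Definition segs := seg x y0 b0 ++ (seg x y1 b1 ++ seg x y2 b2).

Let c1 : chart x y1.
Proof. by rewrite E1 expr2 invfM mulrA; exact/chart_divy/chart_divy/chart_suby. Qed.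
Let c2 : chart x y2.
Proof. by rewrite E2 expr2 invfM mulrA; exact/chart_divy/chart_divy/chart_suby. Qed.
Let d2 : doms (zP x y2 b2) (seg x y2 b2).
Proof. by rewrite -[seg _ _ _]cats0; apply: doms_seg. Qed.
Let d1 : doms (zP x y1 b1) (seg x y1 b1 ++ seg x y2 b2).
Proof. by apply: doms_seg => //; apply: (@doms_next x y1 b1 c1 _ b2); rewrite // -E2. Qed.

Lemma doms_segs : doms (zP x y0 b0) segs.
Proof. by apply: doms_seg => //; apply: (@doms_next x y0 b0 c0 _ b1); rewrite // -E1. Qed.

Let avoid_f1 y y' b b' l c : chart x y' -> y' = (y - k b) / x ^+ 2 ->
  doms (zP x y' b') l -> ne b' c -> avoid l (f1 x y b c).
Proof.
move=> cy' Ey' dl cb; rewrite f1E -Ey'.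
apply: (avoid_lacks (pt0_yV cy' cb)); apply: (doms_lacks dl).
  by apply: (val_sub0 (chart_good 0 b' cy') (val_y _ _)).
exact: (step_u0 b' cy').
Qed.

Let f1_avoid y y' b b' l c : y' = (y - k b) / x ^+ 2 ->
  avoid (pt0 x y' b' :: l) (f1 x y b c) -> ne b' c.
Proof. by rewrite f1E => <- [n _]; apply/eqP => cb; apply: n; rewrite cb. Qed.

Lemma late_segs O : late segs O <-> chain x y0 y1 y2 b0 b1 b2 ustep O.
Proof.
split.
  case/(late_ustep c0 (nxt := ne b1)) => [c||]; first exact: f1_avoid.
    by constructor 1.
  case/(late_ustep c1 (nxt := ne b2)) => [c||/(late_seg _ c2)]; first exact: f1_avoid.
    by constructor 2.
  by constructor 3.
case=> H.
- apply: ustep_late H => // [c||]; first exact: (avoid_f1 c1 E1 d1).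
    by apply: (@doms_next x y0 b0 c0 _ b1); rewrite // -E1.
  by rewrite -E1; apply: doms_has d1 (val_y _ _).
- apply/late_cat; right; apply: ustep_late H => // [c||].
  + exact: (avoid_f1 c2 E2 d2).
  + by apply: (@doms_next x y1 b1 c1 _ b2); rewrite // -E2.
  + by rewrite -E2; apply: doms_has d2 (val_y _ _).
- by apply/late_cat; right; apply/late_cat; right; apply/late_seg.
Qed.

Lemma chain_ustep_above O : chain x y0 y1 y2 b0 b1 b2 ustep O -> pt0 x y0 b0 `<=` O.
Proof.
have H y y' b b' : chart x y -> y' = (y - k b) / x ^+ 2 -> pt0 x y b `<=` pt0 x y' b'.
  move=> cy -> r /pt_val [d /(val_e1 cy 0) v].
  have := @val_e1 _ _ k x ((y - k b) / x) 0 (chart_e1 b cy) b' r d v.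
  by rewrite rmorph0 subr0 -mulrA -invfM -expr2; apply: val_pt.
case=> [/(ustep_above c0) //|/(ustep_above c1)|/(ustep_above c2)].
  by move=> s; apply: (subset_trans _ s); apply: H c0 E1.
move=> s; apply: (subset_trans _ s); apply: (@subset_trans _ (pt0 x y1 b1)); first exact: H c0 E1.
exact: H c1 E2.
Qed.

End Segments.

(** * Contracted curves as exceptional curves *)

Section TakasakiSurface.
Variables (C : closedFieldType) (K : fieldType) (k : {rmorphism C -> K}).
Implicit Types (x y r s : K) (c d : C) (O R : set K) (S : set (set K)).
Local Notation val := (val k).
Local Notation chart := (chart k).
Local Notation pt0 := (pt0 k).
Local Notation gexc := (gexc k).
Local Notation gdvr := (gdvr k).
Local Notation gcentre := (gcentre C K).

Definition gcontr S O : set K :=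
  if `[< S O >] then [set r | forall O', S O' -> O' r] else O.

Lemma gcontr_out S O : ~ S O -> gcontr S O = O.
Proof. by rewrite /gcontr; case: asboolP. Qed.

Lemma gcontr_sub S O : gcontr S O `<=` O.
Proof. by rewrite /gcontr; case: asboolP => // SO r; apply. Qed.

Lemma gcontr_exc x y O : chart x y -> gexc (pt0 x y 0) O ->
  gcontr (gexc (pt0 x y 0)) O = pt0 x y 0.
Proof.
move=> cxy eO; rewrite /gcontr asboolT //; apply/seteqP; split=> r.
  move=> H; apply: regular_on_exc => //.
    move=> c; apply: H; rewrite /Submission.pt0 gexcP //; left; exists c.
    by rewrite /Submission.guv /= !rmorph0 !subr0.
  apply: H; rewrite /Submission.pt0 gexcP //; right.
  rewrite /Submission.guv /= !rmorph0 !subr0 pt_sym //.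
  exact/chart_swap/chart_divy.
by move=> Pr O'; move/(exc_above (z := GCentre x y 0 0) cxy); apply.
Qed.

Variables (q p : K) (t a1 a2 : C).
Hypothesis cqp : chart q p.
Hypothesis a10 : a1 != 0.
Hypothesis two0 : (2 : C) != 0.

Local Notation h := (q^-1).
Local Notation s0 := (q ^+ 3 / p).

Let q0 : q != 0 := chart_x0 cqp.
Let p0 : p != 0 := chart_y0 cqp.
Let chp : chart h p := chart_inv cqp.
Let chpi : chart h p^-1 := chart_invy chp.
Let cqpi : chart q p^-1 := chart_invy cqp.
Let cqs : chart q (q * p). Proof. by rewrite mulrC; apply: chart_muly. Qed.
Let chw1 : chart h (p / q). Proof. exact: chart_muly. Qed.
Let w2E : p / q ^+ 2 = p / q / q. Proof. by rewrite expr2 invfM mulrA. Qed.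
Let w3E : p / q ^+ 3 = p / q ^+ 2 / q. Proof. by rewrite exprSr invfM mulrA. Qed.
Let chw2 : chart h (p / q ^+ 2). Proof. by rewrite w2E; apply: chart_muly. Qed.
Let chw3 : chart h (p / q ^+ 3). Proof. by rewrite w3E; apply: chart_muly. Qed.
Let chs0 : chart h s0. Proof. by rewrite -[s0]invf_div; apply: chart_invy. Qed.

(* The points to which {q = 0}, {q = oo}, F_6 - F_7 and F_7 - F_8 are contracted,
   in this order, z1 lying on F_6 - F_7 and z2 on F_7 - F_8 *)
Definition z0 := pt0 q (q * p) 0.
Definition z1 := pt0 h (p / q) 0.
Definition z2 := pt0 h (p / q ^+ 2) 0.
Definition z3 := pt0 h (p / q ^+ 3) 0.

Let exc0 x y w w' : chart x y -> y / x = w -> x / y = w' -> gexc (pt0 x y 0) =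
  [set O | (exists c, O = pt0 x w c) \/ O = pt0 w' y 0].
Proof. by move=> cxy <- <-; rewrite exc_pt0 // rmorph0 subr0. Qed.

Lemma exc_z0 : gexc z0 = [set O | (exists c, O = pt0 q p c) \/ O = pt0 p^-1 (q * p) 0].
Proof.
apply: exc0 => //; first by rewrite mulrAC divff // mul1r.
by rewrite invfM mulrA divff // mul1r.
Qed.

Lemma exc_z1 : gexc z1 = [set O | (exists c, O = pt0 h p c) \/ O = pt0 p^-1 (p / q) 0].
Proof.
apply: exc0 => //; first by rewrite invrK divfK.
by rewrite invf_div mulKf.
Qed.

Lemma exc_z2 : gexc z2 = [set O | (exists c, O = pt0 h (p / q) c) \/
  O = pt0 (q / p) (p / q ^+ 2) 0].
Proof.
apply: exc0 => //; first by rewrite w2E invrK divfK.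
by rewrite invf_div expr2 -mulrA mulKf.
Qed.

Lemma exc_z3 : gexc z3 = [set O | (exists c, O = pt0 h (p / q ^+ 2) c) \/
  O = pt0 (q ^+ 2 / p) (p / q ^+ 3) 0].
Proof.
apply: exc0 => //; first by rewrite w3E invrK divfK.
by rewrite invf_div exprS -mulrA mulKf.
Qed.

Let zP x y b := @GCentre C K x y 0 b.

Lemma dvr_no x y r : chart x y -> (forall c, val (zP x y c) r 0) -> r != 0 ->
  ~ gdvr x y r^-1.
Proof. by move=> c v r0 [b]; exact: (val_notV (chart_good 0 b c) (v b) r0). Qed.

Let mulv0 (z : gcentre) r s c : val z r c -> val z s 0 -> val z (r * s) 0.
Proof. by move=> v w; apply: val_eq (valM v w) _ _ => //; rewrite mulr0. Qed.

Lemma no_q y : chart h y -> ~ gdvr h y q.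
Proof. by move=> c; have := dvr_xV c; rewrite invrK. Qed.

Let s0V : s0^-1 = p / q ^+ 3. Proof. by rewrite invf_div. Qed.

(** [s0 = q ^+ 3 / p] has a pole along {q = oo}, and likewise along F_6 - F_7 and F_7 - F_8 in the
    next two lemmas. Hence a point where it is regular lies on none of these curves. *)
Lemma no_s0_1 : ~ gdvr h p s0.
Proof.
rewrite -[s0]invrK s0V; apply: dvr_no => // [c|]; last exact: chart_y0 chw3.
rewrite w3E w2E; apply: mulv0 (val_x k (zP h p c)).
by apply: mulv0 (val_x k (zP h p c)); apply: mulv0 (val_y k (zP h p c)) (val_x k (zP h p c)).
Qed.

Lemma no_s0_2 : ~ gdvr h (p / q) s0.
Proof.
rewrite -[s0]invrK s0V; apply: dvr_no => // [c|]; last exact: chart_y0 chw3.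
rewrite w3E w2E; apply: mulv0 (val_x k (zP h (p / q) c)).
by apply: mulv0 (val_y k (zP h (p / q) c)) (val_x k (zP h (p / q) c)).
Qed.

Lemma no_s0_3 : ~ gdvr h (p / q ^+ 2) s0.
Proof.
rewrite -[s0]invrK s0V; apply: dvr_no => // [c|]; last exact: chart_y0 chw3.
by rewrite w3E; apply: mulv0 (val_y k (zP h (p / q ^+ 2) c)) (val_x k (zP h (p / q ^+ 2) c)).
Qed.

End TakasakiSurface.

(** * Points away from the centres in both coordinate systems *)

Section SpecialPoints.
Variables (C : closedFieldType) (K : fieldType) (k : {rmorphism C -> K}).
Implicit Types (x y r s : K) (c d : C) (O R : set K) (S : set (set K)).
Local Notation gpt := (gpt k).
Local Notation val := (val k).
Local Notation chart := (chart k).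
Local Notation pt0 := (pt0 k).
Local Notation gcentre := (gcentre C K).

Variables (q p : K) (t a1 : C).
Hypothesis cqp : chart q p.
Hypothesis two0 : (2 : C) != 0.

Local Notation xi := (xi q).
Local Notation gg := (gg k q p t a1).
Local Notation F := (xi ^+ 2).
Local Notation h := (q^-1).
Local Notation s0 := (q ^+ 3 / p).

Let q0 : q != 0 := chart_x0 cqp.
Let p0 : p != 0 := chart_y0 cqp.
Let twoK : (2 : K) != 0. Proof. by rewrite -(rmorph_nat k) fmorph_eq0. Qed.
Let powK n : (2 ^+ n : K) != 0. Proof. exact: expf_neq0. Qed.
Let fourK : (4 : K) != 0. Proof. by have := powK 2; rewrite -natrX. Qed.
Let eightK : (8 : K) != 0. Proof. by have := powK 3; rewrite -natrX. Qed.
Let sixteenK : (16 : K) != 0. Proof. by have := powK 4; rewrite -natrX. Qed.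
Let powC n : (2 ^+ n : C) != 0. Proof. exact: expf_neq0. Qed.
Let fourC : (4 : C) != 0. Proof. by have := powC 2; rewrite -natrX. Qed.
Let eightC : (8 : C) != 0. Proof. by have := powC 3; rewrite -natrX. Qed.
Let sixteenC : (16 : C) != 0. Proof. by have := powC 4; rewrite -natrX. Qed.
Let n64C : (64 : C) != 0. Proof. by have := powC 6; rewrite -natrX. Qed.

Let cxg : chart xi gg := chart_xigg t a1 cqp two0.
Let cqF : chart q (F * gg) := chart_qFgg t a1 cqp two0.
Let cxF : chart xi (F * gg).
Proof. by rewrite {1}(xiE k q); apply: chart_scale; [rewrite invr_eq0|exact: cqF]. Qed.
Let cqs : chart q (q * p). Proof. by rewrite mulrC; apply: chart_muly. Qed.

Definition aff_b a b : C := t / 2 + 2 * a1 / a ^+ 2 + b / (2 * a) + a ^+ 2 / 16.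

Let val_m (z : gcentre) a : good k z -> a != 0 -> val z q a ->
  val z (k t / 2 + 2 * k a1 / q ^+ 2 + q ^+ 2 / 16) (t / 2 + 2 * a1 / a ^+ 2 + a ^+ 2 / 16).
Proof.
move=> gz a0 vq; have a20 : a ^+ 2 != 0 by rewrite expf_neq0.
apply: (valD gz (valD gz _ _)).
- exact: val_div two0 (val_cst k z t) (val_nat k z 2).
- exact: val_div a20 (valM (val_nat k z 2) (val_cst k z a1)) (valXn 2 vq).
- exact: val_div sixteenC (valXn 2 vq) (val_nat k z 16).
Qed.

Let vxi (z : gcentre) a : val z q a -> val z xi (a / 2).
Proof. by move=> v; apply: val_div two0 v (val_nat k z 2). Qed.

Let vq_xi (z : gcentre) a : val z xi (a / 2) -> val z q a.
Proof.
move=> v; apply: val_eq (valM (val_nat k z 2) v) _ _; last by rewrite mulrC divfK.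
by rewrite /Submission.xi mulrC divfK.
Qed.

Let ggE : gg = (k t / 2 + 2 * k a1 / q ^+ 2 + q ^+ 2 / 16) + p / (2 * q).
Proof. by rewrite /Submission.gg addrAC. Qed.

Lemma aff_pt a b : a != 0 ->
  gpt (GCentre q p a b) = gpt (GCentre xi gg (a / 2) (aff_b a b)).
Proof.
move=> a0; pose z := @GCentre C K q p a b.
pose w := @GCentre C K xi gg (a / 2) (aff_b a b).
have gz : good k z := chart_good _ _ cqp. have gw : good k w := chart_good _ _ cxg.
have a20 : 2 * a != 0 by rewrite mulf_neq0.
have bE : aff_b a b = (t / 2 + 2 * a1 / a ^+ 2 + a ^+ 2 / 16) + b / (2 * a).
  by rewrite /aff_b addrAC.
have vz := val_m gz a0 (val_x k z).
have wq : val w q a by apply/vq_xi/(val_x k w).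
have vw := val_m gw a0 wq.
apply: (@pt_eq _ _ k w z) => //=.
  apply: val_eq (valM (valB gw (val_y k w) vw) (valM (val_nat k w 2) wq)) _ _ => /=.
    by rewrite ggE addrC addKr divfK // mulf_neq0.
  by rewrite bE addrC addKr divfK.
rewrite -/z; first exact/vxi/(val_x k z).
rewrite bE ggE; apply: (valD gz vz).
exact: val_div a20 (val_y k z) (valM (val_nat k z 2) (val_x k z)).
Qed.

Lemma goo_pt a : a != 0 -> pt0 p^-1 q a = pt0 gg^-1 xi (a / 2).
Proof.
move=> a0; pose z := @GCentre C K p^-1 q 0 a; pose w := @GCentre C K gg^-1 xi 0 (a / 2).
have gz : good k z := chart_good _ _ (chart_inv (chart_swap cqp)).
have gw : good k w := chart_good _ _ (chart_inv (chart_swap cxg)).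
have a20 : 2 * a != 0 by rewrite mulf_neq0.
have i20 : (2 * a)^-1 != 0 by rewrite invr_eq0.
have vz := val_m gz a0 (val_y k z).
have wq : val w q a by apply/vq_xi/(val_y k w).
have vw := val_m gw a0 wq.
set m := k t / 2 + _ + _ in vz vw; set c := t / 2 + _ + _ in vz vw.
have gE : gg = m + p / (2 * q) := ggE.
have g0 : gg != 0 := chart_y0 cxg.
have q20 : 2 * q != 0 by rewrite mulf_neq0.
apply: (@pt_eq _ _ k w z) => //=.
- have vd : val w (2 * q * (1 - m * gg^-1)) (2 * a).
    apply: val_eq (valM (valM (val_nat k w 2) wq) (valB gw (val1 k w) (valM vw (val_x k w)))) _ _ => //.
    by rewrite mulr0 subr0 mulr1.
  apply: val_eq (val_div a20 (val_x k w) vd) _ _; rewrite /= ?mul0r //.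
  have pE : p = 2 * q * (gg - m) by rewrite gE addrC addKr mulrC divfK.
  have n0 : gg - m != 0 by apply: contraTneq p0 => E; rewrite pE E mulr0 eqxx.
  have -> : p^-1 = (2 * q * (gg - m))^-1 by rewrite -pE.
  by move: (gg) g0 n0 => G g0 n0; field; rewrite ?g0 ?n0 ?q0 ?twoK.
- have gi : gg^-1 = p^-1 / ((2 * q)^-1 + m * p^-1).
    rewrite gE -[RHS]invfM; congr (_^-1).
    by rewrite mulrDr addrC mulrCA divff // mulr1.
  have vd : val z ((2 * q)^-1 + m * p^-1) (2 * a)^-1.
    apply: val_eq (valD gz (valV a20 (valM (val_nat k z 2) (val_y k z))) (valM vz (val_x k z))) _ _ => //.
    by rewrite mulr0 addr0.
  by rewrite gi; apply: val_eq (val_div i20 (val_x k z) vd) _ _; rewrite // mul0r.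
- exact/vxi/(val_y k z).
Qed.

Let msq : K := k a1 / 2 + k t * q ^+ 2 / 8 + q ^+ 4 / 64.

Let val_msq (z : gcentre) : good k z -> val z q 0 -> val z msq (a1 / 2).
Proof.
move=> gz vq; apply: val_eq (valD gz (valD gz (val_div two0 (val_cst k z a1) (val_nat k z 2))
  (val_div eightC (valM (val_cst k z t) (valXn 2 vq)) (val_nat k z 8)))
  (val_div n64C (valXn 4 vq) (val_nat k z 64))) _ _ => //.
by rewrite !exprS !mul0r mulr0 mul0r !addr0.
Qed.

Let xq0 (z : gcentre) : val z xi 0 -> val z q 0.
Proof. by move=> v; apply: vq_xi; rewrite mul0r. Qed.

Let qx0 (z : gcentre) : val z q 0 -> val z xi 0.
Proof. by move=> v; apply: val_eq (vxi v) _ _; rewrite // mul0r. Qed.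

Let i80 : (8^-1 : C) != 0. Proof. by rewrite invr_eq0. Qed.

Lemma zero_oo_pt : pt0 q (q * p)^-1 0 = pt0 xi (F * gg)^-1 0.
Proof.
have FE : F * gg = q * p / 8 + msq := FggE t a1 cqp two0.
have cz := chart_invy cqs; have cw := chart_invy cxF.
pose z := @GCentre C K q (q * p)^-1 0 0; pose w := @GCentre C K xi (F * gg)^-1 0 0.
have gz : good k z := chart_good _ _ cz. have gw : good k w := chart_good _ _ cw.
have s0 : q * p != 0 := chart_y0 cqs.
have f0 : F * gg != 0 := chart_y0 cxF.
have vz := val_msq gz (val_x k z).
have wq := xq0 (val_x k w); have vw := val_msq gw wq.
apply: (@pt_eq _ _ k w z) => //=.
- have vd : val w (8 * (1 - msq * (F * gg)^-1)) 8.
    apply: val_eq (valM (val_nat k w 8) (valB gw (val1 k w) (valM vw (val_y k w)))) _ _ => //.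
    by rewrite mulr0 subr0 mulr1.
  apply: val_eq (val_div eightC (val_y k w) vd) _ _; rewrite /= ?mul0r //.
  have pE : q * p = 8 * (F * gg - msq) by rewrite FE addrK [8 * _]mulrC divfK.
  have n0 : F * gg - msq != 0 by apply: contraTneq s0 => E; rewrite pE E mulr0 eqxx.
  have -> : (q * p)^-1 = (8 * (F * gg - msq))^-1 by rewrite -pE.
  by move: (F * gg) f0 n0 => G f0 n0; field; rewrite ?f0 ?n0 ?eightK.
- exact/qx0/(val_x k z).
- have vd : val z (8^-1 + msq * (q * p)^-1) 8^-1.
    apply: val_eq (valD gz (valV eightC (val_nat k z 8)) (valM vz (val_y k z))) _ _ => //.
    by rewrite mulr0 addr0.
  apply: val_eq (val_div i80 (val_y k z) vd) _ _; rewrite /= ?mul0r //.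
  rewrite FE -[RHS]invfM; congr (_^-1).
  by rewrite mulrDr [q * p * (_ * _)]mulrCA divff // mulr1.
Qed.

Let moo : K := 4^-1 + 2 * k t * h ^+ 2 + 8 * k a1 * h ^+ 4.

Let val_moo (z : gcentre) : good k z -> val z h 0 -> val z moo 4^-1.
Proof.
move=> gz vh; apply: val_eq (valD gz (valD gz (valV fourC (val_nat k z 4))
  (valM (valM (val_nat k z 2) (val_cst k z t)) (valXn 2 vh)))
  (valM (valM (val_nat k z 8) (val_cst k z a1)) (valXn 4 vh))) _ _ => //.
by rewrite !exprS !mul0r !mulr0 !addr0.
Qed.

(** The point s = oo of the fibre q = oo. Since g / f is 2 p / q^3 plus a function with value 1/4,
    its image has f / g = 4; it is the point that receives the three curves contracted over q =
    oo. *)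
Lemma oo_pt4 : pt0 h (p / q ^+ 3) 0 = pt0 xi^-1 (F / gg) 4.
Proof.
have ggFE : gg / F = 2 * (p / q ^+ 3) + moo.
  by rewrite /Submission.gg /Submission.xi /moo; field; rewrite ?q0 ?twoK ?fourK ?eightK ?sixteenK.
have cz : chart h (p / q ^+ 3).
  have -> : p / q ^+ 3 = p / q / q / q by field.
  exact/chart_muly/chart_muly/chart_muly/chart_inv.
have cw : chart xi^-1 (F / gg).
  rewrite -[F / gg]invf_div; apply: chart_invy.
  have -> : gg / F = gg * xi^-1 * xi^-1 by rewrite -exprVn expr2 mulrA.
  exact/chart_muly/chart_muly/chart_inv.
pose z := @GCentre C K h (p / q ^+ 3) 0 0; pose w := @GCentre C K xi^-1 (F / gg) 0 4.
have gz : good k z := chart_good _ _ cz. have gw : good k w := chart_good _ _ cw.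
have i40 : (4^-1 : C) != 0 by rewrite invr_eq0.
have vz := val_moo gz (val_x k z).
have wh : val w h 0.
  apply: val_eq (valM (val_cst k w 2^-1) (val_x k w)) _ _; last by rewrite mulr0.
  by rewrite /= (xiVE k q) mulrA -rmorphM mulVf // rmorph1 mul1r.
have vw := val_moo gw wh.
apply: (@pt_eq _ _ k w z) => //=.
- have vd := val_div two0 (valB gw (valV fourC (val_y k w)) vw) (val_nat k w 2).
  apply: val_eq vd _ _; last by rewrite subrr mul0r.
  by rewrite /= invf_div ggFE addrK [2 * _]mulrC mulfK.
- rewrite (xiVE k q); apply: val_eq (valM (val_cst k z 2) (val_x k z)) _ _ => //.
  by rewrite mulr0.
- have vd : val z (gg / F) 4^-1.
    rewrite ggFE; apply: val_eq (valD gz (valM (val_nat k z 2) (val_y k z)) vz) _ _ => //.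
    by rewrite mulr0 add0r.
  by apply: val_eq (valV i40 vd) _ _; rewrite ?invrK ?invf_div.
Qed.

End SpecialPoints.

(** * The points of Takasaki's surface *)

Section TakasakiPoints.
Variables (C : closedFieldType) (K : fieldType) (k : {rmorphism C -> K}).
Implicit Types (x y r s : K) (c d : C) (O R : set K) (S : set (set K)).
Local Notation gpt := (gpt k).
Local Notation val := (val k).
Local Notation chart := (chart k).
Local Notation pt0 := (pt0 k).
Local Notation gexc := (gexc k).
Local Notation guv := (guv k).
Local Notation ustep := (ustep k).
Local Notation late := (late k).
Local Notation dom := (dom k).
Local Notation doms := (doms k).
Local Notation seg := (seg k).
Local Notation segs := (segs k).
Local Notation gcentre := (gcentre C K).

Variables (q p : K) (t a1 a2 : C).
Hypothesis cqp : chart q p.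
Hypothesis a10 : a1 != 0.
Hypothesis two0 : (2 : C) != 0.

Local Notation xi := (xi q).
Local Notation gg := (gg k q p t a1).
Local Notation b1 := (b1 t).
Local Notation b2 := (b2 t a1 a2).
Local Notation b3 := (b3 a2).
Local Notation F := (xi ^+ 2).
Local Notation h := (q^-1).
Local Notation s0 := (q ^+ 3 / p).
Local Notation fA1 := (fA1 k F gg).
Local Notation fA2 := (fA2 k F gg b1).
Local Notation tq1 := (tq1 C q p).
Local Notation tq6 := (tq6 C q p).
Local Notation tq7 := (tq7 k q p).
Local Notation tq8 := (tq8 k q p).
Local Notation z0 := (z0 k q p).
Local Notation z1 := (z1 k q p).
Local Notation z2 := (z2 k q p).
Local Notation z3 := (z3 k q p).
Local Notation up := (up k xi gg a1 b1 b2 b3).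

Let q0 : q != 0 := chart_x0 cqp.
Let p0 : p != 0 := chart_y0 cqp.
Let chp : chart h p := chart_inv cqp.
Let chpi : chart h p^-1 := chart_invy chp.
Let cqpi : chart q p^-1 := chart_invy cqp.
Let cqs : chart q (q * p). Proof. by rewrite mulrC; apply: chart_muly. Qed.
Let chw1 : chart h (p / q). Proof. exact: chart_muly. Qed.
Let w2E : p / q ^+ 2 = p / q / q. Proof. by rewrite expr2 invfM mulrA. Qed.
Let w3E : p / q ^+ 3 = p / q ^+ 2 / q. Proof. by rewrite exprSr invfM mulrA. Qed.
Let chw2 : chart h (p / q ^+ 2). Proof. by rewrite w2E; apply: chart_muly. Qed.
Let chw3 : chart h (p / q ^+ 3). Proof. by rewrite w3E; apply: chart_muly. Qed.
Let chs0 : chart h s0. Proof. by rewrite -[s0]invf_div; apply: chart_invy. Qed.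
Let cxg : chart xi gg := chart_xigg t a1 cqp two0.
Let cxF : chart xi (F * gg).
Proof.
rewrite {1}(xiE k q); apply: chart_scale; first by rewrite invr_eq0.
exact: chart_qFgg.
Qed.
Let cB0 : chart xi^-1 (gg / F).
Proof.
have -> : gg / F = gg * xi^-1 * xi^-1 by rewrite -exprVn expr2 mulrA.
exact/chart_muly/chart_muly/chart_inv.
Qed.
Let cA0 : chart xi^-1 (F / gg).
Proof. by rewrite -[F / gg]invf_div; apply: chart_invy. Qed.
Let EA1 : fA1 = (F / gg - k 2) / xi^-1 ^+ 2. Proof. by rewrite exprVn. Qed.
Let EA2 : fA2 = (fA1 - k b1) / xi^-1 ^+ 2. Proof. by rewrite exprVn. Qed.
Let xi20 : F != 0. Proof. by rewrite expf_neq0 // (xi0 cqp two0). Qed.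
Let EB1 : gg = (gg / F - k 0) / xi^-1 ^+ 2.
Proof. by rewrite exprVn rmorph0 subr0 invrK divfK. Qed.
Let EB2 : F * gg = (gg - k 0) / xi^-1 ^+ 2.
Proof. by rewrite exprVn rmorph0 subr0 invrK mulrC. Qed.

Definition segA := segs xi^-1 (F / gg) fA1 fA2 2 b1 b2.
Definition segB := segs xi^-1 (gg / F) gg (F * gg) 0 0 b3.

Definition takPs := gpt tq1 :: (seg xi (F * gg) a1 ++ (seg xi (F * gg) 0 ++
  ([:: gpt tq6; gpt tq7; gpt tq8] ++ (segA ++ segB)))).

Lemma takPsE : takPs = [seq gpt z | z <- [:: tq1; tq2 k q p a1; tq3 k q p a1;
  tq4 k q p a1; tq5 k q p a1; tq6; tq7; tq8; tq9 k q p; tq10 k q p;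
  tq11 k q p t; tq12 k q p t; tq13 k q p t a1 a2; tq14 k q p t a1 a2;
  tq15 k q p; tq16 k q p; tq17 k q p t; tq18 k q p t; tq19 k q p t a1 a2;
  tq20 k q p t a1 a2]].
Proof.
rewrite /=.
rewrite (tq2E t cqp a10 two0) (tq3E t cqp a10 two0) (tq4E t cqp a10 two0).
rewrite (tq5E t cqp a10 two0) (tq9E t a1 cqp two0) (tq10E t a1 cqp two0).
rewrite (tq11E t a1 cqp two0) (tq12E t a1 cqp two0) (tq13E t a1 a2 cqp two0).
rewrite (tq14E t a1 a2 cqp two0) (tq15E t a1 cqp two0) (tq16E t a1 cqp two0).
rewrite (tq17E t a1 cqp two0) (tq18E t a1 cqp two0) (tq19E t a1 a2 cqp two0).
by rewrite (tq20E t a1 a2 cqp two0).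
Qed.

Definition gXTak := foldl (blow1 k) (gP1xP1 k q p) takPs.

Let zP x y b := @GCentre C K x y 0 b.
Local Notation zc1 := (zP xi (F * gg) a1).
Local Notation zc2 := (zP xi (F * gg) 0).
Local Notation zA := (zP xi^-1 (F / gg) 2).
Local Notation zB := (zP xi^-1 (gg / F) 0).

Let fourC : (4 : C) != 0. Proof. by have := expf_neq0 2 two0; rewrite -natrX. Qed.
Let eightC : (8 : C) != 0. Proof. by have := expf_neq0 3 two0; rewrite -natrX. Qed.
Let fa10 : 4 * a1 != 0. Proof. by rewrite mulf_neq0. Qed.
Let nfa10 : - (4 * a1) != 0. Proof. by rewrite oppr_eq0. Qed.

Let ch7 : chart h (q / p). Proof. by rewrite -[q / p]invf_div; apply: chart_invy. Qed.
Let ch8 : chart h (q ^+ 2 / p). Proof. by rewrite -[q ^+ 2 / p]invf_div; apply: chart_invy. Qed.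
Let c7s : chart (q / p) h. Proof. exact: chart_swap. Qed.
Let c8s : chart (q ^+ 2 / p) h. Proof. exact: chart_swap. Qed.
Let h0 : h != 0. Proof. by rewrite invr_eq0. Qed.
Let pi0 : p^-1 != 0. Proof. by rewrite invr_eq0. Qed.

Let u1 c r d : val tq1 r d -> val (guv tq1 c 0) r d.
Proof.
have g : good k (guv tq1 c 0) by apply: (@good_uv _ _ k tq1).
by apply: val_uv; rewrite //= rmorph0 subr0.
Qed.

Let u67 r d : val tq6 r d -> val tq7 r d.
Proof.
move=> v; have cs : chart (gx (gswap tq6)) (gy (gswap tq6)) by apply/chart_swap.
apply: (@val_uv _ _ k (gswap tq6) 0); first exact: (@good_uv _ _ k (gswap tq6) 0 0 cs).
  by rewrite /= rmorph0 subr0.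
by apply/val_swap => //; apply: (@chart_good _ _ k h p^-1 0 0).
Qed.

Let u78 r d : val tq7 r d -> val tq8 r d.
Proof.
rewrite (tq8c k q p) (tq7c k q p) => v.
have := @val_uv _ _ k (@GCentre C K (q / p) h 0 0) 0 r d.
rewrite /Submission.guv /= !rmorph0 !subr0 invrK mulrAC -expr2; apply=> //.
exact: chart_good.
Qed.

Let u8 c r d : val tq8 r d -> val (@GCentre C K s0 h c 0) r d.
Proof.
have g : good k (guv tq8 c 0) by rewrite tq8_uv; apply/chart_good/chart_swap.
by rewrite -(tq8_uv k q p); apply: val_uv; rewrite // tq8c /= rmorph0 subr0.
Qed.

Let cs0 : chart s0 h. Proof. exact: chart_swap. Qed.

(** The centre q_9 in its two presentations: a point of the exceptional curve of q_8, and the start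
    of the first chain. Values known at q_6, q_7, q_8 are thus carried to all the centres of the
    chain. *)
Let ptA : gpt (@GCentre C K s0 h 8 0) = gpt zA.
Proof. by rewrite -(tq8_uv k q p) -/(tq9 k q p) (tq9E t a1 cqp two0). Qed.
Let ptB : gpt (@GCentre C K s0 h (- 8) 0) = gpt zB.
Proof. by rewrite -(tq8_uv k q p) -/(tq15 k q p) (tq15E t a1 cqp two0). Qed.
Let gA : good k zA := chart_good _ _ cA0.
Let gB : good k zB := chart_good _ _ cB0.
Let g1 : good k zc1 := chart_good _ _ cxF.
Let g2 : good k zc2 := chart_good _ _ cxF.
Let vA r d : val (@GCentre C K s0 h 8 0) r d -> val zA r d.
Proof. by apply: val_pteq ptA; rewrite //; apply: chart_good. Qed.
Let vB r d : val (@GCentre C K s0 h (- 8) 0) r d -> val zB r d.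
Proof. by apply: val_pteq ptB; rewrite //; apply: chart_good. Qed.
Let v1 r d : val (guv tq1 (4 * a1) 0) r d -> val zc1 r d.
Proof.
apply: val_pteq; rewrite //; first by apply: (@good_uv _ _ k tq1).
exact: (tq2E t cqp a10 two0).
Qed.
Let v2 r d : val (guv tq1 (- (4 * a1)) 0) r d -> val zc2 r d.
Proof.
apply: val_pteq; rewrite //; first by apply: (@good_uv _ _ k tq1).
exact: (tq4E t cqp a10 two0).
Qed.

(** The centres over q = oo; [head1] collects those over q = 0. As q has a pole at every centre of
    the first list and q^-1 at every centre of the second, the two parts of the sequence do not
    interfere. *)
Definition tail6 := [:: gpt tq6; gpt tq7; gpt tq8] ++ (segA ++ segB).
Definition head1 := gpt tq1 :: (seg xi (F * gg) a1 ++ seg xi (F * gg) 0).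

Let takE : takPs = head1 ++ tail6. Proof. by []. Qed.

Let dS1 : doms zc1 (seg xi (F * gg) a1).
Proof. by rewrite -[seg _ _ _]cats0; apply: doms_seg. Qed.
Let dS2 : doms zc2 (seg xi (F * gg) 0).
Proof. by rewrite -[seg _ _ _]cats0; apply: doms_seg. Qed.
Let dA : doms zA segA := doms_segs b2 cA0 EA1 EA2.
Let dB : doms zB segB := doms_segs b3 cB0 EB1 EB2.
Let dAB : doms tq8 (segA ++ segB).
Proof.
by apply: doms_cat; [apply: doms_trans dA|apply: doms_trans dB] => r d v; [exact/vA/u8|exact/vB/u8].
Qed.
Let domc z : good k z -> dom z (gpt z). Proof. by exists z. Qed.
Let g8 : good k tq8. Proof. by rewrite tq8c; apply: chart_good. Qed.
Let g7 : good k tq7. Proof. by rewrite tq7c; apply: chart_good. Qed.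
Let g6 : good k tq6 := chart_good _ _ chpi.
Let gt1 : good k tq1 := chart_good _ _ cqpi.
Let d8 : doms tq8 (gpt tq8 :: (segA ++ segB)). Proof. by split; first exact: domc. Qed.
Let d7 : doms tq7 (gpt tq7 :: gpt tq8 :: (segA ++ segB)).
Proof. by split; [exact: domc|apply: doms_trans d8]. Qed.
Let d6 : doms tq6 tail6. Proof. by split; [exact: domc|apply: doms_trans d7]. Qed.
Let d1 : doms tq1 head1.
Proof.
split; first exact: domc.
by apply: doms_cat; [apply: doms_trans dS1|apply: doms_trans dS2] => r d v; [exact/v1/u1|exact/v2/u1].
Qed.

Let Lq : lacks q tail6.
Proof. by rewrite -[q]invrK; apply: doms_lacks d6 (val_x _ _) _. Qed.
Let Lp : lacks p tail6.
Proof. by rewrite -[p]invrK; apply: doms_lacks d6 (val_y _ _) _. Qed.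
Let Lh1 : lacks h head1.
Proof. by apply: doms_lacks d1 (val_x _ _) _. Qed.
Let Lp1 : lacks p head1.
Proof. by rewrite -[p]invrK; apply: doms_lacks d1 (val_y _ _) _. Qed.

Lemma gXTak_late O : late takPs O -> gXTak O.
Proof. by move=> lO; apply/foldl_blow1; right. Qed.

Lemma gXTak_head O : O q -> late head1 O -> gXTak O.
Proof.
move=> Oq lO; apply: gXTak_late; rewrite takE; apply/late_cat; left; split=> //.
exact: avoid_lacks Oq Lq.
Qed.

Lemma gXTak_tail O : late tail6 O -> gXTak O.
Proof. by move=> lO; apply: gXTak_late; rewrite takE; apply/late_cat; right. Qed.

Lemma gXTak_P1 x y a b O : x \in [:: q; h] -> y \in [:: p; p^-1] -> O = gpt (GCentre x y a b) ->
  O h \/ O p -> O q \/ O p -> gXTak O.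
Proof.
move=> xi yi EO H1 H2; apply/foldl_blow1; left; split; first by exists x, y, a, b.
rewrite takE; apply/avoid_cat; split.
  by case: H1 => Or; apply: (avoid_lacks Or).
by case: H2 => Or; apply: (avoid_lacks Or).
Qed.

(* Two sufficient conditions for O to lie on no contracted curve *)
Definition noncontr O := O q /\ (O h \/ O (q * p)^-1) \/ O h /\ O s0.

Let ptV (z : gcentre) r c : c != 0 -> val z r c -> gpt z r^-1.
Proof. by move=> c0 v; exact: (val_pt (valV c0 v)). Qed.

Lemma tak_gen a b : a != 0 ->
  gXTak (gpt (GCentre xi gg a b)) /\ noncontr (gpt (GCentre xi gg a b)).
Proof.
move=> a0; have aE : 2 * a != 0 by rewrite mulf_neq0.
(* The value of p at the point, obtained by solving [gg = b] at q = 2 a. *)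
pose b' := (b - (t / 2 + 2 * a1 / (2 * a) ^+ 2 + (2 * a) ^+ 2 / 16)) * (2 * (2 * a)).
have -> : gpt (GCentre xi gg a b) = gpt (@GCentre C K q p (2 * a) b').
  rewrite (aff_pt t a1 cqp two0 b' aE); congr (gpt (GCentre _ _ _ _)).
    by rewrite mulrC mulKf.
  rewrite /aff_b addrAC /b' mulfK ?mulf_neq0 //.
  by rewrite addrC subrK.
have Oq : gpt (@GCentre C K q p (2 * a) b') q := val_pt (val_x k (GCentre q p _ _)).
have Oh : gpt (@GCentre C K q p (2 * a) b') h := ptV aE (val_x k (GCentre q p _ _)).
by split; [apply: gXTak_P1 (erefl _) _ _; rewrite ?inE ?eqxx //; left|left; split=> //; left].
Qed.

Lemma tak_goo a : a != 0 -> gXTak (pt0 gg^-1 xi a) /\ noncontr (pt0 gg^-1 xi a).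
Proof.
move=> a0; have aE : 2 * a != 0 by rewrite mulf_neq0.
have -> : pt0 gg^-1 xi a = pt0 p^-1 q (2 * a).
  by rewrite (goo_pt t a1 cqp two0 aE) mulrC mulKf.
have Oq : pt0 p^-1 q (2 * a) q := val_pt (val_y k (zP p^-1 q _)).
have Oh : pt0 p^-1 q (2 * a) h := ptV aE (val_y k (zP p^-1 q _)).
split; last by left; split=> //; left.
have cs : chart p^-1 q by apply: chart_swap.
apply: (@gXTak_P1 q p^-1 (2 * a) 0); rewrite ?inE ?eqxx ?orbT //.
- by rewrite (pt_sym _ _ cqpi).
- by left.
- by left.
Qed.

Lemma tak_q0 c : gXTak (pt0 q p c).
Proof.
have Oq : pt0 q p c q := pt0_x _ _ _ _; have Op : pt0 q p c p := pt0_y _ _ _ _.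
by apply: (@gXTak_P1 q p 0 c); rewrite ?inE ?eqxx //; right.
Qed.

Lemma tak_qoo c : gXTak (pt0 h p c).
Proof.
have Op : pt0 h p c p := pt0_y _ _ _ _.
by apply: (@gXTak_P1 h p 0 c); rewrite ?inE ?eqxx ?orbT //; right.
Qed.

Let cqpp : chart (q * p) p^-1.
Proof. by have := chart_div cqpi; rewrite invrK. Qed.

Lemma gexc_tq1 O : gexc (gpt tq1) O <-> [\/ exists2 c, c != 0 & O = pt0 q (q * p) c,
  O = pt0 p^-1 (q * p) 0 | O = pt0 xi (F * gg)^-1 0].
Proof.
have E c : gpt (guv tq1 c 0) = gpt (GCentre (q * p) p^-1 c 0).
  by rewrite /Submission.guv /= !rmorph0 !subr0 invrK.
have E' c : c != 0 -> gpt (guv tq1 c 0) = pt0 q (q * p) c.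
  by move=> c0; rewrite (tq1_uv t a1 cqp two0) // -(zero_pt t a1 cqp two0).
have E0 : gpt (guv tq1 0 0) = pt0 p^-1 (q * p) 0 by rewrite E (pt_sym _ _ cqpp).
have Eoo : gpt (guv (gswap tq1) 0 0) = pt0 xi (F * gg)^-1 0.
  rewrite -(zero_oo_pt t a1 cqp two0) /Submission.guv /gswap /= !rmorph0 !subr0.
  by rewrite /Submission.pt0 (pt_sym _ _ (chart_invy cqs)) invfM [h * _]mulrC.
rewrite gexcP // Eoo; split=> [[[c ->]|->]|[[c c0 ->]|->|->]].
- by have [->|c0] := eqVneq c 0; [constructor 2|constructor 1; exists c; rewrite // E'].
- by constructor 3.
- by left; exists c; rewrite E'.
- by left; exists 0.
- by right.
Qed.

Let avoid_S O : O (F * gg - k a1)^-1 -> O (F * gg)^-1 ->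
  avoid (seg xi (F * gg) a1 ++ seg xi (F * gg) 0) O.
Proof.
move=> O1 O2; apply/avoid_cat; split.
  apply: (avoid_lacks O1); apply: (doms_lacks dS1); last exact: (step_u0 a1 cxF).
  exact: val_sub0 (val_y _ _).
apply: (avoid_lacks O2); apply: (doms_lacks dS2); first exact: val_y.
exact: chart_y0 cxF.
Qed.

Let pt0_q c : pt0 xi (F * gg) c q.
Proof.
have := zero_pt t a1 cqp two0 (8 * c - 4 * a1).
rewrite subrK [8 * c]mulrC mulfK // => <-; exact: pt0_x.
Qed.

Lemma z0E : z0 = pt0 xi (F * gg) (a1 / 2).
Proof.
rewrite /Submission.z0 (zero_pt t a1 cqp two0); congr pt0.
by field; rewrite ?two0 ?eightC.
Qed.

Lemma tak_W0 : gXTak (pt0 p^-1 (q * p) 0).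
Proof.
have ez : gexc z0 (pt0 p^-1 (q * p) 0) by rewrite (exc_z0 cqp); right.
have sub : z0 `<=` pt0 p^-1 (q * p) 0 := exc_above (z := zP q (q * p) 0) cqs ez.
rewrite z0E in sub.
have h2 : a1 / 2 != 0 by rewrite mulf_neq0 // invr_eq0.
have h1 : a1 / 2 != a1.
  apply: contraNneq h2 => E; have : a1 - a1 / 2 = 0 by rewrite E subrr.
  by rewrite (_ : a1 - a1 / 2 = a1 / 2); [move/eqP|field].
apply: gXTak_head; first exact/sub/pt0_q.
left; split; first by apply/gexc_tq1; constructor 2.
by apply: avoid_S; apply: sub; [exact: pt0_yV|exact: pt0_yV0].
Qed.

(** The value a_1 / 2 is left out: the point there is [z0], which appears only once {q = 0} has been
    contracted. *)
Lemma tak_zero c : c != 0 -> c != a1 -> c != a1 / 2 ->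
  gXTak (pt0 xi (F * gg) c) /\ noncontr (pt0 xi (F * gg) c).
Proof.
move=> c0 c1 c2; pose c' := 8 * c - 4 * a1.
have c'0 : c' != 0.
  apply: contra_neq c2 => E; have -> : c = (c' + 4 * a1) / 8.
    by rewrite /c' subrK mulrC mulKf.
  by rewrite E add0r; field; rewrite ?two0 ?eightC.
have E : pt0 xi (F * gg) c = pt0 q (q * p) c'.
  by rewrite (zero_pt t a1 cqp two0) /c' subrK [8 * c]mulrC mulfK.
split; last by left; split; [exact: pt0_q|right; rewrite E; exact: pt0_yV0].
apply: gXTak_head; first exact: pt0_q.
left; split; first by apply/gexc_tq1; constructor 1; exists c'.
by apply: avoid_S; [exact: pt0_yV|exact: pt0_yV0].
Qed.

Lemma tak_zoo : gXTak (pt0 xi (F * gg)^-1 0) /\ noncontr (pt0 xi (F * gg)^-1 0).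
Proof.
have Oq : pt0 xi (F * gg)^-1 0 q.
  by rewrite -(zero_oo_pt t a1 cqp two0); apply: pt0_x.
have nO : ~ pt0 xi (F * gg)^-1 0 (F * gg).
  have := val_notV (@chart_good _ _ k _ _ 0 0 (chart_invy cxF)) (val_y _ _).
  by move/(_ (chart_y0 (chart_invy cxF))); rewrite invrK.
split; last first.
  by left; split=> //; right; rewrite -(zero_oo_pt t a1 cqp two0); apply: pt0_y.
apply: gXTak_head => //; left; split; first by apply/gexc_tq1; constructor 3.
by apply/avoid_cat; split; apply: (avoid_has nO); [apply: doms_has dS1 _|apply: doms_has dS2 _]; apply: val_y.
Qed.

Let nc_S b c O : c != 0 -> pt0 q (q * p) c = pt0 xi (F * gg) b ->
  pt0 xi (F * gg) b `<=` O -> noncontr O.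
Proof.
move=> c0 E sub; left; split; first exact/sub/pt0_q.
by right; apply: sub; rewrite -E; exact: pt0_yV0.
Qed.

Lemma tak_S1 O : ustep xi (F * gg) a1 (@any C) O -> gXTak O /\ noncontr O.
Proof.
move=> H; have sub := ustep_above cxF H; split.
  apply: gXTak_head; first exact/sub/pt0_q.
  right; apply/late_cat; left; split; first exact/late_seg.
  apply: (@avoid_lacks _ (F * gg)^-1); first exact/sub/pt0_yV0.
  by apply: (doms_lacks dS2); [exact: val_y|exact: chart_y0 cxF].
apply: nc_S sub; first exact: fa10.
by rewrite (zero_pt t a1 cqp two0); congr pt0; field; rewrite eightC.
Qed.

Lemma tak_S2 O : ustep xi (F * gg) 0 (@any C) O -> gXTak O /\ noncontr O.
Proof.
move=> H; have sub := ustep_above cxF H; split.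
  apply: gXTak_head; first exact/sub/pt0_q.
  by right; apply/late_cat; right; apply/late_seg.
apply: nc_S sub; first exact: nfa10.
by rewrite (zero_pt t a1 cqp two0) addNr mul0r.
Qed.

Let pt0_inv x y c : chart x y -> c != 0 -> pt0 x y^-1 c = pt0 x y c^-1.
Proof.
move=> cxy c0; have g : good k (zP x y c^-1) := chart_good _ _ cxy.
apply: (@pt_eq _ _ k (zP x y c^-1) (zP x y^-1 c)) => //=.
- exact: (val_x k (zP x y c^-1)).
- have c0' : c^-1 != 0 by rewrite invr_eq0.
  by have := valV c0' (val_y k (zP x y c^-1)); rewrite invrK.
- exact: (val_x k (zP x y^-1 c)).
- by have := valV c0 (val_y k (zP x y^-1 c)); rewrite /= invrK.
Qed.

Let T7E : gpt tq7 = pt0 h (q / p) 0. Proof. by rewrite tq7c (pt_sym _ _ c7s). Qed.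
Let T8E : gpt tq8 = pt0 h (q ^+ 2 / p) 0. Proof. by rewrite tq8c (pt_sym _ _ c8s). Qed.

Lemma gexc_tq6 O : gexc (gpt tq6) O <->
  [\/ exists2 c, c != 0 & O = pt0 h (p / q) c, O = pt0 p^-1 (p / q) 0 | O = gpt tq7].
Proof.
have cpq : chart (p / q) p^-1.
  by have := chart_div chpi; rewrite invrK mulrC.
rewrite [gexc _](exc_pt0 0 chpi) rmorph0 subr0 !invrK [p^-1 * q]mulrC [h * p]mulrC T7E.
rewrite [pt0 (p / q) _ _](pt_sym _ _ cpq) -[q / p]invf_div.
split=> [[[c ->]|->]|[[c c0 ->]|->|->]]; last by left; exists 0.
- have [->|c0] := eqVneq c 0; first by constructor 3.
  by constructor 1; exists c^-1; rewrite ?invr_eq0 // pt0_inv.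
- by constructor 2.
- by left; exists c^-1; rewrite pt0_inv ?invr_eq0 // invrK.
- by right.
Qed.

Lemma gexc_tq7 O : gexc (gpt tq7) O <->
  [\/ exists2 c, c != 0 & O = pt0 h (p / q ^+ 2) c, O = pt0 (q / p) (p / q ^+ 2) 0
    | O = gpt tq8].
Proof.
have E1 : q / p / h = q ^+ 2 / p by rewrite invrK mulrAC.
have E2 : h / (q / p) = p / q ^+ 2 by rewrite invf_div w2E mulrC.
have cpq : chart (p / q ^+ 2) (q / p) by rewrite -E2; apply: chart_div.
rewrite T7E exc_pt0 // rmorph0 subr0 E1 E2 T8E [pt0 (p / q ^+ 2) _ _](pt_sym _ _ cpq) -[q ^+ 2 / p]invf_div.
split=> [[[c ->]|->]|[[c c0 ->]|->|->]]; last by left; exists 0.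
- have [->|c0] := eqVneq c 0; first by constructor 3.
  by constructor 1; exists c^-1; rewrite ?invr_eq0 // pt0_inv.
- by constructor 2.
- by left; exists c^-1; rewrite pt0_inv ?invr_eq0 // invrK.
- by right.
Qed.

Let cW8 : chart (q ^+ 2 / p) (p / q ^+ 3).
Proof.
have -> : p / q ^+ 3 = h / (q ^+ 2 / p) by rewrite w3E invf_div mulrC.
exact/chart_swap/chart_div.
Qed.

Lemma gexc_tq8 O : gexc (gpt tq8) O <->
  (exists c, O = pt0 h s0 c) \/ O = pt0 (q ^+ 2 / p) (p / q ^+ 3) 0.
Proof.
have E1 : q ^+ 2 / p / h = s0 by rewrite invrK mulrAC -exprSr.
have E2 : h / (q ^+ 2 / p) = p / q ^+ 3 by rewrite w3E invf_div mulrC.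
rewrite T8E exc_pt0 // rmorph0 subr0 E1 E2.
by rewrite [pt0 (p / q ^+ 3) _ _](pt_sym _ _ (chart_swap cW8)).
Qed.

Let L7 : lacks (p / q) (gpt tq7 :: gpt tq8 :: (segA ++ segB)).
Proof.
rewrite -invf_div; apply: (doms_lacks d7); last exact: chart_y0 ch7.
by rewrite tq7c; apply: val_x.
Qed.

Let L8 : lacks (p / q ^+ 2) (gpt tq8 :: (segA ++ segB)).
Proof.
rewrite -invf_div; apply: (doms_lacks d8); last exact: chart_y0 ch8.
by rewrite tq8c; apply: val_x.
Qed.

Lemma tak_6 c : c != 0 -> gXTak (pt0 h (p / q) c).
Proof.
move=> c0; apply: gXTak_tail; left; split; first by apply/gexc_tq6; constructor 1; exists c.
exact: avoid_lacks (pt0_y _ _ _ _) L7.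
Qed.

Lemma tak_6oo : gXTak (pt0 p^-1 (p / q) 0).
Proof.
apply: gXTak_tail; left; split; first by apply/gexc_tq6; constructor 2.
exact: avoid_lacks (pt0_y _ _ _ _) L7.
Qed.

Lemma tak_7 c : c != 0 -> gXTak (pt0 h (p / q ^+ 2) c).
Proof.
move=> c0; apply: gXTak_tail; right; left; split.
  by apply/gexc_tq7; constructor 1; exists c.
exact: avoid_lacks (pt0_y _ _ _ _) L8.
Qed.

Lemma tak_7oo : gXTak (pt0 (q / p) (p / q ^+ 2) 0).
Proof.
apply: gXTak_tail; right; left; split; first by apply/gexc_tq7; constructor 2.
exact: avoid_lacks (pt0_y _ _ _ _) L8.
Qed.

Let vAs : val zA s0 8. Proof. exact/vA/(val_x k (GCentre s0 h 8 0)). Qed.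
Let vBs : val zB s0 (- 8). Proof. exact/vB/(val_x k (GCentre s0 h (- 8) 0)). Qed.

Lemma tak_W8 : gXTak (pt0 (q ^+ 2 / p) (p / q ^+ 3) 0).
Proof.
have nO : ~ pt0 (q ^+ 2 / p) (p / q ^+ 3) 0 s0.
  rewrite -[s0]invf_div; apply: (val_notV (chart_good 0 0 cW8) (val_y _ _)).
  exact: chart_y0 cW8.
apply: gXTak_tail; right; right; left; split; first by apply/gexc_tq8; right.
suff av : avoid (segA ++ segB) (pt0 (q ^+ 2 / p) (p / q ^+ 3) 0) by [].
apply/avoid_cat; split; apply: (avoid_has nO); first exact: doms_has dA vAs.
exact: doms_has dB vBs.
Qed.

Let avoid_AB c : c != 8 -> c != - 8 -> avoid (segA ++ segB) (pt0 h s0 c).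
Proof.
move=> c1 c2; apply/avoid_cat; split; [apply: (avoid_lacks (pt0_yV chs0 c1))|apply: (avoid_lacks (pt0_yV chs0 c2))].
  apply: (doms_lacks dA); last exact: (step_u0 _ chs0).
  exact: val_sub0 gA vAs.
apply: (doms_lacks dB); last exact: (step_u0 _ chs0).
exact: val_sub0 gB vBs.
Qed.

(** The inverse of the Moebius transformation of [oo_pt]. The value c = 4 corresponds to s = oo, the
    point [z3], which exists only after the contractions. *)
Lemma oo_pt_inv c : c != 4 -> pt0 xi^-1 (F / gg) c = pt0 h s0 (8 * c / (4 - c)).
Proof.
move=> c4; have n4 : 4 - c != 0 by rewrite subr_eq0 eq_sym.
have dE : 2 + 8 * c / (4 - c) / 4 = 8 / (4 - c) by field; rewrite n4 fourC.
rewrite (oo_pt t a1 cqp two0) dE; last by rewrite mulf_neq0 ?invr_eq0.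
by congr pt0; field; rewrite n4 eightC.
Qed.

Lemma tak_oo c : c != 2 -> c != 4 -> gXTak (pt0 xi^-1 (F / gg) c) /\ noncontr (pt0 xi^-1 (F / gg) c).
Proof.
move=> c2 c4; pose d := 8 * c / (4 - c).
have n4 : 4 - c != 0 by rewrite subr_eq0 eq_sym.
have E : pt0 xi^-1 (F / gg) c = pt0 h s0 d := oo_pt_inv c4.
rewrite E; split; last first.
  by right; split; [exact: pt0_x|exact: pt0_y].
apply: gXTak_tail; right; right; left; split; first by apply/gexc_tq8; left; exists d.
have n16 : (16 : C) != 0 by have := expf_neq0 4 two0; rewrite -natrX.
have n32 : (32 : C) != 0 by have := expf_neq0 5 two0; rewrite -natrX.
apply: avoid_AB.
- rewrite -subr_eq0 (_ : d - 8 = 16 * (c - 2) / (4 - c)); last by rewrite /d; field.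
  by rewrite !mulf_neq0 ?invr_eq0 // subr_eq0.
- rewrite -subr_eq0 (_ : d - - 8 = 32 / (4 - c)); last by rewrite /d; field.
  by rewrite mulf_neq0 ?invr_eq0.
Qed.

Let nc_oo z b O : gpt z = b -> val z h 0 -> (exists c, val z s0 c) -> b `<=` O -> noncontr O.
Proof.
by move=> <- vh [c vs] sub; right; split; apply: sub; [exact: (val_pt vh)|exact: (val_pt vs)].
Qed.

Let vhA : val zA h 0. Proof. exact/vA/(val_y k (GCentre s0 h 8 0)). Qed.
Let vhB : val zB h 0. Proof. exact/vB/(val_y k (GCentre s0 h (- 8) 0)). Qed.

Lemma tak_A O : chain xi^-1 (F / gg) fA1 fA2 2 b1 b2 ustep O -> gXTak O /\ noncontr O.
Proof.
move=> H; have sub := chain_ustep_above cA0 EA1 EA2 H; split; last first.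
  by apply: (@nc_oo zA) sub => //; exists 8.
suff lO : late (segA ++ segB) O by apply: gXTak_tail; do 3!right.
apply/late_cat; left; split; first exact/(late_segs b2 cA0 EA1 EA2).
apply: (@avoid_lacks _ (F / gg)); first exact/sub/pt0_y.
rewrite -invf_div; apply: (doms_lacks dB); first exact: val_y.
exact: chart_y0 cB0.
Qed.

Lemma tak_B O : chain xi^-1 (gg / F) gg (F * gg) 0 0 b3 ustep O -> gXTak O /\ noncontr O.
Proof.
move=> H; have sub := chain_ustep_above cB0 EB1 EB2 H; split; last first.
  by apply: (@nc_oo zB) sub => //; exists (- 8).
suff lO : late (segA ++ segB) O by apply: gXTak_tail; do 3!right.
by apply/late_cat; right; apply/(late_segs b3 cB0 EB1 EB2).
Qed.

(** The curve [gexc z2] contains [z1], and [gexc z3] contains [z2], neither of which exists before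
    contraction. The conditions [O (q / p)] and [O (q ^+ 2 / p)] rule them out; they also say that
    the point is on no curve contracted earlier. *)
Lemma tak_cases O : gXTak O -> [\/ gexc z0 O, gexc z1 O, [/\ gexc z2 O, O h & O (q / p)]
  | [/\ gexc z3 O, O h & O (q ^+ 2 / p)]] \/ up O /\ noncontr O.
Proof.
move/foldl_blow1 => [[P1 av]|].
  have [n1 av'] := av; have : avoid tail6 O by have /avoid_cat [] : avoid (head1 ++ tail6) O := av.
  case=> n6 _; case: (P1xP1_points cqp P1) => [[[a [b [a0 ->]]]|[a a0 ->]|[b ->]|[b ->]]|[//|//]].
  - have ah : a / 2 != 0 by rewrite mulf_neq0 ?invr_eq0.
    right; rewrite (aff_pt t a1 cqp two0 b a0); split; last by case: (tak_gen (aff_b t a1 a b) ah).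
    exact: UpGen.
  - have ah : a / 2 != 0 by rewrite mulf_neq0 ?invr_eq0.
    right; rewrite (goo_pt t a1 cqp two0 a0); split; last by case: (tak_goo ah).
    exact: UpGoo.
  - by left; constructor 1; rewrite (exc_z0 cqp); left; exists b.
  - by left; constructor 2; rewrite (exc_z1 cqp); left; exists b.
have hd : late head1 O -> gexc (gpt tq1) O /\ avoid (seg xi (F * gg) a1 ++ seg xi (F * gg) 0) O
  \/ late (seg xi (F * gg) a1 ++ seg xi (F * gg) 0) O by [].
have tl : late tail6 O -> [\/ gexc (gpt tq6) O /\ avoid [:: gpt tq7] O,
  gexc (gpt tq7) O /\ avoid [:: gpt tq8] O, gexc (gpt tq8) O /\ avoid (segA ++ segB) O
  | late (segA ++ segB) O].
  case=> [[e [n _]]|[[e [n _]]|[e|l]]];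
    [constructor 1|constructor 2|constructor 3|constructor 4] => //; by split.
rewrite takE => /late_cat [[/hd {hd tl} H' _]|/tl {hd tl}].
  case: H' => [[/gexc_tq1 H av]|/late_cat [[/(late_seg _ cxF) H _]|/(late_seg _ cxF) H]].
  - have [n2 n4] : O <> pt0 xi (F * gg) a1 /\ O <> pt0 xi (F * gg) 0.
      by case/avoid_cat: av => [[? _] [? _]].
    case: H => [[c c0 E]|->|->].
    + rewrite (zero_pt t a1 cqp two0) in E.
      have [Ec|cn] := eqVneq ((c + 4 * a1) / 8) (a1 / 2).
        case/eqP: c0; have -> : c = 8 * ((c + 4 * a1) / 8 - a1 / 2) by field; rewrite ?two0 ?eightC.
        by rewrite Ec subrr mulr0.
      right; rewrite E.
      have m1 : (c + 4 * a1) / 8 != a1 by apply/eqP => E1; apply: n2; rewrite E E1.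
      have m0 : (c + 4 * a1) / 8 != 0 by apply/eqP => E1; apply: n4; rewrite E E1.
      by split; [exact: UpZero|case: (tak_zero m0 m1 cn)].
    + by left; constructor 1; rewrite (exc_z0 cqp); right.
    + by right; split; [exact: UpZeroOo|case: tak_zoo].
  - by right; split; [exact: UpS1|case: (tak_S1 H)].
  - by right; split; [exact: UpS2|case: (tak_S2 H)].
case=> [[/gexc_tq6 H [n7 _]]|[/gexc_tq7 H [n8 _]]|[/gexc_tq8 H av]|/late_cat].
- case: H => [[c c0 ->]|->|//]; last by left; constructor 2; rewrite (exc_z1 cqp); right.
  left; constructor 3; split; [by rewrite (exc_z2 cqp); left; exists c|exact: pt0_x|].
  by rewrite -[q / p]invf_div; apply: pt0_yV0.
- case: H => [[c c0 ->]|->|//].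
    left; constructor 4; split; [by rewrite (exc_z3 cqp); left; exists c|exact: pt0_x|].
    by rewrite -[q ^+ 2 / p]invf_div; apply: pt0_yV0.
  left; constructor 3; split; [by rewrite (exc_z2 cqp); right| |exact: pt0_x].
  have -> : h = (q / p) * (p / q ^+ 2) by field; rewrite ?q0 ?p0.
  exact: (val_pt (valM (val_x k (zP (q / p) (p / q ^+ 2) 0)) (val_y k (zP (q / p) (p / q ^+ 2) 0)))).
- case: H => [[c E]|->].
    case/avoid_cat: av => [[n9 _] [n15 _]].
    have n8 : c != 8 by apply/eqP => Ec; apply: n9; rewrite E Ec /Submission.pt0 (pt_sym _ _ chs0).
    have m8 : c != - 8 by apply/eqP => Ec; apply: n15; rewrite E Ec /Submission.pt0 (pt_sym _ _ chs0).
    have Nn : 2 + c / 4 != 0.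
      apply: contra_neq m8 => E0; have -> : c = 4 * (2 + c / 4) - 8 by field.
      by rewrite E0 mulr0 add0r.
    right; rewrite E; split; last by right; split; [exact: pt0_x|exact: pt0_y].
    rewrite (oo_pt t a1 cqp two0) //; apply: UpOo.
    apply: contra_neq n8 => E2; have Ec : c = 2 * (2 + c / 4) by rewrite -{1}E2 divfK.
    have -> : c = 2 * (c - 2 * (2 + c / 4)) + 8 by field.
    by rewrite -Ec subrr mulr0 add0r.
  left; constructor 4; split; [by rewrite (exc_z3 cqp); right| |exact: pt0_x].
  have -> : h = (q ^+ 2 / p) * (p / q ^+ 3) by field; rewrite ?q0 ?p0.
  exact: (val_pt (valM (val_x k (zP (q ^+ 2 / p) (p / q ^+ 3) 0)) (val_y k (zP _ _ _)))).
- case=> [[/(late_segs b2 cA0 EA1 EA2) H _]|/(late_segs b3 cB0 EB1 EB2) H].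
    by right; split; [exact: UpA|case: (tak_A H)].
  by right; split; [exact: UpB|case: (tak_B H)].
Qed.

End TakasakiPoints.

(** * The four successive contractions *)

Section TakasakiContraction.
Variables (C : closedFieldType) (K : fieldType) (k : {rmorphism C -> K}).
Implicit Types (x y r s : K) (c d : C) (O R : set K) (S : set (set K)).
Local Notation gpt := (gpt k).
Local Notation val := (val k).
Local Notation chart := (chart k).
Local Notation pt0 := (pt0 k).
Local Notation gexc := (gexc k).
Local Notation gdvr := (gdvr k).

Let zP x y b := @GCentre C K x y 0 b.

Lemma dvr_inv x y y' : chart x y -> y' = y^-1 -> gdvr x y `<=` gdvr x y'.
Proof.
move=> cxy ->; apply: (dvr_via (l := [:: 0])) => c; rewrite inE => c0; exists c^-1.
have gi : good k (zP x y^-1 c^-1) := chart_good _ _ (chart_invy cxy).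
apply: (pt_sub gi); first exact: (val_x k (zP x y^-1 c^-1)).
have ci : c^-1 != 0 by rewrite invr_eq0.
by have := valV ci (val_y k (zP x y^-1 c^-1)); rewrite /= !invrK.
Qed.

Lemma dvr_flip x u : chart x u -> gdvr u (x / u) `<=` gdvr x (u / x).
Proof.
move=> cu; have u0 := chart_y0 cu.
apply: (dvr_via (l := [:: 0])) => c; rewrite inE => c0; exists c^-1.
have gi : good k (zP x (u / x) c^-1) := chart_good _ _ (chart_divy cu).
have ci : c^-1 != 0 by rewrite invr_eq0.
have vx := val_x k (zP x (u / x) c^-1); have vy := val_y k (zP x (u / x) c^-1).
have x0 := chart_x0 cu.
apply: (pt_sub gi) => /=.
  by apply: val_eq (valM vy vx) _ _; rewrite /= ?mulr0 ?divfK.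
by have := valV ci vy; rewrite /= invf_div invrK.
Qed.

Lemma exc_dvr x y b O : chart x y -> gexc (pt0 x y b) O -> O `<=` gdvr x ((y - k b) / x).
Proof.
move=> cxy; rewrite exc_pt0 // => -[[c ->]|->]; first exact: pt0_dvr.
have cu : chart x (y - k b) by apply: chart_suby.
rewrite /Submission.pt0 (pt_sym _ _ (chart_div cu)); apply: subset_trans (dvr_flip cu).
exact: pt0_dvr.
Qed.

Variables (q p : K) (t a1 a2 : C).
Hypothesis cqp : chart q p.
Hypothesis a10 : a1 != 0.
Hypothesis two0 : (2 : C) != 0.

Local Notation xi := (xi q).
Local Notation gg := (gg k q p t a1).
Local Notation b1 := (b1 t).
Local Notation b2 := (b2 t a1 a2).
Local Notation b3 := (b3 a2).
Local Notation h := (q^-1).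
Local Notation s0 := (q ^+ 3 / p).
Local Notation z0 := (z0 k q p).
Local Notation z1 := (z1 k q p).
Local Notation z2 := (z2 k q p).
Local Notation z3 := (z3 k q p).
Local Notation up := (up k xi gg a1 b1 b2 b3).
Local Notation gXTak := (gXTak k q p t a1 a2).
Local Notation noncontr := (noncontr q p).

Let q0 : q != 0 := chart_x0 cqp.
Let p0 : p != 0 := chart_y0 cqp.
Let chp : chart h p := chart_inv cqp.
Let cqs : chart q (q * p). Proof. by rewrite mulrC; apply: chart_muly. Qed.
Let w2E : p / q ^+ 2 = p / q / q. Proof. by rewrite expr2 invfM mulrA. Qed.
Let w3E : p / q ^+ 3 = p / q ^+ 2 / q. Proof. by rewrite exprSr invfM mulrA. Qed.
Let chw1 : chart h (p / q). Proof. exact: chart_muly. Qed.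
Let chw2 : chart h (p / q ^+ 2). Proof. by rewrite w2E; apply: chart_muly. Qed.
Let chw3 : chart h (p / q ^+ 3). Proof. by rewrite w3E; apply: chart_muly. Qed.

Let sub0 O : gexc z0 O -> O `<=` gdvr q p.
Proof. by move/(exc_dvr cqs); rewrite rmorph0 subr0 mulrAC divff // mul1r. Qed.
Let sub1 O : gexc z1 O -> O `<=` gdvr h p.
Proof. by move/(exc_dvr chw1); rewrite rmorph0 subr0 invrK divfK. Qed.
Let sub2 O : gexc z2 O -> O `<=` gdvr h (p / q).
Proof. by move/(exc_dvr chw2); rewrite rmorph0 subr0 invrK w2E divfK. Qed.
Let sub3 O : gexc z3 O -> O `<=` gdvr h (p / q ^+ 2).
Proof. by move/(exc_dvr chw3); rewrite rmorph0 subr0 invrK w3E divfK. Qed.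

Let z0_q O : gexc z0 O -> O q.
Proof. by move/(exc_above (z := zP q (q * p) 0) cqs); apply; apply: pt0_x. Qed.
Let z1_h O : gexc z1 O -> O h.
Proof. by move/(exc_above (z := zP h (p / q) 0) chw1); apply; apply: pt0_x. Qed.

Let hN0 O : O h -> ~ gexc z0 O.
Proof. by move=> Oh /sub0 /(_ _ Oh); apply: dvr_xV. Qed.
Let qN1 O : O q -> ~ gexc z1 O.
Proof. by move=> Oq /sub1 /(_ _ Oq); apply: no_q. Qed.
Let qN2 O : O q -> ~ gexc z2 O.
Proof. by move=> Oq /sub2 /(_ _ Oq); apply: no_q. Qed.
Let qN3 O : O q -> ~ gexc z3 O.
Proof. by move=> Oq /sub3 /(_ _ Oq); apply: no_q. Qed.
Let no_qs : ~ gdvr q p (q * p)^-1.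
Proof.
apply: dvr_no => // [c|]; last exact: chart_y0 cqs.
by apply: val_eq (valM (val_x k (zP q p c)) (val_y k (zP q p c))) _ _; rewrite ?mul0r.
Qed.
Let mulx0 x y r c e : val (zP x y c) r e -> val (zP x y c) (r * x) 0.
Proof. by move=> v; apply: val_eq (valM v (val_x k (zP x y c))) _ _; rewrite ?mulr0. Qed.
Let no_qp : ~ gdvr h p (q / p).
Proof.
rewrite -[q / p]invf_div; apply: dvr_no => // [c|]; last exact: chart_y0 chw1.
exact: mulx0 (val_y k (zP h p c)).
Qed.
Let no_q2 : ~ gdvr h p (q ^+ 2 / p).
Proof.
rewrite -[q ^+ 2 / p]invf_div w2E; apply: dvr_no => // [c|]; last by rewrite -w2E; exact: chart_y0 chw2.
exact/mulx0/mulx0/(val_y k (zP h p c)).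
Qed.
Let no_q2' : ~ gdvr h (p / q) (q ^+ 2 / p).
Proof.
rewrite -[q ^+ 2 / p]invf_div w2E; apply: dvr_no => // [c|]; last by rewrite -w2E; exact: chart_y0 chw2.
exact/mulx0/(val_y k (zP h (p / q) c)).
Qed.

Let noncontrN O : noncontr O -> [/\ ~ gexc z0 O, ~ gexc z1 O, ~ gexc z2 O & ~ gexc z3 O].
Proof.
case=> [[Oq Ohs]|[Oh Os]]; split; try by [apply: qN1|apply: qN2|apply: qN3|apply: hN0].
- by case: Ohs => [/hN0 //|Os /sub0 /(_ _ Os)].
- by move/sub1/(_ _ Os); apply: no_s0_1.
- by move/sub2/(_ _ Os); apply: no_s0_2.
- by move/sub3/(_ _ Os); apply: no_s0_3.
Qed.

Definition tS R : set (set K) := [set O | gXTak O /\ O `<=` R].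
Definition gsig1 := gcontr (tS (gdvr q p)).
Definition gsig2 := gcontr (gsig1 @` tS (gdvr h p)) \o gsig1.
Definition gsig3 := gcontr (gsig2 @` tS (gdvr h (p / q))) \o gsig2.
Definition gsig := gcontr (gsig3 @` tS (gdvr h (p / q ^+ 2))) \o gsig3.

Let cases O := tak_cases (t := t) (a2 := a2) cqp a10 two0 (O := O).

Lemma S1E : tS (gdvr q p) = gexc z0.
Proof.
apply/seteqP; split=> O.
  case=> /cases [[//|/z1_h Oh|[_ Oh _]|[_ Oh _]]|[_ nc]] OR.
  - by case: (dvr_xV cqp (OR _ Oh)).
  - by case: (dvr_xV cqp (OR _ Oh)).
  - by case: (dvr_xV cqp (OR _ Oh)).
  - case: nc => [[_ [Oh|Os]]|[Oh _]]; [case: (dvr_xV cqp (OR _ Oh))|case: (no_qs (OR _ Os))|case: (dvr_xV cqp (OR _ Oh))].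
move=> e; split; last exact: sub0.
move: e; rewrite (exc_z0 cqp) => -[[c ->]|->]; [exact: tak_q0|exact: tak_W0].
Qed.

Let sig1_z0 O : gexc z0 O -> gsig1 O = z0.
Proof. by rewrite /gsig1 S1E; exact: gcontr_exc. Qed.
Let sig1_out O : ~ gexc z0 O -> gsig1 O = O.
Proof. by rewrite /gsig1 S1E; exact: gcontr_out. Qed.

Let oo_cases O y : chart h y -> O `<=` gdvr h y -> ~ gdvr h y s0 -> gXTak O ->
  [\/ gexc z1 O, [/\ gexc z2 O, O h & O (q / p)] | [/\ gexc z3 O, O h & O (q ^+ 2 / p)]].
Proof.
move=> cy OR ns /cases [[/z0_q Oq|||]|[_ [[Oq _]|[_ Os]]]]; try by [constructor 1|constructor 2|constructor 3].
- by case: (no_q cy (OR _ Oq)).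
- by case: (no_q cy (OR _ Oq)).
- by case: (ns (OR _ Os)).
Qed.

Lemma S2E : gsig1 @` tS (gdvr h p) = gexc z1.
Proof.
apply/seteqP; split=> O.
  case=> O1 [X1 OR <-]; case: (oo_cases chp OR (no_s0_1 cqp) X1) => [e|[_ _ o]|[_ _ o]].
  - by rewrite (sig1_out (hN0 (z1_h e))).
  - by case: (no_qp (OR _ o)).
  - by case: (no_q2 (OR _ o)).
move=> e; exists O; last exact: (sig1_out (hN0 (z1_h e))).
split; last exact: sub1.
by move: e; rewrite (exc_z1 cqp) => -[[c ->]|->]; [exact: tak_qoo|exact: tak_6oo].
Qed.

Let sig2_z1 O : gexc z1 O -> gsig2 O = z1.
Proof.
by move=> e; rewrite /gsig2 /= (sig1_out (hN0 (z1_h e))) S2E; exact: gcontr_exc.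
Qed.
Let sig2_out O : ~ gexc z0 O -> ~ gexc z1 O -> gsig2 O = O.
Proof. by move=> n0 n1; rewrite /gsig2 /= sig1_out // S2E gcontr_out. Qed.

(** Once {q = oo} is contracted to [z1], the image of F_6 - F_7 is the whole exceptional curve of
    [z2], so that [gcontr_exc] applies to the next contraction. *)
Lemma S3E : gsig2 @` tS (gdvr h (p / q)) = gexc z2.
Proof.
have z12 : gexc z2 z1 by rewrite (exc_z2 cqp); left; exists 0.
have fix2 O : O h -> O (q / p) -> gsig2 O = O.
  move=> Oh o; apply: sig2_out; first exact: hN0.
  by move/sub1/(_ _ o).
apply/seteqP; split=> O.
  case=> O1 [X1 OR <-]; case: (oo_cases chw1 OR (no_s0_2 cqp) X1) => [e|[e Oh o]|[_ _ o]].
  - by rewrite sig2_z1.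
  - by rewrite fix2.
  - by case: (no_q2' (OR _ o)).
rewrite (exc_z2 cqp) => -[[c ->]|->].
  have [->|c0] := eqVneq c 0.
    (* The point [z1] is not on the original curve: it is reached from the intersection of F_6 - F_7
       with {q = oo}, which has just been contracted to it. *)
    exists (pt0 p^-1 (p / q) 0).
      split; first exact: tak_6oo.
      have cpq : chart p^-1 (p / q).
        by have := chart_div (chart_invy chp); rewrite invrK mulrC => /chart_swap.
      rewrite /Submission.pt0 (pt_sym _ _ cpq).
      have := @exc_dvr h p^-1 0 (gpt (GCentre (p / q) p^-1 0 0)) (chart_invy chp).
      rewrite rmorph0 subr0 invrK exc_pt0; last exact: chart_invy.
      rewrite rmorph0 subr0 !invrK [h * p]mulrC => H.
      apply: (subset_trans (H _)); first by right.
      rewrite [p^-1 * q]mulrC; apply: dvr_inv; last by rewrite invf_div.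
      by rewrite -[q / p]invf_div; apply: chart_invy.
    by apply: sig2_z1; rewrite (exc_z1 cqp); right.
  exists (pt0 h (p / q) c).
    by split; [exact: tak_6|exact: pt0_dvr].
  by apply: fix2; [exact: pt0_x|rewrite -[q / p]invf_div; apply: pt0_yV0].
have Oq : pt0 (q / p) (p / q ^+ 2) 0 (q / p) by apply: pt0_x.
have Oh : pt0 (q / p) (p / q ^+ 2) 0 h.
  have -> : h = (q / p) * (p / q ^+ 2) by field; rewrite ?q0 ?p0.
  exact: (val_pt (valM (val_x k (zP (q / p) (p / q ^+ 2) 0)) (val_y k (zP _ _ _)))).
exists (pt0 (q / p) (p / q ^+ 2) 0); last exact: fix2.
by split; [exact: tak_7oo|apply: sub2; rewrite (exc_z2 cqp); right].
Qed.

Let sig3_z2 O : gexc z1 O \/ gexc z2 O /\ O h /\ O (q / p) -> gsig3 O = z2.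
Proof.
have z12 : gexc z2 z1 by rewrite (exc_z2 cqp); left; exists 0.
rewrite /gsig3 /= S3E; case=> [e|[e [Oh o]]]; first by rewrite sig2_z1 //; apply: gcontr_exc.
by rewrite sig2_out; [exact: gcontr_exc|exact: hN0|move/sub1/(_ _ o)].
Qed.
Let sig3_out O : ~ gexc z0 O -> ~ gexc z1 O -> ~ gexc z2 O -> gsig3 O = O.
Proof. by move=> n0 n1 n2; rewrite /gsig3 /= S3E sig2_out // gcontr_out. Qed.
Let sig3_q2 O : O h -> O (q ^+ 2 / p) -> gsig3 O = O.
Proof.
move=> Oh o; apply: sig3_out; [exact: hN0|by move/sub1/(_ _ o)|by move/sub2/(_ _ o)].
Qed.

Lemma S4E : gsig3 @` tS (gdvr h (p / q ^+ 2)) = gexc z3.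
Proof.
have z23 : gexc z3 z2 by rewrite (exc_z3 cqp); left; exists 0.
apply/seteqP; split=> O.
  case=> O1 [X1 OR <-]; case: (oo_cases chw2 OR (no_s0_3 cqp) X1) => [e|[e Oh o]|[e Oh o]].
  - by rewrite sig3_z2 //; left.
  - by rewrite sig3_z2 //; right.
  - by rewrite sig3_q2.
rewrite (exc_z3 cqp) => -[[c ->]|->].
  have [->|c0] := eqVneq c 0.
    (* Likewise [z2] is reached from the intersection of F_7 - F_8 with F_6 - F_7. *)
    exists (pt0 (q / p) (p / q ^+ 2) 0).
      split; first exact: tak_7oo.
      have ch7 : chart h (q / p) by rewrite -[q / p]invf_div; apply: chart_invy.
      have cpq : chart (q / p) (p / q ^+ 2).
        have := chart_div ch7; rewrite invf_div mulrC -w2E; exact: chart_swap.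
      rewrite /Submission.pt0 (pt_sym _ _ cpq).
      have := @exc_dvr h (q / p) 0 (gpt (GCentre (p / q ^+ 2) (q / p) 0 0)) ch7.
      rewrite exc_pt0 // rmorph0 subr0 invf_div [h * _]mulrC -w2E invrK => H.
      apply: (subset_trans (H _)); first by right.
      have E2 : q / p * q = q ^+ 2 / p by rewrite mulrAC.
      rewrite E2; apply: dvr_inv; last by rewrite invf_div.
      by rewrite -[q ^+ 2 / p]invf_div; apply: chart_invy.
    apply: sig3_z2; right; split; first by rewrite (exc_z2 cqp); right.
    split; last exact: pt0_x.
    have -> : h = (q / p) * (p / q ^+ 2) by field; rewrite ?q0 ?p0.
    exact: (val_pt (valM (val_x k (zP (q / p) (p / q ^+ 2) 0)) (val_y k (zP _ _ _)))).
  exists (pt0 h (p / q ^+ 2) c).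
    by split; [exact: tak_7|exact: pt0_dvr].
  by apply: sig3_q2; [exact: pt0_x|rewrite -[q ^+ 2 / p]invf_div; apply: pt0_yV0].
have Oq : pt0 (q ^+ 2 / p) (p / q ^+ 3) 0 (q ^+ 2 / p) by apply: pt0_x.
have Oh : pt0 (q ^+ 2 / p) (p / q ^+ 3) 0 h.
  have -> : h = (q ^+ 2 / p) * (p / q ^+ 3) by field; rewrite ?q0 ?p0.
  exact: (val_pt (valM (val_x k (zP (q ^+ 2 / p) (p / q ^+ 3) 0)) (val_y k (zP _ _ _)))).
exists (pt0 (q ^+ 2 / p) (p / q ^+ 3) 0); last exact: sig3_q2.
by split; [exact: tak_W8|apply: sub3; rewrite (exc_z3 cqp); right].
Qed.

Lemma gsig_fix O : noncontr O -> gsig O = O.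
Proof. by case/noncontrN => n0 n1 n2 n3; rewrite /gsig /= S4E sig3_out // gcontr_out. Qed.

Lemma gsig_z0 O : gexc z0 O -> gsig O = z0.
Proof.
move=> e; have zq : z0 q by apply: pt0_x.
have E2 : gsig2 O = z0 by rewrite /gsig2 /= sig1_z0 // S2E; apply/gcontr_out/(qN1 zq).
have E3 : gsig3 O = z0 by rewrite /gsig3 /= E2 S3E; apply/gcontr_out/(qN2 zq).
by rewrite /gsig /= E3 S4E; apply/gcontr_out/(qN3 zq).
Qed.

Lemma gsig_z3 O : gexc z1 O \/ gexc z2 O /\ O h /\ O (q / p) \/
  gexc z3 O /\ O h /\ O (q ^+ 2 / p) -> gsig O = z3.
Proof.
have z23 : gexc z3 z2 by rewrite (exc_z3 cqp); left; exists 0.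
have G : gexc z3 (gsig3 O) -> gsig O = z3 by rewrite /gsig /= S4E => e; apply: gcontr_exc.
case=> [e|[e|[e [Oh o]]]]; apply: G.
- by rewrite sig3_z2 //; left.
- by rewrite sig3_z2 //; right.
- by rewrite sig3_q2.
Qed.

Lemma gsig_sub O : gsig O `<=` O.
Proof.
do 3!(apply: (subset_trans (@gcontr_sub _ _ _))).
exact: gcontr_sub.
Qed.

(** The contractions produce only two new points, [z0] and [z3], and in the coordinates xi and g
    these are the ordinary points f g = a_1 / 2 and f / g = 4 of the two fibres. *)
Lemma gsig_up O : gXTak O -> up (gsig O).
Proof.
have fourC : (4 : C) != 0 by have := expf_neq0 2 two0; rewrite -natrX.
have n42 : (4 : C) != 2 by rewrite -subr_eq0 (_ : 4 - 2 = 2 :> C) //; ring.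
have U3 : up z3 by rewrite /Submission.z3 (oo_pt4 t a1 cqp two0); apply: UpOo.
case/cases => [[e|e|[e Oh o]|[e Oh o]]|[u nc]]; last by rewrite gsig_fix.
- rewrite gsig_z0 // (z0E t a1 cqp two0); have h2 : a1 / 2 != 0 by rewrite mulf_neq0 // invr_eq0.
  apply: UpZero => //; apply: contraNneq h2 => E; have : a1 - a1 / 2 = 0 by rewrite E subrr.
  by rewrite (_ : a1 - a1 / 2 = a1 / 2); [move/eqP|field].
- by rewrite gsig_z3 //; left.
- by rewrite gsig_z3 //; right; left.
- by rewrite gsig_z3 //; right; right.
Qed.

End TakasakiContraction.

(** * Images of the curves *)

Section CurveImages.
Variables (C : closedFieldType) (K : fieldType) (k : {rmorphism C -> K}).
Implicit Types (x y r s : K) (c d : C) (O R : set K) (S : set (set K)).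
Local Notation gpt := (gpt k).
Local Notation val := (val k).
Local Notation chart := (chart k).
Local Notation pt0 := (pt0 k).
Local Notation gexc := (gexc k).
Local Notation gdvr := (gdvr k).
Local Notation f1 := (f1 k).
Local Notation f2 := (f2 k).
Local Notation f3 := (f3 k).
Local Notation e1 := (e1 k).
Local Notation e2 := (e2 k).
Local Notation e3 := (e3 k).
Local Notation ustep := (ustep k).
Local Notation dvrL := (dvrL k).
Local Notation dvrE := (dvrE k).

Let zP x y b := @GCentre C K x y 0 b.

(** The upstairs counterparts of [dvrL] and [dvrE]. The slope is divided by x once more in [udvrE],
    because [{f1}] comes from a second blow-up. *)
Definition udvrL x y b := gdvr (y - k b) (x / (y - k b)).
Definition udvrE x y b := gdvr x ((y - k b) / x ^+ 2).

Section Local.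
Variables (x y : K) (b : C).
Hypothesis cxy : chart x y.
Local Notation u := (y - k b).
Let cu : chart x u := chart_suby b cxy.
Let u0 : u != 0 := chart_y0 cu.
Let x0 : x != 0 := chart_x0 cu.

Lemma f1_dvrE c : f1 x y b c `<=` udvrE x y b.
Proof. by rewrite f1E; apply: pt0_dvr. Qed.

Lemma f2_dvrL d : f2 x y b d `<=` udvrL x y b.
Proof. exact: pt0_dvr. Qed.

Lemma f3_dvrE : f3 x y b `<=` udvrE x y b.
Proof.
have := @exc_dvr _ _ k x (u / x) 0 (f3 x y b) (chart_e1 b cxy).
rewrite rmorph0 subr0 -mulrA -invfM -expr2; apply.
have := exc_f1 b cxy; rewrite /Submission.uO /Submission.e1 => ->; by right.
Qed.

Lemma f3_dvrL : f3 x y b `<=` udvrL x y b.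
Proof.
have cv : chart x (u / x) := chart_e1 b cxy.
have c3 : chart (u / x) (x ^+ 2 / u).
  have -> : x ^+ 2 / u = x / (u / x) by rewrite invf_div mulrA -expr2.
  exact/chart_swap/chart_div.
rewrite f3E // (pt_sym _ _ c3); apply: (subset_trans (@pt0_dvr _ _ k (x ^+ 2 / u) (u / x) 0)).
apply: (dvr_via (l := [:: 0])) => c; rewrite inE => c0; exists c^-1.
have cL : chart u (x / u) by apply/chart_swap/chart_div.
have gi : good k (zP u (x / u) c^-1) := chart_good _ _ cL.
have ci : c^-1 != 0 by rewrite invr_eq0.
have vx := val_x k (zP u (x / u) c^-1); have vy := val_y k (zP u (x / u) c^-1).
apply: (pt_sub gi) => /=.
  apply: val_eq (valM (valXn 2 vy) vx) _ _; rewrite /= ?mulr0 //.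
  by field.
by have := valV ci vy; rewrite /= invf_div invrK.
Qed.

Lemma f2_dvr0 : f2 x y b 0 `<=` gdvr x y.
Proof.
have cL : chart (x / u) u by apply/chart_div.
rewrite /Submission.f2 /Submission.pt0 (pt_sym _ _ (chart_swap cL)).
apply: (subset_trans (@pt0_dvr _ _ k (x / u) u 0)).
apply: (dvr_via (l := [:: 0])) => c; rewrite inE => c0; exists (c + b).
have gi : good k (zP x y (c + b)) := chart_good _ _ cxy.
have vx := val_x k (zP x y (c + b)); have vy := val_y k (zP x y (c + b)).
have vu : val (zP x y (c + b)) u c.
  by apply: val_eq (valB gi vy (val_cst k _ b)) _ _; rewrite // addrK.
apply: (pt_sub gi) => //=.
by apply: val_eq (val_div c0 vx vu) _ _; rewrite // mul0r.
Qed.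

End Local.

Variables (fs tau : {rmorphism K -> K}).
Hypothesis fk : forall a, fs (k a) = k a.
Hypothesis tk : forall a, tau (k a) = k a.
Hypothesis tf : forall r, tau (fs r) = fs r.
Variables (q p f g : K) (t a1 a2 : C).
Hypothesis cqp : chart q p.
Hypothesis a10 : a1 != 0.
Hypothesis two0 : (2 : C) != 0.

Local Notation xi := (xi q).
Local Notation gg := (gg k q p t a1).
Local Notation b1 := (b1 t).
Local Notation b2 := (b2 t a1 a2).
Local Notation b3 := (b3 a2).
Local Notation F := (xi ^+ 2).
Local Notation gXTak := (gXTak k q p t a1 a2).
Local Notation gXOkt := (gXOkt k f g a1 b1 b2 b3).
Local Notation noncontr := (noncontr q p).
Local Notation gsig := (gsig k q p t a1 a2).
Local Notation tS := (tS k q p t a1 a2).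
Local Notation fA1 := (fA1 k F gg).
Local Notation fA2 := (fA2 k F gg b1).
Local Notation gA1 := (Submission.fA1 k f g).
Local Notation gA2 := (Submission.fA2 k f g b1).
Local Notation cover := (cover k fs tau).

Hypothesis cv : cover f g xi gg.
Let cfg : chart f g. Proof. by case: cv. Qed.
Let twoK : (2 : K) != 0. Proof. by rewrite -(rmorph_nat k) fmorph_eq0. Qed.

Definition dS R : set (set K) := [set O | gXOkt O /\ O `<=` R].
Definition gphi O := pre fs (gsig O).

Lemma gphi_XOkt O : gXTak O -> gXOkt (gphi O).
Proof. by move/(gsig_up cqp a10 two0)/(up_down twoK fk tk tf cv) => [/(down_XOkt cfg a10)]. Qed.

(** One inclusion only compares valuation rings, using that a contraction shrinks local rings
    ([gsig_sub]). The other lifts each point of the target curve, for which the lists of the lemmas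
    named [on_] are made. *)
Lemma curve_image Rup Rdn : (forall O, O `<=` Rup -> pre fs O `<=` Rdn) ->
  (forall O, gXOkt O -> O `<=` Rdn -> exists O1, [/\ gXTak O1, O1 `<=` Rup & gphi O1 = O]) ->
  gphi @` tS Rup = dS Rdn.
Proof.
move=> sub lift; apply/seteqP; split=> O.
  case=> O1 [X1 OR <-]; split; first exact: gphi_XOkt.
  by apply: sub; apply: subset_trans OR; apply: gsig_sub.
by case=> XO OR; have [O1 [X1 R1 <-]] := lift O XO OR; exists O1.
Qed.

Let lift_nc O O' Rup : gXTak O /\ noncontr O -> O `<=` Rup -> pre fs O = O' ->
  exists O1, [/\ gXTak O1, O1 `<=` Rup & gphi O1 = O'].
Proof.
by move=> [XO nc] OR E; exists O; split=> //; rewrite /gphi (gsig_fix t a2 cqp a10 two0).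
Qed.

Lemma sqrt_ex d : exists c : C, c ^+ 2 = d.
Proof.
have /closed_rootP [c /rootP] : size ('X^2 - d%:P) != 1%N by rewrite size_XnsubC.
by rewrite !hornerE ?hornerXn => /eqP; rewrite subr_eq0 => /eqP E; exists c.
Qed.

Section StepImages.
Variables (x y xi' eta : K) (b : C).
Hypothesis cv' : cover x y xi' eta.
Let cxe : chart xi' eta. Proof. by case: cv'. Qed.
Let cxy : chart x y. Proof. by case: cv'. Qed.

Lemma image_L : (forall O, ustep xi' eta b (fun=> False) O -> gXTak O /\ noncontr O) ->
  (forall O, gXOkt O -> O `<=` dvrL x y b -> (exists d, O = e2 x y b d) \/ O = e3 x y b) ->
  gphi @` tS (udvrL xi' eta b) = dS (dvrL x y b).
Proof.
move=> ok on; apply: curve_image => [O OR|O XO OR].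
  exact: (pre_dvr' twoK fk tk tf (cover_f2 fk tk tf cv' b)).
case: (on O XO OR) => [[d ->]|->].
  (* L is covered by squaring, so its points are lifted by a square root of the coordinate. *)
  have [c <-] := sqrt_ex d.
  apply: (@lift_nc (f2 xi' eta b c)); last exact: (pre_f2 twoK fk tk tf b cv').
    by apply: ok; constructor 2; exists c.
  exact: f2_dvrL.
apply: (@lift_nc (f3 xi' eta b)); last exact: (pre_f3 twoK fk tk tf b cv').
  by apply: ok; constructor 3.
exact: f3_dvrL.
Qed.

(** The third alternative is the point of E on the next L. Its lift belongs to the next step, at
    coordinate 0 of the next curve [{f2}], and it also lies on this curve by [f2_dvr0]. *)
Lemma image_E nxt y' eta' b' :
  (forall O, ustep xi' eta b nxt O -> gXTak O /\ noncontr O) ->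
  (y' = (y - k b) / x -> eta' = (eta - k b) / xi' ^+ 2 -> 
   forall O, gXOkt O -> O `<=` dvrE x y b ->
    [\/ exists2 c, nxt c & O = e1 x y b c, O = e3 x y b | O = e2 x y' b' 0 /\
      gXTak (f2 xi' eta' b' 0) /\ noncontr (f2 xi' eta' b' 0)]) ->
  y' = (y - k b) / x -> eta' = (eta - k b) / xi' ^+ 2 ->
  gphi @` tS (udvrE xi' eta b) = dS (dvrE x y b).
Proof.
move=> ok on Ey Ee; have cvn : cover x y' xi' eta' by rewrite Ey Ee; exact: (cover_f1 fk cv' b).
apply: curve_image => [O OR|O XO OR].
  exact: (pre_dvr twoK fk tk tf (cover_f1 fk cv' b)).
case: (on Ey Ee O XO OR) => [[c nc ->]|->|[-> [X2 nc]]].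
- apply: (@lift_nc (f1 xi' eta b c)); last exact: (pre_f1 twoK fk tk tf b cv').
    by apply: ok; constructor 1; exists c.
  exact: f1_dvrE.
- apply: (@lift_nc (f3 xi' eta b)); last exact: (pre_f3 twoK fk tk tf b cv').
    by apply: ok; constructor 3.
  exact: f3_dvrE.
- apply: (@lift_nc (f2 xi' eta' b' 0)) => //; last first.
    by rewrite (pre_f2 twoK fk tk tf b' cvn) expr0n.
  by rewrite /udvrE -Ee; apply: f2_dvr0; case: cvn.
Qed.

Lemma image_Elast : (forall O, ustep xi' eta b (@any C) O -> gXTak O /\ noncontr O) ->
  (forall O, gXOkt O -> O `<=` dvrE x y b ->
    (exists2 c, any c & O = e1 x y b c) \/ O = e3 x y b) ->
  gphi @` tS (udvrE xi' eta b) = dS (dvrE x y b).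
Proof.
move=> ok on; apply: (@image_E (@any C) _ _ b ok _ erefl erefl) => _ _ O XO OR.
by case: (on O XO OR); [constructor 1|constructor 2].
Qed.

End StepImages.

Lemma ustep_mono (nxt nxt' : C -> Prop) x y b O : (forall c, nxt c -> nxt' c) ->
  ustep x y b nxt O -> ustep x y b nxt' O.
Proof. by move=> s [[c /s nc ->]|H|->]; [constructor 1; exists c|constructor 2|constructor 3]. Qed.

Let dn O : gXOkt O -> down k f g a1 b1 b2 b3 (step k) O := fun H => XOkt_down cfg H.

Let cv0 : cover f (f * g) xi (F * gg) := cover_zero cv.
Let cvA0 : cover f^-1 (f / g) xi^-1 (F / gg) := cover_A0 cv.
Let cvA1 : cover f^-1 gA1 xi^-1 fA1 := cover_A1 fk cv.
Let cvA2 : cover f^-1 gA2 xi^-1 fA2 := cover_A2 fk b1 cv.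
Let cvB0 : cover f^-1 (g / f) xi^-1 (gg / F) := cover_B0 cv.
Let cvB1 : cover f^-1 g xi^-1 gg := cover_B1 cv.
Let cvB2 : cover f^-1 (f * g) xi^-1 (F * gg) := cover_B2 cv.

Let okA0 O : ustep xi^-1 (F / gg) 2 (ne b1) O -> gXTak O /\ noncontr O.
Proof. by move=> H; apply: (tak_A cqp two0); constructor 1. Qed.
Let okA1 O : ustep xi^-1 fA1 b1 (ne b2) O -> gXTak O /\ noncontr O.
Proof. by move=> H; apply: (tak_A cqp two0); constructor 2. Qed.
Let okA2 O : ustep xi^-1 fA2 b2 (@any C) O -> gXTak O /\ noncontr O.
Proof. by move=> H; apply: (tak_A cqp two0); constructor 3. Qed.
Let okB0 O : ustep xi^-1 (gg / F) 0 (ne 0) O -> gXTak O /\ noncontr O.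
Proof. by move=> H; apply: (tak_B cqp two0); constructor 1. Qed.
Let okB1 O : ustep xi^-1 gg 0 (ne b3) O -> gXTak O /\ noncontr O.
Proof. by move=> H; apply: (tak_B cqp two0); constructor 2. Qed.
Let okB2 O : ustep xi^-1 (F * gg) b3 (@any C) O -> gXTak O /\ noncontr O.
Proof. by move=> H; apply: (tak_B cqp two0); constructor 3. Qed.
Let ok1 O : ustep xi (F * gg) a1 (@any C) O -> gXTak O /\ noncontr O := tak_S1 a2 cqp a10 two0 (O := O).
Let ok2 O : ustep xi (F * gg) 0 (@any C) O -> gXTak O /\ noncontr O := tak_S2 a2 cqp a10 two0 (O := O).
Let f2_in x y b nxt d : ustep x y b nxt (f2 x y b d). Proof. by constructor 2; exists d. Qed.

Let z_in : 0 \in [:: 0; a1]. Proof. by rewrite inE eqxx. Qed.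
Let a_in : a1 \in [:: 0; a1]. Proof. by rewrite !inE eqxx orbT. Qed.
Let a10' : 0 != a1. Proof. by rewrite eq_sym. Qed.

Lemma img_C1 : gphi @` tS (udvrL xi (F * gg) a1) = dS (dvrL f (f * g) a1).
Proof.
apply: (image_L cv0) => O H; first by apply: ok1; exact: ustep_mono H.
exact: (on_zeroL cfg (dn H) a_in z_in a10).
Qed.

Lemma img_C2 : gphi @` tS (udvrL xi (F * gg) 0) = dS (dvrL f (f * g) 0).
Proof.
apply: (image_L cv0) => O H; first by apply: ok2; exact: ustep_mono H.
exact: (on_zeroL cfg (dn H) z_in a_in a10').
Qed.

Lemma img_F3 : gphi @` tS (udvrE xi (F * gg) a1) = dS (dvrE f (f * g) a1).
Proof.
by apply: (image_Elast cv0) => // O H; exact: (on_zeroE cfg (dn H) a_in z_in a10).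
Qed.

Lemma img_F5 : gphi @` tS (udvrE xi (F * gg) 0) = dS (dvrE f (f * g) 0).
Proof.
by apply: (image_Elast cv0) => // O H; exact: (on_zeroE cfg (dn H) z_in a_in a10').
Qed.

Lemma img_C6 : gphi @` tS (udvrL xi^-1 (F / gg) 2) = dS (dvrL f^-1 (f / g) 2).
Proof.
apply: (image_L cvA0) => O H; first by apply: okA0; exact: ustep_mono H.
exact: (on_L6 cfg (dn H)).
Qed.

Lemma img_C8 : gphi @` tS (udvrL xi^-1 fA1 b1) = dS (dvrL f^-1 gA1 b1).
Proof.
apply: (image_L cvA1) => O H; first by apply: okA1; exact: ustep_mono H.
exact: (on_L7 cfg (dn H)).
Qed.

Lemma img_C10 : gphi @` tS (udvrL xi^-1 fA2 b2) = dS (dvrL f^-1 gA2 b2).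
Proof.
apply: (image_L cvA2) => O H; first by apply: okA2; exact: ustep_mono H.
exact: (on_L8 cfg (dn H)).
Qed.

Lemma img_C11 : gphi @` tS (udvrL xi^-1 (gg / F) 0) = dS (dvrL f^-1 (g / f) 0).
Proof.
apply: (image_L cvB0) => O H; first by apply: okB0; exact: ustep_mono H.
exact: (on_L5 cfg (dn H)).
Qed.

Lemma img_C13 : gphi @` tS (udvrL xi^-1 gg 0) = dS (dvrL f^-1 g 0).
Proof.
apply: (image_L cvB1) => O H; first by apply: okB1; exact: ustep_mono H.
exact: (on_L4 cfg (dn H)).
Qed.

Lemma img_C15 : gphi @` tS (udvrL xi^-1 (F * gg) b3) = dS (dvrL f^-1 (f * g) b3).
Proof.
apply: (image_L cvB2) => O H; first by apply: okB2; exact: ustep_mono H.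
exact: (on_L3 cfg (dn H)).
Qed.

Lemma img_F14 : gphi @` tS (udvrE xi^-1 fA2 b2) = dS (dvrE f^-1 gA2 b2).
Proof. by apply: (image_Elast cvA2) => // O H; exact: (on_E8 cfg (dn H)). Qed.

Lemma img_F20 : gphi @` tS (udvrE xi^-1 (F * gg) b3) = dS (dvrE f^-1 (f * g) b3).
Proof. by apply: (image_Elast cvB2) => // O H; exact: (on_E2 cfg (dn H)). Qed.

Lemma img_C7 : gphi @` tS (udvrE xi^-1 (F / gg) 2) = dS (dvrE f^-1 (f / g) 2).
Proof.
apply: (image_E cvA0 (y' := gA1) (eta' := fA1) (b' := b1) okA0).
- move=> _ _ O H OR; case: (on_D4 cfg (dn H) OR) => [?|?|->]; [by constructor 1|by constructor 2|constructor 3].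
  by split=> //; apply/okA1/f2_in.
- by [].
- by rewrite exprVn.
Qed.

Lemma img_C9 : gphi @` tS (udvrE xi^-1 fA1 b1) = dS (dvrE f^-1 gA1 b1).
Proof.
apply: (image_E cvA1 (y' := gA2) (eta' := fA2) (b' := b2) okA1).
- move=> _ _ O H OR; case: (on_D5 cfg (dn H) OR) => [?|?|->]; [by constructor 1|by constructor 2|constructor 3].
  by split=> //; apply/okA2/f2_in.
- by [].
- by rewrite exprVn.
Qed.

Lemma img_C12 : gphi @` tS (udvrE xi^-1 (gg / F) 0) = dS (dvrE f^-1 (g / f) 0).
Proof.
apply: (image_E cvB0 (y' := g) (eta' := gg) (b' := 0) okB0).
- move=> _ _ O H OR; case: (on_D2 cfg (dn H) OR) => [?|?|->]; [by constructor 1|by constructor 2|constructor 3].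
  by split=> //; apply/okB1/f2_in.
- exact: (B1E cfg).
- by rewrite exprVn rmorph0 subr0 invrK divfK // expf_neq0 // (xi0 cqp two0).
Qed.

Lemma img_C14 : gphi @` tS (udvrE xi^-1 gg 0) = dS (dvrE f^-1 g 0).
Proof.
apply: (image_E cvB1 (y' := (f * g)) (eta' := (F * gg)) (b' := b3) okB1).
- move=> _ _ O H OR; case: (on_D1 cfg (dn H) OR) => [?|?|->]; [by constructor 1|by constructor 2|constructor 3].
  by split=> //; apply/okB2/f2_in.
- exact: (B2E k f g).
- by rewrite exprVn rmorph0 subr0 invrK mulrC.
Qed.

Let cxF : chart xi (F * gg). Proof. by case: cv0. Qed.
Let cA : chart xi^-1 (F / gg). Proof. by case: cvA0. Qed.
Let cB : chart xi^-1 (gg / F). Proof. by case: cvB0. Qed.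
Let cxg : chart xi gg. Proof. by case: cv. Qed.
Let cqs : chart q (q * p). Proof. by rewrite mulrC; apply: chart_muly. Qed.
Let fourC : (4 : C) != 0. Proof. by have := expf_neq0 2 two0; rewrite -natrX. Qed.
Let eightC : (8 : C) != 0. Proof. by have := expf_neq0 3 two0; rewrite -natrX. Qed.
Let q0 : q != 0 := chart_x0 cqp.
Let p0 : p != 0 := chart_y0 cqp.
Let chs0 : chart q^-1 (q ^+ 3 / p).
Proof.
have -> : q ^+ 3 / p = p^-1 / q^-1 / q^-1 / q^-1 by rewrite !invrK; field; rewrite p0.
exact/chart_divy/chart_divy/chart_divy/chart_invy/chart_inv.
Qed.

Lemma exc_tq1_dvr O : gexc (gpt (tq1 C q p)) O -> O `<=` gdvr xi (F * gg).
Proof.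
have c1 : chart q p^-1 := chart_invy cqp.
move/(@exc_dvr _ _ k q p^-1 0 O c1); rewrite rmorph0 subr0 => s; apply: (subset_trans s).
have -> : p^-1 / q = (q * p)^-1 by rewrite invfM mulrC.
apply: (@subset_trans _ (gdvr q (q * p))); first by apply: dvr_inv; rewrite ?invrK //; apply: chart_invy.
apply: (dvr_via (l := [::])) => c _; exists ((c + 4 * a1) / 8).
by rewrite (zero_pt t a1 cqp two0).
Qed.

Lemma exc_tq8_dvr O : gexc (gpt (tq8 k q p)) O -> O `<=` gdvr xi^-1 (F / gg).
Proof.
have c1 : chart q^-1 (q ^+ 2 / p).
  have -> : q ^+ 2 / p = p^-1 / q^-1 / q^-1 by rewrite !invrK; field; rewrite p0.
  exact/chart_divy/chart_divy/chart_invy/chart_inv.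
have -> : gpt (tq8 k q p) = pt0 q^-1 (q ^+ 2 / p) 0 by rewrite tq8c (pt_sym _ _ (chart_swap c1)).
move/(exc_dvr c1); rewrite rmorph0 subr0 invrK => s; apply: (subset_trans s).
have -> : q ^+ 2 / p * q = q ^+ 3 / p by rewrite mulrAC -exprSr.
apply: (dvr_via (l := [:: - 8])) => c; rewrite inE => c8; exists (c / (2 + c / 4)).
rewrite (oo_pt t a1 cqp two0) //.
apply: contraNneq c8 => E; have -> : c = 4 * (2 + c / 4) - 8 by field.
by rewrite E mulr0 add0r.
Qed.

Lemma img_C3 : gphi @` tS (gdvr xi (F * gg)) = dS (gdvr f (f * g)).
Proof.
apply: curve_image => [O OR|O XO OR]; first exact: (pre_dvr twoK fk tk tf cv0).
have pre0 c := pre_pt0 twoK fk tk tf cv0 c.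
case: (on_D0 cfg (dn XO) OR) => [[c [c0 c1 ->]]|->|->|->].
(* At a_1 / 2 the preimage is the contracted point [z0]; it is lifted by the point where {q = 0}
   meets the exceptional curve of q_1. *)
- have [Ec|cn] := eqVneq c (a1 / 2); last first.
    by apply: (lift_nc (tak_zero t a2 cqp two0 c0 c1 cn)); [exact: pt0_dvr|exact: pre0].
  have e0 : gexc (z0 k q p) (pt0 p^-1 (q * p) 0) by rewrite (exc_z0 cqp); right.
  exists (pt0 p^-1 (q * p) 0); split; first exact: tak_W0.
    by apply/exc_tq1_dvr/(gexc_tq1 t a1 cqp two0); constructor 2.
  by rewrite /gphi (gsig_z0 t a2 cqp a10 two0 e0) (z0E t a1 cqp two0) pre0 Ec.
- apply: (lift_nc (tak_zoo t a1 a2 cqp two0)); last exact: (pre_pt0 twoK fk tk tf (cover_zoo cv)).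
  apply: (subset_trans (@pt0_dvr _ _ k _ _ _)); apply: dvr_inv; rewrite ?invrK //.
  exact: chart_invy.
- apply: (lift_nc (O := f2 xi (F * gg) a1 0)); first exact/ok1/f2_in.
    exact: f2_dvr0.
  by rewrite (pre_f2 twoK fk tk tf a1 cv0) expr0n.
- apply: (lift_nc (O := f2 xi (F * gg) 0 0)); first exact/ok2/f2_in.
    exact: f2_dvr0.
  by rewrite (pre_f2 twoK fk tk tf 0 cv0) expr0n.
Qed.

Lemma img_C5 : gphi @` tS (gdvr xi^-1 (F / gg)) = dS (gdvr f^-1 (f / g)).
Proof.
apply: curve_image => [O OR|O XO OR]; first exact: (pre_dvr twoK fk tk tf cvA0).
have pre0 c := pre_pt0 twoK fk tk tf cvA0 c.
case: (on_D3 cfg (dn XO) OR) => [[c c2 ->]|->|->].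
(* At 4 the preimage is the contracted point [z3]; it is lifted by the point where F_7 - F_8 meets
   the proper transform of the exceptional curve of q_8. *)
- have [Ec|cn] := eqVneq c 4; last first.
    by apply: (lift_nc (tak_oo t a1 a2 cqp two0 c2 cn)); [exact: pt0_dvr|exact: pre0].
  pose W := pt0 (q ^+ 2 / p) (p / q ^+ 3) 0.
  have e3 : gexc (z3 k q p) W by rewrite (exc_z3 cqp); right.
  have Wh : W q^-1.
    have -> : q^-1 = (q ^+ 2 / p) * (p / q ^+ 3) by field; rewrite ?q0 ?p0.
    exact: (val_pt (valM (val_x k (zP (q ^+ 2 / p) (p / q ^+ 3) 0)) (val_y k (zP _ _ _)))).
  exists W; split; first exact: tak_W8.
    by apply/exc_tq8_dvr/(gexc_tq8 cqp); right.
  have H : gsig W = z3 k q p.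
    by apply: (gsig_z3 t a2 cqp a10 two0); right; right; split=> //; split=> //; exact: pt0_x.
  by rewrite /gphi H /Submission.z3 (oo_pt4 t a1 cqp two0) pre0 Ec.
- apply: (lift_nc (O := f2 xi^-1 (F / gg) 2 0)); first exact/okA0/f2_in.
    exact: f2_dvr0.
  by rewrite (pre_f2 twoK fk tk tf 2 cvA0) expr0n.
- apply: (lift_nc (O := f2 xi^-1 (gg / F) 0 0)); first exact/okB0/f2_in.
    apply: (@subset_trans _ (gdvr xi^-1 (gg / F))); first exact: f2_dvr0.
    by apply: (dvr_inv cB); rewrite [RHS]invf_div.
  by rewrite (pre_f2 twoK fk tk tf 0 cvB0) expr0n.
Qed.

Lemma img_C4 : gphi @` tS (gdvr gg^-1 xi) = dS (gdvr g^-1 f).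
Proof.
apply: curve_image => [O OR|O XO OR]; first exact: (pre_dvr' twoK fk tk tf (cover_goo cv)).
have cgx : chart gg^-1 xi by apply/chart_inv/chart_swap.
have vx c := val_x k (zP gg^-1 xi c); have vy c := val_y k (zP gg^-1 xi c).
have gi c : good k (zP gg^-1 xi c) := chart_good _ _ cgx.
have x0 : xi != 0 := chart_x0 cxg.
case: (on_D6 cfg two0 (dn XO) OR) => [[a a0 ->]|->|->].
- have [c Ec] := sqrt_ex a; have c0 : c != 0 by apply: contra_neq a0 => c0; rewrite -Ec c0 expr0n.
  apply: (lift_nc (tak_goo t a2 cqp a10 two0 c0)); first exact: pt0_dvr.
  by rewrite /Submission.pt0 (pre_cover' twoK fk tk tf c 0 (cover_goo cv)) Ec.
- apply: (lift_nc (tak_zoo t a1 a2 cqp two0)); last exact: (pre_pt0 twoK fk tk tf (cover_zoo cv)).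
  have cw := chart_invy cxF.
  rewrite /Submission.pt0 (pt_sym _ _ cw); apply: (subset_trans (@pt0_dvr _ _ k (F * gg)^-1 xi 0)).
  apply: (dvr_via (l := [:: 0])) => c; rewrite inE => c0; exists c.
  apply: (pt_sub (gi c)) => //=.
  have c20 : c ^+ 2 != 0 by rewrite expf_neq0.
  by apply: val_eq (val_div c20 (vx c) (valXn 2 (vy c))) _ _; rewrite /= ?mul0r // invfM [LHS]mulrC.
- apply: (lift_nc (O := pt0 xi^-1 (F / gg) 0)); last exact: (pre_pt0 twoK fk tk tf cvA0).
    by apply: (tak_oo t a1 a2 cqp two0); rewrite // eq_sym.
  rewrite /Submission.pt0 (pt_sym _ _ cA); apply: (subset_trans (@pt0_dvr _ _ k (F / gg) xi^-1 0)).
  apply: (dvr_via (l := [:: 0])) => c; rewrite inE => c0; exists c^-1.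
  have ci : c^-1 != 0 by rewrite invr_eq0.
  apply: (pt_sub (gi c^-1)) => /=.
    by apply: val_eq (valM (valXn 2 (vy c^-1)) (vx c^-1)) _ _; rewrite ?mulr0.
  by have := valV ci (vy c^-1); rewrite /= invrK.
Qed.

End CurveImages.

Section OkamotoCentres.
Variables (C : closedFieldType) (K : fieldType) (k : {rmorphism C -> K}).
Local Notation gpt := (gpt k).
Local Notation chart := (chart k).
Local Notation pt0 := (pt0 k).
Local Notation guv := (guv k).
Local Notation gcentre := (gcentre C K).

Variables (f g : K) (t a1 a2 : C).
Hypothesis cfg : chart f g.
Hypothesis a10 : a1 != 0.

Definition tp1 : gcentre := GCentre f^-1 g 0 0.
Definition tp2 := gUV k tp1 (- a2) 0.
Definition tp3 : gcentre := GCentre f g^-1 0 0.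
Definition tp4 := guv tp3 a1 0.
Definition tp5 : gcentre := GCentre f^-1 g^-1 0 0.
Definition tp6 := gUV k tp5 2 0.
Definition tp7 := guv tp6 (- (4 * t)) 0.
Definition tp8 := guv tp7 (4 * (1 - a1 - a2 + 2 * t ^+ 2)) 0.

Lemma okPsE : okPs k f g a1 (b1 t) (b2 t a1 a2) (b3 a2) =
  [seq gpt z | z <- [:: tp1; tp2; tp3; tp4; tp5; tp6; tp7; tp8]].
Proof.
have f0 := chart_x0 cfg; have g0 := chart_y0 cfg.
have cF := chart_fg cfg; have cA := chart_A0 cfg.
have cA1 : chart f^-1 (fA1 k f g) := chart_y1 cA erefl.
have cA2 : chart f^-1 (fA2 k f g (b1 t)) := chart_y2 cA erefl erefl.
have E6 : tp6 = GCentre (f / g) f^-1 2 0.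
  by rewrite /tp6 /gUV /Submission.guv /= !rmorph0 !subr0 invrK mulrC.
have E7 : tp7 = GCentre (fA1 k f g) f^-1 (b1 t) 0.
  by rewrite /tp7 E6 /Submission.guv /= !rmorph0 !subr0.
have E8 : tp8 = GCentre (fA2 k f g (b1 t)) f^-1 (b2 t a1 a2) 0.
  by rewrite /tp8 E7 /Submission.guv /= !rmorph0 !subr0.
have E2 : tp2 = GCentre (f * g) f^-1 (- a2) 0.
  by rewrite /tp2 /gUV /Submission.guv /= !rmorph0 !subr0 invrK mulrC.
have E4 : gpt tp4 = pt0 f (f * g) a1.
  have cz' : chart (f * g) g^-1 by have := chart_div (chart_invy cfg); rewrite invrK.
  rewrite /tp4 /Submission.guv /= !rmorph0 !subr0 invrK.
  pose z := @GCentre C K f (f * g) 0 a1; pose z' := @GCentre C K (f * g) g^-1 a1 0.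
  have gz : good k z := chart_good _ _ cF.
  apply: (@pt_eq _ _ k z z') => //=.
  - exact: (val_y k z).
  - apply: val_eq (val_div a10 (val_x k z) (val_y k z)) _ _; last by rewrite mul0r.
    by rewrite /= invfM mulrA divff // mul1r.
  - apply: val_eq (valM (val_x k z') (val_y k z')) _ _; last by rewrite mulr0.
    by rewrite /= mulfK.
  - exact: (val_x k z').
rewrite /okPs /= E4 E2 E6 E7 E8 /okP2 /okP6 /okP7 /okP8 /Submission.pt0.
rewrite (pt_sym _ _ (chart_inv cF)) (pt_sym _ _ cA) (pt_sym _ _ cA1) (pt_sym _ _ cA2).
by [].
Qed.

End OkamotoCentres.

(** * The Zariski models over C(X, Y) *)

Section ZariskiTopology.
Variable C : fieldType.
Implicit Types (O : spoint C) (X S : set (spoint C)) (R : set (rfun C)).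

Lemma nbhs_spoint O (B : set (spoint C)) : nbhs O B ->
  exists rs : seq (rfun C), (forall r, r \in rs -> O r) /\
    forall O', (forall r, r \in rs -> O' r) -> B O'.
Proof.
rewrite nbhsE => -[U [oU OU] UB].
case: oU OU UB => D sD <- [V VD OV] UB.
have [A sA EV] := sD _ VD.
exists (finmap.enum_fset A); split=> [r rA|O' H].
  by have := OV; rewrite -EV; apply.
apply: UB; exists V => //; change (V O').
by rewrite -EV => r rA; exact: H.
Qed.

Lemma open_reg r : open [set O : spoint C | O r].
Proof.
pose V : set (spoint C) := [set O | O r].
exists [set V]; last by rewrite bigcup_set1.
move=> _ ->; exists (finmap.fset1 r); first by move=> i _; rewrite in_setE.
apply/seteqP; split=> O.
  by move=> H; have := H r (finmap.fset11 r).
by move=> Or r' /finmap.fset1P ->.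
Qed.

(** The set of points where [r] is regular is open, so a function regular at a point of the closure
    is regular at some point of [S], hence belongs to [R]. *)
Lemma closure_reg S O R : closure S O -> S `<=` [set O' | O' `<=` R] -> O `<=` R.
Proof.
move=> cO SR r Or; have := cO [set O' | O' r].
case; first by apply: open_nbhs_nbhs; split; [exact: open_reg|].
by move=> O' [/SR sub O'r]; apply: sub.
Qed.

Lemma closure_dense S O : (forall rs : seq (rfun C), (forall r, r \in rs -> O r) ->
  exists2 O', S O' & forall r, r \in rs -> O' r) -> closure S O.
Proof.
move=> H B /nbhs_spoint [rs [Ors HB]]; have [O' SO' O'rs] := H rs Ors.
by exists O'; split=> //; apply: HB.
Qed.

End ZariskiTopology.

(** * Substitution as a morphism of C(X, Y) *)

Section FunctionField.
Variable C : fieldType.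

Lemma frac_numden (R : idomainType) (r : {fraction R}) :
  r = FracField.tofrac (frac (repr r)).1 / FracField.tofrac (frac (repr r)).2.
Proof.
set x := repr r; have dx : (frac x).2 != 0 by apply: denom_ratioP.
have d0 : FracField.tofrac (frac x).2 != 0 :> {fraction R} by rewrite tofrac_eq0.
apply: (mulIf d0); rewrite divfK // -[r in LHS](@reprK _ _ r) -/x.
rewrite -[LHS]/(FracField.mul _ _) !piE; apply/eqP.
by rewrite FracField.equivf_def /FracField.mulf !numden_Ratio ?mulf_neq0 ?oner_neq0 // ?mulr1 mulrC.
Qed.

Definition cstm : {rmorphism C -> rfun C} :=
  (@FracField.tofrac {poly {poly C}} \o (@polyC {poly C} \o @polyC C)).

Lemma evE x y P : ev x y P = gev cstm x y P. Proof. by []. Qed.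

Local Notation X := (varX C).
Local Notation Y := (varY C).

Lemma ev_XY P : gev cstm X Y P = FracField.tofrac P.
Proof.
elim/poly2_ind: P => [a|||P Q IP IQ|P Q IP IQ].
- by rewrite evC.
- by rewrite evX.
- by rewrite evY.
- by rewrite gevD IP IQ tofracD.
- by rewrite gevM IP IQ tofracM.
Qed.

Lemma chart_XY : chart cstm X Y.
Proof.
split=> [P|r]; first by rewrite ev_XY => /eqP; rewrite tofrac_eq0 => /eqP.
exists (frac (repr r)).1, (frac (repr r)).2; rewrite !ev_XY -frac_numden; split=> //.
by rewrite tofrac_eq0; apply: denom_ratioP.
Qed.

Variables x y : rfun C.
Hypothesis ixy : indep cstm x y.

Let ev0 P : P != 0 -> gev cstm x y P != 0.
Proof. by apply: contra_neq => /ixy. Qed.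

(** [subst] works with a chosen representative of the fraction; independence of [x] and [y] makes
    the result the same for every representative, from which additivity and multiplicativity
    follow. *)
Lemma subst_div A B : B != 0 ->
  subst x y (FracField.tofrac A / FracField.tofrac B) = gev cstm x y A / gev cstm x y B.
Proof.
move=> B0; rewrite /subst !evE.
set r := FracField.tofrac A / FracField.tofrac B; have := frac_numden r.
have d0 : (frac (repr r)).2 != 0 by apply: denom_ratioP.
set n := (frac _).1; set d := (frac _).2 in d0 *.
move=> E; have E2 : n * B = A * d.
  apply/eqP; rewrite -tofrac_eq !tofracM.
  have EE : FracField.tofrac n / FracField.tofrac d = FracField.tofrac A / FracField.tofrac B.
    by rewrite -[LHS]E.
  by move/eqP: EE; rewrite eqr_div ?tofrac_eq0.
by apply/eqP; rewrite eqr_div ?ev0 // -!gevM E2.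
Qed.

Lemma subst_frac r : exists A B, [/\ B != 0, r = FracField.tofrac A / FracField.tofrac B
  & subst x y r = gev cstm x y A / gev cstm x y B].
Proof.
exists (frac (repr r)).1, (frac (repr r)).2; rewrite -frac_numden; split=> //.
exact: denom_ratioP.
Qed.

Lemma subf_div (F : fieldType) (a b c d : F) : b != 0 -> d != 0 ->
  a / b - c / d = (a * d - c * b) / (b * d).
Proof. by move=> b0 d0; field; rewrite b0 d0. Qed.

Lemma subst_is_zmod : zmod_morphism (subst x y).
Proof.
move=> r s; have [A [B [B0 Er ->]]] := subst_frac r; have [D [E [E0 Es ->]]] := subst_frac s.
have -> : r - s = FracField.tofrac (A * E - D * B) / FracField.tofrac (B * E).
  by rewrite Er Es tofracB !tofracM subf_div ?tofrac_eq0.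
by rewrite subst_div ?mulf_neq0 // gevB !gevM subf_div ?ev0.
Qed.

Lemma subst_is_monoid : monoid_morphism (subst x y).
Proof.
split=> [|r s].
  have -> : 1 = FracField.tofrac 1 / FracField.tofrac 1 :> rfun C by rewrite tofrac1 divr1.
  by rewrite subst_div ?oner_neq0 // gev1 divr1.
have [A [B [B0 Er ->]]] := subst_frac r; have [D [E [E0 Es ->]]] := subst_frac s.
have -> : r * s = FracField.tofrac (A * D) / FracField.tofrac (B * E).
  by rewrite Er Es mulf_div !tofracM.
by rewrite subst_div ?mulf_neq0 // !gevM mulf_div.
Qed.

(** The proof of independence is an argument of the function so that the morphism structure, which
    depends on it, can be attached to this head symbol. *)
Definition subst_fun of indep cstm x y := subst x y.
HB.instance Definition _ :=
  GRing.isZmodMorphism.Build (rfun C) (rfun C) (subst_fun ixy) subst_is_zmod.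
HB.instance Definition _ :=
  GRing.isMonoidMorphism.Build (rfun C) (rfun C) (subst_fun ixy) subst_is_monoid.
Definition substm : {rmorphism rfun C -> rfun C} := subst_fun ixy.

Lemma substmE r : substm r = subst x y r. Proof. by []. Qed.

Lemma substm_tofrac P : substm (FracField.tofrac P) = gev cstm x y P.
Proof.
rewrite substmE -[FracField.tofrac P]divr1 -tofrac1 subst_div ?oner_neq0 //.
by rewrite gev1 divr1.
Qed.

Lemma substm_cst a : substm (cstm a) = cstm a.
Proof. by rewrite [cstm a]/(FracField.tofrac a%:P%:P) substm_tofrac evC. Qed.

Lemma substm_X : substm X = x.
Proof. by rewrite [X]/(FracField.tofrac 'X) substm_tofrac evX. Qed.

Lemma substm_Y : substm Y = y.
Proof. by rewrite [Y]/(FracField.tofrac 'Y) substm_tofrac evY. Qed.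

End FunctionField.

Lemma morph_XY (C : fieldType) (K : fieldType) (u v : {rmorphism rfun C -> K}) :
  (forall a, u (cstm C a) = v (cstm C a)) -> u (varX C) = v (varX C) ->
  u (varY C) = v (varY C) -> u =1 v.
Proof.
move=> Ec Ex Ey; have E P : u (FracField.tofrac P) = v (FracField.tofrac P).
  elim/poly2_ind: P => [a|||P Q IP IQ|P Q IP IQ] //.
    exact: Ec.
  - by rewrite tofracD !rmorphD IP IQ.
  - by rewrite tofracM !rmorphM IP IQ.
by move=> r; rewrite (frac_numden r) !fmorph_div !E.
Qed.

(** * Zariski models in terms of abstract coordinates *)

Section Bridge.
Variable C : closedFieldType.
Local Notation K := (rfun C).
Local Notation k := (cstm C).
Implicit Types (z : centre C) (O : spoint C) (X S : set (spoint C)) (x y r : rfun C) (l : seq C).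

Definition cg z : gcentre C K := GCentre (cx z) (cy z) (ca z) (cb z).

Lemma uvE z c d : cg (uv z c d) = guv k (cg z) c d. Proof. by []. Qed.
Lemma UVE z c d : cg (UV z c d) = gUV k (cg z) c d. Proof. by []. Qed.

Lemma excE O : exc O = gexc k O.
Proof.
apply/seteqP; split=> O' [z [c [E1 E2]]]; first by exists (cg z), c.
by case: z E1 E2 => x y a b E1 E2; exists (Centre x y a b), c.
Qed.

Lemma excs1 O : excs [set O] = gexc k O.
Proof. by rewrite /excs bigcup_set1 excE. Qed.

Lemma foldl_blowup X (l : seq (centre C)) :
  foldl (fun X z => blowup X [set pt z]) X l =
  foldl (blow1 k) X [seq gpt k w | w <- map cg l].
Proof.
elim: l X => //= z l IH X; rewrite IH; congr foldl.
by rewrite /blowup excs1.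
Qed.

Lemma cofin_all x y (rs : seq (rfun C)) : (forall r, r \in rs -> gdvr k x y r) ->
  exists l : seq C, forall b, b \notin l -> forall r, r \in rs -> pt0 k x y b r.
Proof.
elim: rs => [_|r rs IH H]; first by exists [::].
have [l Hl] : exists l : seq C, forall b, b \notin l -> forall r, r \in rs -> pt0 k x y b r.
  by apply: IH => s srs; apply: H; rewrite in_cons srs orbT.
have [l' Hl'] := dvr_cofin (H r (mem_head r rs)).
exists (l ++ l') => b; rewrite mem_cat negb_or => /andP [bl bl'] s; rewrite in_cons.
by case/orP=> [/eqP ->|srs]; [exact: Hl'|exact: Hl].
Qed.

(* A nonempty basic open set of the curve contains all but finitely many of its
   points. *)
Lemma proper_dvr X S x y l : (forall O, S O -> X O -> O `<=` gdvr k x y) ->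
  (forall b, b \notin l -> S (pt0 k x y b) /\ X (pt0 k x y b)) ->
  Defs.proper X S = [set O | X O /\ O `<=` gdvr k x y].
Proof.
move=> sub dense; apply/seteqP; split=> O.
  by case=> cO XO; split=> //; apply: closure_reg cO _ => O' [SO' XO']; apply: sub.
case=> XO OR; split=> //; apply: closure_dense => rs Ors.
have [l' Hl'] := cofin_all (fun r rr => OR r (Ors r rr)).
have [b] := fresh (l ++ l'); rewrite mem_cat negb_or => /andP [bl bl'].
exists (pt0 k x y b); last exact: Hl'.
exact: dense.
Qed.

End Bridge.

(** * Takasaki's curves through their valuation rings *)

Section TakasakiCurves.
Variable C : closedFieldType.
Local Notation k := (cstm C).
Implicit Types (O : spoint C) (x y : rfun C) (c : C).
Local Notation gpt := (gpt k).
Local Notation chart := (chart k).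
Local Notation pt0 := (pt0 k).
Local Notation gexc := (gexc k).
Local Notation gdvr := (gdvr k).
Local Notation f1 := (f1 k).
Local Notation f2 := (f2 k).
Local Notation uO := (uO k).
Local Notation ustep := (ustep k).
Local Notation udvrL := (udvrL k).
Local Notation udvrE := (udvrE k).

Variables (q p : rfun C) (t a1 a2 : C).
Hypothesis cqp : chart q p.
Hypothesis a10 : a1 != 0.
Hypothesis two0 : (2 : C) != 0.

Local Notation xi := (xi q).
Local Notation gg := (gg k q p t a1).
Local Notation F := (xi ^+ 2).
Local Notation gXTak := (gXTak k q p t a1 a2).
Local Notation noncontr := (noncontr q p).
Local Notation tS := (tS k q p t a1 a2).
Local Notation h := (q^-1).

Lemma tak_L x y b : chart x y ->
  (forall O, ustep x y b (fun=> False) O -> gXTak O /\ noncontr O) ->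
  Defs.proper gXTak (gexc (pt0 x y b)) = tS (udvrL x y b).
Proof.
move=> cxy ok; apply: (proper_dvr (l := [::])) => [O e _|c _].
  have cu : chart x (y - k b) by apply: chart_suby.
  exact: (subset_trans (exc_dvr cxy e) (dvr_flip (chart_swap cu))).
split; first by rewrite (exc_f2 b cxy); left; exists c.
by case: (ok (f2 x y b c)); first by constructor 2; exists c.
Qed.

Lemma tak_E x y b (nxt : C -> Prop) (l : seq C) : chart x y -> (forall c, c \notin l -> nxt c) ->
  (forall O, ustep x y b nxt O -> gXTak O /\ noncontr O) ->
  Defs.proper gXTak (gexc (uO x y b)) = tS (udvrE x y b).
Proof.
move=> cxy ln ok; have E : (y - k b) / x / x = (y - k b) / x ^+ 2.
  by rewrite expr2 invfM mulrA.
apply: (proper_dvr (l := l)) => [O e _|c cl].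
  have := exc_dvr (chart_e1 b cxy) e; rewrite rmorph0 subr0 E; exact.
rewrite -(f1E k); split; first by rewrite (exc_f1 b cxy); left; exists c.
by case: (ok (f1 x y b c)); first by constructor 1; exists c => //; apply: ln.
Qed.

Let q0 : q != 0 := chart_x0 cqp.
Let p0 : p != 0 := chart_y0 cqp.
Let chp : chart h p := chart_inv cqp.

Lemma tak_q0_E : Defs.proper gXTak (xline q p) = tS (gdvr q p).
Proof.
apply: (proper_dvr (l := [::])) => [O [b _ <-] _|b _]; first exact: (@pt0_dvr _ _ k q p b).
by split; [exists b|exact: tak_q0].
Qed.

Lemma tak_qoo_E : Defs.proper gXTak (xline h p) = tS (gdvr h p).
Proof.
apply: (proper_dvr (l := [::])) => [O [b _ <-] _|b _]; first exact: (@pt0_dvr _ _ k h p b).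
by split; [exists b|exact: tak_qoo].
Qed.

Lemma tak_poo_E : Defs.proper gXTak (yline q p^-1) = tS (gdvr gg^-1 xi).
Proof.
have cqi : chart q p^-1 := chart_invy cqp.
apply: (proper_dvr (l := [:: 0])) => [O [a _ <-] _|b].
  rewrite [pt _](pt_sym a 0 cqi : gpt (GCentre q p^-1 a 0) = _).
  apply: (subset_trans (@pt0_dvr _ _ k p^-1 q a)).
  apply: (dvr_via (l := [:: 0])) => c; rewrite inE => c0; exists (c / 2).
  by rewrite (goo_pt t a1 cqp two0).
rewrite inE => b0; have b20 : b * 2 != 0 by rewrite mulf_neq0.
split; last by case: (tak_goo t a2 cqp a10 two0 b0).
exists (b * 2) => //; have := goo_pt t a1 cqp two0 b20; rewrite mulfK // => <-.
exact: (pt_sym (b * 2) 0 cqi).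
Qed.

Lemma tak_tq1_E : Defs.proper gXTak (gexc (gpt (tq1 C q p))) = tS (gdvr xi (F * gg)).
Proof.
apply: (proper_dvr (l := [:: 0; a1; a1 / 2])) => [O e _|c].
  exact: (exc_tq1_dvr t a1 cqp two0 e).
rewrite !inE !negb_or => /and3P [c0 c1 c2].
split; last by case: (tak_zero t a2 cqp two0 c0 c1 c2).
have eightC : (8 : C) != 0 by have := expf_neq0 3 two0; rewrite -natrX.
apply/(gexc_tq1 t a1 cqp two0); constructor 1; exists (8 * c - 4 * a1).
  apply: contra_neq c2 => E; have -> : c = (8 * c - 4 * a1 + 4 * a1) / 8.
    by rewrite subrK mulrC mulKf.
  by rewrite E add0r; field; rewrite two0 eightC.
by rewrite (zero_pt t a1 cqp two0) subrK [8 * c]mulrC mulfK.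
Qed.

Lemma tak_tq6_E : Defs.proper gXTak (gexc (gpt (tq6 C q p))) = tS (gdvr h (p / q)).
Proof.
have c6 : chart h p^-1 := chart_invy chp.
apply: (proper_dvr (l := [:: 0])) => [O e _|c].
  apply: (subset_trans (@exc_dvr _ _ k h p^-1 0 O c6 e)); rewrite rmorph0 subr0 invrK.
  apply: dvr_inv; last by rewrite invfM invrK.
  by have := chart_divy c6; rewrite invrK.
rewrite inE => c0; split; last exact: (tak_6 t a1 a2 cqp two0 c0).
by apply/(gexc_tq6 cqp); constructor 1; exists c.
Qed.

Lemma tak_tq7_E : Defs.proper gXTak (gexc (gpt (tq7 k q p))) = tS (gdvr h (p / q ^+ 2)).
Proof.
have c7 : chart h (q / p).
  by have := chart_divy (chart_invy chp); rewrite invrK mulrC.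
have E7 : gpt (tq7 k q p) = pt0 h (q / p) 0 by rewrite tq7c (pt_sym _ _ (chart_swap c7)).
apply: (proper_dvr (l := [:: 0])) => [O e _|c].
  rewrite E7 in e; apply: (subset_trans (exc_dvr c7 e)); rewrite rmorph0 subr0 invrK.
  have E : q / p * q = q ^+ 2 / p by rewrite mulrAC.
  rewrite E; apply: dvr_inv; last by rewrite invf_div.
  by rewrite -E; have := chart_divy c7; rewrite invrK.
rewrite inE => c0; split; last exact: (tak_7 t a1 a2 cqp two0 c0).
by apply/(gexc_tq7 cqp); constructor 1; exists c.
Qed.

Lemma tak_tq8_E : Defs.proper gXTak (gexc (gpt (tq8 k q p))) = tS (gdvr xi^-1 (F / gg)).
Proof.
apply: (proper_dvr (l := [:: 2; 4])) => [O e _|c].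
  exact: (exc_tq8_dvr t a1 cqp two0 e).
rewrite !inE negb_or => /andP [c2 c4].
split; last by case: (tak_oo t a1 a2 cqp two0 c2 c4).
apply/(gexc_tq8 cqp); left; exists (8 * c / (4 - c)).
exact: (oo_pt_inv t a1 cqp two0 c4).
Qed.

End TakasakiCurves.

Section DvrIdentities.
Variables (C : closedFieldType) (K : fieldType) (k : {rmorphism C -> K}) (f g : K).
Hypothesis cfg : chart k f g.

Lemma dvrE_B0 : dvrE k f^-1 (g / f) 0 = gdvr k f^-1 g.
Proof. by rewrite /dvrE -(B1E cfg). Qed.

Lemma dvrE_B1 : dvrE k f^-1 g 0 = gdvr k f^-1 (f * g).
Proof. by rewrite /dvrE -(B2E k f g). Qed.

Lemma dvrE_A0 : dvrE k f^-1 (f / g) 2 = gdvr k f^-1 (fA1 k f g). Proof. by []. Qed.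

Lemma dvrE_A1 b : dvrE k f^-1 (fA1 k f g) b = gdvr k f^-1 (fA2 k f g b).
Proof. by []. Qed.

Lemma e1_f0 c : e1 k f (f * g) 0 c = pt0 k f g c.
Proof. by rewrite /e1 rmorph0 subr0 mulrAC divff ?mul1r // (chart_x0 cfg). Qed.

Lemma dvrE_f0 : dvrE k f (f * g) 0 = gdvr k f g.
Proof. by rewrite /dvrE rmorph0 subr0 mulrAC divff ?mul1r // (chart_x0 cfg). Qed.

Lemma exc_eZ_dvrL x y b O : chart k x y -> gexc k (eZ k x y b) O -> O `<=` dvrL k x y b.
Proof.
move=> cxy /(exc_dvr (chart_eZ b cxy)); rewrite rmorph0 subr0.
by rewrite -mulrA -invfM -expr2.
Qed.

Lemma eZ_chart x y b : chart k x y -> exists z, [/\ chart k (gx z) (gy z),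
  eZ k x y b = gpt k z & forall O, gexc k (eZ k x y b) O -> ~ O x^-1].
Proof.
move=> cxy; exists (GCentre (y - k b) (x / (y - k b)) 0 0); split=> //.
  exact: chart_eZ.
move=> O e Ox; have [_ _ _ _ [_ nx _]] := dvrL_facts b cxy.
exact: (nx (exc_eZ_dvrL cxy e Ox)).
Qed.

Lemma dom_max z O : chart k (gx z) (gy z) -> gexc k (gpt k z) O ->
  gpt k z `<=` O /\ gmax (gpt k z) `<=` gmax O.
Proof.
move=> cz e; split; first exact: (exc_above cz e).
have [w [gw -> H]] := exc_dom cz e; move=> r /(val_max (chart_good (ga z) (gb z) cz)) v.
exact/(val_max gw)/H.
Qed.

Lemma notin_avoid (l : seq (set K)) O : (forall P, List.In P l -> O <> P) -> avoid l O.
Proof.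
elim: l => //= P l IH H; split; first by apply: H; left.
by apply: IH => P' H'; apply: H; right.
Qed.

Lemma exc_okP3_dvr O : gexc k (okP3 k f g) O -> O `<=` gdvr k f (f * g).
Proof.
have c1 : chart k f g^-1 := chart_invy cfg.
move/(@exc_dvr _ _ k f g^-1 0 O c1) => s; apply: (subset_trans s); rewrite rmorph0 subr0.
have -> : g^-1 / f = (f * g)^-1 by rewrite invfM mulrC.
by apply: dvr_inv; rewrite ?invrK //; apply/chart_invy/chart_fg.
Qed.

Lemma exc_okP5_dvr O : gexc k (okP5 k f g) O -> O `<=` gdvr k f^-1 (f / g).
Proof.
have c1 : chart k f^-1 g^-1 by apply/chart_invy/chart_inv.
move/(@exc_dvr _ _ k f^-1 g^-1 0 O c1) => s; apply: (subset_trans s).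
by rewrite rmorph0 subr0 invrK mulrC.
Qed.

Lemma dvr_B0A0 : gdvr k f^-1 (g / f) `<=` gdvr k f^-1 (f / g).
Proof. by apply: dvr_inv; rewrite ?invf_div //; apply: chart_B0. Qed.

End DvrIdentities.

(** * Okamoto's curves, their nodes and proper transforms *)

Section OkamotoCurves.
Variable C : closedFieldType.
Local Notation k := (cstm C).
Implicit Types (O : spoint C) (x y : rfun C) (b c : C) (S : set (spoint C)).
Local Notation chart := (chart k).
Local Notation pt0 := (pt0 k).
Local Notation gexc := (gexc k).
Local Notation gdvr := (gdvr k).
Local Notation e1 := (e1 k).
Local Notation e2 := (e2 k).
Local Notation e3 := (e3 k).
Local Notation eZ := (eZ k).
Local Notation dvrL := (dvrL k).
Local Notation dvrE := (dvrE k).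

Lemma eZ_dvr x y b : chart x y -> eZ x y b `<=` gdvr x y.
Proof. exact: f2_dvr0. Qed.

Lemma eZ_dvrE x y b : chart x y -> eZ x y b `<=` dvrE x y b.
Proof.
move=> cxy; apply: (exc_dvr cxy).
by rewrite [gexc _](exc_e1 b cxy); right.
Qed.

Variables (f g : rfun C) (a1 b1 b2 b3 : C).
Hypothesis cfg : chart f g.
Hypothesis a10 : a1 != 0.
Hypothesis two0 : (2 : C) != 0.

Local Notation gXOk := (gXOk k f g a1 b1 b2 b3).
Local Notation gXOkt := (gXOkt k f g a1 b1 b2 b3).
Local Notation okZs := (okZs k f g a1 b1 b2 b3).
Local Notation fA1 := (fA1 k f g).
Local Notation fA2 := (fA2 k f g b1).

Definition kS R : set (spoint C) := [set O | gXOk O /\ O `<=` R].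
Definition ktS R : set (spoint C) := [set O | gXOkt O /\ O `<=` R].

Let ok O := gXOk O /\ avoid okZs O.

(* S is the curve of the divisor R on XOk, and its proper transform on XOkt *)
Definition curve_of S R := Defs.proper gXOk S = kS R /\ Defs.proper gXOkt (kS R) = ktS R.

Lemma curve_ofP S x y (l : seq C) : (forall O, S O -> O `<=` gdvr x y) ->
  (forall b, b \notin l -> S (pt0 x y b) /\ ok (pt0 x y b)) -> curve_of S (gdvr x y).
Proof.
move=> sub dense; split; apply: (proper_dvr (l := l)).
- by move=> O SO _; exact: sub.
- by move=> b bl; have [? []] := dense b bl.
- by move=> O [].
- move=> b bl; have [SO [XO aO]] := dense b bl; split; last by left.
  by split=> //; apply: sub.
Qed.

Lemma curve_exc x y b (nxt : C -> Prop) (l : seq C) : chart x y ->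
  (forall c, c \notin l -> nxt c) -> (forall c, nxt c -> ok (e1 x y b c)) ->
  curve_of (gexc (pt0 x y b)) (dvrE x y b).
Proof.
move=> cxy ln H; apply: (curve_ofP (l := l)) => [O e|c cl]; first exact: (exc_dvr cxy e).
split; last exact/H/ln.
by rewrite [gexc _](exc_e1 b cxy); left; exists c.
Qed.

Let f0 : f != 0 := chart_x0 cfg.
Let g0 : g != 0 := chart_y0 cfg.
Let cF : chart f (f * g) := chart_fg cfg.
Let cA : chart f^-1 (f / g) := chart_A0 cfg.
Let cB : chart f^-1 (g / f) := chart_B0 cfg.
Let cA1 : chart f^-1 fA1 := chart_y1 cA erefl.
Let cA2 : chart f^-1 fA2 := chart_y2 cA erefl erefl.
Let cB1 : chart f^-1 g := chart_inv cfg.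
Let cB2 : chart f^-1 (f * g) := chart_inv cF.
Let ne_notin (b c : C) : c \notin [:: b] -> ne b c. Proof. by rewrite inE. Qed.

Let E2B : dvrE f^-1 (g / f) 0 = gdvr f^-1 g := dvrE_B0 cfg.
Let E1B : dvrE f^-1 g 0 = gdvr f^-1 (f * g) := dvrE_B1 k f g.
Let E0f : dvrE f (f * g) 0 = gdvr f g := dvrE_f0 cfg.

Lemma curve_D1 : curve_of (gexc (okP1 k f g)) (dvrE f^-1 g 0).
Proof.
apply: (@curve_exc f^-1 g 0 (ne b3) [:: b3] cB1) => [c|c nc].
  exact: ne_notin.
exact: (B1_e1 b1 b2 cfg a10 nc).
Qed.

Lemma curve_E2 : curve_of (gexc (okP2 k f g b3)) (dvrE f^-1 (f * g) b3).
Proof.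
apply: (@curve_exc f^-1 (f * g) b3 (@any C) [::] cB2) => [c|c nc].
  by [].
exact: (B2_e1 b1 b2 b3 cfg a10 c).
Qed.

Lemma curve_E4 : curve_of (gexc (okP4 k f g a1)) (dvrE f (f * g) a1).
Proof.
apply: (@curve_exc f (f * g) a1 (@any C) [::] cF) => [c|c nc].
  by [].
exact: (S1_e1 b1 b2 b3 cfg a10 c).
Qed.

Lemma curve_D4 : curve_of (gexc (okP6 k f g)) (dvrE f^-1 (f / g) 2).
Proof.
apply: (@curve_exc f^-1 (f / g) 2 (ne b1) [:: b1] cA) => [c|c nc].
  exact: ne_notin.
exact: (A0_e1 a1 b2 b3 cfg nc).
Qed.

Lemma curve_D5 : curve_of (gexc (okP7 k f g b1)) (dvrE f^-1 fA1 b1).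
Proof.
apply: (@curve_exc f^-1 fA1 b1 (ne b2) [:: b2] cA1) => [c|c nc].
  exact: ne_notin.
exact: (A1_e1 a1 b1 b3 cfg nc).
Qed.

Lemma curve_E8 : curve_of (gexc (okP8 k f g b1 b2)) (dvrE f^-1 fA2 b2).
Proof.
apply: (@curve_exc f^-1 fA2 b2 (@any C) [::] cA2) => [c|c nc].
  by [].
exact: (A2_e1 a1 b1 b2 b3 cfg c).
Qed.

Lemma curve_D0 : curve_of (gexc (okP3 k f g)) (gdvr f (f * g)).
Proof.
apply: (curve_ofP (l := [:: 0; a1])) => [O e|c]; first exact: (exc_okP3_dvr cfg e).
rewrite !inE negb_or => /andP [c0 ca]; split; last exact: (zero_ok b1 b2 b3 cfg c0 ca).
by apply/(exc_P3 cfg); constructor 1; exists c.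
Qed.

Lemma curve_D3 : curve_of (gexc (okP5 k f g)) (gdvr f^-1 (f / g)).
Proof.
apply: (curve_ofP (l := [:: 2])) => [O e|c]; first exact: (exc_okP5_dvr cfg e).
rewrite inE => c2; split; last exact: (oo_ok a1 b1 b2 b3 cfg c2).
by apply/(exc_P5 cfg); left; exists c.
Qed.

Lemma curve_D2 : curve_of (xline f^-1 g) (dvrE f^-1 (g / f) 0).
Proof.
rewrite E2B; apply: (curve_ofP (l := [:: 0])) => [O [b _ <-]|c].
  exact: (@pt0_dvr _ _ k f^-1 g b).
move=> /ne_notin c0; split; first by exists c.
have := B0_e1 b1 b2 b3 cfg a10 c0; by rewrite (p1_step cfg).
Qed.

Lemma curve_D6 : curve_of (yline f g^-1) (gdvr g^-1 f).
Proof.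
have cgi : chart f g^-1 := chart_invy cfg.
have E a : pt (Centre f g^-1 a 0) = pt0 g^-1 f a := pt_sym a 0 cgi.
apply: (curve_ofP (l := [:: 0])) => [O [a _ <-]|c].
  by rewrite E; exact: (@pt0_dvr _ _ k g^-1 f a).
rewrite inE => c0; split; first by exists c.
exact: (goo_ok a1 b1 b2 b3 cfg c0).
Qed.

Lemma curve_f0 : curve_of (xline f g) (dvrE f (f * g) 0).
Proof.
rewrite E0f; apply: (curve_ofP (l := [::])) => [O [b _ <-]|c _].
  exact: (@pt0_dvr _ _ k f g b).
split; first by exists c.
have := S2_e1 b1 b2 b3 cfg a10 c.
by rewrite (e1_f0 cfg).
Qed.

Let z_in : 0 \in [:: 0; a1]. Proof. by rewrite inE eqxx. Qed.
Let a_in : a1 \in [:: 0; a1]. Proof. by rewrite !inE eqxx orbT. Qed.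
Let a10' : 0 != a1. Proof. by rewrite eq_sym. Qed.

Let kS_z R R' Z : (forall O, gXOk O -> O `<=` R -> O `<=` R' -> O = Z) ->
  List.In Z okZs -> Z `<=` R -> Z `<=` R' -> kS R `&` kS R' = [set Z].
Proof.
move=> H Zin ZR ZR'; apply/seteqP; split=> O; first by case=> [[XO OR] [_ OR']]; exact: H.
by move=> ->; have XZ : gXOk Z := okZs_in cfg a10 Zin.
Qed.

Let dk O : gXOk O -> down k f g a1 b1 b2 b3 (stepZ k) O := fun H => gXOk_down cfg H.

Lemma kS_z1 : kS (gdvr f (f * g)) `&` kS (dvrE f (f * g) 0) = [set (okZ1 k f g)].
Proof.
apply: (@kS_z (gdvr f (f * g)) (dvrE f (f * g) 0) (okZ1 k f g)) => [O /dk dO R R'|||].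
- exact: (on_zeroZ cfg dO z_in a_in a10' R R').
- by left.
- exact: (@eZ_dvr _ _ 0 cF).
- exact: (@eZ_dvrE _ _ 0 cF).
Qed.

Lemma kS_z2 : kS (gdvr f (f * g)) `&` kS (dvrE f (f * g) a1) = [set (okZ2 k f g a1)].
Proof.
apply: (@kS_z (gdvr f (f * g)) (dvrE f (f * g) a1) (okZ2 k f g a1)) => [O /dk dO R R'|||].
- exact: (on_zeroZ cfg dO a_in z_in a10 R R').
- by right; left.
- exact: (@eZ_dvr _ _ a1 cF).
- exact: (@eZ_dvrE _ _ a1 cF).
Qed.

Lemma kS_z3 : kS (dvrE f^-1 g 0) `&` kS (dvrE f^-1 (f * g) b3) = [set (okZ3 k f g b3)].
Proof.
apply: (@kS_z (dvrE f^-1 g 0) (dvrE f^-1 (f * g) b3) (okZ3 k f g b3)) => [O /dk dO R R'|||].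
- exact: (on_z3 cfg dO R R').
- by do 2!right; left.
- rewrite E1B; exact: (@eZ_dvr _ _ b3 cB2).
- exact: (@eZ_dvrE _ _ b3 cB2).
Qed.

Lemma kS_z4 : kS (dvrE f^-1 g 0) `&` kS (dvrE f^-1 (g / f) 0) = [set (okZ4 k f g)].
Proof.
apply: (@kS_z (dvrE f^-1 g 0) (dvrE f^-1 (g / f) 0) (okZ4 k f g)) => [O /dk dO R R'|||].
- exact: (on_z4 cfg dO R' R).
- by do 3!right; left.
- exact: (@eZ_dvrE _ _ 0 cB1).
- rewrite E2B; exact: (@eZ_dvr _ _ 0 cB1).
Qed.

Lemma kS_z5 : kS (dvrE f^-1 (g / f) 0) `&` kS (gdvr f^-1 (f / g)) = [set (okZ5 k f g)].
Proof.
apply: (@kS_z (dvrE f^-1 (g / f) 0) (gdvr f^-1 (f / g)) (okZ5 k f g)) => [O /dk dO R R'|||].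
- exact: (on_z5 cfg dO R' R).
- by do 4!right; left.
- exact: (@eZ_dvrE _ _ 0 cB).
- exact: (subset_trans (@eZ_dvr _ _ 0 cB) (dvr_B0A0 cfg)).
Qed.

Lemma kS_z6 : kS (gdvr f^-1 (f / g)) `&` kS (dvrE f^-1 (f / g) 2) = [set (okZ6 k f g)].
Proof.
apply: (@kS_z (gdvr f^-1 (f / g)) (dvrE f^-1 (f / g) 2) (okZ6 k f g)) => [O /dk dO R R'|||].
- exact: (on_z6 cfg dO R R').
- by do 5!right; left.
- exact: (@eZ_dvr _ _ 2 cA).
- exact: (@eZ_dvrE _ _ 2 cA).
Qed.

Lemma kS_z7 : kS (dvrE f^-1 (f / g) 2) `&` kS (dvrE f^-1 fA1 b1) = [set (okZ7 k f g b1)].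
Proof.
apply: (@kS_z (dvrE f^-1 (f / g) 2) (dvrE f^-1 fA1 b1) (okZ7 k f g b1)) => [O /dk dO R R'|||].
- exact: (on_z7 cfg dO R R').
- by do 6!right; left.
- rewrite dvrE_A0; exact: (@eZ_dvr _ _ b1 cA1).
- exact: (@eZ_dvrE _ _ b1 cA1).
Qed.

Lemma kS_z8 : kS (dvrE f^-1 fA1 b1) `&` kS (dvrE f^-1 fA2 b2) = [set (okZ8 k f g b1 b2)].
Proof.
apply: (@kS_z (dvrE f^-1 fA1 b1) (dvrE f^-1 fA2 b2) (okZ8 k f g b1 b2)) => [O /dk dO R R'|||].
- exact: (on_z8 cfg dO R R').
- by do 7!right; left.
- rewrite dvrE_A1; exact: (@eZ_dvr _ _ b2 cA2).
- exact: (@eZ_dvrE _ _ b2 cA2).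
Qed.

Let dn O : gXOkt O -> down k f g a1 b1 b2 b3 (step k) O := fun H => XOkt_down cfg H.

Let exc_ktS x y b : chart x y -> List.In (eZ x y b) okZs ->
  (forall O, gXOkt O -> O `<=` dvrL x y b -> (exists d, O = e2 x y b d) \/ O = e3 x y b) ->
  gexc (eZ x y b) = ktS (dvrL x y b).
Proof.
move=> cxy Zin H; apply/seteqP; split=> O.
  move=> e; split; last exact: exc_eZ_dvrL.
  by right; exists (eZ x y b).
by case=> XO OR; rewrite [gexc _](exc_e2 b cxy); exact: H.
Qed.

Lemma excZ1 : gexc (okZ1 k f g) = ktS (dvrL f (f * g) 0).
Proof.
apply: (@exc_ktS f (f * g) 0 cF) => [|O /dn dO]; first by left.
exact: (on_zeroL cfg dO z_in a_in a10').
Qed.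

Lemma excZ2 : gexc (okZ2 k f g a1) = ktS (dvrL f (f * g) a1).
Proof.
apply: (@exc_ktS f (f * g) a1 cF) => [|O /dn dO]; first by right; left.
exact: (on_zeroL cfg dO a_in z_in a10).
Qed.

Lemma excZ3 : gexc (okZ3 k f g b3) = ktS (dvrL f^-1 (f * g) b3).
Proof.
apply: (@exc_ktS f^-1 (f * g) b3 cB2) => [|O /dn dO]; first by do 2!right; left.
exact: (on_L3 cfg dO).
Qed.

Lemma excZ4 : gexc (okZ4 k f g) = ktS (dvrL f^-1 g 0).
Proof.
apply: (@exc_ktS f^-1 g 0 cB1) => [|O /dn dO]; first by do 3!right; left.
exact: (on_L4 cfg dO).
Qed.

Lemma excZ5 : gexc (okZ5 k f g) = ktS (dvrL f^-1 (g / f) 0).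
Proof.
apply: (@exc_ktS f^-1 (g / f) 0 cB) => [|O /dn dO]; first by do 4!right; left.
exact: (on_L5 cfg dO).
Qed.

Lemma excZ6 : gexc (okZ6 k f g) = ktS (dvrL f^-1 (f / g) 2).
Proof.
apply: (@exc_ktS f^-1 (f / g) 2 cA) => [|O /dn dO]; first by do 5!right; left.
exact: (on_L6 cfg dO).
Qed.

Lemma excZ7 : gexc (okZ7 k f g b1) = ktS (dvrL f^-1 fA1 b1).
Proof.
apply: (@exc_ktS f^-1 fA1 b1 cA1) => [|O /dn dO]; first by do 6!right; left.
exact: (on_L7 cfg dO).
Qed.

Lemma excZ8 : gexc (okZ8 k f g b1 b2) = ktS (dvrL f^-1 fA2 b2).
Proof.
apply: (@exc_ktS f^-1 fA2 b2 cA2) => [|O /dn dO]; first by do 7!right; left.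
exact: (on_L8 cfg dO).
Qed.

End OkamotoCurves.

(** * The comorphism and the involution *)

Section Comorphism.
Variable C : closedFieldType.
Local Notation K := (rfun C).
Local Notation k := (cstm C).
Local Notation X := (varX C).
Local Notation Y := (varY C).
Variables (t a1 : C).
Hypothesis two0 : (2 : C) != 0.
Local Notation xi := (xi X).
Local Notation gg := (gg k X Y t a1).

(** Substituting x^2 for the first variable only moves the n-th coefficient to position 2n, so no
    relation is created. *)
Lemma indep_sqr (x y : K) : indep k x y -> indep k (x ^+ 2) y.
Proof.
move=> i P; have -> : x ^+ 2 = gev k x y 'X^2 by rewrite gevXn evX.
rewrite gev_comp => /i E; apply/polyP => n; rewrite coef0.
have := congr1 (fun s : {poly {poly C}} => s`_(n * 2)) E.
by rewrite coef_comp_poly_Xn // coef0 dvdn_mull // mulnK.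
Qed.

Lemma chart_cover : chart k xi gg. Proof. exact: (chart_xigg t a1 (chart_XY C) two0). Qed.

Lemma indep_phi : indep k (xi ^+ 2) gg.
Proof. by apply: indep_sqr; case: chart_cover. Qed.

Lemma chart_NN : chart k (- X) (- Y).
Proof.
have n0 : (-1 : C) != 0 by rewrite oppr_eq0 oner_neq0.
have := chart_scale n0 (chart_swap (chart_scale n0 (chart_XY C))).
by rewrite rmorphN1 !mulN1r => /chart_swap.
Qed.

Lemma indep_tau : indep k (- X) (- Y). Proof. by case: chart_NN. Qed.

Definition phim : {rmorphism K -> K} := substm indep_phi.
Definition taum : {rmorphism K -> K} := substm indep_tau.

Lemma phim_cst a : phim (k a) = k a. Proof. exact: substm_cst. Qed.
Lemma taum_cst a : taum (k a) = k a. Proof. exact: substm_cst. Qed.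
Lemma taumX : taum X = - X. Proof. exact: substm_X. Qed.
Lemma taumY : taum Y = - Y. Proof. exact: substm_Y. Qed.

Lemma taum_xi : taum xi = - xi.
Proof. by rewrite /Submission.xi fmorph_div taumX rmorph_nat mulNr. Qed.

Lemma taum_gg : taum gg = gg.
Proof.
have kt : taum (k t) = k t := taum_cst t; have ka : taum (k a1) = k a1 := taum_cst a1.
rewrite /Submission.gg.
rewrite [taum (_ + X ^+ 2 / 16)]rmorphD [taum (_ + Y / _)]rmorphD.
rewrite [taum (k t / 2 + _)]rmorphD !fmorph_div [taum (2 * k a1)]rmorphM [taum (2 * X)]rmorphM.
rewrite !rmorphXn /= taumX taumY kt ka !rmorph_nat sqrrN.
by rewrite mulrN invrN mulrNN.
Qed.

Lemma taum_phim r : taum (phim r) = phim r.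
Proof.
apply: (@morph_XY C K (taum \o phim) phim) => [a||] /=.
- by rewrite phim_cst taum_cst.
- have -> : phim X = xi ^+ 2 := substm_X indep_phi.
  by rewrite rmorphXn /= taum_xi sqrrN.
- have -> : phim Y = gg := substm_Y indep_phi.
  exact: taum_gg.
Qed.

Lemma taumK : involutive taum.
Proof.
move=> r; apply: (@morph_XY C K (taum \o taum) idfun) => [a||] /=.
- by rewrite !taum_cst.
- by rewrite taumX rmorphN taumX opprK.
- by rewrite taumY rmorphN taumY opprK.
Qed.

Lemma cover_phi : cover k phim taum X Y xi gg.
Proof.
split; [exact: chart_XY|exact: chart_cover|exact: (substm_X indep_phi)
  |exact: (substm_Y indep_phi)|exact: taum_xi].
Qed.

End Comorphism.

(** * Identification of the surfaces and their curves *)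

Section Surfaces.
Variable C : closedFieldType.
Local Notation k := (cstm C).
Implicit Types (O : spoint C) (S : set (spoint C)).
Local Notation gpt := (gpt k).
Local Notation gexc := (gexc k).
Local Notation gdvr := (gdvr k).
Local Notation udvrL := (udvrL k).
Local Notation udvrE := (udvrE k).
Local Notation dvrL := (dvrL k).
Local Notation dvrE := (dvrE k).
Local Notation X := (varX C).
Local Notation Y := (varY C).
Variables (t a1 a2 : C).
Hypothesis a10 : a1 != 0.
Hypothesis two0 : (2 : C) != 0.
Local Notation xi := (xi X).
Local Notation gg := (gg k X Y t a1).
Local Notation b1 := (b1 t).
Local Notation b2 := (b2 t a1 a2).
Local Notation b3 := (b3 a2).
Local Notation F := (xi ^+ 2).
Local Notation gXTak := (gXTak k X Y t a1 a2).
Local Notation gsig := (gsig k X Y t a1 a2).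
Local Notation gXOk := (gXOk k X Y a1 b1 b2 b3).
Local Notation gXOkt := (gXOkt k X Y a1 b1 b2 b3).
Local Notation okZs := (okZs k X Y a1 b1 b2 b3).
Local Notation tS := (tS k X Y t a1 a2).
Local Notation kS := (kS X Y a1 b1 b2 b3).
Local Notation ktS := (ktS X Y a1 b1 b2 b3).
Local Notation fA1 := (fA1 k F gg).
Local Notation fA2 := (fA2 k F gg b1).
Local Notation gA1 := (Submission.fA1 k X Y).
Local Notation gA2 := (Submission.fA2 k X Y b1).
Local Notation chart := (chart k).

Let cXY : chart X Y := chart_XY C.
Let cv := cover_phi t a1 two0.
Local Notation fs := (phim t a1 two0).
Let fk := phim_cst t a1 two0.
Let tk := @taum_cst C.
Let tf := taum_phim t a1 two0.

(** The centres are matched one at a time, each rewriting with the previous match, so that every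
    conversion check unfolds a single blow-up. *)
Lemma cg_q1 : cg (q1 C) = tq1 C X Y. Proof. exact: erefl. Qed.
Lemma cg_q6 : cg (q6 C) = tq6 C X Y. Proof. exact: erefl. Qed.
Lemma cg_q2 : cg (q2 a1) = (tq2 k X Y a1).
Proof. rewrite /q2 uvE cg_q1; exact: erefl. Qed.
Lemma cg_q3 : cg (q3 a1) = (tq3 k X Y a1).
Proof. rewrite /q3 uvE cg_q2; exact: erefl. Qed.
Lemma cg_q4 : cg (q4 a1) = (tq4 k X Y a1).
Proof. rewrite /q4 uvE cg_q1; exact: erefl. Qed.
Lemma cg_q5 : cg (q5 a1) = (tq5 k X Y a1).
Proof. rewrite /q5 uvE cg_q4; exact: erefl. Qed.
Lemma cg_q7 : cg (q7 C) = (tq7 k X Y).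
Proof. rewrite /q7 UVE cg_q6; exact: erefl. Qed.
Lemma cg_q8 : cg (q8 C) = (tq8 k X Y).
Proof. rewrite /q8 uvE cg_q7; exact: erefl. Qed.
Lemma cg_q9 : cg (q9 C) = (tq9 k X Y).
Proof. rewrite /q9 uvE cg_q8; exact: erefl. Qed.
Lemma cg_q10 : cg (q10 C) = (tq10 k X Y).
Proof. rewrite /q10 uvE cg_q9; exact: erefl. Qed.
Lemma cg_q11 : cg (q11 t) = (tq11 k X Y t).
Proof. rewrite /q11 uvE cg_q10; exact: erefl. Qed.
Lemma cg_q12 : cg (q12 t) = (tq12 k X Y t).
Proof. rewrite /q12 uvE cg_q11; exact: erefl. Qed.
Lemma cg_q13 : cg (q13 t a1 a2) = (tq13 k X Y t a1 a2).
Proof. rewrite /q13 uvE cg_q12; exact: erefl. Qed.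
Lemma cg_q14 : cg (q14 t a1 a2) = (tq14 k X Y t a1 a2).
Proof. rewrite /q14 uvE cg_q13; exact: erefl. Qed.
Lemma cg_q15 : cg (q15 C) = (tq15 k X Y).
Proof. rewrite /q15 uvE cg_q8; exact: erefl. Qed.
Lemma cg_q16 : cg (q16 C) = (tq16 k X Y).
Proof. rewrite /q16 uvE cg_q15; exact: erefl. Qed.
Lemma cg_q17 : cg (q17 t) = (tq17 k X Y t).
Proof. rewrite /q17 uvE cg_q16; exact: erefl. Qed.
Lemma cg_q18 : cg (q18 t) = (tq18 k X Y t).
Proof. rewrite /q18 uvE cg_q17; exact: erefl. Qed.
Lemma cg_q19 : cg (q19 t a1 a2) = (tq19 k X Y t a1 a2).
Proof. rewrite /q19 uvE cg_q18; exact: erefl. Qed.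
Lemma cg_q20 : cg (q20 t a1 a2) = (tq20 k X Y t a1 a2).
Proof. rewrite /q20 uvE cg_q19; exact: erefl. Qed.
Lemma cg_p1 : cg (p1 C) = tp1 C X Y. Proof. exact: erefl. Qed.
Lemma cg_p2 : cg (p2 a2) = (tp2 k X Y a2).
Proof. rewrite /p2 UVE cg_p1; exact: erefl. Qed.
Lemma cg_p3 : cg (p3 C) = tp3 C X Y. Proof. exact: erefl. Qed.
Lemma cg_p4 : cg (p4 a1) = (tp4 k X Y a1).
Proof. rewrite /p4 uvE cg_p3; exact: erefl. Qed.
Lemma cg_p5 : cg (p5 C) = tp5 C X Y. Proof. exact: erefl. Qed.
Lemma cg_p6 : cg (p6 C) = (tp6 k X Y).
Proof. rewrite /p6 UVE cg_p5; exact: erefl. Qed.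
Lemma cg_p7 : cg (p7 t) = (tp7 k X Y t).
Proof. rewrite /p7 uvE cg_p6; exact: erefl. Qed.
Lemma cg_p8 : cg (p8 t a1 a2) = (tp8 k X Y t a1 a2).
Proof. rewrite /p8 uvE cg_p7; exact: erefl. Qed.

Lemma XTakE : XTak t a1 a2 = gXTak.
Proof.
rewrite /XTak foldl_blowup /Submission.gXTak (takPsE t a2 cXY a10 two0) /map.
rewrite cg_q1 cg_q2 cg_q3 cg_q4 cg_q5 cg_q6 cg_q7 cg_q8 cg_q9 cg_q10 cg_q11 cg_q12 cg_q13 cg_q14 cg_q15 cg_q16 cg_q17 cg_q18 cg_q19 cg_q20.
exact: erefl.
Qed.

Lemma XOkE : XOk t a1 a2 = gXOk.
Proof.
rewrite /XOk foldl_blowup /Submission.gXOk (okPsE t a2 cXY a10) /map.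
rewrite cg_p1 cg_p2 cg_p3 cg_p4 cg_p5 cg_p6 cg_p7 cg_p8.
exact: erefl.
Qed.

Lemma takFE z : TakF t a1 a2 z = Defs.proper gXTak (gexc (gpt (cg z))).
Proof. by rewrite /TakF XTakE excE. Qed.

Lemma Tak_q0E : Tak_q0 t a1 a2 = tS (gdvr X Y).
Proof. rewrite /Tak_q0 XTakE; exact: (tak_q0_E t a2 cXY a10 two0). Qed.
Lemma Tak_qooE : Tak_qoo t a1 a2 = tS (gdvr X^-1 Y).
Proof. rewrite /Tak_qoo XTakE; exact: (tak_qoo_E t a2 cXY a10 two0). Qed.
Lemma Tak_pooE : Tak_poo t a1 a2 = tS (gdvr gg^-1 xi).
Proof. rewrite /Tak_poo XTakE; exact: (tak_poo_E t a2 cXY a10 two0). Qed.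
Lemma TakF_q1 : TakF t a1 a2 (q1 C) = tS (gdvr xi (F * gg)).
Proof. rewrite takFE cg_q1; exact: (tak_tq1_E t a1 a2 cXY two0). Qed.
Lemma TakF_q6 : TakF t a1 a2 (q6 C) = tS (gdvr X^-1 (Y / X)).
Proof. rewrite takFE cg_q6; exact: (tak_tq6_E t a1 a2 cXY two0). Qed.
Lemma TakF_q7 : TakF t a1 a2 (q7 C) = tS (gdvr X^-1 (Y / X ^+ 2)).
Proof. rewrite takFE cg_q7; exact: (tak_tq7_E t a1 a2 cXY two0). Qed.
Lemma TakF_q8 : TakF t a1 a2 (q8 C) = tS (gdvr xi^-1 (F / gg)).
Proof. rewrite takFE cg_q8; exact: (tak_tq8_E t a1 a2 cXY two0). Qed.

Lemma sigmaE : sigma t a1 a2 = gsig.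
Proof.
have s1 : sigma1 t a1 a2 = gsig1 k X Y t a1 a2 by rewrite /sigma1 Tak_q0E.
have s2 : sigma2 t a1 a2 = gsig2 k X Y t a1 a2 by rewrite /sigma2 Tak_qooE s1.
have s3 : sigma3 t a1 a2 = gsig3 k X Y t a1 a2 by rewrite /sigma3 TakF_q6 s2.
by rewrite /sigma TakF_q7 s3.
Qed.

Let cv0 := cover_zero cv.
Let cvA0 := cover_A0 cv.
Let cvA1 := cover_A1 fk cv.
Let cvA2 := cover_A2 fk b1 cv.
Let cvB0 := cover_B0 cv.
Let cvB1 := cover_B1 cv.
Let cvB2 := cover_B2 cv.
Lemma cvc x y x' y' (c : cover k fs (taum C) x y x' y') : chart x' y'. Proof. by case: c. Qed.

Lemma nF (nxt : C -> Prop) (P : spoint C -> Prop) x y b :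
  (forall O, ustep k x y b nxt O -> P O) -> forall O, ustep k x y b (fun=> False) O -> P O.
Proof.
move=> H O H'; apply: (H O).
exact: (@ustep_mono _ _ k (fun=> False) nxt x y b O (fun c f => False_ind _ f) H').
Qed.

Lemma ok1 O (H : ustep k xi (F * gg) a1 (@any C) O) : gXTak O /\ noncontr X Y O.
Proof. exact: (tak_S1 a2 cXY a10 two0 H). Qed.
Lemma ok2 O (H : ustep k xi (F * gg) 0 (@any C) O) : gXTak O /\ noncontr X Y O.
Proof. exact: (tak_S2 a2 cXY a10 two0 H). Qed.
Lemma okA0 O (H : ustep k xi^-1 (F / gg) 2 (ne b1) O) : gXTak O /\ noncontr X Y O.
Proof. exact: (tak_A (t := t) (a2 := a2) cXY two0 (Or31 _ _ H)). Qed.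
Lemma okA1 O (H : ustep k xi^-1 fA1 b1 (ne b2) O) : gXTak O /\ noncontr X Y O.
Proof. exact: (tak_A (t := t) (a2 := a2) cXY two0 (Or32 _ _ H)). Qed.
Lemma okA2 O (H : ustep k xi^-1 fA2 b2 (@any C) O) : gXTak O /\ noncontr X Y O.
Proof. exact: (tak_A (t := t) (a2 := a2) cXY two0 (Or33 _ _ H)). Qed.
Lemma okB0 O (H : ustep k xi^-1 (gg / F) 0 (ne 0) O) : gXTak O /\ noncontr X Y O.
Proof. exact: (tak_B (t := t) (a2 := a2) cXY two0 (Or31 _ _ H)). Qed.
Lemma okB1 O (H : ustep k xi^-1 gg 0 (ne b3) O) : gXTak O /\ noncontr X Y O.
Proof. exact: (tak_B (t := t) (a2 := a2) cXY two0 (Or32 _ _ H)). Qed.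
Lemma okB2 O (H : ustep k xi^-1 (F * gg) b3 (@any C) O) : gXTak O /\ noncontr X Y O.
Proof. exact: (tak_B (t := t) (a2 := a2) cXY two0 (Or33 _ _ H)). Qed.
Lemma ne_notin (b c : C) : c \notin [:: b] -> ne b c. Proof. by rewrite inE. Qed.
Lemma any_notin (c : C) : c \notin [::] -> any c. Proof. exact: (fun _ => I). Qed.

Lemma TakF_q2 : TakF t a1 a2 (q2 a1) = tS (udvrL xi (F * gg) a1).
Proof. rewrite takFE cg_q2 (tq2E t cXY a10 two0); exact: (tak_L (cvc cv0) (nF ok1)). Qed.
Lemma TakF_q4 : TakF t a1 a2 (q4 a1) = tS (udvrL xi (F * gg) 0).
Proof. rewrite takFE cg_q4 (tq4E t cXY a10 two0); exact: (tak_L (cvc cv0) (nF ok2)). Qed.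
Lemma TakF_q9 : TakF t a1 a2 (q9 C) = tS (udvrL xi^-1 (F / gg) 2).
Proof. rewrite takFE cg_q9 (tq9E t a1 cXY two0); exact: (tak_L (cvc cvA0) (nF okA0)). Qed.
Lemma TakF_q11 : TakF t a1 a2 (q11 t) = tS (udvrL xi^-1 fA1 b1).
Proof. rewrite takFE cg_q11 (tq11E t a1 cXY two0); exact: (tak_L (cvc cvA1) (nF okA1)). Qed.
Lemma TakF_q13 : TakF t a1 a2 (q13 t a1 a2) = tS (udvrL xi^-1 fA2 b2).
Proof. rewrite takFE cg_q13 (tq13E t a1 a2 cXY two0); exact: (tak_L (cvc cvA2) (nF okA2)). Qed.
Lemma TakF_q15 : TakF t a1 a2 (q15 C) = tS (udvrL xi^-1 (gg / F) 0).
Proof. rewrite takFE cg_q15 (tq15E t a1 cXY two0); exact: (tak_L (cvc cvB0) (nF okB0)). Qed.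
Lemma TakF_q17 : TakF t a1 a2 (q17 t) = tS (udvrL xi^-1 gg 0).
Proof. rewrite takFE cg_q17 (tq17E t a1 cXY two0); exact: (tak_L (cvc cvB1) (nF okB1)). Qed.
Lemma TakF_q19 : TakF t a1 a2 (q19 t a1 a2) = tS (udvrL xi^-1 (F * gg) b3).
Proof. rewrite takFE cg_q19 (tq19E t a1 a2 cXY two0); exact: (tak_L (cvc cvB2) (nF okB2)). Qed.
Lemma TakF_q3 : TakF t a1 a2 (q3 a1) = tS (udvrE xi (F * gg) a1).
Proof. rewrite takFE cg_q3 (tq3E t cXY a10 two0); exact: (tak_E (cvc cv0) any_notin ok1). Qed.
Lemma TakF_q5 : TakF t a1 a2 (q5 a1) = tS (udvrE xi (F * gg) 0).
Proof. rewrite takFE cg_q5 (tq5E t cXY a10 two0); exact: (tak_E (cvc cv0) any_notin ok2). Qed.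
Lemma TakF_q10 : TakF t a1 a2 (q10 C) = tS (udvrE xi^-1 (F / gg) 2).
Proof. rewrite takFE cg_q10 (tq10E t a1 cXY two0); exact: (tak_E (cvc cvA0) (@ne_notin b1) okA0). Qed.
Lemma TakF_q12 : TakF t a1 a2 (q12 t) = tS (udvrE xi^-1 fA1 b1).
Proof. rewrite takFE cg_q12 (tq12E t a1 cXY two0); exact: (tak_E (cvc cvA1) (@ne_notin b2) okA1). Qed.
Lemma TakF_q14 : TakF t a1 a2 (q14 t a1 a2) = tS (udvrE xi^-1 fA2 b2).
Proof. rewrite takFE cg_q14 (tq14E t a1 a2 cXY two0); exact: (tak_E (cvc cvA2) any_notin okA2). Qed.
Lemma TakF_q16 : TakF t a1 a2 (q16 C) = tS (udvrE xi^-1 (gg / F) 0).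
Proof. rewrite takFE cg_q16 (tq16E t a1 cXY two0); exact: (tak_E (cvc cvB0) (@ne_notin 0) okB0). Qed.
Lemma TakF_q18 : TakF t a1 a2 (q18 t) = tS (udvrE xi^-1 gg 0).
Proof. rewrite takFE cg_q18 (tq18E t a1 cXY two0); exact: (tak_E (cvc cvB1) (@ne_notin b3) okB1). Qed.
Lemma TakF_q20 : TakF t a1 a2 (q20 t a1 a2) = tS (udvrE xi^-1 (F * gg) b3).
Proof. rewrite takFE cg_q20 (tq20E t a1 a2 cXY two0); exact: (tak_E (cvc cvB2) any_notin okB2). Qed.

Lemma OkFE z : OkE t a1 a2 z = Defs.proper gXOk (gexc (gpt (cg z))).
Proof. rewrite /OkE XOkE excE; exact: erefl. Qed.

Lemma tp1E : gpt (tp1 C X Y) = okP1 k X Y.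
Proof. exact: (esym (congr1 (fun s => nth set0 s 0) (okPsE t a2 cXY a10))). Qed.
Lemma tp2E : gpt (tp2 k X Y a2) = okP2 k X Y b3.
Proof. exact: (esym (congr1 (fun s => nth set0 s 1) (okPsE t a2 cXY a10))). Qed.
Lemma tp3E : gpt (tp3 C X Y) = okP3 k X Y.
Proof. exact: (esym (congr1 (fun s => nth set0 s 2) (okPsE t a2 cXY a10))). Qed.
Lemma tp4E : gpt (tp4 k X Y a1) = okP4 k X Y a1.
Proof. exact: (esym (congr1 (fun s => nth set0 s 3) (okPsE t a2 cXY a10))). Qed.
Lemma tp5E : gpt (tp5 C X Y) = okP5 k X Y.
Proof. exact: (esym (congr1 (fun s => nth set0 s 4) (okPsE t a2 cXY a10))). Qed.
Lemma tp6E : gpt (tp6 k X Y) = okP6 k X Y.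
Proof. exact: (esym (congr1 (fun s => nth set0 s 5) (okPsE t a2 cXY a10))). Qed.
Lemma tp7E : gpt (tp7 k X Y t) = okP7 k X Y b1.
Proof. exact: (esym (congr1 (fun s => nth set0 s 6) (okPsE t a2 cXY a10))). Qed.
Lemma tp8E : gpt (tp8 k X Y t a1 a2) = okP8 k X Y b1 b2.
Proof. exact: (esym (congr1 (fun s => nth set0 s 7) (okPsE t a2 cXY a10))). Qed.
Lemma D0E : D0 t a1 a2 = kS (gdvr X (X * Y)).
Proof. rewrite /D0 OkFE cg_p3 tp3E; exact: (proj1 (curve_D0 a1 b1 b2 b3 cXY)). Qed.
Lemma D1E : D1 t a1 a2 = kS (dvrE X^-1 Y 0).
Proof. rewrite /D1 OkFE cg_p1 tp1E; exact: (proj1 (curve_D1 b1 b2 b3 cXY a10)). Qed.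
Lemma D3E : D3 t a1 a2 = kS (gdvr X^-1 (X / Y)).
Proof. rewrite /D3 OkFE cg_p5 tp5E; exact: (proj1 (curve_D3 a1 b1 b2 b3 cXY)). Qed.
Lemma D4E : D4 t a1 a2 = kS (dvrE X^-1 (X / Y) 2).
Proof. rewrite /D4 OkFE cg_p6 tp6E; exact: (proj1 (curve_D4 a1 b1 b2 b3 cXY)). Qed.
Lemma D5E : D5 t a1 a2 = kS (dvrE X^-1 gA1 b1).
Proof. rewrite /D5 OkFE cg_p7 tp7E; exact: (proj1 (curve_D5 a1 b1 b2 b3 cXY)). Qed.
Lemma D2E : D2 t a1 a2 = kS (dvrE X^-1 (Y / X) 0).
Proof. rewrite /D2 XOkE; exact: (proj1 (curve_D2 b1 b2 b3 cXY a10)). Qed.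
Lemma D6E : D6 t a1 a2 = kS (gdvr Y^-1 X).
Proof. rewrite /D6 XOkE; exact: (proj1 (curve_D6 a1 b1 b2 b3 cXY)). Qed.
Lemma Ok_f0E : Ok_f0 t a1 a2 = kS (dvrE X (X * Y) 0).
Proof. rewrite /Ok_f0 XOkE; exact: (proj1 (curve_f0 b1 b2 b3 cXY a10)). Qed.
Lemma OkE2E : OkE t a1 a2 (p2 a2) = kS (dvrE X^-1 (X * Y) b3).
Proof. rewrite OkFE cg_p2 tp2E; exact: (proj1 (curve_E2 b1 b2 b3 cXY a10)). Qed.
Lemma OkE4E : OkE t a1 a2 (p4 a1) = kS (dvrE X (X * Y) a1).
Proof. rewrite OkFE cg_p4 tp4E; exact: (proj1 (curve_E4 b1 b2 b3 cXY a10)). Qed.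
Lemma OkE8E : OkE t a1 a2 (p8 t a1 a2) = kS (dvrE X^-1 gA2 b2).
Proof. rewrite OkFE cg_p8 tp8E; exact: (proj1 (curve_E8 a1 b1 b2 b3 cXY)). Qed.
Lemma z1_E : Defs.z1 t a1 a2 = [set okZ1 k X Y].
Proof. rewrite /Defs.z1 D0E Ok_f0E; exact: (kS_z1 b1 b2 b3 cXY a10). Qed.
Lemma z2_E : Defs.z2 t a1 a2 = [set okZ2 k X Y a1].
Proof. rewrite /Defs.z2 D0E OkE4E; exact: (kS_z2 b1 b2 b3 cXY a10). Qed.
Lemma z3_E : Defs.z3 t a1 a2 = [set okZ3 k X Y b3].
Proof. rewrite /Defs.z3 D1E OkE2E; exact: (kS_z3 b1 b2 b3 cXY a10). Qed.
Lemma z4_E : Defs.z4 t a1 a2 = [set okZ4 k X Y].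
Proof. rewrite /Defs.z4 D1E D2E; exact: (kS_z4 b1 b2 b3 cXY a10). Qed.
Lemma z5_E : Defs.z5 t a1 a2 = [set okZ5 k X Y].
Proof. rewrite /Defs.z5 D2E D3E; exact: (kS_z5 b1 b2 b3 cXY a10). Qed.
Lemma z6_E : Defs.z6 t a1 a2 = [set okZ6 k X Y].
Proof. rewrite /Defs.z6 D3E D4E; exact: (kS_z6 b1 b2 b3 cXY a10). Qed.
Lemma z7_E : Defs.z7 t a1 a2 = [set okZ7 k X Y b1].
Proof. rewrite /Defs.z7 D4E D5E; exact: (kS_z7 b1 b2 b3 cXY a10). Qed.
Lemma z8_E : Defs.z8 t a1 a2 = [set okZ8 k X Y b1 b2].
Proof. rewrite /Defs.z8 D5E OkE8E; exact: (kS_z8 b1 b2 b3 cXY a10). Qed.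

Lemma zsE O : zs t a1 a2 O <-> List.In O okZs.
Proof.
rewrite /zs z1_E z2_E z3_E z4_E z5_E z6_E z7_E z8_E; split.
  case=> [[[[[[[->|->]|->]|->]|->]|->]|->]|->]; [left; exact: erefl|right; left; exact: erefl|do 2!right; left; exact: erefl|do 3!right; left; exact: erefl|do 4!right; left; exact: erefl|do 5!right; left; exact: erefl|do 6!right; left; exact: erefl|do 7!right; left; exact: erefl].
case=> [<-|[<-|[<-|[<-|[<-|[<-|[<-|[<-|[]]]]]]]]]; [do 7!left; exact: erefl|do 6!left; right; exact: erefl|do 5!left; right; exact: erefl|do 4!left; right; exact: erefl|do 3!left; right; exact: erefl|do 2!left; right; exact: erefl|do 1!left; right; exact: erefl|right; exact: erefl].
Qed.

Lemma XOktE : XOkt t a1 a2 = gXOkt.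
Proof.
rewrite /XOkt XOkE; apply/seteqP; split=> O.
  case=> [[XO nz]|[Z /zsE Zin]]; last by rewrite excE => e; right; exists Z.
  by left; split=> //; apply: notin_avoid => P Pin EO; apply: nz; apply/zsE; rewrite EO.
case=> [[XO aO]|[Z Zin e]]; last by right; exists Z; [exact/zsE|rewrite excE].
by left; split=> // /zsE Zin; exact: (avoid_in aO Zin).
Qed.

Lemma L1E : L1 t a1 a2 = ktS (dvrL X (X * Y) 0).
Proof. rewrite /L1 z1_E excs1; exact: (excZ1 b1 b2 b3 cXY a10). Qed.
Lemma L2E : L2 t a1 a2 = ktS (dvrL X (X * Y) a1).
Proof. rewrite /L2 z2_E excs1; exact: (excZ2 b1 b2 b3 cXY a10). Qed.
Lemma L3E : L3 t a1 a2 = ktS (dvrL X^-1 (X * Y) b3).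
Proof. rewrite /L3 z3_E excs1; exact: (excZ3 a1 b1 b2 b3 cXY). Qed.
Lemma L4E : L4 t a1 a2 = ktS (dvrL X^-1 Y 0).
Proof. rewrite /L4 z4_E excs1; exact: (excZ4 a1 b1 b2 b3 cXY). Qed.
Lemma L5E : L5 t a1 a2 = ktS (dvrL X^-1 (Y / X) 0).
Proof. rewrite /L5 z5_E excs1; exact: (excZ5 a1 b1 b2 b3 cXY). Qed.
Lemma L6E : L6 t a1 a2 = ktS (dvrL X^-1 (X / Y) 2).
Proof. rewrite /L6 z6_E excs1; exact: (excZ6 a1 b1 b2 b3 cXY). Qed.
Lemma L7E : L7 t a1 a2 = ktS (dvrL X^-1 gA1 b1).
Proof. rewrite /L7 z7_E excs1; exact: (excZ7 a1 b1 b2 b3 cXY). Qed.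
Lemma L8E : L8 t a1 a2 = ktS (dvrL X^-1 gA2 b2).
Proof. rewrite /L8 z8_E excs1; exact: (excZ8 a1 b1 b2 b3 cXY). Qed.
Lemma Dt0E : Dt0 t a1 a2 = ktS (gdvr X (X * Y)).
Proof. rewrite /Dt0 XOktE D0E; exact: (proj2 (curve_D0 a1 b1 b2 b3 cXY)). Qed.
Lemma Dt1E : Dt1 t a1 a2 = ktS (dvrE X^-1 Y 0).
Proof. rewrite /Dt1 XOktE D1E; exact: (proj2 (curve_D1 b1 b2 b3 cXY a10)). Qed.
Lemma Dt2E : Dt2 t a1 a2 = ktS (dvrE X^-1 (Y / X) 0).
Proof. rewrite /Dt2 XOktE D2E; exact: (proj2 (curve_D2 b1 b2 b3 cXY a10)). Qed.
Lemma Dt3E : Dt3 t a1 a2 = ktS (gdvr X^-1 (X / Y)).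
Proof. rewrite /Dt3 XOktE D3E; exact: (proj2 (curve_D3 a1 b1 b2 b3 cXY)). Qed.
Lemma Dt4E : Dt4 t a1 a2 = ktS (dvrE X^-1 (X / Y) 2).
Proof. rewrite /Dt4 XOktE D4E; exact: (proj2 (curve_D4 a1 b1 b2 b3 cXY)). Qed.
Lemma Dt5E : Dt5 t a1 a2 = ktS (dvrE X^-1 gA1 b1).
Proof. rewrite /Dt5 XOktE D5E; exact: (proj2 (curve_D5 a1 b1 b2 b3 cXY)). Qed.
Lemma Dt6E : Dt6 t a1 a2 = ktS (gdvr Y^-1 X).
Proof. rewrite /Dt6 XOktE D6E; exact: (proj2 (curve_D6 a1 b1 b2 b3 cXY)). Qed.
Lemma Okt_f0E : Okt_f0 t a1 a2 = ktS (dvrE X (X * Y) 0).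
Proof. rewrite /Okt_f0 XOktE Ok_f0E; exact: (proj2 (curve_f0 b1 b2 b3 cXY a10)). Qed.
Lemma Et2E : Et2 t a1 a2 = ktS (dvrE X^-1 (X * Y) b3).
Proof. rewrite /Et2 XOktE OkE2E; exact: (proj2 (curve_E2 b1 b2 b3 cXY a10)). Qed.
Lemma Et4E : Et4 t a1 a2 = ktS (dvrE X (X * Y) a1).
Proof. rewrite /Et4 XOktE OkE4E; exact: (proj2 (curve_E4 b1 b2 b3 cXY a10)). Qed.
Lemma Et8E : Et8 t a1 a2 = ktS (dvrE X^-1 gA2 b2).
Proof. rewrite /Et8 XOktE OkE8E; exact: (proj2 (curve_E8 a1 b1 b2 b3 cXY)). Qed.

Lemma imgE S : pre fs @` (sigma t a1 a2 @` S) = gphi k fs X Y t a1 a2 @` S.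
Proof. by rewrite sigmaE image_comp. Qed.

Lemma C1_image : pre fs @` C1 t a1 a2 = L2 t a1 a2.
Proof. rewrite /C1 imgE TakF_q2 L2E; exact: (img_C1 fk tk tf a2 cXY a10 two0 cv). Qed.
Lemma C2_image : pre fs @` C2 t a1 a2 = L1 t a1 a2.
Proof. rewrite /C2 imgE TakF_q4 L1E; exact: (img_C2 fk tk tf a2 cXY a10 two0 cv). Qed.
Lemma C3_image : pre fs @` C3 t a1 a2 = Dt0 t a1 a2.
Proof. rewrite /C3 imgE TakF_q1 Dt0E; exact: (img_C3 fk tk tf a2 cXY a10 two0 cv). Qed.
Lemma C4_image : pre fs @` C4 t a1 a2 = Dt6 t a1 a2.
Proof. rewrite /C4 imgE Tak_pooE Dt6E; exact: (img_C4 fk tk tf a2 cXY a10 two0 cv). Qed.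
Lemma C5_image : pre fs @` C5 t a1 a2 = Dt3 t a1 a2.
Proof. rewrite /C5 imgE TakF_q8 Dt3E; exact: (img_C5 fk tk tf a2 cXY a10 two0 cv). Qed.
Lemma C6_image : pre fs @` C6 t a1 a2 = L6 t a1 a2.
Proof. rewrite /C6 imgE TakF_q9 L6E; exact: (img_C6 fk tk tf a2 cXY a10 two0 cv). Qed.
Lemma C7_image : pre fs @` C7 t a1 a2 = Dt4 t a1 a2.
Proof. rewrite /C7 imgE TakF_q10 Dt4E; exact: (img_C7 fk tk tf a2 cXY a10 two0 cv). Qed.
Lemma C8_image : pre fs @` C8 t a1 a2 = L7 t a1 a2.
Proof. rewrite /C8 imgE TakF_q11 L7E; exact: (img_C8 fk tk tf a2 cXY a10 two0 cv). Qed.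
Lemma C9_image : pre fs @` C9 t a1 a2 = Dt5 t a1 a2.
Proof. rewrite /C9 imgE TakF_q12 Dt5E; exact: (img_C9 fk tk tf a2 cXY a10 two0 cv). Qed.
Lemma C10_image : pre fs @` C10 t a1 a2 = L8 t a1 a2.
Proof. rewrite /C10 imgE TakF_q13 L8E; exact: (img_C10 fk tk tf a2 cXY a10 two0 cv). Qed.
Lemma C11_image : pre fs @` C11 t a1 a2 = L5 t a1 a2.
Proof. rewrite /C11 imgE TakF_q15 L5E; exact: (img_C11 fk tk tf a2 cXY a10 two0 cv). Qed.
Lemma C12_image : pre fs @` C12 t a1 a2 = Dt2 t a1 a2.
Proof. rewrite /C12 imgE TakF_q16 Dt2E; exact: (img_C12 fk tk tf a2 cXY a10 two0 cv). Qed.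
Lemma C13_image : pre fs @` C13 t a1 a2 = L4 t a1 a2.
Proof. rewrite /C13 imgE TakF_q17 L4E; exact: (img_C13 fk tk tf a2 cXY a10 two0 cv). Qed.
Lemma C14_image : pre fs @` C14 t a1 a2 = Dt1 t a1 a2.
Proof. rewrite /C14 imgE TakF_q18 Dt1E; exact: (img_C14 fk tk tf a2 cXY a10 two0 cv). Qed.
Lemma C15_image : pre fs @` C15 t a1 a2 = L3 t a1 a2.
Proof. rewrite /C15 imgE TakF_q19 L3E; exact: (img_C15 fk tk tf a2 cXY a10 two0 cv). Qed.
Lemma F3_image : pre fs @` F3 t a1 a2 = Et4 t a1 a2.
Proof. rewrite /F3 imgE TakF_q3 Et4E; exact: (img_F3 fk tk tf a2 cXY a10 two0 cv). Qed.
Lemma F5_image : pre fs @` F5 t a1 a2 = Okt_f0 t a1 a2.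
Proof. rewrite /F5 imgE TakF_q5 Okt_f0E; exact: (img_F5 fk tk tf a2 cXY a10 two0 cv). Qed.
Lemma F14_image : pre fs @` F14 t a1 a2 = Et8 t a1 a2.
Proof. rewrite /F14 imgE TakF_q14 Et8E; exact: (img_F14 fk tk tf a2 cXY a10 two0 cv). Qed.
Lemma F20_image : pre fs @` F20 t a1 a2 = Et2 t a1 a2.
Proof. rewrite /F20 imgE TakF_q20 Et2E; exact: (img_F20 fk tk tf a2 cXY a10 two0 cv). Qed.

End Surfaces.

(** * The decomposition and the absence of contracted curves *)

Section Decomposition.
Variable C : closedFieldType.
Local Notation K := (rfun C).
Local Notation k := (cstm C).
Implicit Types (O : spoint C) (S : set (spoint C)).
Local Notation gpt := (gpt k).
Local Notation gexc := (gexc k).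
Local Notation X := (varX C).
Local Notation Y := (varY C).
Variables (t a1 a2 : C).
Hypothesis a10 : a1 != 0.
Hypothesis two0 : (2 : C) != 0.
Local Notation xi := (xi X).
Local Notation gg := (gg k X Y t a1).
Local Notation b1 := (b1 t).
Local Notation b2 := (b2 t a1 a2).
Local Notation b3 := (b3 a2).
Local Notation gXTak := (gXTak k X Y t a1 a2).
Local Notation gsig := (gsig k X Y t a1 a2).
Local Notation gXOk := (gXOk k X Y a1 b1 b2 b3).
Local Notation gXOkt := (gXOkt k X Y a1 b1 b2 b3).
Local Notation okZs := (okZs k X Y a1 b1 b2 b3).
Local Notation chart := (chart k).

Let cXY : chart X Y := chart_XY C.
Let cv := cover_phi t a1 two0.
Local Notation fs := (phim t a1 two0).
Local Notation tau := (taum C).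
Let fk := phim_cst t a1 two0.
Let tk := @taum_cst C.
Let tf := taum_phim t a1 two0.
Let twoK : (2 : K) != 0.
Proof. by rewrite -(rmorph_nat k) fmorph_eq0. Qed.

Lemma XTakm_up O : XTakm t a1 a2 O -> exists2 O1, gXTak O1 & O = gsig O1.
Proof.
rewrite /XTakm (sigmaE t a2 a10 two0) (XTakE t a2 a10 two0) => -[O1 XO1 <-].
by exists O1.
Qed.

Lemma XTakm_covered O : XTakm t a1 a2 O -> gXOkt (pre fs O) /\ covered k fs tau O.
Proof.
case/XTakm_up => O1 X1 ->; split; first exact: (gphi_XOkt fk tk tf cXY a10 two0 cv X1).
exact: (proj2 (up_down twoK fk tk tf cv (gsig_up cXY a10 two0 X1))).
Qed.

(** The last clause records that the curves L_i lie over f = 0 or f = oo: f and f^-1 are never both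
    regular on them. So the projection fixes every point where f is finite and nonzero. *)
Lemma okZ_chart Z : List.In Z okZs -> exists z, [/\ chart (gx z) (gy z), Z = gpt z
  & forall O, gexc Z O -> O X -> O X^-1 -> False].
Proof.
have cF := chart_fg cXY; have cA := chart_A0 cXY; have cB := chart_B0 cXY.
have cA1 : chart X^-1 (fA1 k X Y) := chart_y1 cA erefl.
have cA2 : chart X^-1 (fA2 k X Y b1) := chart_y2 cA erefl erefl.
have cB1 : chart X^-1 Y := chart_inv cXY.
have cB2 : chart X^-1 (X * Y) := chart_inv cF.
have H0 y b : chart X y -> exists z, [/\ chart (gx z) (gy z), eZ k X y b = gpt z
    & forall O, gexc (eZ k X y b) O -> O X -> O X^-1 -> False].
  move=> c; have [z [cz Ez nz]] := eZ_chart b c; exists z.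
  exact: (And3 cz Ez (fun O e _ Oi => nz O e Oi)).
have Hoo y b : chart X^-1 y -> exists z, [/\ chart (gx z) (gy z), eZ k X^-1 y b = gpt z
    & forall O, gexc (eZ k X^-1 y b) O -> O X -> O X^-1 -> False].
  move=> c; have [z [cz Ez nz]] := eZ_chart b c; exists z.
  by rewrite invrK in nz; exact: (And3 cz Ez (fun O e Oi _ => nz O e Oi)).
case=> [<-|[<-|[<-|[<-|[<-|[<-|[<-|[<-|[]]]]]]]]].
- exact: (H0 _ 0 cF).
- exact: (H0 _ a1 cF).
- exact: (Hoo _ b3 cB2).
- exact: (Hoo _ 0 cB1).
- exact: (Hoo _ 0 cB).
- exact: (Hoo _ 2 cA).
- exact: (Hoo _ b1 cA1).
- exact: (Hoo _ b2 cA2).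
Qed.

Lemma rho_id O : (forall Z, List.In Z okZs -> ~ gexc Z O) -> rho t a1 a2 O = O.
Proof.
move=> H; rewrite /rho /blowdown; apply: xgetPN => Z [/(zsE t a2 a10) Zin].
rewrite excE; exact: H.
Qed.

(** [blowdown] picks some centre whose exceptional curve contains the point. That property is
    enough: it gives the inclusion of local rings and of maximal ideals, whichever centre is
    picked. *)
Lemma rho_local O : gXOkt O ->
  [/\ gXOk (rho t a1 a2 O), rho t a1 a2 O `<=` O & maxideal (rho t a1 a2 O) `<=` maxideal O].
Proof.
move=> XO; have [[Z [Zin eZ]]|nZ] := pselect (exists Z, List.In Z okZs /\ gexc Z O).
  have : [set Z | zs t a1 a2 Z /\ exc Z O] (rho t a1 a2 O).
    rewrite /rho /blowdown; apply: xgetPex; exists Z; split; first exact/(zsE t a2 a10).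
    by rewrite excE.
  case=> /(zsE t a2 a10) Win; rewrite excE => eW; split.
  - exact: (okZs_in cXY a10 Win).
  - have [z [cz Ez _]] := okZ_chart Win; rewrite Ez in eW *.
    exact: (proj1 (dom_max cz eW)).
  - have [z [cz Ez _]] := okZ_chart Win; rewrite Ez in eW *.
    exact: (proj2 (dom_max cz eW)).
have E : rho t a1 a2 O = O by apply: rho_id => Z Zin e; apply: nZ; exists Z.
rewrite E; split; [|exact: subset_refl|exact: subset_refl].
case: XO => [[XO _]|[Z Zin e]]; first exact: XO.
by case: nZ; exists Z.
Qed.

Lemma pre_maxideal O : fs @` maxideal (pre fs O) `<=` maxideal O.
Proof.
move=> _ [r [Or rn] <-]; split; first exact: Or.
case: rn => [->|nr]; first by left; exact: rmorph0.
by right=> Oi; apply: nr; rewrite /pre /= fmorphV.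
Qed.

Lemma phit_morphism : is_morphism (phi_star t a1) (XTakm t a1 a2) (XOkt t a1 a2) (pre fs).
Proof.
move=> O /XTakm_covered [XO _]; rewrite (XOktE t a2 a10); split; first exact: XO.
  by move=> _ [r Or <-].
exact: pre_maxideal.
Qed.

Lemma rho_phit_morphism : is_morphism (phi_star t a1) (XTakm t a1 a2) (XOk t a1 a2)
  (rho t a1 a2 \o pre fs).
Proof.
move=> O /XTakm_covered [/rho_local [XO sub subm] _]; rewrite (XOkE t a2 a10); split.
- exact: XO.
- by move=> _ [r Or <-]; exact: (sub r Or).
- by move=> _ [r Or <-]; apply: pre_maxideal; exists r; first exact: subm.
Qed.

Lemma affine_image a b : a != 0 -> XTakm t a1 a2 (affine_pt a b) /\
  (rho t a1 a2 \o pre fs) (affine_pt a b) = affine_pt (phi_f a) (phi_g t a1 a b).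
Proof.
move=> a0; have E : affine_pt a b = gpt (GCentre xi gg (a / 2) (aff_b t a1 a b)).
  exact: (aff_pt t a1 cXY two0 b a0).
have ah : a / 2 != 0 by rewrite mulf_neq0 ?invr_eq0.
have [XO nc] := tak_gen t a2 cXY a10 two0 (aff_b t a1 a b) ah.
split.
  exists (affine_pt a b); rewrite E; first by rewrite (XTakE t a2 a10 two0).
  by rewrite (sigmaE t a2 a10 two0) (gsig_fix t a2 cXY a10 two0 nc).
have E2 : pre fs (affine_pt a b) = affine_pt (phi_f a) (phi_g t a1 a b).
  by rewrite E (pre_cover twoK fk tk tf _ _ cv).
rewrite /comp E2; apply: rho_id => Z Zin e; have [z [cz Ez H]] := okZ_chart Zin.
pose w : gcentre C K := GCentre X Y (phi_f a) (phi_g t a1 a b).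
have f0 : phi_f a != 0 by rewrite expf_neq0.
exact: (H _ e (val_pt (val_x k w)) (val_pt (valV f0 (val_x k w)))).
Qed.

Lemma closure_point O1 O : closure ([set O1] : set (spoint C)) O -> O `<=` O1.
Proof. by move=> c; apply: (closure_reg c) => _ ->; exact: subset_refl. Qed.

Lemma subset_closed S O1 O2 : (forall O, S O -> O = O1 \/ O = O2) ->
  S `<=` closure ([set O1] : set (spoint C)) `|` closure ([set O2] : set (spoint C)).
Proof. by move=> H O /H [->|->]; [left|right]; apply: subset_closure. Qed.

(** A curve contracted to one point would lie in the fibre formed by [O1] and [pre tau O1]. This
    pair is covered by the closures of its two points, so by irreducibility one closure contains the
    curve. Lying in the closure of a point means inclusion of local rings, and
    [covered_incomparable] turns this into equality: the curve would be a single point. *)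
Lemma no_contracted S : is_curve (XTakm t a1 a2) S -> forall O, pre fs @` S <> [set O].
Proof.
move=> [SX _ irr [[O1 SO1] _] nS] O ES.
have pE O' : S O' -> pre fs O' = O by move=> SO'; have : (pre fs @` S) (pre fs O') by [exists O'|]; rewrite ES.
have cov O' : S O' -> covered k fs tau O' by move=> /SX /XTakm_covered [].
have inc O2 : S O2 -> S `<=` closure ([set O2] : set (spoint C)) -> False.
  move=> SO2 sub; apply: (nS O2); apply/seteqP; split=> [O' SO'|_ ->]; last exact: SO2.
  apply: (esym (covered_incomparable twoK fk tk tf (@taumK C) (cov _ SO2) (cov _ SO') _ _)).
    by rewrite (pE _ SO2) (pE _ SO').
  exact: (closure_point (sub _ SO')).
have two O' : S O' -> O' = O1 \/ O' = pre tau O1.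
  move=> SO'; apply: (covered_fibre twoK fk tk tf (@taumK C) (cov _ SO1) (cov _ SO')).
  by rewrite (pE _ SO1) (pE _ SO').
have [S2|n2] := pselect (S (pre tau O1)); last first.
  apply: (nS O1); apply/seteqP; split=> [O' SO'|_ ->]; last exact: SO1.
  by case: (two _ SO') => // E; case: n2; rewrite -E.
case: (irr _ _ (@closed_closure (spoint C) [set O1]) (@closed_closure (spoint C) [set pre tau O1]) (subset_closed two)).
  exact: inc.
exact: inc.
Qed.

End Decomposition.

Theorem theorem7 (R : realType) (t a1 a2 : R[i]) (ha1 : a1 != 0) :
  exists phit : spoint R[i] -> spoint R[i],
    [/\ is_morphism (phi_star t a1) (XTakm t a1 a2) (XOkt t a1 a2) phit,
        is_morphism (phi_star t a1) (XTakm t a1 a2) (XOk t a1 a2)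
          (rho t a1 a2 \o phit)
        /\ (forall q p : R[i], q != 0 ->
              XTakm t a1 a2 (affine_pt q p)
              /\ (rho t a1 a2 \o phit) (affine_pt q p)
                 = affine_pt (phi_f q) (phi_g t a1 q p)),
        (forall S : set (spoint R[i]), is_curve (XTakm t a1 a2) S ->
           forall O : spoint R[i], phit @` S <> [set O]),
        [/\ phit @` C1 t a1 a2 = L2 t a1 a2,
            phit @` C2 t a1 a2 = L1 t a1 a2,
            phit @` C3 t a1 a2 = Dt0 t a1 a2,
            phit @` C4 t a1 a2 = Dt6 t a1 a2
          & phit @` C5 t a1 a2 = Dt3 t a1 a2]
        /\ [/\ phit @` C6 t a1 a2 = L6 t a1 a2,
            phit @` C7 t a1 a2 = Dt4 t a1 a2,
            phit @` C8 t a1 a2 = L7 t a1 a2,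
            phit @` C9 t a1 a2 = Dt5 t a1 a2
          & phit @` C10 t a1 a2 = L8 t a1 a2]
        /\ [/\ phit @` C11 t a1 a2 = L5 t a1 a2,
            phit @` C12 t a1 a2 = Dt2 t a1 a2,
            phit @` C13 t a1 a2 = L4 t a1 a2,
            phit @` C14 t a1 a2 = Dt1 t a1 a2
          & phit @` C15 t a1 a2 = L3 t a1 a2]
      & [/\ phit @` F3 t a1 a2 = Et4 t a1 a2,
            phit @` F5 t a1 a2 = Okt_f0 t a1 a2,
            phit @` F14 t a1 a2 = Et8 t a1 a2
          & phit @` F20 t a1 a2 = Et2 t a1 a2]].
Proof.
have two0 : (2 : R[i]) != 0 by rewrite pnatr_eq0.
exists (pre (phim t a1 two0)); split.
- exact: phit_morphism.
- split; first exact: rho_phit_morphism.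
  by move=> q p q0; exact: affine_image.
- exact: no_contracted.
- split; [|split]; split.
  + exact: (C1_image t a2 ha1 two0).
  + exact: (C2_image t a2 ha1 two0).
  + exact: (C3_image t a2 ha1 two0).
  + exact: (C4_image t a2 ha1 two0).
  + exact: (C5_image t a2 ha1 two0).
  + exact: (C6_image t a2 ha1 two0).
  + exact: (C7_image t a2 ha1 two0).
  + exact: (C8_image t a2 ha1 two0).
  + exact: (C9_image t a2 ha1 two0).
  + exact: (C10_image t a2 ha1 two0).
  + exact: (C11_image t a2 ha1 two0).
  + exact: (C12_image t a2 ha1 two0).
  + exact: (C13_image t a2 ha1 two0).
  + exact: (C14_image t a2 ha1 two0).
  + exact: (C15_image t a2 ha1 two0).
- split.
  + exact: (F3_image t a2 ha1 two0).
  + exact: (F5_image t a2 ha1 two0).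
  + exact: (F14_image t a2 ha1 two0).
  + exact: (F20_image t a2 ha1 two0).
Qed.
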